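(* Let $X$ be a smooth manifold of dimension $n$, and let $V_1,\ldots,V_n\subset C^\infty(X,\mathbb R)$ be finite-dimensional vector subspaces, each equipped with a norm. Assume that for each $i$ the unit ball $B_i\subset V_i$ and the unit ball $B_i^*\subset V_i^*$ of the dual norm are smooth convex bodies. Let $\mu_i$ be the unique smooth normal measure on ${\rm AGr}^1(V_i^* )$ such that $\chi_1(\mu_i)(\xi)=\|\xi\|_i^*$ for all $\xi\in V_i^*$, and put $\Xi=\mu_1\times\ldots\times\mu_n$. Let $U\subset X$ be a relatively compact open set, let $\mathfrak M(U)$ be the average number of solutions in $U$ with respect to $\Xi$, let $\mathcal B_i$ be the $B$-body in $X$ corresponding to the space of functions $V_i$, and let $\mathcal B_i^U$ be the restriction of $\mathcal B_i$ to $U$. Then $$\mathfrak M(U)=\frac{n!}{2^n}\,{\rm vol}(\mathcal B_1^U,\ldots,\mathcal B_n^U),$$ where ${\rm vol}(\mathcal B_1^U,\ldots,\mathcal B_n^U)$ is the mixed volume of $B$-bodies.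
   Context: For a finite-dimensional real vector space $W$, ${\rm AGr}^1(W)$ is the set (manifold) of affine hyperplanes of $W$ and ${\rm Gr}_1(W)$ is the Grassmannian of lines through $0$ in $W$. Normal measures. A normal measure on ${\rm AGr}^1(W)$ is a signed Borel measure that is translation invariant and finite on compact sets. For such $\mu$ and $\xi\in W$, $\chi_1(\mu)(\xi)=\mu(\{H\in{\rm AGr}^1(W): H\cap[0,\xi]\neq\emptyset\})$, where $[0,\xi]$ is the segment from $0$ to $\xi$. Fix a scalar product on $W$ and the corresponding Haar (rotation-invariant) measure $\nu$ on ${\rm Gr}_1(W)$. A normal measure on ${\rm AGr}^1(W)$ is called smooth if it is of the form $$\mu_\varphi(A)=\int_{L\in{\rm Gr}_1(W)}\varphi(L)\Big(\int_{A_L}dh\Big)d\nu(L),\qquad A_L=\{h\in L: h+L^\perp\in A\},$$ with $\varphi\in C^\infty({\rm Gr}_1(W))$, $dh$ being Lebesgue measure on the Euclidean line $L$. For a norm on $W$ with $\|\cdot\|$ smooth away from $0$ there is a unique smooth normal measure $\mu$ with $\chi_1(\mu)=\|\cdot\|$ (it may be non-positive). $\|\cdot\|_i^*$ denotes the dual norm on $V_i^*$. Average number of solutions. A tuple $H=(H_1,\ldots,H_n)\in{\rm AGr}^1(V_1^* )\times\ldots\times{\rm AGr}^1(V_n^* )$ with $H_i=\{v^*\in V_i^*: v^*(f_i)=a_i\}$, $0\ne f_i\in V_i$, $a_i\in\mathbb R$, is identified with the system of equations $f_1-a_1=\ldots=f_n-a_n=0$ on $X$. $N_U(H)$ is the number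 of isolated solutions of this system in $U$. For a (signed) measure $\Xi$ on ${\rm AGr}^1(V_1^* )\times\ldots\times{\rm AGr}^1(V_n^* )$, the average number of solutions in $U$ with respect to $\Xi$ is $\mathfrak M(U)=\int N_U(H)\,d\Xi(H)$. $B$-bodies. A Banach convex body ($B$-body) $\mathcal E$ in a manifold $Y$ is a collection of compact convex sets $\mathcal E(y)\subset T_y^*Y$, symmetric about $0$ (possibly with empty interior), depending continuously on $y\in Y$. Its volume ${\rm vol}(\mathcal E)$ is the volume of $\bigcup_y\mathcal E(y)\subset T^*Y$ with respect to the volume form $\omega^n/n!$, where $n=\dim Y$ and $\omega$ is the standard symplectic form. Linear combinations with non-negative coefficients are taken fiberwise using Minkowski sum. Then ${\rm vol}(\lambda_1\mathcal E_1+\ldots+\lambda_n\mathcal E_n)$ is a homogeneous polynomial of degree $n$ in $\lambda_1,\ldots,\lambda_n$; the mixed volume ${\rm vol}(\mathcal E_1,\ldots,\mathcal E_n)$ is its coefficient at $\lambda_1\cdots\lambda_n$ divided by $n!$. Restriction of $\mathcal E$ to an open set $U$ means the collection of $\mathcal E(y)$ with $y\in U$. $B$-body of a space of functions. For a finite-dimensional normed space $V\subset C^\infty(X,\mathbb R)$ with unit ball $B\subset V$, define $\theta_V\colon X\to V^*$ by $\theta_V(x)(f)=f(x)$. The $B$-body corresponding to $V$ is $\mathcal B(x)=(d_x\theta_V)^*(B)\subset T_x^*X$, where $(d_x\theta_V)^*\colon V=(V^* )^*\to T_x^*X$ is the dual of the differential of $\theta_V$ at $x$. *)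

(* Defs.v *)
From HB Require Import structures.
From mathcomp Require Import all_boot all_order all_algebra.
From mathcomp Require Import all_classical all_reals all_analysis.
From mathcomp Require mpoly.

Set Implicit Arguments.
Unset Strict Implicit.
Unset Printing Implicit Defensive.

Import Order.TTheory GRing.Theory Num.Theory.
Import numFieldNormedType.Exports VectorInternalTheory.

Local Open Scope classical_set_scope.
Local Open Scope ring_scope.

(** * Smooth maps between open subsets of normed spaces *)

Section Smooth.
Context (R : realType) (V W : normedModType R).

(* In finite dimension this is the usual C^k: all iterated directional
   derivatives up to order k exist and are continuous on the open set O. *)
Fixpoint Ck_on (k : nat) (O : set V) (f : V -> W) : Prop :=
  (forall x, O x -> {for x, continuous f}) /\
  if k is k'.+1 then
    forall v, (forall x, O x -> derivable f x v) /\
              Ck_on k' O (fun x => 'D_v f x)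
  else True.

Definition smooth_on (O : set V) (f : V -> W) : Prop := forall k, Ck_on k O f.

End Smooth.

(** * Smooth manifolds *)

Section Charts.
Context (R : realType) (n : nat) (X : topologicalType).

(* The inverse of [fwd] is not part of the data, so that the empty manifold
   is not excluded. *)
Record chart := Chart {
  dom : set X;
  fwd : X -> 'rV[R]_n;
  dom_open : open dom;
  fwd_inj : {in dom &, injective fwd};
  fwd_continuous : forall x, dom x -> {for x, continuous fwd};
  fwd_open : forall O, open O -> O `<=` dom -> open (fwd @` O) }.

(* The coordinate expression F \o fwd^-1, meaningful on fwd @` dom. *)
Definition local_rep (W : pointedType) (c : chart) (F : X -> W)
    (q : 'rV[R]_n) : W :=
  get (F @` (dom c `&` fwd c @^-1` [set q])).

End Charts.

(* A Hausdorff space with a countable smooth atlas; countability of the atlas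
   amounts to second countability.  Repeated or empty charts are allowed, so
   finite atlases are covered. *)
Record manifold (R : realType) (n : nat) := Manifold {
  carrier :> topologicalType;
  carrier_hausdorff : hausdorff_space carrier;
  atlas : nat -> chart R n carrier;
  atlas_cover : forall x, exists k, `[< dom (atlas k) x >];
  atlas_smooth : forall k l,
    smooth_on (fwd (atlas k) @` (dom (atlas k) `&` dom (atlas l)))
              (local_rep (atlas k) (fwd (atlas l))) }.

Section Tangent.
Context (R : realType) (n : nat) (X : manifold R n).

Definition smooth_function (f : X -> R) : Prop :=
  forall k, smooth_on (fwd (atlas X k) @` dom (atlas X k))
                      (local_rep (atlas X k) f).

(* The index of the preferred chart at x: the first one containing x. *)
Definition chart_idx (x : X) : nat := ex_minn (atlas_cover x).

Definition chart_at (x : X) : chart R n X := atlas X (chart_idx x).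

(* T_x X, a tangent vector being given by its coordinates in the preferred chart
   at x. *)
Definition tangent (x : X) := 'rV[R]_n.

End Tangent.

(** * Finite-dimensional vector spaces and their duals *)

(* A [vectType] carries no topology; topological and differential notions on W
   are read through the linear isomorphism [r2v : 'rV_(dim W) -> W]. *)

Section Duals.
Context (R : realType).
Implicit Types V W : vectType R.

Definition dualsp V : vectType R := 'Hom(V, R^o).

(* The canonical map V -> V^** *)
Definition bidual V (f : V) : dualsp (dualsp V) :=
  linfun (fun xi : dualsp V => xi f : R^o).

Definition adjoint V W (L : 'Hom(V, W)) (p : dualsp W) : dualsp V :=
  (p \o L)%VF.

End Duals.

(** * Norms and smooth convex bodies *)

Section Norms.
Context (R : realType) (W : vectType R).

Definition is_norm (N : W -> R) : Prop :=
  [/\ forall u v, N (u + v) <= N u + N v,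
      forall a v, N (a *: v) = `|a| * N v &
      forall v, N v = 0 -> v = 0].

Definition unit_ball (N : W -> R) : set W := [set v | N v <= 1].

Definition dual_norm (N : W -> R) (xi : dualsp W) : R :=
  sup [set `|xi v : R| | v in unit_ball N].

(* A convex body whose boundary is a smooth hypersurface: near each boundary
   point it is a regular sublevel set of a smooth function. *)
Definition smooth_convex_body (K : set W) : Prop :=
  let K' := r2v @^-1` K : set 'rV[R]_(dim W) in
  [/\ convex_set (K : set (convex_lmodType W)), compact K', interior K' !=set0 &
      forall p, (closure K' `\` interior K') p ->
        exists (O : set 'rV[R]_(dim W)) (g : 'rV[R]_(dim W) -> R),
          [/\ open O, O p, smooth_on O g, exists v, 'd g p v != 0 &
              K' `&` O = [set q | g q <= 0] `&` O]].

End Norms.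

(** * Affine hyperplanes and lines *)

Section FinalTopology.
Context (S : topologicalType) (D : set S) (oD : open D) (T : pointedType)
        (g : S -> T).

(* T with the final topology induced by g restricted to the open set D; on
   g @` D this is the quotient topology, and T `\` g @` D is discrete. *)
Definition final_topology & open D & (S -> T) : Type := T.

Local Notation Tf := (final_topology oD g).

Definition final_open : set (set Tf) := [set A | open (D `&` g @^-1` A)].

Let final_openT : final_open setT.
Proof. by rewrite /final_open/= preimage_setT setIT. Qed.

Let final_openI : setI_closed final_open.
Proof.
move=> A B oA oB; rewrite /final_open/= preimage_setI setIIr.
exact: openI.
Qed.

Let final_open_bigU (I : Type) (f : I -> set Tf) :
  (forall i, final_open (f i)) -> final_open (\bigcup_i f i).
Proof.
move=> of_; rewrite /final_open/= preimage_bigcup setI_bigcupr.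
by apply: bigcup_open => i _; exact: of_.
Qed.

HB.instance Definition _ := Pointed.on Tf.
HB.instance Definition _ :=
  isOpenTopological.Build Tf final_openT final_openI final_open_bigU.

End FinalTopology.

Definition borel (T : ptopologicalType) := g_sigma_algebraType (@open T).

Definition pointed_vspace (R : realType) (W : vectType R) := {vspace W}.

HB.instance Definition _ (R : realType) (W : vectType R) :=
  Choice.on (pointed_vspace W).
HB.instance Definition _ (R : realType) (W : vectType R) :=
  isPointed.Build (pointed_vspace W) 0%VS.

Section Grassmannians.
Context (R : realType).
Implicit Types W : vectType R.

Lemma open_nonzero n : open [set r : 'rV[R]_n | r != 0].
Proof.
rewrite (_ : [set _ | _] = ~` [set 0]).
  apply: closed_openC; apply: accessible_closed_set1.
  exact/hausdorff_accessible/norm_hausdorff.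
by apply/seteqP; split=> r /=; [move/eqP|move=> ?; exact/eqP].
Qed.

Lemma open_nonzero_fst n : open [set la : 'rV[R]_n * R | la.1 != 0].
Proof.
by apply: open_comp (@open_nonzero n) => p _; exact: cvg_fst.
Qed.

Definition hyperplane W (l : dualsp W) (a : R) : set W := [set w | l w = a].

Definition line W (v : W) : pointed_vspace W := <[v]>%VS.

(* The set of affine hyperplanes AGr^1(W) and the Grassmannian of lines Gr_1(W)
   are the subsets [AGr] and [Gr1] of the pointed ambient types of all subsets
   and of all subspaces of W.  The ambient types are given the final topology,
   which induces on [AGr] and [Gr1] their manifold topology and makes them
   clopen. *)
Definition AGr_space W :=
  final_topology (@open_nonzero_fst (dim (dualsp W)))
    (fun la => hyperplane (r2v la.1 : dualsp W) la.2).

Definition AGr W : set (AGr_space W) :=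
  [set H | exists (l : dualsp W) (a : R), l != 0 /\ H = hyperplane l a].

Definition Gr1_space W :=
  final_topology (@open_nonzero (dim W)) (fun r => line (r2v r : W)).

Definition Gr1 W : set (Gr1_space W) := [set L | \dim (L : {vspace W}) = 1%N].

End Grassmannians.

(** * Signed measures *)

(* A signed measure, possibly with infinite total mass, given by its Jordan
   decomposition (a [charge] of the library is finite). *)
Record signed_measure d (T : measurableType d) (R : realType) := SignedMeasure {
  pos_part : {measure set T -> \bar R};
  neg_part : {measure set T -> \bar R};
  jordan_singular : exists D : set T,
    [/\ measurable D, pos_part (~` D) = 0%E & neg_part D = 0%E] }.

Section SignedMeasures.
Context d (T : measurableType d) (R : realType) (mu : signed_measure T R).
Local Open Scope ereal_scope.

Definition finite_mass (A : set T) : Prop :=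
  pos_part mu A < +oo /\ neg_part mu A < +oo.

(* Meaningful unless both parts of A have infinite mass. *)
Definition smeasure (A : set T) : \bar R := pos_part mu A - neg_part mu A.

Definition sintegral (f : T -> \bar R) : \bar R :=
  \int[pos_part mu]_x f x - \int[neg_part mu]_x f x.

End SignedMeasures.

(** * Normal measures *)

Section NormalMeasures.
Context (R : realType) (W : vectType R).
Local Open Scope ereal_scope.

Definition scalar_product (ip : W -> W -> R) : Prop :=
  [/\ forall (a : R) u v w, ip (a *: u + v)%R w = (a * ip u w + ip v w)%R,
      forall u v, ip u v = ip v u & forall u, u != 0%R -> (0 < ip u u)%R].

Definition AGr_measure := signed_measure (borel (AGr_space W)) R.

Definition translate (w : W) (H : AGr_space W) : AGr_space W :=
  [set (h + w)%R | h in H].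

Definition normal_measure (mu : AGr_measure) : Prop :=
  [/\ pos_part mu (~` @AGr R W) = 0 /\ neg_part mu (~` @AGr R W) = 0,
      forall K : set (AGr_space W), compact K -> finite_mass mu K &
      forall (A : set (borel (AGr_space W))) w, measurable A ->
        smeasure mu (translate w @` A) = smeasure mu A].

Definition chi1 (mu : AGr_measure) (xi : W) : \bar R :=
  smeasure mu [set H | AGr H /\
                 exists2 t : R, (0 <= t <= 1)%R & (H : set W) (t *: xi)%R].

Definition orthogonal_to (ip : W -> W -> R) (L : {vspace W}) : set W :=
  [set w | forall l, l \in L -> ip l w = 0%R].

(* The normalisation is immaterial. *)
Definition haar_measure (ip : W -> W -> R)
    (nu : {measure set (borel (Gr1_space W)) -> \bar R}) : Prop :=
  [/\ nu (~` @Gr1 R W) = 0, nu setT < +oo, (0 < dim W)%N -> 0 < nu setT &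
      forall g : 'End(W), (forall u v, ip (g u) (g v) = ip u v) ->
        forall A : set (borel (Gr1_space W)), measurable A ->
          nu [set L | A (g @: (L : {vspace W}))%VS] = nu A].

(* A vector spanning the line L, of length 1 for ip. *)
Definition unit_vector (ip : W -> W -> R) (L : {vspace W}) : W :=
  ((Num.sqrt (ip (vpick L) (vpick L)))^-1 *: vpick L)%R.

(* The Lebesgue measure of A_L = {h in L : h + L^perp in A}, where t |-> t u
   with u a unit vector identifies the Euclidean line L with R. *)
Definition transverse_measure (ip : W -> W -> R) (A : set (AGr_space W))
    (L : {vspace W}) : \bar R :=
  lebesgue_measure
    [set t : R | A (translate (t *: unit_vector ip L)%R (orthogonal_to ip L))].

Definition smooth_on_Gr1 (phi : Gr1_space W -> R) : Prop :=
  smooth_on [set r : 'rV[R]_(dim W) | r != 0%R] (fun r => phi (line (r2v r))).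

Definition smooth_normal_measure (mu : AGr_measure) : Prop :=
  normal_measure mu /\
  exists ip (nu : {measure set (borel (Gr1_space W)) -> \bar R}) phi,
    [/\ scalar_product ip, haar_measure ip nu, smooth_on_Gr1 phi &
        forall A : set (borel (AGr_space W)),
          measurable A -> A `<=` @AGr R W -> finite_mass mu A ->
          smeasure mu A =
            \int[nu]_(L in @Gr1 R W) ((phi L)%:E * transverse_measure ip A L)].

End NormalMeasures.

(** * Product measures *)

Section ProductMeasure.
Context (R : realType) (n : nat) (W : 'I_n -> vectType R).

Definition cylinders : set (set (forall i, borel (AGr_space (W i)))) :=
  [set B | exists i (A : set (borel (AGr_space (W i)))),
             measurable A /\ B = [set H | A (H i)]].

(* The product of the AGr^1(W i) with the product sigma-algebra *)
Definition AGr_tuple := g_sigma_algebraType cylinders.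

Definition is_product_measure (mu : forall i, AGr_measure (W i))
    (Xi : signed_measure AGr_tuple R) : Prop :=
  forall A : (forall i, set (borel (AGr_space (W i)))),
    (forall i, measurable (A i) /\ finite_mass (mu i) (A i)) ->
    smeasure Xi [set H | forall i, A i (H i)] =
      (\prod_i fine (smeasure (mu i) (A i)))%:E.

End ProductMeasure.

(** * Spaces of functions and systems of equations *)

(* A finite-dimensional subspace of C^oo(X, R), as an abstract vector space
   with an injective linear realization by smooth functions. *)
Record function_space (R : realType) (n : nat) (X : manifold R n) :=
  FunctionSpace {
    space :> vectType R;
    fun_of : space -> X -> R;
    fun_of_linear : forall (a : R) (f g : space) (x : X),
      fun_of (a *: f + g) x = a * fun_of f x + fun_of g x;
    fun_of_inj : injective fun_of;
    fun_of_smooth : forall f, smooth_function (fun_of f) }.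

Section Bodies.
Context (R : realType) (n : nat) (X : manifold R n).

(* The cotangent space at x *)
Definition cotangent (x : X) : vectType R := dualsp (tangent x).

Definition theta (V : function_space X) (x : X) : dualsp V :=
  linfun (fun f : V => fun_of f x : R^o).

(* The differential at x of a map from X to a vector space. *)
Definition tdiff (W : vectType R) (F : X -> W) (x : X) : 'Hom(tangent x, W) :=
  let c := chart_at x in
  linfun (fun v : tangent x =>
    r2v ('d (local_rep c (v2r \o F)) (fwd c x) v) : W).

(* The fibres of a family of subsets of the cotangent spaces, e.g. a B-body *)
Definition body := forall x : X, set (cotangent x).

Definition body_of (V : function_space X) (N : V -> R) : body := fun x =>
  [set adjoint (tdiff (theta V) x) (bidual f) | f in unit_ball N].

Definition combination m (lambda : 'I_m -> R) (E : 'I_m -> body) : body :=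
  fun x => [set p | exists2 q : 'I_m -> cotangent x,
                      (forall i, E i x (q i)) & p = \sum_i lambda i *: q i].

(* The system of equations with coefficients H_i = {f_i = a_i} *)
Definition solutions (V : 'I_n -> function_space X)
    (H : AGr_tuple (fun i => dualsp (V i))) : set X :=
  [set x | forall i, exists (f : V i) (a : R),
             [/\ f != 0, H i = hyperplane (bidual f) a & fun_of f x = a]].

Definition nb_solutions (V : 'I_n -> function_space X) (U : set X)
    (H : AGr_tuple (fun i => dualsp (V i))) : \bar R :=
  counting (U `&` isolated (solutions H)).

Definition average_nb_solutions (V : 'I_n -> function_space X)
    (Xi : signed_measure (AGr_tuple (fun i => dualsp (V i))) R) (U : set X) :
    \bar R :=
  sintegral Xi (nb_solutions U).

End Bodies.

(** * Volumes *)

(* The m-dimensional Lebesgue (outer) measure; the boxes are indexed by an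
   arbitrary set of naturals so that the empty set is null also for m = 0. *)
Definition lebesgue_rV (R : realType) (m : nat) (A : set 'rV[R]_m) : \bar R :=
  ereal_inf [set s | exists (P : pred nat) (a b : nat -> 'rV[R]_m),
    [/\ forall k j, a k 0 j <= b k 0 j,
        A `<=` \bigcup_(k in [set k | P k])
                 [set q | forall j, a k 0 j <= q 0 j <= b k 0 j] &
        s = (\sum_(0 <= k <oo | P k) (\prod_j (b k 0 j - a k 0 j))%:E)%E]].

Section Volumes.
Context (R : realType) (n : nat) (X : manifold R n).

(* The coordinates (q, p) of a covector with respect to the preferred chart. *)
Definition canonical_coordinates (x : X) (p : cotangent x) : 'rV[R]_(n + n) :=
  row_mx (fwd (chart_at x) x) (\row_j (p (delta_mx 0 j : 'rV[R]_n) : R)).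

(* The volume of the union of the fibres over U for omega^n/n!: in canonical
   coordinates omega = sum_i dp_i /\ dq_i and |omega^n/n!| = dq dp is Lebesgue
   measure. The Borel sets {chart_idx = k} partition X, and on each of them the
   canonical coordinates are those of the single chart [atlas X k]. *)
Definition volume (U : set X) (E : body X) : \bar R :=
  (\sum_(0 <= k <oo)
     lebesgue_rV [set z | exists x (p : cotangent x),
       [/\ U x, chart_idx x = k, E x p & z = canonical_coordinates p]])%E.

(* The coefficient of lambda_1 ... lambda_n in vol(sum_i lambda_i E_i),
   divided by n!. The polynomial is determined by its values on lambda >= 0. *)
Definition mixed_volume (U : set X) (E : 'I_n -> body X) : R :=
  get [set c | exists P : mpoly.mpoly n R,
    [/\ forall m, mpoly.mcoeff m P != 0 -> mpoly.mdeg m = n,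
        forall lambda : 'I_n -> R, (forall i, 0 <= lambda i) ->
          volume U (combination lambda E) = (mpoly.meval lambda P)%:E &
        c = mpoly.mcoeff (mpoly.Multinom [tuple 1%N | i < n]) P / n`!%:R]].

End Volumes.

(* Main.v *)
(** Both sides are one and the same integral over products of Grassmannians and over U.

    A smooth normal measure mu_i is the image of phi_i(L) dnu_i(L) dt under (L, t) |-> {v : v(a_i(L)) = t}, so the
    hypothesis on chi_1 says that the support function of the unit ball of V_i is
    x |-> int phi_i(L) |<a_i(L), x>| dnu_i(L): the ball is a generalized zonoid, phi_i being possibly negative.

    For fixed L = (L_1, ..., L_n) the area formula in the charts turns the integral over t of the number of points of
    U where the functions a_i(L_i) take the values t_i into the integral over U of |det(d a_1(L_1), ..., d a_n(L_n))|.
    Integrating against phi_1(L_1) ... phi_n(L_n) gives the average number of solutions.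

    On the other side the fibres of lambda_1 B_1 + ... + lambda_n B_n are generalized zonoids again, and the volume of
    a generalized zonoid is 2^n/n! times the integral of |det| over n-tuples of its generators. So the volume of the
    combination is a form in lambda whose coefficient at lambda_1 ... lambda_n is 2^n times the average above; the
    other tuples of indices do not contribute to this monomial, and finiteness follows by covering the closure
    of U by finitely many boxes in charts. *)

Require Import Defs.
From HB Require Import structures.
From mathcomp Require Import all_boot all_order all_algebra.
From mathcomp Require Import all_classical all_reals all_analysis.
From mathcomp Require Import fingroup perm measurable_realfun ring lra.
From mathcomp Require mpoly.
Set Implicit Arguments.
Unset Strict Implicit.
Unset Printing Implicit Defensive.
Import Order.TTheory GRing.Theory Num.Theory.
Import numFieldNormedType.Exports VectorInternalTheory.
Local Open Scope classical_set_scope.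
Local Open Scope ring_scope.

(** The densities phi_i may change sign, and both sides feel it. A unit ball need not be a limit of
    zonotopes with non-negative weights, so its volume is reached by extrapolation: after adding s
    times the negative part, for s = 1, ..., n + 1, honest zonotopes approximate, and the volumes
    are polynomials of degree at most n in s. On the other side [Xi] comes with its own Jordan
    decomposition, of possibly infinite mass, and is known only on products of sets of finite mass;
    it is compared with the image of the signed product density through identities between sums of
    positive measures. The factor 2^n / n! is that of zonotopes: the segments [-c, c] have
    half-length |c|, and a parallelotope is met once for each order of its n edges. The number of
    isolated solutions is not known to be measurable; it is squeezed below the number of all
    solutions, with which it agrees where the latter is finite, hence almost everywhere. The mixed
    volume is selected among all polynomials that represent the volume, so the uniqueness of its
    coefficient is part of the argument. *)

(** * Borel sets of row vectors and the countable base of rational cubes *)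

Section BorelRV.
Context (R : realType).

Definition halfspaces n : set (set 'rV[R]_n) :=
  [set A | exists (j : 'I_n) (c : R), A = [set q : 'rV[R]_n | q 0 j <= c]].

Definition ratbox n (p : 'rV[rat]_n * rat) : set 'rV[R]_n :=
  [set q | forall j, ratr (p.1 0 j - p.2) <= q 0 j <= ratr (p.1 0 j + p.2)].

(** Rational cubes are a countable base. Generation of the Borel sets, Lindelof arguments and
    density of rational points all go through this lemma. *)
Lemma open_ratbox n (O : set 'rV[R]_n) : open O ->
  O = \bigcup_(p in [set p | ratbox p `<=` O]) ratbox p.
Proof.
move=> oO.
apply/seteqP; split=> [q Oq|q [p]]; last by move=> h /h.
have /nbhs_ballP[e /= e0 eO] : nbhs q O by exact: open_nbhs_nbhs.
(* The centre will be [r]-close to [q] and the points of the cube [r]-close to the centre, hence the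
   bound e / 2. *)
have [r /andP[r0 re]] : exists r : rat, 0 < (ratr r : R) < e / 2.
  have [r h] := @rat_in_itvoo R 0 (e / 2) (divr_gt0 e0 (ltr0Sn _ 1)).
  by exists r; move: h; rewrite in_itv.
have hj (j : 'I_n) : {s : rat | q 0 j - ratr r < (ratr s : R) < q 0 j + ratr r}.
  apply: cid.
  have [|s h] := @rat_in_itvoo R (q 0 j - ratr r) (q 0 j + ratr r).
    by rewrite ltrD2l gtrN.
  by exists s; move: h; rewrite in_itv.
pose s := \row_j sval (hj j).
exists (s, r); last first.
  move=> j /=; rewrite mxE /=; case: (hj j) => x /= /andP[h1 h2].
  by rewrite raddfB raddfD /=; apply/andP; split; apply: ltW; lra.
move=> t ft; apply: eO.
split=> // i j; rewrite (ord1 i).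
have := ft j; rewrite /= mxE; case: (hj j) => x /= /andP[h1 h2].
rewrite raddfB raddfD /= => /andP[h3 h4].
by rewrite /ball /= ltr_distlC; apply/andP; split; lra.
Qed.

Lemma open_halfspaces n (O : set 'rV[R]_n) : open O -> <<s @halfspaces n >> O.
Proof.
move=> oO.
pose T := g_sigma_algebraType (@halfspaces n).
pose f (p : 'rV[rat]_n * rat) : set T := ratbox p.
have mf p : measurable (f p).
  have -> : f p = \bigcap_(j in [set: 'I_n])
     ([set q | (q : 'rV[R]_n) 0 j <= ratr (p.1 0 j + p.2)] `&`
      \bigcap_(k in [set: nat]) ~` [set q | (q : 'rV[R]_n) 0 j <= ratr (p.1 0 j - p.2) - k.+1%:R^-1]).
    apply/seteqP; split=> [q qf j _|q qf j].
      have /andP[h1 h2] := qf j; split => //= k _ /=; apply/negP; rewrite -ltNge.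
      by apply: lt_le_trans h1; rewrite ltrBlDr ltrDl.
    have [/= -> h] := qf j I; rewrite andbT; apply/ler_addgt0Pr => e e0.
    have [k ke] := ltr_add_invr e0; rewrite add0r in ke.
    have := h k I => /= /negP; rewrite -ltNge => /ltW.
    by rewrite lerBlDr => /le_trans; apply; rewrite lerD2l ltW.
  apply: fin_bigcap_measurable => // j _; apply: measurableI.
    by apply: sub_gen_smallest; exists j, (ratr (p.1 0 j + p.2)).
  apply: bigcapT_measurable => k; apply: measurableC.
  by apply: sub_gen_smallest; exists j, (ratr (p.1 0 j - p.2) - k.+1%:R^-1).
suff -> : O = \bigcup_(p in [set p | f p `<=` O]) f p.
  have : measurable (\bigcup_(p in [set p | f p `<=` O]) f p); last by [].
  (* The union over a countable type becomes a sequence through [pickle], with empty terms at the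
     numbers that code no cube inside [O]. *)
  have -> : \bigcup_(p in [set p | f p `<=` O]) f p =
     \bigcup_(k in [set: nat]) (if unpickle k is Some p then if `[< f p `<=` O >] then f p else set0 else set0).
    apply/seteqP; split=> [q [p pO fq]|q [k _]].
      by exists (pickle p) => //; rewrite pickleK; case: asboolP.
    by case: unpickle => // p; case: asboolP => // pO fq; exists p.
  apply: bigcupT_measurable => k; case: unpickle => // p; case: asboolP => // _.
exact: open_ratbox.
Qed.

Lemma borel_halfspaces n (A : set (borel 'rV[R]_n)) :
  measurable A -> <<s @halfspaces n >> A.
Proof.
apply: smallest_sub; first exact: smallest_sigma_algebra.
by move=> O /open_halfspaces.
Qed.

Lemma open_borel (T : ptopologicalType) (O : set T) : open O -> measurable (O : set (borel T)).
Proof. by move=> oO; apply: sub_gen_smallest. Qed.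

Lemma closed_borel (T : ptopologicalType) (O : set T) : closed O -> measurable (O : set (borel T)).
Proof.
move=> oO; rewrite -(setCK O); apply: measurableC; apply: open_borel.
exact: closed_openC.
Qed.

Lemma measurable_to_borel d (Y : measurableType d) (T : ptopologicalType) (f : Y -> borel T) :
  (forall O : set T, open O -> measurable (f @^-1` O)) -> measurable_fun setT f.
Proof.
by move=> h; apply: (@measurability _ _ Y (borel T) setT f (@open T)) => // _ [B oB <-]; rewrite setTI; exact: h.
Qed.

Lemma measurable_rV d (Y : measurableType d) n (f : Y -> borel 'rV[R]_n) :
  (forall j, measurable_fun setT (fun y => (f y : 'rV[R]_n) 0 j)) -> measurable_fun setT f.
Proof.
move=> h; apply: measurable_to_borel => O /open_halfspaces oO.
have : measurable_fun setT (f : Y -> g_sigma_algebraType (@halfspaces n)).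
  apply: (@measurability _ _ Y (g_sigma_algebraType (@halfspaces n)) setT f (@halfspaces n)) => // _ [B [j [c ->]] <-]; rewrite setTI.
  have := h j measurableT [set` `]-oo, c]] (measurable_itv _).
  by rewrite setTI; congr measurable; apply/seteqP; split=> y /=; rewrite in_itv.
by move=> /(_ measurableT _ oO); rewrite setTI.
Qed.

Lemma continuous_borel (S T : ptopologicalType) (f : S -> T) :
  continuous f -> measurable_fun setT (f : borel S -> borel T).
Proof.
by move=> /continuousP cf; apply: measurable_to_borel => O oO; apply: open_borel; apply: cf.
Qed.

Lemma continuous_borelR (S : ptopologicalType) (f : S -> R) :
  continuous f -> measurable_fun setT (f : borel S -> R).
Proof.
move=> /continuousP cf; apply: (measurability _ (RGenOInfty.measurableE R)).
by move=> _ [_ [a ->] <-]; rewrite setTI; apply: open_borel; apply: cf.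
Qed.

Lemma measurable_coord n j : measurable_fun setT (fun q : borel 'rV[R]_n => (q : 'rV[R]_n) 0 j).
Proof. by apply: continuous_borelR => q; exact: coord_continuous. Qed.

End BorelRV.

(** * Lebesgue measure as an outer measure by boxes, and its characterisation on Borel sets *)

Section OuterLebesgue.
Context (R : realType) (n : nat).
Implicit Types (A B : set 'rV[R]_n) (a b : 'rV[R]_n).
Local Notation mu := (@lebesgue_rV R n).

Definition box (a b : 'rV[R]_n) : set 'rV[R]_n :=
  [set q | forall j, a 0 j <= q 0 j <= b 0 j].
Definition box_vol (a b : 'rV[R]_n) : R := \prod_j (b 0 j - a 0 j).

Lemma box_vol_ge0 a b : (forall j, a 0 j <= b 0 j) -> 0 <= box_vol a b.
Proof. by move=> ab; apply: prodr_ge0 => j _; rewrite subr_ge0. Qed.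

Lemma lebesgue_rV_ge0 A : (0 <= mu A)%E.
Proof.
apply: le_ereal_inf_tmp => _ [P [a [b [ab _ ->]]]].
by apply: nneseries_ge0 => k _ _; rewrite lee_fin box_vol_ge0.
Qed.

Lemma lebesgue_rV0 : mu set0 = 0%E.
Proof.
apply/eqP; rewrite eq_le lebesgue_rV_ge0 andbT.
apply: ereal_inf_lbound; exists pred0, (fun=> 0), (fun=> 0); split => //.
by rewrite eseries_pred0.
Qed.

Lemma le_lebesgue_rV A B : A `<=` B -> (mu A <= mu B)%E.
Proof.
move=> AB; apply: le_ereal_inf => _ [P [a [b [ab cB ->]]]].
by exists P, a, b; split => //; exact: subset_trans cB.
Qed.

Lemma lebesgue_rV_box a b : (forall j, a 0 j <= b 0 j) -> (mu (box a b) <= (box_vol a b)%:E)%E.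
Proof.
move=> ab; apply: ereal_inf_lbound; exists (pred1 0%N), (fun=> a), (fun=> b); split => //.
  by move=> q qab; exists 0%N => //=.
have h k : (0 <= (box_vol a b)%:E)%E by rewrite lee_fin box_vol_ge0.
rewrite nneseries_esum; last by move=> k _; exact: h.
rewrite (_ : [set k | _ ] = [set 0%N]); last by apply/seteqP; split=> k /= => [/eqP|->].
by rewrite esum_set1//; exact: (h nat 0%N).
Qed.

Lemma lebesgue_rV_sigma : sigma_subadditive mu.
Proof.
move=> A; have [[i ioo]|] := pselect (exists i, mu (A i) = +oo%E).
  rewrite (eseries_pinfty _ _ ioo) ?leey// => k _.
  by rewrite -ltNye (lt_le_trans _ (lebesgue_rV_ge0 _)).
rewrite -forallNE => Aoo.
suff add2e (e : {posnum R}) :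
    (mu (\bigcup_n A n) <= \sum_(i <oo) mu (A i) + e%:num%:E)%E.
  by apply/lee_addgt0Pr => _/posnumP[].
rewrite (le_trans _ (epsilon_trick _ _ _))//; last first.
  by move=> k; exact: lebesgue_rV_ge0.
pose D := (pred nat * (nat -> 'rV[R]_n) * (nat -> 'rV[R]_n))%type.
pose v (c : D) (k : nat) : \bar R := (box_vol (c.1.2 k) (c.2 k))%:E.
pose P k (c : D) := [/\ forall i j, c.1.2 i 0 j <= c.2 i 0 j,
   A k `<=` \bigcup_(i in [set i | c.1.1 i]) box (c.1.2 i) (c.2 i) &
  (\sum_(0 <= i <oo | c.1.1 i) v c i <= mu (A k) + (e%:num / (2 ^ k.+1)%:R)%:E)%E].
have [G PG] : {G : nat -> D & forall k, P k (G k)}.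
  apply: (@choice _ _ P) => k; rewrite /P.
  have en1 : (0 < e%:num / (2 ^ k.+1)%:R)%R by [].
  have fA : mu (A k) \is a fin_num.
    by rewrite ge0_fin_numE ?lebesgue_rV_ge0// ltey; exact/eqP/Aoo.
  have [x [Q [a [b [ab AB ->]]] xS]] := lb_ereal_inf_adherent en1 fA.
  by exists (Q, a, b); split => //; exact: ltW.
have v0 k i : (0 <= v (G k) i)%E.
  by rewrite lee_fin box_vol_ge0// => j; have [] := PG k.
apply: (@le_trans _ _ (\sum_(0 <= k <oo) \sum_(0 <= i <oo | (G k).1.1 i) v (G k) i)%E); last first.
  apply: lee_nneseries => k _; first by move=> _; exact: nneseries_ge0.
  by have [] := PG k.
have -> : (\sum_(0 <= k <oo) \sum_(0 <= i <oo | (G k).1.1 i) v (G k) i =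
   \esum_(p in setT `*`` (fun k => [set i | (G k).1.1 i])) v (G p.1) p.2)%E.
  rewrite nneseries_esumT; last by move=> k; exact: nneseries_ge0.
  rewrite -(@esum_esum R _ _ _ _ (fun k i => v (G k) i))//.
  by apply: eq_esum => k _; rewrite nneseries_esum.
have /card_esym/ppcard_eqP[f] := card_nat2.
apply: ereal_inf_lbound.
exists (fun m => (G (f m).1).1.1 (f m).2), (fun m => (G (f m).1).1.2 (f m).2),
  (fun m => (G (f m).1).2 (f m).2); split.
- by move=> m j; have [] := PG (f m).1.
- move=> q [k _ Aq]; have [_ /(_ _ Aq)[i /= Gi qi] _] := PG k.
  have fK : f (f^-1%FUN (k, i)) = (k, i)
    by apply: functions.invK; exact: mem_set.
  by exists (f^-1%FUN (k, i)); rewrite /= fK.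
- have -> : (\sum_(0 <= m <oo | (G (f m).1).1.1 (f m).2)
      (\prod_j ((G (f m).1).2 (f m).2 0 j - (G (f m).1).1.2 (f m).2 0 j))%:E =
    \esum_(m in [set m | (G (f m).1).1.1 (f m).2]) v (G (f m).1) (f m).2)%E.
    by rewrite nneseries_esum// => m _; exact: v0.
  rewrite (reindex_esum [set m | (G (f m).1).1.1 (f m).2] _ f)//.
  split=> [m /= h|x y _ _|[k i] /= [_ h]]; first by split.
    by move=> /(congr1 f^-1%FUN); rewrite !functions.funK//; exact: mem_set.
  have fK : f (f^-1%FUN (k, i)) = (k, i)
    by apply: functions.invK; exact: mem_set.
  by exists (f^-1%FUN (k, i)); rewrite /= fK.
Qed.

End OuterLebesgue.

HB.instance Definition _ (R : realType) n :=
  isOuterMeasure.Build R 'rV[R]_n (@lebesgue_rV R n)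
    (@lebesgue_rV0 R n) (@lebesgue_rV_ge0 R n) (@le_lebesgue_rV R n) (@lebesgue_rV_sigma R n).

(** For two measures with the same finite mass on a box: if one dominates the other on a set and on
    its complement in the box, they agree on the set. *)
Lemma lee_add_squeeze (R : realType) (x1 x2 x3 x4 : \bar R) (c : R) :
  (0 <= x1 -> 0 <= x2 -> x2 + x1 = c%:E -> x4 + x3 = c%:E -> x2 <= x4 -> x1 <= x3 -> x4 <= x2)%E.
Proof.
move: x1 x2 x3 x4 => [x1| |] [x2| |] [x3| |] [x4| |] //=.
by rewrite !lee_fin -!EFinD => _ _ [e1] [e2]; lra.
Qed.

Definition pushm d1 d2 (T1 : measurableType d1) (T2 : measurableType d2) (R : realType)
  (m : {measure set T1 -> \bar R}) (f : T1 -> T2) (mf : measurable_fun setT f) :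
  {measure set T2 -> \bar R} := measure_function_pushforward__canonical__measure_function_Measure m mf.

Lemma lebesgue_segment (R : realType) (a b : R) : a <= b ->
  lebesgue_measure (`[a, b]%classic : set R) = (b - a)%:E.
Proof.
rewrite lebesgue_measure_itv /= lte_fin le_eqVlt => /predU1P[->|->]; last by rewrite -EFinB.
by rewrite ltxx subrr.
Qed.

Section LebesgueMeasure.
Context (R : realType) (n : nat).
Implicit Types (A B : set 'rV[R]_n) (a b : 'rV[R]_n).

(** The halfspace cuts every box of a cover into two boxes whose volumes add up exactly, so a cover
    of a set splits into covers of both parts at the same total cost. *)
Lemma caratheodory_halfspace j c :
  (@lebesgue_rV R n).-caratheodory [set q : 'rV[R]_n | q 0 j <= c].
Proof.
apply: le_caratheodory_measurable => X.
apply: le_ereal_inf_tmp => _ [P [a [b [ab cX ->]]]].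
(* The level [c] clamped to the side of the box: a box lying on one side of the hyperplane yields a
   degenerate box of volume 0. *)
pose m k := Num.min (b k 0 j) (Num.max (a k 0 j) c).
have am k : a k 0 j <= m k by rewrite /m le_min ab le_max lexx.
have mb k : m k <= b k 0 j by rewrite /m ge_min lexx.
pose upd (x : 'rV[R]_n) y : 'rV[R]_n := \row_i if i == j then y else x 0 i.
have updj x y : upd x y 0 j = y by rewrite mxE eqxx.
have updi x y i : i != j -> upd x y 0 i = x 0 i by rewrite mxE => /negbTE ->.
have le1 k i : a k 0 i <= upd (b k) (m k) 0 i.
  by have [->|ij] := eqVneq i j; rewrite ?updj ?updi.
have le2 k i : upd (a k) (m k) 0 i <= b k 0 i.
  by have [->|ij] := eqVneq i j; rewrite ?updj ?updi.
have volE k : box_vol (a k) (b k) =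
    box_vol (a k) (upd (b k) (m k)) + box_vol (upd (a k) (m k)) (b k).
  have vE x y : box_vol x y = (y 0 j - x 0 j) * \prod_(i | i != j) (y 0 i - x 0 i).
    by rewrite /box_vol (bigD1 j).
  rewrite !vE !updj.
  rewrite [X in _ = _ * X + _](eq_bigr (fun i => b k 0 i - a k 0 i)); last by move=> i ij; rewrite updi.
  rewrite [X in _ = _ + _ * X](eq_bigr (fun i => b k 0 i - a k 0 i)); last by move=> i ij; rewrite updi.
  by rewrite -mulrDl; congr (_ * _); ring.
have -> : (\sum_(0 <= k <oo | P k) (\prod_j0 (b k 0 j0 - a k 0 j0))%:E =
   \sum_(0 <= k <oo | P k) (box_vol (a k) (upd (b k) (m k)))%:E +
   \sum_(0 <= k <oo | P k) (box_vol (upd (a k) (m k)) (b k))%:E)%E.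
  rewrite -nneseriesD; first last.
  - by move=> k _ _; rewrite lee_fin; exact: box_vol_ge0.
  - by move=> k _ _; rewrite lee_fin; exact: box_vol_ge0.
  by apply: eq_eseriesr => k _; rewrite -EFinD -volE.
apply: leeD; apply: ereal_inf_lbound.
- exists P, a, (fun k => upd (b k) (m k)); split => // q [/cX[k Pk qk] /= qc].
  exists k => // i; have [->|ij] := eqVneq i j; last by rewrite updi// qk.
  by have /andP[h1 h2] := qk j; rewrite updj h1 /= /m le_min h2 le_max qc orbT.
- exists P, (fun k => upd (a k) (m k)), b; split => // q [/cX[k Pk qk] /= /negP]; rewrite -ltNge => qc.
  exists k => // i; have [->|ij] := eqVneq i j; last by rewrite updi// qk.
  by have /andP[h1 h2] := qk j; rewrite updj h2 andbT /m ge_min ge_max h1 (ltW qc) orbT.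
Qed.

Lemma borel_caratheodory (A : set (borel 'rV[R]_n)) :
  measurable A -> (@lebesgue_rV R n).-caratheodory A.
Proof.
move=> /borel_halfspaces; apply: smallest_sub.
  split; first exact: caratheodory_measurable_set0.
    by move=> B mB; rewrite setTD; exact: caratheodory_measurable_setC.
  by move=> F mF; exact: caratheodory_measurable_bigcup.
by move=> _ [j [c ->]]; exact: caratheodory_halfspace.
Qed.

Definition lebesgue_n : set (borel 'rV[R]_n) -> \bar R := @lebesgue_rV R n.

Lemma lebesgue_n_semi_sigma_additive : semi_sigma_additive lebesgue_n.
Proof.
move=> F mF tF mUF.
apply: (@caratheodory_measure_sigma_additive R 'rV[R]_n (@lebesgue_rV R n)) => //.
- by move=> k; by apply: borel_caratheodory; exact: mF.
- exact: borel_caratheodory.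
Qed.

HB.instance Definition _ := isMeasure.Build _ (borel 'rV[R]_n) R lebesgue_n
  (@lebesgue_rV0 R n) (@lebesgue_rV_ge0 R n) lebesgue_n_semi_sigma_additive.

Lemma closed_box a b : closed (box a b).
Proof.
have -> : box a b = \bigcap_(j in [set: 'I_n]) ((fun q : 'rV[R]_n => q 0 j) @^-1` `[a 0 j, b 0 j]).
  apply/seteqP; split=> q h j; first by move=> _; rewrite /= in_itv /=; exact: h.
  by have := h j I; rewrite /= in_itv.
apply: closed_bigI => j _; apply: closed_comp; last exact: interval_closed.
by move=> q _; exact: coord_continuous.
Qed.

Lemma measurable_box a b : measurable (box a b : set (borel 'rV[R]_n)).
Proof. by apply: closed_borel; exact: closed_box. Qed.

Lemma box_measure_le (m : {measure set (borel 'rV[R]_n) -> \bar R}) :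
  (forall a b, (forall j, a 0 j <= b 0 j) -> m (box a b) = (box_vol a b)%:E) ->
  forall A : set (borel 'rV[R]_n), measurable A -> (m A <= lebesgue_n A)%E.
Proof.
move=> mbox A mA; apply: le_ereal_inf_tmp => _ [P [a [b [ab cA ->]]]].
pose F k : set (borel 'rV[R]_n) := if P k then box (a k) (b k) else set0.
have mF k : measurable (F k) by rewrite /F; case: (P k) => //; exact: measurable_box.
have AF : A `<=` \bigcup_k F k.
  by move=> q /cA[k /= Pk qk]; exists k => //; rewrite /F Pk.
apply: le_trans (measure_sigma_subadditive m mF mA AF) _.
rewrite [leRHS]eseries_mkcond; apply: lee_nneseries => k _; first by [].
rewrite /F; case: (P k); last by rewrite measure0.
by rewrite mbox.
Qed.

(** The upper bound is a cover by one box; the lower bound is the mere existence of a measure [m]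
    with the right values, which stays below the outer measure by subadditivity. The volume of boxes
    thus reduces to a construction. *)
Lemma box_measure_box (m : {measure set (borel 'rV[R]_n) -> \bar R}) :
  (forall a b, (forall j, a 0 j <= b 0 j) -> m (box a b) = (box_vol a b)%:E) ->
  forall a b, (forall j, a 0 j <= b 0 j) -> lebesgue_n (box a b) = (box_vol a b)%:E.
Proof.
move=> mbox a b ab; apply/eqP; rewrite eq_le lebesgue_rV_box//= -(mbox _ _ ab).
exact: box_measure_le (measurable_box _ _).
Qed.

Definition bigbox (k : nat) : set (borel 'rV[R]_n) := box (const_mx (- k%:R)) (const_mx k%:R).

Lemma bigboxE k q : bigbox k q <-> forall j, `|q 0 j| <= k%:R.
Proof.
by split=> h j; have := h j; rewrite !mxE ler_norml.
Qed.

Lemma bigbox_nd : nondecreasing_seq bigbox.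
Proof.
move=> i k ik; apply/subsetPset => q /bigboxE h; apply/bigboxE => j.
by rewrite (le_trans (h j))// ler_nat.
Qed.

Lemma bigcup_bigbox : \bigcup_k bigbox k = setT.
Proof.
rewrite -subTset => q _; exists (Num.truncn (`|q|)).+1 => //; apply/bigboxE => j.
apply: le_trans (ltW (truncnS_gt _)); rewrite /Num.Def.normr/= mx_normrE.
exact: (@le_bigmax _ _ _ _ (fun ij : 'I_1 * 'I_n => `|q ij.1 ij.2|) (0, j)).
Qed.

(** Domination by [box_measure_le] on [A] and on its complement inside a large cube, with equality
    on the cube, forces equality; the cubes then exhaust the space. The elementary changes of
    variables and the product formulas below need only be checked on boxes. *)
Lemma box_measure_eq (m : {measure set (borel 'rV[R]_n) -> \bar R}) :
  (forall a b, (forall j, a 0 j <= b 0 j) -> m (box a b) = (box_vol a b)%:E) ->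
  forall A : set (borel 'rV[R]_n), measurable A -> m A = lebesgue_n A.
Proof.
move=> mbox A mA.
have bd k : m (A `&` bigbox k) = lebesgue_n (A `&` bigbox k).
  have mQ : measurable (bigbox k) by exact: measurable_box.
  have mAQ : measurable (A `&` bigbox k) by exact: measurableI.
  have mQA : measurable (bigbox k `\` A) by exact: measurableD.
  have eQ (m' : {measure set (borel 'rV[R]_n) -> \bar R}) :
      m' (bigbox k) = (m' (A `&` bigbox k) + m' (bigbox k `\` A))%E.
    rewrite -measureU//.
      congr (m' _); apply/seteqP; split=> [q qk|q [[]//|[]//]].
      by have [Aq|Aq] := pselect (A q); [left|right].
    by apply/seteqP; split=> // q [[Aq _] [_]].
  have kk (j : 'I_n) : (const_mx (- k%:R) : 'rV[R]_n) 0 j <= (const_mx k%:R : 'rV[R]_n) 0 j.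
    by rewrite !mxE (@le_trans _ _ 0) ?oppr_le0 ?ler0n.
  have e1 := mbox _ _ kk; have e2 := box_measure_box mbox kk.
  rewrite -/(bigbox k) eQ in e1; rewrite -/(bigbox k) eQ in e2.
  have l1 := box_measure_le mbox mAQ; have l2 := box_measure_le mbox mQA.
  apply/eqP; rewrite eq_le l1 /=.
  exact: (lee_add_squeeze (measure_ge0 m _) (measure_ge0 m _) e1 e2 l1 l2).
have mU k : measurable (A `&` bigbox k) by apply: measurableI => //; exact: measurable_box.
have nd : nondecreasing_seq (fun k => A `&` bigbox k).
  by move=> i k ik; apply/subsetPset; apply: setIS; exact/subsetPset/bigbox_nd.
have UE : \bigcup_k (A `&` bigbox k) = A by rewrite -setI_bigcupr bigcup_bigbox setIT.
have mUU : measurable (\bigcup_k (A `&` bigbox k)) by rewrite UE.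
have c1 := nondecreasing_cvg_mu (mu := m) mU mUU nd.
have c2 := nondecreasing_cvg_mu (mu := lebesgue_n) mU mUU nd.
rewrite UE in c1 c2; rewrite -(cvg_lim _ c1)// -(cvg_lim _ c2)//.
suff -> : m \o (fun k => A `&` bigbox k) = lebesgue_n \o (fun k => A `&` bigbox k) by [].
by apply/funext => k; exact: bd.
Qed.

End LebesgueMeasure.

Lemma measurable_row_mx (R : realType) m n :
  measurable_fun setT (fun p : borel 'rV[R]_m * borel 'rV[R]_n => (row_mx p.1 p.2 : borel 'rV[R]_(m + n))).
Proof.
apply: measurable_rV => j; case: (splitP j) => i ji.
- rewrite (_ : (fun _ => _) = (fun p => (p.1 : 'rV[R]_m) 0 i)).
    by apply: (measurableT_comp (measurable_coord i)); exact: measurable_fst.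
  by apply/funext => p; rewrite (_ : j = lshift n i) ?row_mxEl//; exact: val_inj.
- rewrite (_ : (fun _ => _) = (fun p => (p.2 : 'rV[R]_n) 0 i)).
    by apply: (measurableT_comp (measurable_coord i)); exact: measurable_snd.
  by apply/funext => p; rewrite (_ : j = rshift m i) ?row_mxEr//; exact: val_inj.
Qed.

Section Existence.
Context (R : realType).

Lemma lebesgue_n_box_sigma_finite n :
  (forall a b : 'rV[R]_n, (forall j, a 0 j <= b 0 j) -> lebesgue_n (box a b) = (box_vol a b)%:E) ->
  sigma_finite setT (@lebesgue_n R n).
Proof.
move=> h; exists (@bigbox R n); first by rewrite bigcup_bigbox.
move=> k; split; first exact: measurable_box.
by rewrite h ?ltry// => j; rewrite !mxE (@le_trans _ _ 0) ?oppr_le0 ?ler0n.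
Qed.

Lemma measurable_row1 n :
  measurable_fun setT (fun p : R * borel 'rV[R]_n => (row_mx p.1%:M p.2 : borel 'rV[R]_(1 + n))).
Proof.
apply: measurable_rV => j; case: (splitP j) => i ji.
- rewrite (_ : (fun _ => _) = fst); first exact: measurable_fst.
  apply/funext => p; have -> : j = lshift n 0 by apply: val_inj; rewrite /= ji (ord1 i).
  by rewrite row_mxEl mxE eqxx mulr1n.
- rewrite (_ : (fun _ => _) = (fun p => (p.2 : 'rV[R]_n) 0 i)).
    by apply: (measurableT_comp (measurable_coord i)); exact: measurable_snd.
  by apply/funext => p; rewrite (_ : j = rshift 1 i) ?row_mxEr//; exact: val_inj.
Qed.

(** By induction on [n]: the product of the measures in dimensions 1 and [n], carried over by
    [row_mx], is the auxiliary measure for [box_measure_box]. In dimension 0 the only box is the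
    whole space, of volume 1, and a Dirac mass serves. *)
Lemma lebesgue_n_box n (a b : 'rV[R]_n) :
  (forall j, a 0 j <= b 0 j) -> lebesgue_n (box a b) = (box_vol a b)%:E.
Proof.
elim: n a b => [|n IH] a b ab.
  pose m : {measure set (borel 'rV[R]_0) -> \bar R} := \d_(0 : borel 'rV[R]_0).
  apply: (@box_measure_box R 0 m) => // c d _.
  rewrite /m/= diracE mem_set; last by case.
  by rewrite /box_vol big_ord0.
have sf := lebesgue_n_box_sigma_finite IH.
(* The product measure requires a sigma-finite second factor, and sigma-finiteness is known only
   through the induction hypothesis; hence the structure is packed inside the proof. *)
have [S SE] : exists S : {sigma_finite_measure set (borel 'rV[R]_n) -> \bar R}, S = @lebesgue_n R n :> (set _ -> _).
  by exists (HB.pack_for {sigma_finite_measure set (borel 'rV[R]_n) -> \bar R} (@lebesgue_n R n)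
  (@Measure_isSigmaFinite.Build _ _ _ (@lebesgue_n R n) sf)).
pose f := fun p : R * borel 'rV[R]_n => (row_mx p.1%:M p.2 : borel 'rV[R]_(1 + n)).
have mf : measurable_fun setT f by exact: measurable_row1.
pose m0 : {measure set _ -> \bar R} := (@lebesgue_measure R \x S)%E.
pose m : {measure set (borel 'rV[R]_(1 + n)) -> \bar R} := pushm m0 mf.
refine (@box_measure_box R (1 + n) m _ a b ab) => c d cd.
rewrite /m/= /pushm/= /pushforward.
have -> : f @^-1` box c d = `[c 0 (lshift n 0), d 0 (lshift n 0)] `*` box (rsubmx c) (rsubmx d).
  apply/seteqP; split=> -[x q] /= h.
    split; first by have := h (lshift n 0); rewrite /f row_mxEl mxE mulr1n /= in_itv.
    by move=> j; have := h (rshift 1 j); rewrite /f row_mxEr !mxE.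
  case: h => h1 h2 j; rewrite /f; case: (splitP j) => i ji.
    have -> : j = lshift n 0 by apply: val_inj; rewrite /= ji (ord1 i).
    by rewrite row_mxEl mxE eqxx mulr1n; move: h1; rewrite /= in_itv.
  have -> : j = rshift 1 i by exact: val_inj.
  by rewrite row_mxEr; have := h2 i; rewrite !mxE.
rewrite (product_measure1E (@lebesgue_measure R) S) ?SE//; last exact: measurable_box.
rewrite [X in (X * _)%E](_ : _ = (d 0 (lshift n 0) - c 0 (lshift n 0))%:E); last exact: lebesgue_segment.
rewrite [X in (_ * X)%E]IH => [|j]; last by rewrite !mxE.
rewrite -EFinM; congr EFin; rewrite /box_vol big_split_ord /= big_ord1; congr (_ * _).
by apply: eq_bigr => j _; rewrite !mxE.
Qed.

End Existence.

HB.instance Definition _ (R : realType) n :=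
  @Measure_isSigmaFinite.Build _ _ _ (@lebesgue_n R n) (lebesgue_n_box_sigma_finite (@lebesgue_n_box R n)).

(** * Linear changes of variables *)

Section Linear.
Context (R : realType).

Lemma rV_coord_le n (q : 'rV[R]_n) j : `|q 0 j| <= `|q|.
Proof.
rewrite [leRHS]/Num.Def.normr/= mx_normrE.
exact: (@le_bigmax _ _ _ _ (fun ij : 'I_1 * 'I_n => `|q ij.1 ij.2|) (0, j)).
Qed.

Lemma rV_norm_le n (q : 'rV[R]_n) c : 0 <= c -> (forall j, `|q 0 j| <= c) -> `|q| <= c.
Proof.
move=> c0 h; rewrite [leLHS]/Num.Def.normr/= mx_normrE; apply/bigmax_leP; split => // -[i j] _ /=.
by rewrite (ord1 i).
Qed.

Definition mxsum m n (A : 'M[R]_(m, n)) : R := \sum_i \sum_j `|A i j|.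

Lemma mxsum_ge0 m n (A : 'M[R]_(m, n)) : 0 <= mxsum A.
Proof. by apply: sumr_ge0 => i _; apply: sumr_ge0. Qed.

Lemma rV_norm_mul m n (q : 'rV[R]_m) (A : 'M[R]_(m, n)) : `|q *m A| <= `|q| * mxsum A.
Proof.
apply: rV_norm_le => [|j]; first by rewrite mulr_ge0 ?mxsum_ge0.
rewrite mxE; apply: le_trans (ler_norm_sum _ _ _) _.
apply: (@le_trans _ _ (\sum_k `|q| * `|A k j|)).
  by apply: ler_sum => k _; rewrite normrM ler_wpM2r// rV_coord_le.
rewrite -mulr_sumr ler_wpM2l//.
by apply: ler_sum => k _; rewrite (bigD1 j)//= lerDl; exact: sumr_ge0.
Qed.

Lemma metric_continuous (S W : normedModType R) (f : S -> W) :
  (forall q e, 0 < e -> exists2 d, 0 < d & forall p, `|q - p| < d -> `|f q - f p| < e) ->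
  continuous f.
Proof.
move=> h q A /nbhs_ballP[e /= e0 eA]; have [d d0 hd] := h q e e0.
apply/nbhs_ballP; exists d => //= p; rewrite -ball_normE /= => qp.
by apply: eA; rewrite -ball_normE /=; exact: hd.
Qed.

Lemma mulmxr_continuous m n (A : 'M[R]_(m, n)) : continuous (fun q : 'rV[R]_m => q *m A).
Proof.
apply: metric_continuous => q e e0.
exists (e / (mxsum A + 1)) => [|p]; first by rewrite divr_gt0// ltr_wpDl ?mxsum_ge0.
rewrite ltr_pdivlMr ?ltr_wpDl ?mxsum_ge0// => h; rewrite -mulmxBl.
apply: le_lt_trans (rV_norm_mul _ _) _; apply: le_lt_trans h.
by rewrite ler_wpM2l// lerDl.
Qed.

Lemma shift_continuous n (v : 'rV[R]_n) : continuous (fun q : 'rV[R]_n => q + v).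
Proof.
apply: metric_continuous => q e e0; exists e => // p.
by rewrite opprD addrACA subrr addr0.
Qed.

Lemma measurable_mulmxr m n (A : 'M[R]_(m, n)) :
  measurable_fun setT (fun q : borel 'rV[R]_m => (q *m A : borel 'rV[R]_n)).
Proof. by apply: continuous_borel; exact: mulmxr_continuous. Qed.

Lemma measurable_shift n (v : 'rV[R]_n) :
  measurable_fun setT (fun q : borel 'rV[R]_n => ((q : 'rV[R]_n) + v : borel 'rV[R]_n)).
Proof. by apply: continuous_borel; exact: shift_continuous. Qed.

Lemma lebesgue_n_shift n (v : 'rV[R]_n) (E : set (borel 'rV[R]_n)) : measurable E ->
  lebesgue_n [set q | E ((q : 'rV[R]_n) + v)] = lebesgue_n E.
Proof.
move=> mE; pose m := pushm (@lebesgue_n R n) (measurable_shift v).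
apply: (@box_measure_eq R n m _ E mE) => a b ab.
rewrite /m/= /pushm/= /pushforward.
have -> : (fun q : borel 'rV[R]_n => ((q : 'rV[R]_n) + v : borel 'rV[R]_n)) @^-1` box a b = box (a - v) (b - v).
  by apply/seteqP; split=> q h j; have := h j; rewrite !mxE lerBlDr lerBrDr.
rewrite lebesgue_n_box => [|j]; last by rewrite !mxE lerD2r.
by congr EFin; apply: eq_bigr => j _; rewrite !mxE; ring.
Qed.

(** Stated for preimages, which are Borel for every matrix, and multiplicative in the matrix by
    [scalesM]; the factor turns out to be |det A|. *)
Definition scales n (A : 'M[R]_n) (c : R) :=
  forall E : set (borel 'rV[R]_n), measurable E ->
    (lebesgue_n [set q | E ((q : 'rV[R]_n) *m A)] * c%:E)%E = lebesgue_n E.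

Lemma scalesM n (A B : 'M[R]_n) c d : scales A c -> scales B d -> scales (A *m B) (c * d).
Proof.
move=> hA hB E mE; have mB := measurable_mulmxr B measurableT mE.
rewrite setTI in mB; have := hA _ mB; rewrite /preimage /= => eA.
rewrite EFinM muleA -[RHS](hB E mE).
have -> : [set q | E ((q : 'rV[R]_n) *m (A *m B))] = [set q | E ((q : 'rV[R]_n) *m A *m B)].
  by apply/seteqP; split=> q /=; rewrite mulmxA.
by rewrite eA.
Qed.

(** A negative diagonal entry reverses the interval; [min] and [max] treat both signs at once. *)
Lemma le_min_max_div (x y z d : R) : d != 0 -> x <= y ->
  (Num.min (x / d) (y / d) <= z <= Num.max (x / d) (y / d)) = (x <= z * d <= y).
Proof.
move=> d0 xy; have [dp|dn|d00] := ltrgt0P d; last by rewrite d00 eqxx in d0.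
  have h : x / d <= y / d by rewrite ler_pM2r ?invr_gt0.
  by rewrite min_l// max_r// ler_pdivrMr// ler_pdivlMr.
have h : y / d <= x / d by rewrite ler_nM2r ?invr_lt0.
by rewrite min_r// max_l// ler_ndivrMr// ler_ndivlMr// andbC.
Qed.

Lemma scales_diag n (d : 'rV[R]_n) : (forall j, d 0 j != 0) ->
  scales (diag_mx d) (\prod_j `|d 0 j|).
Proof.
move=> d0 E mE.
have c0 : 0 <= \prod_j `|d 0 j| by apply: prodr_ge0.
pose m : {measure set (borel 'rV[R]_n) -> \bar R} := mscale (NngNum c0) (pushm (@lebesgue_n R n) (measurable_mulmxr (diag_mx d))).
have mb (a b : 'rV[R]_n) : (forall j, a 0 j <= b 0 j) -> m (box a b) = (box_vol a b)%:E.
  move=> ab; rewrite /m/= /mscale/= /pushm/= /pushforward.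
  have -> : (fun q : borel 'rV[R]_n => ((q : 'rV[R]_n) *m diag_mx d : borel 'rV[R]_n)) @^-1` box a b =
     box (\row_j Num.min (a 0 j / d 0 j) (b 0 j / d 0 j)) (\row_j Num.max (a 0 j / d 0 j) (b 0 j / d 0 j)).
    by apply/seteqP; split=> q h j; have := h j; rewrite /= mul_mx_diag !mxE le_min_max_div.
  rewrite lebesgue_n_box => [|j]; last by rewrite !mxE le_max ge_min lexx.
  rewrite -EFinM; congr EFin; rewrite /box_vol -big_split/=; apply: eq_bigr => j _; rewrite !mxE.
  have dj := d0 j; have abj := ab j.
  have -> : Num.max (a 0 j / d 0 j) (b 0 j / d 0 j) - Num.min (a 0 j / d 0 j) (b 0 j / d 0 j) = `|a 0 j / d 0 j - b 0 j / d 0 j|.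
    by case: ltgtP => h; [rewrite ltr0_norm ?subr_lt0//; ring|rewrite gtr0_norm ?subr_gt0//|rewrite h subrr normr0].
  by rewrite -mulrBl normrM mulrCA -normrM divff// normr1 mulr1 distrC ger0_norm// subr_ge0.
have := @box_measure_eq R n m mb E mE.
by rewrite /m/= /mscale/= /pushm/= /pushforward muleC.
Qed.

Lemma scales_perm n (s : 'S_n) : scales (perm_mx s) 1.
Proof.
move=> E mE; rewrite mule1.
pose m := pushm (@lebesgue_n R n) (measurable_mulmxr (perm_mx s)).
apply: (@box_measure_eq R n m _ E mE) => a b ab.
rewrite /m/= /pushm/= /pushforward.
have pE (q : 'rV[R]_n) j : (q *m perm_mx s) 0 j = q 0 (s^-1 j)%g.
  by rewrite -[s in LHS]invgK -col_permE mxE.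
have -> : (fun q : borel 'rV[R]_n => ((q : 'rV[R]_n) *m perm_mx s : borel 'rV[R]_n)) @^-1` box a b =
   box (\row_j a 0 (s j)) (\row_j b 0 (s j)).
  apply/seteqP; split=> q h j.
    by rewrite !mxE; have := h (s j); rewrite /= pE permK.
  by rewrite /= pE; have := h (s^-1 j)%g; rewrite !mxE permKV.
rewrite lebesgue_n_box => [|j]; last by rewrite !mxE.
congr EFin; rewrite /box_vol [RHS](reindex_inj (@perm_inj _ s)) /=.
by apply: eq_bigr => j _; rewrite !mxE.
Qed.

Lemma lebesgue_n_cons n (E : set (borel 'rV[R]_(1 + n))) : measurable E ->
  lebesgue_n E = (\int[@lebesgue_measure R]_x lebesgue_n [set y : borel 'rV[R]_n | E (row_mx x%:M y)])%E.
Proof.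
move=> mE.
pose m0 : {measure set _ -> \bar R} := (@lebesgue_measure R \x @lebesgue_n R n)%E.
pose m := pushm m0 (@measurable_row1 R n).
rewrite -(@box_measure_eq R (1 + n) m _ E mE).
  rewrite /m/= /pushm/= /pushforward /m0/= /product_measure1/=.
  by apply: eq_integral => x _ /=; congr lebesgue_n; apply/seteqP; split=> y; [move=> /set_mem|move=> h; apply/mem_set].
move=> c d cd; rewrite /m/= /pushm/= /pushforward.
set f := (fun p : _ * _ => _).
have -> : f @^-1` box c d = `[c 0 (lshift n 0), d 0 (lshift n 0)] `*` box (rsubmx c) (rsubmx d).
  apply/seteqP; split=> -[x q] /= h.
    split; first by have := h (lshift n 0); rewrite /f row_mxEl mxE mulr1n /= in_itv.
    by move=> j; have := h (rshift 1 j); rewrite /f row_mxEr !mxE.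
  case: h => h1 h2 j; rewrite /f; case: (splitP j) => i ji.
    have -> : j = lshift n 0 by apply: val_inj; rewrite /= ji (ord1 i).
    by rewrite row_mxEl mxE eqxx mulr1n; move: h1; rewrite /= in_itv.
  have -> : j = rshift 1 i by exact: val_inj.
  by rewrite row_mxEr; have := h2 i; rewrite !mxE.
rewrite (product_measure1E (@lebesgue_measure R) (@lebesgue_n R n))//; last exact: measurable_box.
rewrite [X in (X * _)%E](_ : _ = (d 0 (lshift n 0) - c 0 (lshift n 0))%:E); last exact: lebesgue_segment.
rewrite [X in (_ * X)%E](_ : _ = (box_vol (rsubmx c) (rsubmx d))%:E); last first.
  by apply: lebesgue_n_box => j; rewrite !mxE.
rewrite -EFinM; congr EFin; rewrite /box_vol big_split_ord /= big_ord1; congr (_ * _).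
by apply: eq_bigr => j _; rewrite !mxE.
Qed.

Lemma measurable_section n (E : set (borel 'rV[R]_(1 + n))) (x : R) : measurable E ->
  measurable [set y : borel 'rV[R]_n | E (row_mx x%:M y)].
Proof.
move=> mE; have := measurable_xsection x (measurable_row1 measurableT mE).
by rewrite setTI; congr measurable; apply/seteqP; split=> y; [move=> /set_mem|move=> h; apply/mem_set].
Qed.

(** By induction on the size, cutting along the first coordinate [x]: a section is transformed by
    the smaller triangular matrix followed by the translation by [x] times the rest of the first
    row, and neither changes its measure. *)
Lemma scales_upper n (A : 'M[R]_n) : (forall i j : 'I_n, (j <= i)%N -> A i j = (i == j)%:R) -> scales A 1.
Proof.
elim: n A => [|n IH] A hA E mE; rewrite mule1.
  by congr lebesgue_n; apply/seteqP; split=> q /=; rewrite (flatmx0 A) mulmx0 (thinmx0 q).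
have e1 : ulsubmx (A : 'M[R]_(1 + n)) = 1%:M.
  by apply/matrixP => i j; rewrite !mxE hA ?ord1// eqxx.
have e2 : dlsubmx (A : 'M[R]_(1 + n)) = 0.
  apply/matrixP => i j; rewrite !mxE hA; last by rewrite (ord1 j).
  by rewrite -val_eqE /= (ord1 j).
have -> : A = block_mx (1%:M : 'M[R]_1) (ursubmx (A : 'M[R]_(1 + n))) 0 (drsubmx (A : 'M[R]_(1 + n))).
  by rewrite -e1 -e2 submxK.
rewrite lebesgue_n_cons//; last first.
  have := measurable_mulmxr (block_mx (1%:M : 'M[R]_1) (ursubmx (A : 'M[R]_(1 + n))) 0 (drsubmx (A : 'M[R]_(1 + n)))) measurableT mE.
  by rewrite setTI.
rewrite lebesgue_n_cons//; apply: eq_integral => x _.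
have mEx := measurable_section x mE.
have mEx' : measurable [set y : borel 'rV[R]_n | E (row_mx x%:M ((y : 'rV[R]_n) + x%:M *m ursubmx (A : 'M[R]_(1 + n))))].
  by have := measurable_shift (x%:M *m ursubmx (A : 'M[R]_(1 + n))) measurableT mEx; rewrite setTI.
transitivity (lebesgue_n [set y : borel 'rV[R]_n | E (row_mx x%:M ((y : 'rV[R]_n) *m drsubmx (A : 'M[R]_(1 + n)) + x%:M *m ursubmx (A : 'M[R]_(1 + n))))]).
  congr lebesgue_n; apply: eq_set => y.
  have hy : row_mx x%:M y *m block_mx (1%:M : 'M[R]_1) (ursubmx (A : 'M[R]_(1 + n))) 0 (drsubmx (A : 'M[R]_(1 + n)))
     = row_mx x%:M ((y : 'rV[R]_n) *m drsubmx (A : 'M[R]_(1 + n)) + x%:M *m ursubmx (A : 'M[R]_(1 + n))).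
    by rewrite mul_row_block mulmx1 mulmx0 addr0 addrC.
  by rewrite -hy.
rewrite -[RHS](lebesgue_n_shift (x%:M *m ursubmx (A : 'M[R]_(1 + n))) mEx).
have hD : scales (drsubmx (A : 'M[R]_(1 + n))) 1.
  by apply: IH => i j ji; rewrite !mxE hA//= (inj_eq (@rshift_inj _ _)).
by have := hD _ mEx'; rewrite mule1.
Qed.

(** Reversing the order of the coordinates turns a lower triangular matrix into an upper triangular
    one. *)
Lemma scales_lower n (A : 'M[R]_n) : (forall i j : 'I_n, (i <= j)%N -> A i j = (i == j)%:R) -> scales A 1.
Proof.
move=> hA; pose s := perm (@rev_ord_inj n).
have sK i : s (s i) = i by rewrite !permE rev_ordK.
have sV : (s^-1 = s)%g.
  by apply/permP => i; apply: (@perm_inj _ s); rewrite permKV sK.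
pose B := \matrix_(i, j) A (s i) (s j).
have -> : A = perm_mx s *m B *m perm_mx s.
  apply/matrixP => i j; rewrite -row_permE -[X in _ *m perm_mx X]sV -[X in _ *m perm_mx X]invgK sV -col_permE !mxE.
  by rewrite sV !sK.
rewrite -[1]mulr1 -[X in X * _]mulr1; apply: scalesM (scales_perm _); apply: scalesM; first exact: scales_perm.
apply: scales_upper => i j ji; rewrite mxE hA ?(inj_eq perm_inj)//.
by rewrite !permE /= leq_sub2l.
Qed.

(** LUP decomposition, with the upper factor split further into its diagonal and a unipotent matrix:
    every factor is of a type treated above, and only the diagonal contributes to |det A|. *)
Lemma scales_det n (A : 'M[R]_n) : A \in unitmx -> scales A `|\det A|.
Proof.
case: n A => [|n] A uA.
  move=> E mE; rewrite (flatmx0 A) det_mx00 normr1 mule1.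
  by congr lebesgue_n; apply/seteqP; split=> q /=; rewrite mulmx0 (thinmx0 q).
move: (cormen_lup_perm A) (cormen_lup_correct A) (@cormen_lup_upper _ _ A) (cormen_lup_detL A) (@cormen_lup_lower _ _ A).
case: (cormen_lup A) => [[P L] U] /= /is_perm_mxP[s ->] PA hU dL hL.
have dU : \det U = \prod_i U i i.
  by rewrite -det_tr det_trig; [apply: eq_bigr => i _; rewrite mxE|apply/is_trig_mxP => i j ij; rewrite mxE hU].
have dA : `|\det A| = \prod_i `|U i i|.
  have := congr1 (fun M : 'M[R]_n.+1 => `|\det M|) PA; rewrite /= !det_mulmx dL mul1r dU normr_prod => <-.
  by rewrite normrM det_perm normrX normrN1 expr1n mul1r.
have U0 i : U i i != 0.
  have : \prod_i `|U i i| != 0 by rewrite -dA normr_eq0 -unitfE -unitmxE.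
  by rewrite prodf_seq_neq0 => /allP /(_ i); rewrite mem_index_enum normr_eq0 => /(_ isT).
pose d := \row_i U i i.
pose U' := \matrix_(i, j) (U i j / U i i).
have UE : U = diag_mx d *m U'.
  by apply/matrixP => i j; rewrite mul_diag_mx !mxE mulrCA divff// mulr1.
have AE : A = perm_mx (s^-1)%g *m (L *m (diag_mx d *m U')).
  rewrite -UE; have <- : perm_mx s *m A = L *m U by exact: PA.
  by rewrite mulmxA -perm_mxM mulVg perm_mx1 mul1mx.
have -> : `|\det A| = 1 * (1 * ((\prod_j `|d 0 j|) * 1)).
  by rewrite dA !mul1r mulr1; apply: eq_bigr => i _; rewrite mxE.
rewrite AE.
apply: scalesM (scales_perm _) _; apply: scalesM; first exact: scales_lower.
apply: scalesM; first by apply: scales_diag => j; rewrite mxE.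
apply: scales_upper => i j; rewrite leq_eqVlt => /predU1P[/val_inj->|ji]; rewrite mxE.
  by rewrite divff// eqxx.
by rewrite hU// mul0r -val_eqE eq_sym (ltn_eqF ji).
Qed.

Lemma lebesgue_n_image n (A : 'M[R]_n) (E : set (borel 'rV[R]_n)) : A \in unitmx -> measurable E ->
  lebesgue_n ((fun q : 'rV[R]_n => q *m A) @` E) = (`|\det A|%:E * lebesgue_n E)%E.
Proof.
move=> uA mE; have := scales_det (A := invmx A); rewrite unitmx_inv => /(_ uA) h.
rewrite -(h E mE) muleCA -EFinM det_inv normfV mulfV ?mule1 ?normr_eq0 -?unitfE -?unitmxE//.
congr lebesgue_n; apply/seteqP; split=> [_ [q Eq <-]|q /= Eq]; first by rewrite /= mulmxK.
by exists (q *m invmx A) => //; rewrite mulmxKV.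
Qed.

End Linear.

(** * Outer measure of images: cubes, Lipschitz maps, slabs *)

Section CoverLemma.
Context (R : realType) (n : nat).
Implicit Types (a b q : 'rV[R]_n).
Local Notation mu := (@lebesgue_rV R n).

Lemma lebesgue_rV_fin (I : finType) (F : I -> set 'rV[R]_n) (A : set 'rV[R]_n) :
  A `<=` (fun q => exists i, F i q) -> (mu A <= \sum_i mu (F i))%E.
Proof.
move=> AF; pose G (k : nat) : set 'rV[R]_n := if insub k is Some i then F (@enum_val I predT i) else set0.
have GE (k : 'I_#|I|) : G k = F (enum_val k) by rewrite /G valK.
have h : A `<=` \big[setU/set0]_(k < #|I|) G k.
  move=> q /AF[i Fi]; rewrite -(bigcup_mkord _ G); exists (enum_rank i) => //=.
  by rewrite GE enum_rankK.
apply: le_trans (le_outer_measure mu _ _ h) _.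
apply: le_trans (outer_measure_subadditive mu _ _) _.
rewrite [leRHS](reindex _ (onW_bij _ (@enum_val_bij I)))/=.
by rewrite (eq_bigr (fun k => mu (F (enum_val k)))) => [|k _]; rewrite ?GE.
Qed.

(** The error is linear in [d] with a constant free of [d], so cubes that overshoot a box by [d] in
    each direction cost nothing in the limit. *)
Lemma prod_perturb (I : Type) (r : seq I) (l : I -> R) (d : R) : (forall i, 0 <= l i) ->
  0 <= d <= 1 -> \prod_(i <- r) (l i + d) <= \prod_(i <- r) l i + d * \prod_(i <- r) (l i + 1).
Proof.
move=> l0 /andP[d0 d1].
suff : [/\ 0 <= \prod_(i <- r) l i, \prod_(i <- r) l i <= \prod_(i <- r) (l i + 1) &
  \prod_(i <- r) (l i + d) <= \prod_(i <- r) l i + d * (\prod_(i <- r) (l i + 1) - \prod_(i <- r) l i)].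
  by move=> [h1 h2 h3]; apply: le_trans h3 _; rewrite lerD2l ler_wpM2l// gerBl.
elim: r => [|i r [h1 h2 h3]]; first by rewrite !big_nil subrr mulr0 addr0.
rewrite !big_cons; move: (\prod_(i <- r) l i) (\prod_(i <- r) (l i + d)) (\prod_(i <- r) (l i + 1)) h1 h2 h3 => P Q S h1 h2 h3.
have li := l0 i; split; [exact: mulr_ge0|nra|].
have h4 : (l i + d) * Q <= (l i + d) * (P + d * (S - P)) by rewrite ler_wpM2l// addr_ge0.
apply: le_trans h4 _; rewrite -subr_ge0.
have -> : l i * P + d * ((l i + 1) * S - l i * P) - (l i + d) * (P + d * (S - P)) = d * (1 - d) * (S - P) by ring.
by rewrite !mulr_ge0// subr_ge0.
Qed.

Variables (F : 'rV[R]_n -> 'rV[R]_n) (A : set 'rV[R]_n) (kappa : R).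
Hypothesis kappa0 : 0 < kappa.
Hypothesis cube_bound : forall c (s : R), 0 < s ->
  (mu (F @` (A `&` box c (c + const_mx s))) <= (kappa * s ^+ n)%:E)%E.

Lemma cover_box a b : (forall j, a 0 j <= b 0 j) -> (mu (F @` (A `&` box a b)) <= (kappa * box_vol a b)%:E)%E.
Proof.
move=> ab.
have step (d : R) : 0 < d -> d <= 1 ->
    (mu (F @` (A `&` box a b)) <= (kappa * \prod_j (b 0 j - a 0 j + d))%:E)%E.
  move=> d0 d1.
  pose m j := (Num.truncn ((b 0 j - a 0 j) / d)).+1.
  pose M := \max_j m j.
  have mM j : (m j <= M)%N by exact: leq_bigmax.
  pose lo (k : {ffun 'I_n -> 'I_M}) : 'rV[R]_n := \row_j (a 0 j + (k j)%:R * d).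
  pose good (k : {ffun 'I_n -> 'I_M}) := [forall j, (k j < m j)%N].
  pose S k := if good k then F @` (A `&` box (lo k) (lo k + const_mx d)) else set0.
  have cover : F @` (A `&` box a b) `<=` (fun p => exists k, S k p).
    move=> _ [q [Aq qab] <-].
    have kj (j : 'I_n) : (Num.truncn ((q 0 j - a 0 j) / d)%R < m j)%N.
      rewrite ltnS; apply: le_truncn; rewrite ler_pM2r ?invr_gt0// lerD2r.
      by have /andP[] := qab j.
    exists [ffun j => Ordinal (leq_trans (kj j) (mM j))].
    rewrite /S ifT; last by apply/forallP => j; rewrite ffunE /=; exact: kj.
    exists q => //; split => // j; rewrite !mxE ffunE /=.
    have /andP[qa qb] := qab j.
    have h0 : 0 <= (q 0 j - a 0 j) / d by rewrite divr_ge0 ?subr_ge0// ltW.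
    have /andP[h1 h2] := truncn_itv h0.
    move: h1; rewrite ler_pdivlMr// => h1.
    move: h2; rewrite ltr_pdivrMr// -natr1 mulrDl mul1r => h2.
    by apply/andP; split; lra.
  apply: le_trans (lebesgue_rV_fin cover) _.
  pose c j (i : 'I_M) : R := if (i < m j)%N then d else 0.
  apply: (@le_trans _ _ (\sum_(k : {ffun 'I_n -> 'I_M}) (kappa * \prod_j c j (k j))%:E)%E).
    apply: lee_sum => k _; rewrite /S; case: ifPn => [gk|_].
      apply: le_trans (cube_bound _ d0) _; rewrite lee_fin ler_wpM2l ?(ltW kappa0)//.
      rewrite (eq_bigr (fun=> d)) => [|j _]; first by rewrite prodr_const card_ord.
      by rewrite /c ifT//; exact: (forallP gk).
    rewrite outer_measure0 lee_fin mulr_ge0 ?(ltW kappa0)// prodr_ge0// => j _.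
    by rewrite /c; case: ifP => // _; rewrite ltW.
  rewrite sumEFin lee_fin -mulr_sumr ler_wpM2l ?(ltW kappa0)//.
  rewrite -(bigA_distr_bigA c); apply: ler_prod => j _; apply/andP; split.
    by apply: sumr_ge0 => i _; rewrite /c; case: ifP => // _; rewrite ltW.
  rewrite /c -big_mkcond/= (eq_bigl (fun i : 'I_M => (i < m j)%N))//.
  rewrite -(big_ord_widen _ (fun=> d) (mM j)) sumr_const card_ord.
  rewrite /m -mulr_natl -natr1 mulrDl mul1r lerD2r -ler_pdivlMr//.
  have h0 : 0 <= (b 0 j - a 0 j) / d by rewrite divr_ge0 ?subr_ge0// ltW.
  by have /andP[] := truncn_itv h0.
apply/lee_addgt0Pr => e e0.
pose C := kappa * \prod_j (b 0 j - a 0 j + 1) + 1.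
have l0 (j : 'I_n) : 0 <= b 0 j - a 0 j by rewrite subr_ge0.
have C0 : 0 < C.
  rewrite ltr_wpDl// mulr_ge0 ?(ltW kappa0)//.
  by apply: prodr_ge0 => j _; rewrite addr_ge0.
pose d := Num.min 1 (e / C).
have d0 : 0 < d by rewrite lt_min ltr01 divr_gt0.
have d1 : d <= 1 by rewrite ge_min lexx.
apply: le_trans (step d d0 d1) _; rewrite -EFinD lee_fin.
have d01 : 0 <= d <= 1 by rewrite (ltW d0).
have hp := @prod_perturb 'I_n (index_enum 'I_n) (fun j => b 0 j - a 0 j) d l0 d01.
apply: (@le_trans _ _ (kappa * (\prod_j (b 0 j - a 0 j) + d * \prod_j (b 0 j - a 0 j + 1)))).
  by rewrite ler_pM2l.
rewrite mulrDr lerD2l.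
apply: (@le_trans _ _ (d * C)).
  by rewrite /C mulrDr mulr1 mulrCA lerDl ltW.
by rewrite -ler_pdivlMr// /d ge_min lexx orbT.
Qed.

(** An estimate on cubes suffices because small cubes fill a box with vanishing overshoot
    ([cover_box]) and the outer measure is an infimum over covers by boxes. The Lipschitz bound and
    Sard's theorem both rest on this. *)
Lemma cover_lemma : (mu (F @` A) <= kappa%:E * mu A)%E.
Proof.
rewrite -lee_pdivrMl//; apply: le_ereal_inf_tmp => _ [P [a [b [ab cA ->]]]].
rewrite lee_pdivrMl// -nneseriesZl; last first.
  by move=> k _; rewrite lee_fin; exact: box_vol_ge0.
pose G k := if P k then F @` (A `&` box (a k) (b k)) else set0.
have h : F @` A `<=` \bigcup_k G k.
  by move=> _ [q Aq <-]; have [k /= Pk qk] := cA q Aq; exists k => //; rewrite /G Pk; exists q.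
apply: le_trans (le_outer_measure mu _ _ h) _.
apply: le_trans (outer_measure_sigma_subadditive mu G) _.
rewrite [leRHS]eseries_mkcond; apply: lee_nneseries => k _; first by [].
rewrite /G; case: (P k); last by rewrite outer_measure0.
exact: cover_box.
Qed.

End CoverLemma.

Section Lipschitz.
Context (R : realType) (n : nat).
Local Notation mu := (@lebesgue_rV R n).

(** In the maximum norm the image of part of a cube of side s has diameter at most c s, hence lies
    in a cube of side c s: the constant is exactly c^n, without dimensional loss, as the sharp area
    formula requires. *)
Lemma lipschitz_lebesgue (F : 'rV[R]_n -> 'rV[R]_n) (A : set 'rV[R]_n) (c : R) : 0 < c ->
  (forall x y, A x -> A y -> `|F x - F y| <= c * `|x - y|) ->
  (mu (F @` A) <= (c ^+ n)%:E * mu A)%E.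
Proof.
move=> c0 hF; apply: cover_lemma; first by rewrite exprn_gt0.
move=> p s s0.
have [->|/set0P[x0 [Ax0 Bx0]]] := eqVneq (A `&` box p (p + const_mx s)) set0.
  by rewrite image_set0 outer_measure0 lee_fin mulr_ge0 ?exprn_ge0 ?ltW.
set B := A `&` _.
have diam x y : B x -> B y -> `|F x - F y| <= c * s.
  move=> [Ax Bx] [Ay By]; apply: le_trans (hF _ _ Ax Ay) _; rewrite ler_pM2l//.
  apply: rV_norm_le => [|j]; first exact: ltW.
  by have := Bx j; have := By j; rewrite !mxE ler_norml; lra.
pose lo : 'rV[R]_n := \row_j inf [set F x 0 j | x in B].
have hinf j : has_inf [set F x 0 j | x in B].
  split; first by exists (F x0 0 j), x0.
  exists (F x0 0 j - c * s) => _ [x Bx <-].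
  have := le_trans (rV_coord_le (F x - F x0) j) (diam _ _ Bx (conj Ax0 Bx0)).
  by rewrite !mxE ler_norml; lra.
have sub : F @` B `<=` box lo (lo + const_mx (c * s)).
  move=> _ [x Bx <-] j; rewrite !mxE; apply/andP; split.
    by apply: ge_inf; [exact: (hinf j).2|exists x].
  rewrite -lerBlDr; apply: lb_le_inf; first exact: (hinf j).1.
  move=> _ [y By <-]; have := le_trans (rV_coord_le (F x - F y) j) (diam _ _ Bx By).
  by rewrite !mxE ler_norml; lra.
apply: le_trans (le_outer_measure mu _ _ sub) _.
apply: le_trans (lebesgue_rV_box _) _ => [j|]; first by rewrite !mxE lerDl mulr_ge0 ?ltW.
rewrite lee_fin /box_vol (eq_bigr (fun=> c * s)) => [|j _]; last by rewrite [(_ + _ : 'rV_n) 0 j]mxE [const_mx _ _ _]mxE; ring.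
by rewrite prodr_const card_ord exprMn.
Qed.

Lemma lebesgue_n_fin_box (a b : 'rV[R]_n) : (lebesgue_n (box a b) < +oo)%E.
Proof.
have [ab|/existsNP[j abj]] := pselect (forall j, a 0 j <= b 0 j); first by rewrite lebesgue_n_box// ltry.
suff -> : box a b = set0 by rewrite measure0.
apply/seteqP; split=> // q /(_ j) /andP[h1 h2]; apply: abj; exact: le_trans h2.
Qed.

Definition slab (w y0 : 'rV[R]_n) (M e : R) : set 'rV[R]_n :=
  [set y | `|y - y0| <= M /\ `|\sum_j (y - y0) 0 j * w 0 j| <= e].

(* The set is mapped into a box by the map replacing the coordinate of maximal weight by the linear form. *)
Lemma slab_bound (w y0 : 'rV[R]_n) (M e : R) (i : 'I_n) : 0 <= M -> 0 <= e ->
  w 0 i != 0 ->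
  (mu (slab w y0 M (e * `|w 0 i|)%R) <=
     (2 * e * (2 * M) ^+ n.-1)%:E)%E.
Proof.
move=> M0 e0 wi.
pose A : 'M[R]_n := \matrix_(k, l) if l == i then w 0 k / w 0 i else (k == l)%:R.
have dA : \det A = 1.
  rewrite (expand_det_row _ i) (bigD1 i)//= big1 ?addr0 => [|l li]; last first.
    by rewrite mxE (negbTE li) eq_sym (negbTE li) mul0r.
  rewrite mxE eqxx divff// mul1r /cofactor -signr_odd oddD addbb expr0 mul1r.
  rewrite (_ : row' i (col' i A) = 1%:M) ?det1//.
  apply/matrixP => k l; rewrite !mxE eq_sym (negbTE (neq_lift i l)).
  by rewrite (inj_eq lift_inj).
have uA : A \in unitmx by rewrite unitmxE dA unitr1.
pose hi : 'rV[R]_n := \row_l if l == i then e else M.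
pose B := box (- hi) hi.
have hh j : (- hi) 0 j <= hi 0 j.
  by rewrite !mxE; case: ifP => _; rewrite ge0_cp.
have volB : lebesgue_n B = (2 * e * (2 * M) ^+ n.-1)%:E.
  rewrite lebesgue_n_box//; congr EFin; rewrite /box_vol (bigD1 i)//= !mxE eqxx.
  rewrite (eq_bigr (fun=> 2 * M)) => [|l li]; last by rewrite !mxE (negbTE li); ring.
  rewrite prodr_const cardC1 card_ord; congr (_ * _); ring.
rewrite -volB; have := @scales_det R n A uA _ (measurable_box (- hi) hi).
rewrite dA normr1 mule1 => <-.
have mS : measurable [set q : borel 'rV[R]_n | box (- hi) hi ((q : 'rV[R]_n) *m A)].
  by have := measurable_mulmxr A measurableT (measurable_box (- hi) hi); rewrite setTI.
rewrite -(lebesgue_n_shift (- y0) mS); apply: le_outer_measure => y [h1 h2] j /=.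
rewrite [(- hi) 0 j]mxE -ler_norml mxE; have [->|ji] := eqVneq j i.
  rewrite [leRHS]mxE eqxx.
  rewrite (eq_bigr (fun k => (y - y0) 0 k * w 0 k / w 0 i)) => [|k _]; last by rewrite [A _ _]mxE eqxx mulrA.
  by rewrite -mulr_suml normrM normfV ler_pdivrMr ?normr_gt0.
rewrite [leRHS]mxE (negbTE ji) (bigD1 j)//= big1 ?addr0 => [|k kj].
  by rewrite [A _ _]mxE (negbTE ji) eqxx mulr1; apply: le_trans h1; exact: rV_coord_le.
by rewrite [A _ _]mxE (negbTE ji) (negbTE kj) mulr0.
Qed.

End Lipschitz.

(** * Strict derivatives and the local area estimate *)

Section PointContinuity.
Context (R : realType) (T : topologicalType).
Implicit Types (x : T).

Lemma continuous_at_sum (I : Type) (r : seq I) (f : I -> T -> R) x :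
  (forall i, {for x, continuous (f i)}) -> {for x, continuous (fun y => \sum_(i <- r) f i y)}.
Proof.
move=> h; elim: r => [|i r IH].
  rewrite (_ : (fun _ => _) = cst 0); first exact: cst_continuous.
  by apply/funext => y; rewrite big_nil.
rewrite (_ : (fun _ => _) = (fun y => f i y + \sum_(k <- r) f k y)); last first.
  by apply/funext => y; rewrite big_cons.
by apply: cvgD; [exact: h|exact: IH].
Qed.

Lemma continuous_at_prod (I : Type) (r : seq I) (f : I -> T -> R) x :
  (forall i, {for x, continuous (f i)}) -> {for x, continuous (fun y => \prod_(i <- r) f i y)}.
Proof.
move=> h; elim: r => [|i r IH].
  rewrite (_ : (fun _ => _) = cst 1); first exact: cst_continuous.
  by apply/funext => y; rewrite big_nil.
rewrite (_ : (fun _ => _) = (fun y => f i y * \prod_(k <- r) f k y)); last first.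
  by apply/funext => y; rewrite big_cons.
by apply: cvgM; [exact: h|exact: IH].
Qed.

Lemma continuous_at_det n (D : T -> 'M[R]_n) x :
  (forall i j, {for x, continuous (fun y => D y i j)}) -> {for x, continuous (fun y => \det (D y))}.
Proof.
move=> h; rewrite /determinant; apply: continuous_at_sum => s.
by apply: cvgM; [exact: cvg_cst|apply: continuous_at_prod => i; exact: h].
Qed.

End PointContinuity.

Section StrictDerivative.
Context (R : realType) (n m : nat).
Implicit Types (F : 'rV[R]_n -> 'rV[R]_m) (L : 'M[R]_(n, m)) (x : 'rV[R]_n).

(* Strict differentiability, with derivative acting on row vectors by right multiplication. *)
Definition strict_deriv F x L := forall e, 0 < e -> exists2 d, 0 < d &
  forall y z, `|y - x| < d -> `|z - x| < d -> `|F y - F z - (y - z) *m L| <= e * `|y - z|.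

Lemma strict_deriv_continuous F x L : strict_deriv F x L -> exists2 d, 0 < d &
  forall y, `|y - x| < d -> {for y, continuous F}.
Proof.
move=> /(_ 1 ltr01)[d d0 h]; exists d => // y yd.
move=> A /nbhs_ballP[e /= e0 eA].
pose C := 1 + mxsum L.
have C0 : 0 < C by rewrite ltr_wpDr ?mxsum_ge0.
apply/nbhs_ballP; exists (Num.min (d - `|y - x|) (e / C)) => /=.
  by rewrite lt_min subr_gt0 yd divr_gt0.
move=> z; rewrite -ball_normE /= lt_min => /andP[z1 z2].
apply: eA; rewrite -ball_normE /=.
have zd : `|z - x| < d.
  have -> : z - x = - (y - z) + (y - x) by rewrite opprB addrA subrK.
  by apply: le_lt_trans (ler_normD _ _) _; rewrite normrN -ltrBrDr.
have h1 := h y z yd zd.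
have -> : F y - F z = (F y - F z - (y - z) *m L) + (y - z) *m L by rewrite subrK.
apply: le_lt_trans (ler_normD _ _) _; apply: (@le_lt_trans _ _ (`|y - z| * C)).
  by rewrite mulrDr mulr1 lerD ?rV_norm_mul// -[leRHS]mul1r.
by rewrite -ltr_pdivlMr.
Qed.

End StrictDerivative.

(** The sets whose trace on the closed ball has a Borel image form a sigma-algebra, injectivity
    taking care of complements. It contains the closed sets, whose traces are compact and have
    compact images, hence the open ones. *)
Lemma measurable_image_inj (R : realType) n (F : 'rV[R]_n -> 'rV[R]_n) x (r : R) (A : set (borel 'rV[R]_n)) :
  (forall y, `|y - x| <= r -> {for y, continuous F}) ->
  {in closed_ball x r &, injective F} -> 0 < r ->
  measurable A -> measurable (F @` (A `&` closed_ball x r) : set (borel 'rV[R]_n)).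
Proof.
move=> cF iF r0.
have cb y : closed_ball x r y <-> `|y - x| <= r.
  by rewrite closed_ballE// /closed_ball_ /= distrC.
have cK : compact (closed_ball x r).
  apply: bounded_closed_compact; last exact: closed_ball_closed.
  exists (`|x| + r); split => [|M]; first exact: num_real.
  move: M => M hM y /cb yr.
  have -> : y = y - x + x by rewrite subrK.
  by apply: le_trans (ler_normD _ _) _; rewrite addrC ltW// (le_lt_trans _ hM)// lerD2l.
have clK (C : set 'rV[R]_n) : closed C -> measurable (F @` (C `&` closed_ball x r) : set (borel 'rV[R]_n)).
  move=> cC; apply: closed_borel; apply: compact_closed; first exact: norm_hausdorff.
  apply: continuous_compact.
    apply: continuous_in_subspaceT => y /set_mem[_ /cb yr]; exact: cF.
  rewrite setIC; exact: compact_closedI.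
pose P : set (set (borel 'rV[R]_n)) :=
  [set B | measurable (F @` (B `&` closed_ball x r) : set (borel 'rV[R]_n))].
suff h : <<s @open 'rV[R]_n >> `<=` P by exact: h.
apply: smallest_sub; last first.
  move=> O oO; rewrite -(setCK O) /P /=.
  have -> : F @` (~` ~` O `&` closed_ball x r) = F @` closed_ball x r `\` F @` (~` O `&` closed_ball x r).
    apply/seteqP; split=> [_ [y [Oy yr] <-]|_ [[y yr <-] h]].
      split; first by exists y.
      by move=> [z [Oz zr] zy]; apply: Oy; rewrite -(iF z y (mem_set zr) (mem_set yr) zy).
    exists y => //; split => //= Oy; apply: h; by exists y.
  apply: measurableD; last by apply: clK; exact: open_closedC.
  by have := clK setT closedT; rewrite setTI.
split.
- by rewrite /P /= set0I image_set0.
- move=> B mB; rewrite setTD /P /=.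
  have -> : F @` (~` B `&` closed_ball x r) = F @` closed_ball x r `\` F @` (B `&` closed_ball x r).
    apply/seteqP; split=> [_ [y [Oy yr] <-]|_ [[y yr <-] h]].
      split; first by exists y.
      by move=> [z [Oz zr] zy]; apply: Oy; rewrite -(iF z y (mem_set zr) (mem_set yr) zy).
    exists y => //; split => //= Oy; apply: h; by exists y.
  apply: measurableD => //.
  by have := clK setT closedT; rewrite setTI.
- move=> B mB; rewrite /P /= setI_bigcupl image_bigcup; apply: bigcupT_measurable => k; exact: mB.
Qed.

Section LocalArea.
Context (R : realType) (n : nat).
Implicit Types (F : 'rV[R]_n -> 'rV[R]_n) (x : 'rV[R]_n).

(** The lower bound is Bernoulli's inequality; the upper one follows from it, since (1 + e)^n (1 -
    e)^n <= 1. *)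
Lemma exp1_bounds (e : R) : 0 <= e -> e * n%:R <= 2^-1 ->
  1 - n%:R * e <= (1 - e) ^+ n /\ (1 + e) ^+ n <= 1 + 2 * n%:R * e.
Proof.
move=> e0 en.
have [n0|n0] := posnP n.
  by move: en; rewrite n0 !expr0 !mul0r; rewrite !mulr0 !mul0r subr0 addr0.
have e1 : e <= 2^-1.
  by apply: le_trans en; rewrite ler_peMr// ler1n.
have h1 k : 1 - k%:R * e <= (1 - e) ^+ k.
  elim: k => [|k IH]; first by rewrite expr0 mul0r subr0.
  rewrite exprS -natr1; have : (1 - e) * (1 - k%:R * e) <= (1 - e) * (1 - e) ^+ k by rewrite ler_wpM2l//; lra.
  apply: le_trans; have : 0 <= k%:R * e * e by rewrite !mulr_ge0.
  lra.
split; first exact: h1.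
have h2 : (1 + e) ^+ n * (1 - e) ^+ n <= 1.
  rewrite -exprMn exprn_ile1//; nra.
have h3 : (1 + e) ^+ n * (1 - n%:R * e) <= 1.
  by apply: le_trans h2; rewrite ler_wpM2l// exprn_ge0//; lra.
have t2 : n%:R * e <= 2^-1 by rewrite mulrC.
have t0 : 0 <= n%:R * e by rewrite mulr_ge0.
rewrite -mulrA; move: (n%:R * e) t0 t2 h3 => t t0 t2 h3.
have t1 : 0 < 1 - t by lra.
rewrite -(ler_pM2r t1); apply: le_trans h3 _; nra.
Qed.

Definition nball x (d : R) : set 'rV[R]_n := [set y | `|y - x| < d].

(** Composed with the inverse of its derivative, [F] becomes a map [G] close to a translation: near
    [x], [G] and its inverse are Lipschitz with constants 1 + e and 1 / (1 - e). The Lipschitz bound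
    applied both ways pinches the measure of the image. *)
Lemma local_area F x (L : 'M[R]_n) eta : strict_deriv F x L -> L \in unitmx -> 0 < eta -> eta < 1 ->
  exists2 d, 0 < d & (forall y z, nball x d y -> nball x d z -> F y = F z -> y = z) /\
  forall A : set (borel 'rV[R]_n), measurable A -> A `<=` nball x d ->
    [/\ measurable (F @` A : set (borel 'rV[R]_n)),
     (((1 - eta) * `|\det L|)%:E * lebesgue_n A <= lebesgue_n (F @` A))%E &
     (lebesgue_n (F @` A) <= ((1 + eta) * `|\det L|)%:E * lebesgue_n A)%E].
Proof.
move=> sF uL eta0 eta1.
(* Then 2 n e <= eta and n e <= 1/2, so the n-th powers of 1 - e and 1 + e stay between 1 - eta and
   1 + eta. *)
pose e := eta / (2 * n.+1%:R).
have n1 : 0 < n.+1%:R :> R by rewrite ltr0n.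
have e0 : 0 < e by rewrite divr_gt0// mulr_gt0.
have en2 : 2 * n%:R * e <= eta.
  rewrite /e mulrCA ger_pMr// -[leRHS](divff (lt0r_neq0 (mulr_gt0 (ltr0Sn R 1) n1))).
  by rewrite ler_pM2r ?invr_gt0 ?mulr_gt0// ler_pM2l// ler_nat.
have en : e * n%:R <= 2^-1 by move: en2; rewrite -mulrA (mulrC _ e); lra.
have e1 : e < 1.
  rewrite /e ltr_pdivrMr ?mulr_gt0// mul1r; apply: lt_le_trans eta1 _.
  by rewrite -[leLHS]mulr1 ler_pM// ?ler1n// ler1n.
have [le1 le2] := exp1_bounds (ltW e0) en.
pose K := mxsum (invmx L) + 1.
have K0 : 0 < K by rewrite ltr_wpDl// mxsum_ge0.
have [d1 d10 h1] := sF (e / K) (divr_gt0 e0 K0).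
have [d2 d20 h2] := strict_deriv_continuous sF.
pose G y := F y *m invmx L.
(* Halved so that the closed ball of radius [d], on which images of Borel sets are Borel, still lies
   where the estimates hold. *)
pose d := Num.min d1 d2 / 2.
have m0 : 0 < Num.min d1 d2 by rewrite lt_min d10.
have d0 : 0 < d by rewrite divr_gt0.
have dd1 y : `|y - x| <= d -> `|y - x| < d1.
  move=> h; apply: le_lt_trans h _; rewrite /d ltr_pdivrMr//.
  by apply: le_lt_trans (_ : d1 < _); [rewrite ge_min lexx|lra].
have dd2 y : `|y - x| <= d -> `|y - x| < d2.
  move=> h; apply: le_lt_trans h _; rewrite /d ltr_pdivrMr//.
  by apply: le_lt_trans (_ : d2 < _); [rewrite ge_min lexx orbT|lra].
have hG y z : `|y - x| <= d -> `|z - x| <= d -> `|G y - G z - (y - z)| <= e * `|y - z|.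
  move=> /dd1 yd /dd1 zd; have := h1 _ _ yd zd => h.
  have -> : G y - G z - (y - z) = (F y - F z - (y - z) *m L) *m invmx L.
    by rewrite [in RHS]mulmxBl mulmxK// mulmxBl.
  apply: le_trans (rV_norm_mul _ _) _.
  apply: (@le_trans _ _ (e / K * `|y - z| * K)).
    by rewrite ler_pM ?mxsum_ge0// lerDl.
  by rewrite mulrAC divfK// gt_eqF.
have hlo y z : `|y - x| <= d -> `|z - x| <= d -> (1 - e) * `|y - z| <= `|G y - G z|.
  move=> yd zd; have := hG _ _ yd zd; have := ler_normB (G y - G z) (G y - G z - (y - z)).
  by rewrite opprB addrCA subrr addr0; lra.
have hhi y z : `|y - x| <= d -> `|z - x| <= d -> `|G y - G z| <= (1 + e) * `|y - z|.
  move=> yd zd; have := hG _ _ yd zd; have := ler_normD (G y - G z - (y - z)) (y - z).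
  by rewrite subrK; lra.
have inj y z : `|y - x| <= d -> `|z - x| <= d -> F y = F z -> y = z.
  move=> yd zd yz; have := hlo _ _ yd zd; rewrite /G yz subrr normr0 => h.
  by apply/eqP; rewrite -subr_eq0 -normr_le0 -(pmulr_rle0 (x := 1 - e))// subr_gt0.
exists d => //; split=> [y z /ltW yd /ltW zd|A mA Ad]; first exact: inj.
have cb y : closed_ball x d y <-> `|y - x| <= d.
  by rewrite closed_ballE// /closed_ball_ /= distrC.
have Ad' y : A y -> `|y - x| <= d by move=> /Ad /ltW.
have mFA : measurable (F @` A : set (borel 'rV[R]_n)).
  have := @measurable_image_inj R n F x d A; rewrite (_ : A `&` _ = A); last first.
    by apply/seteqP; split=> y; [case|move=> Ay; split => //; apply/cb/Ad'].
  apply => //; first by move=> y /dd2; exact: h2.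
  by move=> y z /set_mem /cb yd /set_mem /cb zd; exact: inj.
have GE : G @` A = [set p | (F @` A) (p *m L)].
  apply/seteqP; split=> [_ [y Ay <-]|p [y Ay yp]] /=; first by exists y => //; rewrite mulmxKV.
  by exists y => //; rewrite /G yp mulmxK.
have mGA : measurable (G @` A : set (borel 'rV[R]_n)).
  by rewrite GE; have := measurable_mulmxr L measurableT mFA; rewrite setTI.
have FE : F @` A = (fun q => q *m L) @` (G @` A).
  apply/seteqP; split=> [_ [y Ay <-]|_ [_ [y Ay <-] <-]].
    by exists (G y); [exists y|rewrite /G mulmxKV].
  by exists y => //; rewrite /G mulmxKV.
have volF : lebesgue_n (F @` A) = (`|\det L|%:E * lebesgue_n (G @` A))%E by rewrite FE lebesgue_n_image.
have up : (lebesgue_n (G @` A) <= ((1 + e) ^+ n)%:E * lebesgue_n A)%E.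
  by apply: lipschitz_lebesgue; [rewrite addr_gt0|move=> y z /Ad' yd /Ad' zd; exact: hhi].
(* The inverse of [G] on the image of [A], with value 0 elsewhere. *)
pose H p := xget 0 [set y | A y /\ G y = p].
have HG y : A y -> H (G y) = y.
  move=> Ay; rewrite /H; case: xgetP => [z _ [Az Gz]|/(_ y)[]//].
  by apply: inj (Ad' _ Az) (Ad' _ Ay) _; move: Gz; rewrite /G => /(congr1 (fun M => M *m L)); rewrite !mulmxKV.
have HA : H @` (G @` A) = A.
  by apply/seteqP; split=> [_ [_ [y Ay <-] <-]|y Ay]; [rewrite HG|exists (G y); [exists y|exact: HG]].
have low : (lebesgue_n A <= (((1 - e)^-1) ^+ n)%:E * lebesgue_n (G @` A))%E.
  rewrite -{1}HA; apply: lipschitz_lebesgue; first by rewrite invr_gt0 subr_gt0.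
  move=> _ _ [y Ay <-] [z Az <-]; rewrite !HG// mulrC ler_pdivlMr ?subr_gt0// mulrC.
  exact: hlo (Ad' _ Ay) (Ad' _ Az).
have low' : (((1 - e) ^+ n)%:E * lebesgue_n A <= lebesgue_n (G @` A))%E.
  have pe : 0 < (1 - e) ^+ n by rewrite exprn_gt0// subr_gt0.
  by move: low; rewrite exprVn -lee_pdivrMl ?invr_gt0// invrK.
split => //; rewrite volF.
  apply: (@le_trans _ _ (`|\det L|%:E * (((1 - e) ^+ n)%:E * lebesgue_n A))%E); last first.
    by rewrite lee_wpmul2l// lee_fin.
  rewrite muleA -EFinM lee_wpmul2r// lee_fin mulrC ler_wpM2l//.
  apply: le_trans le1; move: en2; lra.
apply: (@le_trans _ _ (`|\det L|%:E * (((1 + e) ^+ n)%:E * lebesgue_n A))%E).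
  by rewrite lee_wpmul2l// lee_fin.
rewrite muleA -EFinM lee_wpmul2r// lee_fin mulrC ler_wpM2r//.
by apply: le_trans le2 _; lra.
Qed.

End LocalArea.

(** * Countable Borel partitions and Sard's theorem *)

Section Partition.
Context (R : realType) (n : nat).

Lemma nball_open (x : 'rV[R]_n) d : open (nball x d).
Proof.
have -> : nball x d = ball x d by apply/seteqP; split=> y; rewrite -ball_normE /nball /= distrC.
exact: ball_open.
Qed.

Lemma measurable_ratbox (p : 'rV[rat]_n * rat) : measurable (ratbox p : set (borel 'rV[R]_n)).
Proof.
have -> : ratbox p = box (\row_j ratr (p.1 0 j - p.2)) (\row_j ratr (p.1 0 j + p.2)) :> set 'rV[R]_n.
  by apply/seteqP; split=> q h j; have := h j; rewrite !mxE.
exact: measurable_box.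
Qed.

(* Lindelof: a hereditary local property holds on the pieces of a countable Borel partition. *)
Lemma borel_partition (P : set 'rV[R]_n -> Prop) (C : set 'rV[R]_n) :
  P set0 -> (forall A B, A `<=` B -> P B -> P A) ->
  (forall x, C x -> exists2 d, 0 < d & P (nball x d)) ->
  exists A : nat -> set (borel 'rV[R]_n),
    [/\ forall k, measurable (A k), trivIset setT A, C `<=` \bigcup_k A k & forall k, P (A k)].
Proof.
move=> P0 PS loc.
pose B k : set (borel 'rV[R]_n) := if unpickle k is Some p then if `[< P (ratbox p) >] then ratbox p else set0 else set0.
have mB k : measurable (B k).
  rewrite /B; case: unpickle => // p; case: asboolP => // _; exact: measurable_ratbox.
have PB k : P (B k).
  by rewrite /B; case: unpickle => // p; case: asboolP.
exists (seqDU B); split.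
- exact: seqDU_measurable.
- exact: trivIset_seqDU.
- rewrite -seqDU_bigcup_eq => x /loc[d d0 Pd].
  have := open_ratbox (@nball_open x d).
  move=> /seteqP[/(_ x)]; rewrite /nball/= subrr normr0 => /(_ d0)[p /= pd px] _.
  exists (pickle p) => //; rewrite /B pickleK; case: asboolP => // h; exfalso; apply: h.
  exact: PS pd Pd.
- by move=> k; apply: PS (PB k); exact: subDsetl.
Qed.

Lemma null_superset (N : set 'rV[R]_n) : lebesgue_rV N = 0%E ->
  exists B : set (borel 'rV[R]_n), [/\ measurable B, N `<=` B & lebesgue_n B = 0%E].
Proof.
move=> N0.
have h k : exists B : set (borel 'rV[R]_n), [/\ measurable B, N `<=` B & (lebesgue_n B <= (k.+1%:R^-1)%:E)%E].
  have e0 : 0 < k.+1%:R^-1 :> R by rewrite invr_gt0.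
  have fin : (lebesgue_rV N) \is a fin_num by rewrite N0.
  have [s [P [a [b [ab cN ->]]]]] := lb_ereal_inf_adherent e0 fin.
  rewrite [X in (_ < X + _)%E](_ : _ = 0%E)// add0e => hs.
  pose F i : set (borel 'rV[R]_n) := if P i then box (a i) (b i) else set0.
  have mF i : measurable (F i) by rewrite /F; case: (P i) => //; exact: measurable_box.
  exists (\bigcup_i F i); split; first exact: bigcupT_measurable.
    by move=> q /cN[i /= Pi qi]; exists i => //; rewrite /F Pi.
  apply: le_trans (ltW hs); apply: le_trans (measure_sigma_subadditive _ mF _ (@subset_refl _ _)) _.
    exact: bigcupT_measurable.
  rewrite [leRHS]eseries_mkcond; apply: lee_nneseries => i _; first by [].
  rewrite /F; case: (P i); last by rewrite measure0.
  exact: (lebesgue_rV_box (ab i)).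
have [B hB] := choice h.
exists (\bigcap_k B k); split.
- by apply: bigcapT_measurable => k; have [] := hB k.
- by move=> q Nq k _; have [_ + _] := hB k; apply.
- apply/eqP; rewrite eq_le measure_ge0 andbT; apply/lee_addgt0Pr => e e0; rewrite add0e.
  have [k ke] := ltr_add_invr e0; rewrite add0r in ke.
  have [_ _ hk] := hB k; apply: le_trans (_ : lebesgue_n (B k) <= _)%E.
    by apply: le_outer_measure => q; apply.
  by apply: le_trans hk _; rewrite lee_fin ltW.
Qed.

End Partition.

Section Sard.
Context (R : realType) (n : nat).
Implicit Types (F : 'rV[R]_n -> 'rV[R]_n) (x : 'rV[R]_n).
Local Notation mu := (@lebesgue_rV R n).

(* Near a critical point the image of a small cube lies in a thin slab. *)
Lemma sard_local F x (L : 'M[R]_n) (M kappa : R) : strict_deriv F x L -> \det L = 0 ->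
  mxsum L <= M -> 0 < kappa ->
  exists2 d, 0 < d & forall A : set 'rV[R]_n, A `<=` nball x d -> (mu (F @` A) <= kappa%:E * mu A)%E.
Proof.
move=> sF dL LM k0.
(* A nonzero vector annihilated by [L] from the right: the linear part of [F] moves points only
   orthogonally to [v], so [F] itself stays near a hyperplane. *)
have /eqP/det0P[v v0 vL] : \det L^T = 0 by rewrite det_tr.
have Lv j : \sum_k L j k * v 0 k = 0.
  have := congr1 (fun u : 'rV_n => u 0 j) vL; rewrite !mxE => h; rewrite -[RHS]h.
  by apply: eq_bigr => k _; rewrite mxE mulrC.
have [i0 vi0] : exists i, v 0 i != 0 by apply/rV0Pn.
pose i := [arg max_(k > i0) `|v 0 k|]%O.
have imax k : `|v 0 k| <= `|v 0 i|.
  by rewrite /i; case: Order.TotalTheory.arg_maxP => // j _; apply.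
have vi : v 0 i != 0 by rewrite -normr_gt0; apply: lt_le_trans (imax i0); rewrite normr_gt0.
have n0 : (0 < n)%N by exact: leq_ltn_trans (ltn_ord i).
have M0 : 0 <= M by apply: le_trans LM; exact: mxsum_ge0.
(* By [slab_bound] the slab around the image of a cube of side s, of radius (M + 1) s and relative
   half-thickness n e s, has volume at most e C s^n; [e] is then chosen with e C <= kappa. *)
pose C := 2 * n%:R * (2 * (M + 1)) ^+ n.-1.
have C0 : 0 <= C by rewrite !mulr_ge0// exprn_ge0// mulr_ge0// addr_ge0.
pose e := Num.min 1 (kappa / (C + 1)).
have e0 : 0 < e by rewrite lt_min ltr01 divr_gt0// ltr_wpDl.
have e1 : e <= 1 by rewrite ge_min lexx.
have eC : e * C <= kappa.
  apply: (@le_trans _ _ (e * (C + 1))); first by rewrite ler_wpM2l ?(ltW e0)// lerDl.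
  by rewrite -ler_pdivlMr ?ltr_wpDl// ge_min lexx orbT.
have [d d0 hd] := sF e e0.
exists d => // A Ad; apply: cover_lemma => // c s s0.
have [->|/set0P[y0 [Ay0 By0]]] := eqVneq (A `&` box c (c + const_mx s)) set0.
  by rewrite image_set0 outer_measure0 lee_fin mulr_ge0 ?exprn_ge0 ?(ltW k0) ?(ltW s0).
have sub : F @` (A `&` box c (c + const_mx s)) `<=` slab v (F y0) ((M + 1) * s) (n%:R * e * s * `|v 0 i|).
  move=> _ [y [Ay By] <-].
  have ys : `|y - y0| <= s.
    apply: rV_norm_le => [|j]; first exact: ltW.
    by have := By j; have := By0 j; rewrite !mxE ler_norml; lra.
  have hr := hd _ _ (Ad _ Ay) (Ad _ Ay0).
  pose r := F y - F y0 - (y - y0) *m L.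
  have rE : F y - F y0 = r + (y - y0) *m L by rewrite /r subrK.
  have rs : `|r| <= e * s by apply: le_trans hr _; rewrite ler_wpM2l// ltW.
  split.
    rewrite rE; apply: le_trans (ler_normD _ _) _; rewrite mulrDl mul1r addrC lerD//.
      apply: le_trans (rV_norm_mul _ _) _; rewrite mulrC.
      by rewrite ler_pM ?mxsum_ge0.
    by apply: le_trans rs _; rewrite ler_piMl// ltW.
  have -> : \sum_j (F y - F y0) 0 j * v 0 j = \sum_j r 0 j * v 0 j.
    rewrite rE; under eq_bigr do rewrite mxE mulrDl.
    rewrite big_split/= [X in _ + X](_ : _ = 0) ?addr0//.
    under eq_bigr do rewrite mxE mulr_suml.
    rewrite exchange_big/= big1// => k _.
    by under eq_bigr do rewrite -mulrA; rewrite -mulr_sumr Lv mulr0.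
  apply: le_trans (ler_norm_sum _ _ _) _.
  apply: (@le_trans _ _ (\sum_(j < n) e * s * `|v 0 i|)).
    apply: ler_sum => j _; rewrite normrM ler_pM//.
    by apply: le_trans rs; exact: rV_coord_le.
  by rewrite sumr_const card_ord -[leLHS]mulr_natl !mulrA.
apply: le_trans (le_outer_measure mu _ _ sub) _.
apply: le_trans (slab_bound _ _ _ vi) _.
- by rewrite mulr_ge0 ?addr_ge0 ?(ltW s0).
- by rewrite !mulr_ge0 ?(ltW e0) ?(ltW s0).
- rewrite lee_fin; apply: (@le_trans _ _ (e * C * s ^+ n)); last by rewrite ler_wpM2r// exprn_ge0// ltW.
  rewrite -(prednK n0) [s ^+ _]exprS /C !exprMn /= prednK// le_eqVlt; apply/orP; left; apply/eqP; ring.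
Qed.

(** A bounded piece [Cm m] is covered by countably many disjoint Borel cells, on whose subsets [F]
    multiplies outer measures by at most e / (q + 1), with [q] the measure of the cube [bigbox m].
    Whole cells cut by the cube are summed, rather than their traces on [C], since additivity needs
    Borel sets. *)
Lemma sard F (D : 'rV[R]_n -> 'M[R]_n) (C : set 'rV[R]_n) :
  (forall x, C x -> strict_deriv F x (D x) /\ \det (D x) = 0) -> mu (F @` C) = 0%E.
Proof.
move=> hC.
pose Cm (m : nat) := [set x | [/\ C x, bigbox m x & mxsum (D x) <= m%:R]].
have CmU : F @` C `<=` \bigcup_m F @` (Cm m).
  move=> _ [x Cx <-].
  have [m1 _ hm1] : (\bigcup_k @bigbox R n k) x by rewrite bigcup_bigbox.
  have h2 := truncnS_gt (mxsum (D x)).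
  exists (maxn m1 (Num.truncn (mxsum (D x))).+1) => //; exists x => //; split => //.
    by move/subsetPset : (@bigbox_nd R n _ _ (leq_maxl m1 (Num.truncn (mxsum (D x))).+1)); exact.
  by apply: le_trans (ltW h2) _; rewrite ler_nat leq_maxr.
apply/eqP; rewrite eq_le outer_measure_ge0 andbT.
apply: le_trans (le_outer_measure mu _ _ CmU) _.
apply: le_trans (outer_measure_sigma_subadditive mu _) _.
rewrite eseries0// => m _ _; apply/eqP; rewrite eq_le outer_measure_ge0 andbT.
apply/lee_addgt0Pr => e e0; rewrite add0e.
have fQ : lebesgue_n (@bigbox R n m) \is a fin_num by rewrite ge0_fin_numE ?measure_ge0// lebesgue_n_fin_box.
pose q := fine (lebesgue_n (@bigbox R n m)).
have q0 : 0 <= q by rewrite fine_ge0.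
have kap0 : 0 < e / (q + 1) by rewrite divr_gt0// ltr_wpDl.
pose P (B : set 'rV[R]_n) := forall A : set 'rV[R]_n, A `<=` B -> (mu (F @` A) <= (e / (q + 1))%:E * mu A)%E.
have [| | |A [mA tA cA PA]] := @borel_partition R n P (Cm m).
- by move=> A; rewrite subset0 => ->; rewrite image_set0 !outer_measure0 mule0.
- by move=> A B AB PB A' A'A; apply: PB; exact: subset_trans AB.
- move=> x [/hC[sF dD] _ mD]; have [d d0 hd] := sard_local sF dD mD kap0.
  by exists d.
have sub : F @` (Cm m) `<=` \bigcup_k F @` (A k `&` bigbox m).
  by move=> _ [x Cx <-]; have [k _ Ak] := cA _ Cx; exists k => //; exists x => //; split => //; case: Cx.
apply: le_trans (le_outer_measure mu _ _ sub) _.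
apply: le_trans (outer_measure_sigma_subadditive mu _) _.
apply: (@le_trans _ _ (\sum_(0 <= k <oo) (e / (q + 1))%:E * lebesgue_n (A k `&` bigbox m))%E).
  by apply: lee_nneseries => k _; [by []|apply: PA; exact: subIsetl].
rewrite nneseriesZl; last by move=> k _; exact: measure_ge0.
have mQ : measurable (@bigbox R n m) by exact: measurable_box.
rewrite -measure_semi_bigcup//; first last.
- by apply: bigcupT_measurable => k; exact: measurableI.
- by apply: trivIset_setIr.
- by move=> k; exact: measurableI.
apply: (@le_trans _ _ ((e / (q + 1))%:E * lebesgue_n (@bigbox R n m))%E).
  rewrite lee_wpmul2l// ?lee_fin ?(ltW kap0)//.
  by apply: le_outer_measure; apply: bigcup_sub => k _; exact: subIsetr.
rewrite -(fineK fQ) -EFinM lee_fin -/q mulrAC ler_pdivrMr ?ltr_wpDl// ler_wpM2l ?(ltW e0)// lerDl//.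
Qed.

End Sard.

(** * The area formula *)

Lemma counting_bigcup (R : realType) (T : pointedType) (G : (set T)^nat) :
  trivIset setT G -> counting (\bigcup_k G k) = (\sum_(0 <= k <oo) counting (G k) : \bar R)%E.
Proof.
move=> tG; pose T' := g_sigma_algebraType (fun _ : set T => True).
pose G' := G : (set T')^nat.
have mG (A : set T') : measurable A by exact: sub_gen_smallest.
have h := @measure_semi_bigcup _ R T' (counting : set T' -> \bar R) G' (fun k => mG _) tG (mG _).
exact: h.
Qed.

Lemma dist_bounds (R : realType) (a b eta : R) : `|a - b| <= eta * a ->
  (1 - eta) * a <= b <= (1 + eta) * a.
Proof. by rewrite ler_norml mulrBl mulrDl mul1r => /andP[h1 h2]; apply/andP; split; lra. Qed.

Section Area.
Context (R : realType) (n : nat) (F : 'rV[R]_n -> 'rV[R]_n) (D : 'rV[R]_n -> 'M[R]_n) (O : set 'rV[R]_n).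
Hypothesis oO : open O.
Hypothesis sF : forall x, O x -> strict_deriv F x (D x).
Hypothesis cD : forall x i j, O x -> {for x, continuous (fun y => D y i j)}.

Lemma continuous_abs_det x : O x -> {for x, continuous (fun y => `|\det (D y)|)}.
Proof.
move=> Ox; apply: continuous_comp; last exact: norm_continuous.
by apply: continuous_at_det => i j; exact: cD.
Qed.

Lemma measurable_jac : measurable_fun (O : set (borel 'rV[R]_n)) (fun x : borel 'rV[R]_n => `|\det (D x)|).
Proof.
move=> _; have mO : measurable (O : set (borel 'rV[R]_n)) by exact: open_borel.
apply: (measurability _ (RGenOInfty.measurableE R)) => //.
move=> _ [_ [a ->] <-]; apply: open_borel.
rewrite openE => x [Ox xa]; apply: filterI; first exact: open_nbhs_nbhs.
by have := continuous_abs_det Ox; apply; apply: open_nbhs_nbhs; split.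
Qed.

Local Notation jac A := (\int[@lebesgue_n R n]_(x in A) (`|\det (D x)|)%:E)%E.
Let regular := [set x | O x /\ \det (D x) != 0].

Lemma measurable_regular : measurable (regular : set (borel 'rV[R]_n)).
Proof.
have := measurable_jac (open_borel oO) (measurable_itv `]0, +oo[).
congr measurable; apply/seteqP; split=> x [Ox] /=; rewrite in_itv /= andbT normr_gt0 => h; by split.
Qed.

(** On such a set [F] is injective and the area formula holds up to the factor [kappa]; the property
    passes to subsets, as [borel_partition] requires. *)
Definition area_cell (kappa : R) (B : set 'rV[R]_n) := (forall y z, B y -> B z -> F y = F z -> y = z) /\
  forall A : set (borel 'rV[R]_n), measurable A -> A `<=` B -> A `<=` O ->
   [/\ measurable (F @` A : set (borel 'rV[R]_n)),
    (lebesgue_n (F @` A) <= kappa%:E * jac A)%E & (jac A <= kappa%:E * lebesgue_n (F @` A))%E].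

Lemma area_cell_local kappa x : 1 < kappa -> regular x -> exists2 d, 0 < d & area_cell kappa (nball x d).
Proof.
move=> k1 [Ox dx].
(* Chosen so that (1 + eta) / (1 - eta) = kappa: the measure of the image and the integral of the
   Jacobian both lie between (1 - eta) l |A| and (1 + eta) l |A|. *)
pose eta := (kappa - 1) / (kappa + 1).
have kp : 0 < kappa + 1 by lra.
have eta0 : 0 < eta by rewrite divr_gt0// subr_gt0.
have eta1 : eta < 1 by rewrite /eta ltr_pdivrMr// mul1r; lra.
have kE : kappa * (1 - eta) = 1 + eta by rewrite /eta; field; lra.
have uL : D x \in unitmx by rewrite unitmxE unitfE.
have [d1 d10 [inj hd]] := local_area (sF Ox) uL eta0 eta1.
pose l := `|\det (D x)|.
have l0 : 0 < l by rewrite normr_gt0.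
have /nbhs_ballP[d2 /= d20 hd2] : nbhs x [set y | (1 - eta) * l <= `|\det (D y)| <= (1 + eta) * l].
  have := continuous_abs_det Ox; rewrite /prop_for /continuous_at => /cvgrPdist_le.
  move=> /(_ (eta * l) (mulr_gt0 eta0 l0)); apply: filterS => y /=.
  exact: dist_bounds.
exists (Num.min d1 d2); first by rewrite lt_min d10.
have s1 : nball x (Num.min d1 d2) `<=` nball x d1 by move=> y; rewrite /nball /= lt_min => /andP[].
have s2 y : nball x (Num.min d1 d2) y -> (1 - eta) * l <= `|\det (D y)| <= (1 + eta) * l.
  rewrite /nball /= lt_min => /andP[_ yd]; apply: hd2; by rewrite -ball_normE /= distrC.
split=> [y z yd zd|A mA AB AO]; first by apply: inj; exact: s1.
have [mFA lo hi] := hd A mA (subset_trans AB s1).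
have mJ : measurable_fun A (fun y : borel 'rV[R]_n => (`|\det (D y)|)%:E).
  by apply/measurable_EFinP; apply: measurable_funS AO measurable_jac; exact: open_borel.
have cst c : (\int[@lebesgue_n R n]_(x in A) c%:E = c%:E * lebesgue_n A)%E by rewrite integral_cst.
have jlo : (((1 - eta) * l)%:E * lebesgue_n A <= jac A)%E.
  rewrite -cst; apply: ge0_le_integral => //.
  - by move=> y _; rewrite lee_fin mulr_ge0 ?(ltW l0)// subr_ge0 ltW.
  - by move=> y Ay; rewrite lee_fin; have /andP[] := s2 _ (AB _ Ay).
have jhi : (jac A <= ((1 + eta) * l)%:E * lebesgue_n A)%E.
  rewrite -cst; apply: ge0_le_integral => //.
  by move=> y Ay; rewrite lee_fin; have /andP[] := s2 _ (AB _ Ay).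
have k0 : (0 <= kappa%:E)%E by rewrite lee_fin; lra.
have sc : (kappa%:E * (((1 - eta) * l)%:E * lebesgue_n A) = ((1 + eta) * l)%:E * lebesgue_n A)%E.
  by rewrite muleA -EFinM mulrA kE.
split => //.
- by apply: le_trans hi _; rewrite -/l -sc lee_wpmul2l.
- by apply: le_trans jhi _; rewrite -sc lee_wpmul2l.
Qed.

Definition fibre_count (A : set 'rV[R]_n) (y : borel 'rV[R]_n) : \bar R :=
  counting ((A `&` F @^-1` [set y]) : set (borel 'rV[R]_n)).

Lemma fibre_count_cell kappa B A y : area_cell kappa B -> A `<=` B ->
  fibre_count A y = (\1_(F @` A) y)%:E.
Proof.
move=> [inj _] AB; rewrite /fibre_count indicE.
case: (boolP (y \in F @` A)) => [/set_mem[x Ax Fx]|/negP yA].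
  rewrite (_ : _ `&` _ = [set x]); last first.
    apply/seteqP; split=> [z [Az Fz]|_ ->]; last by split.
    by apply: inj; [exact: AB|exact: AB|rewrite Fx].
  by rewrite /counting asboolT// fset_set1 finmap.cardfs1.
rewrite (_ : _ `&` _ = set0) ?measure0//.
apply/seteqP; split=> // z [Az Fz]; apply: yA; apply/mem_set; by exists z.
Qed.

(** Over a partition into cells the fibre count is the sum of the indicators of the images of the
    cells, hence measurable, and its integral is that of the Jacobian up to the factor [kappa]; then
    [kappa] tends to 1. *)
Lemma area_regular (A : set (borel 'rV[R]_n)) : measurable A -> A `<=` regular ->
  measurable_fun setT (fibre_count A) /\ (\int[@lebesgue_n R n]_y fibre_count A y = jac A)%E.
Proof.
move=> mA Areg.
have AO : A `<=` O by move=> x /Areg[].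
have key kappa : 1 < kappa -> [/\ measurable_fun setT (fibre_count A),
    (\int[@lebesgue_n R n]_y fibre_count A y <= kappa%:E * jac A)%E &
    (jac A <= kappa%:E * \int[@lebesgue_n R n]_y fibre_count A y)%E].
  move=> k1.
  have [| | |B [mB tB cB PB]] := @borel_partition R n (area_cell kappa) regular.
  - split=> // C mC; rewrite subset0 => -> _; rewrite image_set0 integral_set0 measure0 mule0.
    by split.
  - move=> C E CE [iE hE]; split=> [y z Cy Cz|C' mC' C'C]; first by apply: iE; exact: CE.
    by apply: hE => //; exact: subset_trans CE.
  - by move=> x; exact: area_cell_local.
  pose Ak k := A `&` B k.
  have mAk k : measurable (Ak k) by exact: measurableI.
  have tAk : trivIset setT Ak by exact: trivIset_setIl.
  have AE : A = \bigcup_k Ak k.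
    rewrite -setI_bigcupr; apply/seteqP; split=> [x Ax|x []//].
    by split => //; apply: cB; exact: Areg.
  have hk k := (PB k).2 (Ak k) (mAk k) (@subIsetr _ _ _) (subset_trans (@subIsetl _ _ _) AO).
  have cE y : fibre_count A y = (\sum_(0 <= k <oo) (\1_(F @` (Ak k)) y)%:E)%E.
    rewrite [LHS]/fibre_count [in LHS]AE setI_bigcupl.
    pose G k : set (borel 'rV[R]_n) := Ak k `&` F @^-1` [set y].
    have tG : trivIset setT G.
      by apply/trivIsetP => i j _ _ ij; have /trivIsetP/(_ i j I I ij) := tAk;
        apply: subsetI_eq0; exact: subIsetl.
    have cG := @counting_bigcup R (borel 'rV[R]_n) G tG.
    rewrite [LHS]cG; apply: eq_eseriesr => k _.
    by rewrite -(fibre_count_cell y (PB k) (@subIsetr _ _ _)).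
  have mI k : measurable_fun setT (fun y : borel 'rV[R]_n => (\1_(F @` (Ak k)) y)%:E : \bar R).
    by apply/measurable_EFinP; apply: measurable_indic; have [] := hk k.
  have mfc : measurable_fun setT (fibre_count A).
    rewrite (_ : fibre_count A = (fun y => \sum_(0 <= k <oo) (\1_(F @` (Ak k)) y)%:E)%E); last exact/funext.
    by apply: ge0_emeasurable_sum => // k y _ _; rewrite lee_fin.
  have IE : (\int[@lebesgue_n R n]_y fibre_count A y = \sum_(0 <= k <oo) lebesgue_n (F @` (Ak k)))%E.
    under eq_integral do rewrite cE.
    rewrite integral_nneseries//.
    apply: eq_eseriesr => k _; rewrite integral_indic ?setIT//.
    by have [] := hk k.
  have JE : (jac A = \sum_(0 <= k <oo) jac (Ak k))%E.
    rewrite {1}AE ge0_integral_bigcup//.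
    apply/measurable_EFinP; apply: measurable_funS measurable_jac; first exact: open_borel.
    by rewrite -AE.
  have J0 k : (0 <= jac (Ak k))%E by apply: integral_ge0 => y _; rewrite lee_fin.
  split => //.
  - rewrite IE JE -nneseriesZl//.
    by apply: lee_nneseries => k _; [by []|have [] := hk k].
  - rewrite IE JE -nneseriesZl//.
    by apply: lee_nneseries => k _; [by []|have [] := hk k].
split; first by have [] := key 2 ltac:(lra).
have I0 : (0 <= \int[@lebesgue_n R n]_y fibre_count A y)%E by apply: integral_ge0 => y _; exact: measure_ge0.
have J0 : (0 <= jac A)%E by apply: integral_ge0 => y _; rewrite lee_fin.
have le_kappa (x y : \bar R) : (0 <= x)%E -> (forall kappa : R, 1 < kappa -> (y <= kappa%:E * x)%E) -> (y <= x)%E.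
  move=> x0 h; case: x x0 h => [x| |] //= x0 h; last by rewrite leey.
  apply/lee_addgt0Pr => e e0; pose k := 1 + e / (x + 1).
  have x1 : 0 < x + 1 by rewrite ltr_wpDl// -lee_fin.
  have k1 : 1 < k by rewrite ltrDl divr_gt0.
  apply: le_trans (h k k1) _; rewrite -EFinM -EFinD lee_fin /k mulrDl mul1r lerD2l.
  by rewrite mulrAC ler_pdivrMr// ler_wpM2l ?(ltW e0)// lerDl.
apply/eqP; rewrite eq_le; apply/andP; split; apply: le_kappa => // k k1; by have [] := key k k1.
Qed.

End Area.

(** * Fubini for row vectors cut into two blocks *)

Section ProductLebesgue.
Context (R : realType) (m n : nat).

Lemma preimage_row_box (c d : 'rV[R]_(m + n)) :
  (fun p : borel 'rV[R]_m * borel 'rV[R]_n => (row_mx p.1 p.2 : borel 'rV[R]_(m + n))) @^-1` box c d =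
  box (lsubmx c) (lsubmx d) `*` box (rsubmx c) (rsubmx d).
Proof.
apply/seteqP; split=> -[x y] /= h.
  by split=> j; [have := h (lshift n j); rewrite row_mxEl !mxE|have := h (rshift m j); rewrite row_mxEr !mxE].
case: h => h1 h2 j; case: (splitP j) => i ji.
  have -> : j = lshift n i by exact: val_inj.
  by rewrite row_mxEl; have := h1 i; rewrite !mxE.
have -> : j = rshift m i by exact: val_inj.
by rewrite row_mxEr; have := h2 i; rewrite !mxE.
Qed.

Lemma lebesgue_n_row (E : set (borel 'rV[R]_(m + n))) : measurable E ->
  lebesgue_n E = (\int[@lebesgue_n R m]_x lebesgue_n [set y : borel 'rV[R]_n | E (row_mx x y)])%E.
Proof.
move=> mE.
pose m0 : {measure set _ -> \bar R} := (@lebesgue_n R m \x @lebesgue_n R n)%E.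
pose mm := pushm m0 (@measurable_row_mx R m n).
rewrite -(@box_measure_eq R (m + n) mm _ E mE).
  rewrite /mm/= /pushm/= /pushforward /m0/= /product_measure1/=.
  by apply: eq_integral => x _ /=; congr lebesgue_n; apply/seteqP; split=> y; [move=> /set_mem|move=> h; apply/mem_set].
move=> c d cd; rewrite /mm/= /pushm/= /pushforward preimage_row_box.
rewrite (product_measure1E (@lebesgue_n R m) (@lebesgue_n R n))//; [|exact: measurable_box|exact: measurable_box].
rewrite [X in (X * _)%E](_ : _ = (box_vol (lsubmx c) (lsubmx d))%:E); last first.
  by apply: lebesgue_n_box => j; rewrite !mxE.
rewrite [X in (_ * X)%E](_ : _ = (box_vol (rsubmx c) (rsubmx d))%:E); last first.
  by apply: lebesgue_n_box => j; rewrite !mxE.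
rewrite -EFinM; congr EFin; rewrite /box_vol big_split_ord /=.
by congr (_ * _); apply: eq_bigr => j _; rewrite !mxE.
Qed.

Lemma measurable_row_preimage (E : set (borel 'rV[R]_(m + n))) : measurable E ->
  measurable [set p : borel 'rV[R]_m * borel 'rV[R]_n | E (row_mx p.1 p.2)].
Proof. by move=> mE; have := measurable_row_mx measurableT mE; rewrite setTI. Qed.

Lemma measurable_row_ysection (E : set (borel 'rV[R]_(m + n))) (y : borel 'rV[R]_n) : measurable E ->
  measurable [set x : borel 'rV[R]_m | E (row_mx x y)].
Proof.
move=> /measurable_row_preimage /(measurable_ysection y).
by congr measurable; apply/seteqP; split=> x; [move=> /set_mem|move=> h; apply/mem_set].
Qed.

Lemma measurable_row_xsection (E : set (borel 'rV[R]_(m + n))) (x : borel 'rV[R]_m) : measurable E ->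
  measurable [set y : borel 'rV[R]_n | E (row_mx x y)].
Proof.
move=> /measurable_row_preimage /(measurable_xsection x).
by congr measurable; apply/seteqP; split=> y; [move=> /set_mem|move=> h; apply/mem_set].
Qed.

Lemma measurable_fun_ysection_lebesgue_n (E : set (borel 'rV[R]_(m + n))) : measurable E ->
  measurable_fun setT (fun y : borel 'rV[R]_n => lebesgue_n [set x : borel 'rV[R]_m | E (row_mx x y)]).
Proof.
move=> mE; have := measurable_fun_ysection (@lebesgue_n R m) (measurable_row_preimage mE).
congr measurable_fun; apply/funext => y /=; congr lebesgue_n.
by apply/seteqP; split=> x; [move=> /set_mem|move=> h; apply/mem_set].
Qed.

Lemma lebesgue_n_row_swap (E : set (borel 'rV[R]_(m + n))) : measurable E ->
  lebesgue_n E = (\int[@lebesgue_n R n]_y lebesgue_n [set x : borel 'rV[R]_m | E (row_mx x y)])%E.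
Proof.
move=> mE; rewrite lebesgue_n_row//.
pose f (p : borel 'rV[R]_m * borel 'rV[R]_n) : \bar R := (\1_[set p : borel 'rV[R]_m * borel 'rV[R]_n | E (row_mx p.1 p.2)] p)%:E.
have mf : measurable_fun setT f.
  by apply/measurable_EFinP; apply: measurable_indic; exact: measurable_row_preimage.
transitivity (\int[@lebesgue_n R m]_x \int[@lebesgue_n R n]_y f (x, y))%E.
  apply: eq_integral => x _.
  rewrite -[in LHS](setIT [set y : borel 'rV[R]_n | E (row_mx x y)]) -integral_indic//.
  exact: measurable_row_xsection.
rewrite (fubini_tonelli f mf); last by move=> p; rewrite lee_fin indicE ler0n.
apply: eq_integral => y _.
rewrite -[in RHS](setIT [set x : borel 'rV[R]_m | E (row_mx x y)]) -integral_indic//.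
exact: measurable_row_ysection.
Qed.

End ProductLebesgue.

(** * Convex bodies and Minkowski sums with a segment *)

Section Minkowski.
Context (R : realType) (n : nat).
Implicit Types (A B K : set 'rV[R]_n) (u v : 'rV[R]_n).

Definition cvx K := forall x y (t : R), K x -> K y -> 0 <= t <= 1 -> K (t *: x + (1 - t) *: y).

Definition msum A B : set 'rV[R]_n := [set a + b | a in A & b in B].

Definition seg u : set 'rV[R]_n := [set t *: u | t in [set t : R | -1 <= t <= 1]].

Lemma compact_borel K : compact K -> measurable (K : set (borel 'rV[R]_n)).
Proof. by move=> cK; apply: closed_borel; apply: compact_closed cK; exact: norm_hausdorff. Qed.

Lemma compact_norm_le K : compact K -> exists2 M, 0 < M & forall x, K x -> `|x| <= M.
Proof.
move=> /compact_bounded[M [_ hM]]; exists (`|M| + 1); first by rewrite ltr_wpDl.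
by apply: hM; rewrite (le_lt_trans (ler_norm _))// ltrDl.
Qed.

Lemma norm_le_box K (M : R) : (forall x, K x -> `|x| <= M) -> K `<=` box (const_mx (- M)) (const_mx M).
Proof. by move=> h x /h xM j; rewrite !mxE -ler_norml; apply: le_trans xM; exact: rV_coord_le. Qed.

Lemma lebesgue_n_norm_le K (M : R) : 0 <= M -> (forall x, K x -> `|x| <= M) ->
  (lebesgue_rV K <= ((2 * M) ^+ n)%:E)%E.
Proof.
move=> M0 /norm_le_box h; apply: le_trans (le_outer_measure (@lebesgue_rV R n) _ _ h) _.
apply: le_trans (lebesgue_rV_box _) _ => [j|]; first by rewrite !mxE ge0_cp.
rewrite lee_fin /box_vol (eq_bigr (fun=> 2 * M)) => [|j _]; last by rewrite !mxE; ring.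
by rewrite prodr_const card_ord.
Qed.

Lemma compact_fin_num K : compact K -> lebesgue_n (K : set (borel 'rV[R]_n)) \is a fin_num.
Proof.
move=> /compact_norm_le[M M0 h]; rewrite ge0_fin_numE ?measure_ge0//.
by apply: le_lt_trans (lebesgue_n_norm_le (ltW M0) h) _; rewrite ltry.
Qed.

Lemma cvx_image (K : set 'rV[R]_n) (A : 'M[R]_n) : cvx K -> cvx ((fun q => q *m A) @` K).
Proof.
move=> vK _ _ t [x Kx <-] [y Ky <-] t01; exists (t *: x + (1 - t) *: y); first exact: vK.
by rewrite mulmxDl -!scalemxAl.
Qed.

End Minkowski.

Section SegmentLast.
Context (R : realType) (m : nat).
Implicit Types (K : set 'rV[R]_(1 + m)).

Let e0 : 'rV[R]_(1 + m) := row_mx 1%:M 0.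

Lemma continuous_lsubmx p q : continuous (fun z : 'rV[R]_(p + q) => lsubmx z).
Proof.
rewrite (_ : (fun _ => _) = (fun z : 'rV[R]_(p + q) => z *m col_mx 1%:M 0)); first exact: mulmxr_continuous.
by apply/funext => z; rewrite -{2}[z]hsubmxK mul_row_col mulmx1 mulmx0 addr0.
Qed.

Lemma continuous_rsubmx p q : continuous (fun z : 'rV[R]_(p + q) => rsubmx z).
Proof.
rewrite (_ : (fun _ => _) = (fun z : 'rV[R]_(p + q) => z *m col_mx 0 1%:M)); first exact: mulmxr_continuous.
by apply/funext => z; rewrite -{2}[z]hsubmxK mul_row_col mulmx1 mulmx0 add0r.
Qed.

Lemma row1_scalar (x : 'rV[R]_1) : x = (x 0 0)%:M.
Proof. by apply/matrixP => i j; rewrite (ord1 i) (ord1 j) mxE eqxx mulr1n. Qed.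

Lemma section_itv K y : compact K -> cvx K -> (exists x, K (row_mx x y)) ->
  exists a b : R, a <= b /\ forall s, K (row_mx s%:M y) <-> a <= s <= b.
Proof.
move=> cK vK [x0 Kx0].
pose S := K `&` [set z | rsubmx z = y].
have cS : compact S.
  apply: compact_closedI => //.
  rewrite (_ : [set z | _] = rsubmx @^-1` [set y])//.
  apply: preimage_closed; first by move=> z _; exact: continuous_rsubmx.
  apply: accessible_closed_set1; apply: hausdorff_accessible; exact: norm_hausdorff.
have S0 : S !=set0 by exists (row_mx x0 y); split => //=; rewrite row_mxKr.
have cf : {within S, continuous (fun z : 'rV[R]_(1 + m) => z 0 0)}.
  by apply: continuous_subspaceT => z; exact: coord_continuous.
have [c1 /set_mem[K1 /= y1] h1] := EVT_min_rV S0 cS cf.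
have [c2 /set_mem[K2 /= y2] h2] := EVT_max_rV S0 cS cf.
have zE (z : 'rV[R]_(1 + m)) : rsubmx z = y -> z = row_mx (z 0 0)%:M y.
  move=> <-; rewrite -{1}[z]hsubmxK; congr row_mx; rewrite [lsubmx z]row1_scalar; congr (_%:M).
  by rewrite mxE; congr (z _ _); exact: val_inj.
have rE (s : R) : (row_mx s%:M y : 'rV[R]_(1 + m)) 0 0 = s.
  rewrite (_ : 0 = lshift m 0 :> 'I_(1 + m)); last exact: val_inj.
  by rewrite row_mxEl mxE eqxx mulr1n.
exists (c1 0 0), (c2 0 0); split; first by apply: h1; apply/mem_set.
move=> s; split=> [Ks|/andP[sa sb]].
  have hs : row_mx s%:M y \in S by apply/mem_set; split => //=; rewrite row_mxKr.
  by have := h1 _ hs; have := h2 _ hs; rewrite rE => -> ->.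
have [ab|ab] := eqVneq (c1 0 0) (c2 0 0).
  have -> : s = c1 0 0 by apply/eqP; rewrite eq_le sa {1}ab sb.
  by rewrite -zE.
have ab' : c1 0 0 < c2 0 0 by rewrite lt_neqAle ab; apply: le_trans sa sb.
pose t := (c2 0 0 - s) / (c2 0 0 - c1 0 0).
have t01 : 0 <= t <= 1.
  by rewrite divr_ge0 ?subr_ge0 ?(ltW ab')//= ler_pdivrMr ?subr_gt0// mul1r lerD2l lerN2.
have := vK _ _ t K1 K2 t01; rewrite (zE _ y1) (zE _ y2) !scale_row_mx add_row_mx.
rewrite -scalerDl addrCA subrr addr0 scale1r !scale_scalar_mx -raddfD /=.
suff -> : t * c1 0 0 + (1 - t) * c2 0 0 = s by [].
by rewrite /t; field; rewrite subr_eq0 eq_sym.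
Qed.

Lemma lebn1_itv (a b : R) (S : set (borel 'rV[R]_1)) : a <= b ->
  (forall x : 'rV[R]_1, S x <-> a <= x 0 0 <= b) -> lebesgue_n S = (b - a)%:E.
Proof.
move=> ab hS; have -> : S = box a%:M b%:M.
  apply/seteqP; split=> x.
    by move=> /hS h j; rewrite (ord1 j) !mxE eqxx !mulr1n.
  by move=> /(_ 0); rewrite !mxE eqxx !mulr1n => /hS.
rewrite lebesgue_n_box => [|j]; last by rewrite (ord1 j) !mxE eqxx !mulr1n.
by rewrite /box_vol big_ord1 !mxE eqxx !mulr1n.
Qed.

Lemma compact_rsubmx K : compact K -> compact (rsubmx @` K : set 'rV[R]_m).
Proof.
by move=> cK; apply: continuous_compact cK; apply: continuous_subspaceT; exact: continuous_rsubmx.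
Qed.

Lemma compact_msum_seg n (K : set 'rV[R]_n) u : compact K -> compact (msum K (seg u)).
Proof.
move=> cK; pose Z := [set z : 'rV[R]_(n + 1) | K (lsubmx z) /\ -1 <= rsubmx z 0 0 <= 1].
have -> : msum K (seg u) = (fun z : 'rV[R]_(n + 1) => z *m col_mx 1%:M u) @` Z.
  apply/seteqP; split=> [_ [k Kk [_ [t t1 <-] <-]]|_ [z [Kz z1] <-]].
    exists (row_mx k t%:M); first by split; rewrite ?row_mxKl// row_mxKr mxE eqxx mulr1n.
    by rewrite mul_row_col mulmx1 mul_scalar_mx.
  exists (lsubmx z) => //; exists (rsubmx z 0 0 *: u); first by exists (rsubmx z 0 0).
  by rewrite -{3}[z]hsubmxK mul_row_col mulmx1 [rsubmx z]row1_scalar mul_scalar_mx mxE eqxx mulr1n.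
apply: continuous_compact; first by apply: continuous_subspaceT; exact: mulmxr_continuous.
have [M M0 hM] := compact_norm_le cK.
apply: bounded_closed_compact.
  exists (M + 1); split=> [|N hN z [Kz z1]]; first exact: num_real.
  apply: le_trans (ltW hN); apply: rV_norm_le => [|j]; first by rewrite addr_ge0// ltW.
  case: (splitP j) => i ji.
    have -> : j = lshift 1 i by exact: val_inj.
    have := le_trans (rV_coord_le (lsubmx z) i) (hM _ Kz); rewrite mxE => /le_trans; apply.
    by rewrite lerDl.
  have -> : j = rshift n 0 by apply: val_inj; rewrite /= ji (ord1 i).
  by move: z1; rewrite mxE -ler_norml => /le_trans; apply; rewrite lerDr ltW.
rewrite (_ : Z = lsubmx @^-1` K `&` (fun z : 'rV[R]_(n + 1) => rsubmx z 0 0) @^-1` `[-1, 1]); last first.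
  by apply/seteqP; split=> z [h1 h2]; split=> //; move: h2; rewrite /= in_itv.
apply: closedI; apply: preimage_closed.
- by move=> z _; exact: continuous_lsubmx.
- by apply: compact_closed cK; exact: norm_hausdorff.
- move=> z _; rewrite (_ : (fun _ => _) = (fun z : 'rV[R]_(n + 1) => z 0 (rshift n 0))); first exact: coord_continuous.
  by apply/funext => w; rewrite mxE.
- exact: interval_closed.
Qed.

(** A line parallel to the first axis that meets [K] does so in an interval, which the segment
    lengthens by [t] at both ends. Integrating over the projection of [K] along this axis gives the
    slope, twice the volume of the projection. *)
Lemma segment_first K : compact K -> cvx K -> exists2 s : R, 0 <= s &
  forall t, 0 <= t -> lebesgue_n (msum K (seg (t *: e0))) = (lebesgue_n (K : set (borel 'rV[R]_(1 + m))) + (t * s)%:E)%E.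
Proof.
move=> cK vK.
pose P : set (borel 'rV[R]_m) := rsubmx @` K.
have mP : measurable P by apply: compact_borel; exact: compact_rsubmx.
have fP : lebesgue_n P \is a fin_num by apply: compact_fin_num; exact: compact_rsubmx.
exists (2 * fine (lebesgue_n P)) => [|t t0]; first by rewrite mulr_ge0// fine_ge0.
have mK := compact_borel cK.
rewrite (lebesgue_n_row_swap mK) (lebesgue_n_row_swap (compact_borel (compact_msum_seg (u := t *: e0) cK))).
have -> : (t * (2 * fine (lebesgue_n P)))%:E = (\int[@lebesgue_n R m]_y ((2 * t)%:E * (\1_P y)%:E))%E.
  rewrite ge0_integralZl//; last 2 first.
  - by apply/measurable_EFinP; exact: measurable_indic.
  - by rewrite lee_fin mulr_ge0.
  have -> : (\int[@lebesgue_n R m]_x (\1_P x)%:E = lebesgue_n P)%E by rewrite integral_indic// setIT.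
  by rewrite -(fineK fP) -EFinM; congr EFin; rewrite /=; ring.
rewrite -ge0_integralD//; last 3 first.
- exact: measurable_fun_ysection_lebesgue_n.
- by move=> y _; rewrite mule_ge0// lee_fin// mulr_ge0.
- by apply: emeasurable_funM => //; apply/measurable_EFinP; exact: measurable_indic.
apply: eq_integral => y _; rewrite indicE.
have secE (s : R) : (msum K (seg (t *: e0))) (row_mx s%:M y) <-> exists r, K (row_mx r%:M y) /\ `|s - r| <= t.
  split.
    move=> [k Kk [_ [c c1 <-]]]; rewrite /e0 !scale_row_mx !scaler0 => h.
    have := congr1 rsubmx h; have := congr1 lsubmx h; rewrite !raddfD /= !row_mxKl !row_mxKr addr0 => hl hr.
    exists (lsubmx k 0 0); split; first by rewrite -row1_scalar -hr hsubmxK.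
    have := congr1 (fun M : 'rV_1 => M 0 0) hl; rewrite !mxE eqxx !mulr1n mulr1 => <-.
    rewrite [X in `|X|](_ : _ = c * t); last by ring.
    by rewrite normrM (ger0_norm t0) ler_piMl// ler_norml.
  move=> [r [Kr rs]]; exists (row_mx r%:M y) => //.
  have [tz|tz] := eqVneq t 0.
    exists 0; first by exists 0; rewrite ?scale0r//= lerN10 ler01.
    by move: rs; rewrite tz normr_le0 subr_eq0 => /eqP ->; rewrite addr0.
  have tp : 0 < t by rewrite lt_neqAle eq_sym tz.
  exists (((s - r) / t) *: (t *: e0)).
    exists ((s - r) / t) => //=; rewrite -ler_norml normrM normfV (gtr0_norm tp).
    by rewrite ler_pdivrMr// mul1r.
  rewrite scalerA divfK// /e0 scale_row_mx scaler0 add_row_mx addr0 scale_scalar_mx mulr1.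
  by rewrite -raddfD /= addrCA subrr addr0.
case: (boolP (y \in P)) => [/set_mem[z Kz zy]|/negP yP].
  have [|a [b [ab hab]]] := @section_itv K y cK vK.
    by exists (lsubmx z); rewrite -zy hsubmxK.
  have s1 : lebesgue_n [set x : borel 'rV[R]_1 | K (row_mx x y)] = (b - a)%:E.
    by apply: lebn1_itv => // x; rewrite {1}[x]row1_scalar; exact: hab.
  have s2 : lebesgue_n [set x : borel 'rV[R]_1 | (msum K (seg (t *: e0))) (row_mx x y)] = ((b + t) - (a - t))%:E.
    apply: lebn1_itv => [|x].
      by rewrite lerD// lerNl (le_trans _ t0)// oppr_le0.
    rewrite {1}[x]row1_scalar; split.
      by move=> /secE[r [/hab /andP[h1 h2]]]; rewrite ler_norml => /andP[h3 h4]; apply/andP; split; lra.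
    move=> /andP[h1 h2]; apply/secE.
    (* The point of [a, b] nearest to the given one. *)
    exists (Num.max a (Num.min b (x 0 0))); split.
      by apply/hab; rewrite le_max lexx /= ge_max ab /= ge_min lexx.
    rewrite ler_norml; case: (lerP b (x 0 0)) => h3; case: (lerP a _) => h4; apply/andP; split; lra.
  rewrite s1 s2.
  by rewrite -EFinM -EFinD; congr EFin; rewrite /=; ring.
rewrite mule0 adde0.
have e1 : [set x : borel 'rV[R]_1 | K (row_mx x y)] = set0.
  by apply/seteqP; split=> // x Kx; apply: yP; apply/mem_set; exists (row_mx x y) => //; rewrite row_mxKr.
have e2 : [set x : borel 'rV[R]_1 | (msum K (seg (t *: e0))) (row_mx x y)] = set0.
  apply/seteqP; split=> // x /=; rewrite {1}[x]row1_scalar => /secE[r [Kr _]].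
  by apply: yP; apply/mem_set; exists (row_mx r%:M y) => //; rewrite row_mxKr.
by rewrite e1 e2 measure0.
Qed.

End SegmentLast.

Section SegmentAffine.
Context (R : realType) (n : nat).
Implicit Types (K : set 'rV[R]_n).

(** An invertible matrix carries the first axis to a given nonzero direction and multiplies all
    volumes by the same factor. *)
Lemma segment_affine K (u : 'rV[R]_n) : compact K -> cvx K -> exists2 s : R, 0 <= s &
  forall t, 0 <= t -> lebesgue_n (msum K (seg (t *: u))) = (lebesgue_n (K : set (borel 'rV[R]_n)) + (t * s)%:E)%E.
Proof.
move=> cK vK; have [u0|u0] := eqVneq u 0.
  exists 0 => // t t0; rewrite mulr0 adde0 u0 scaler0; congr lebesgue_n.
  apply/seteqP; split=> [_ [k Kk [_ [c _ <-] <-]]|k Kk]; first by rewrite scaler0 addr0.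
  by exists k => //; exists 0; rewrite ?addr0//; exists 0; rewrite ?scaler0//= lerN10 ler01.
case: n K cK vK u u0 => [|m] K cK vK u u0; first by rewrite (thinmx0 u) eqxx in u0.
have r1 : \rank u = 1%N by rewrite rank_rV u0.
pose e0 : 'rV[R]_(1 + m) := row_mx 1%:M 0.
(* The rank factorisation of the row [u]: a nonzero scalar, the first basis row, an invertible
   matrix. *)
pose c := col_ebase u 0 0.
pose A : 'M[R]_(1 + m) := c *: row_ebase u.
have uE : u = e0 *m A.
  have pE : (pid_mx 1 : 'rV[R]_(1 + m)) = e0.
    by apply/matrixP => i j; rewrite (ord1 i) /e0 !mxE; case: (splitP j) => k jk; rewrite !mxE jk ?(ord1 k).
  by rewrite -[LHS]mulmx_ebase r1 [col_ebase u]row1_scalar mul_scalar_mx -scalemxAl -scalemxAr -pE.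
have c0 : c != 0.
  have := col_ebase_unit u; rewrite unitmxE [col_ebase u]row1_scalar det_scalar1 unitfE //.
have uA : A \in unitmx by rewrite unitmxZ ?unitfE// row_ebase_unit.
pose K' := (fun q : 'rV[R]_(1 + m) => q *m invmx A) @` K.
have cK' : compact K' by apply: continuous_compact cK; apply: continuous_subspaceT; exact: mulmxr_continuous.
have [s s0 hs] := segment_first cK' (cvx_image (A := invmx A) vK).
have KE : K = (fun q : 'rV[R]_(1 + m) => q *m A) @` K'.
  apply/seteqP; split=> [k Kk|_ [_ [k Kk <-] <-]]; last by rewrite mulmxKV.
  by exists (k *m invmx A); [exists k|rewrite mulmxKV].
exists (`|\det A| * s) => [|t t0]; first by rewrite mulr_ge0.
have -> : msum K (seg (t *: u)) = (fun q : 'rV[R]_(1 + m) => q *m A) @` (msum K' (seg (t *: e0))).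
  apply/seteqP; split=> [_ [k Kk [_ [d d1 <-] <-]]|_ [_ [_ [k Kk <-] [_ [d d1 <-] <-]] <-]].
    exists (k *m invmx A + d *: (t *: e0)).
      by exists (k *m invmx A); [exists k|exists (d *: (t *: e0)) => //; exists d].
    by rewrite mulmxDl mulmxKV// -!scalemxAl -uE.
  exists k => //; exists (d *: (t *: u)); first by exists d.
  by rewrite mulmxDl mulmxKV// -!scalemxAl -uE.
rewrite lebesgue_n_image//; last by apply: compact_borel; exact: compact_msum_seg.
rewrite [in X in _ = (lebesgue_n X + _)%E]KE lebesgue_n_image//; last exact: compact_borel.
rewrite hs// muleDr//; last by rewrite fin_num_adde_defl.
by congr (_ + _)%E; rewrite -EFinM; congr EFin; ring.
Qed.

End SegmentAffine.

(** * Multiaffine functions and polynomials in one variable *)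

Section Multiaffine.
Context (R : realType) (m : nat).
Implicit Types (t w : 'rV[R]_m) (f : 'rV[R]_m -> R).

Definition upd t (j : 'I_m) (x : R) : 'rV[R]_m := \row_i if i == j then x else t 0 i.

Definition nneg t := forall j, 0 <= t 0 j.

Lemma upd_id t j : upd t j (t 0 j) = t.
Proof. by apply/rowP => i; rewrite mxE; case: eqP => // ->. Qed.

Lemma nneg_upd t j x : nneg t -> 0 <= x -> nneg (upd t j x).
Proof. by move=> h x0 i; rewrite mxE; case: ifP. Qed.

Definition multiaffine f := forall t j, nneg t ->
  exists s : R, forall x, 0 <= x -> f (upd t j x) = f (upd t j 0) + x * s.

Lemma multiaffineE f t j x : multiaffine f -> nneg t -> 0 <= x ->
  f (upd t j x) = f (upd t j 0) + x * (f (upd t j 1) - f (upd t j 0)).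
Proof. by move=> hf tp x0; have [s hs] := hf t j tp; rewrite (hs 1)// (hs x)// mul1r; ring. Qed.

Lemma multiaffine_lin (a b : R) f g : multiaffine f -> multiaffine g -> multiaffine (fun t => a * f t + b * g t).
Proof.
move=> hf hg t j tp; have [s hs] := hf t j tp; have [r hr] := hg t j tp.
by exists (a * s + b * r) => x x0; rewrite hs// hr//; ring.
Qed.

(** Coordinates are put on the ray one at a time: replacing one of them by s w_j is affine in s w_j
    by [multiaffineE], with coefficients that are polynomials in s by induction. *)
Lemma ray_poly f w : multiaffine f -> nneg w -> exists p : {poly R}, forall s, 0 <= s -> f (s *: w) = p.[s].
Proof.
move=> hf wp.
pose mix (k : nat) (s : R) t : 'rV[R]_m := \row_j if (j < k)%N then s * w 0 j else t 0 j.
suff h k : (k <= m)%N -> forall t, nneg t -> exists p : {poly R}, forall s, 0 <= s -> f (mix k s t) = p.[s].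
  have [p hp] := h m (leqnn m) w wp; exists p => s s0; rewrite -hp//; congr f.
  by apply/rowP => j; rewrite !mxE ltn_ord.
elim: k => [_ t tp|k IH km t tp].
  exists (f t)%:P => s _; rewrite hornerC; congr f; apply/rowP => j; by rewrite mxE.
pose j : 'I_m := Ordinal km.
have [p0 h0] := IH (ltnW km) (upd t j 0) (nneg_upd j tp (lexx _)).
have [p1 h1] := IH (ltnW km) (upd t j 1) (nneg_upd j tp ler01).
exists (p0 + (w 0 j *: 'X) * (p1 - p0)) => s s0.
have mixE x : mix k s (upd t j x) = upd (mix k s t) j x.
  apply/rowP => i; rewrite !mxE; case: (eqVneq i j) => [->|ij] //.
  by rewrite ltnn.
have -> : mix k.+1 s t = upd (mix k s t) j (s * w 0 j).
  apply/rowP => i; rewrite !mxE ltnS leq_eqVlt -val_eqE /=.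
  by case: eqP => //= ik; congr (_ * w _ _); apply: val_inj.
have mp : nneg (mix k s t) by move=> i; rewrite mxE; case: ifP => // _; rewrite mulr_ge0.
rewrite multiaffineE ?mulr_ge0// -!mixE h0// h1// !hornerE; ring.
Qed.

(** By induction on the number k of nonzero coordinates, with k different from n: setting one of
    them to 0 gives the value 0, so f is linear in each of them and doubling them one after the
    other multiplies f by 2^k. By homogeneity the same doubling multiplies f by 2^n. *)
Lemma multiaffine_homogeneous_eq0 f n : multiaffine f -> (forall s t, 0 <= s -> nneg t -> f (s *: t) = s ^+ n * f t) ->
  (forall t, nneg t -> #|[set j | t 0%R j != 0%R]%SET| = n -> f t = 0) -> forall t, nneg t -> f t = 0.
Proof.
move=> hf hh hn.
suff h k : forall t, nneg t -> (#|[set j | t 0%R j != 0%R]%SET| < k)%N -> f t = 0.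
  by move=> t tp; apply: (h _ t tp (leqnn _)).
elim: k => // k IH t tp; rewrite ltnS leq_eqVlt => /predU1P[tk|]; last exact: IH.
have [kn|kn] := eqVneq k n; first by apply: hn => //; rewrite tk.
pose dbl (s : seq 'I_m) : 'rV[R]_m := \row_i if i \in s then 2 * t 0 i else t 0 i.
have dblp s : nneg (dbl s) by move=> i; rewrite mxE; case: ifP => // _; rewrite mulr_ge0.
have step (s : seq 'I_m) : uniq s -> all (fun j => t 0 j != 0) s -> f (dbl s) = 2 ^+ size s * f t.
  elim: s => [_ _|j s IHs /= /andP[js us] /andP[tj ts]].
    by rewrite expr0 mul1r; congr f; apply/rowP => i; rewrite mxE.
  have -> : dbl (j :: s) = upd (dbl s) j (2 * t 0 j).
    apply/rowP => i; rewrite !mxE in_cons; case: eqVneq => [->|] //=.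
  have e1 : dbl s = upd (dbl s) j (t 0 j).
    by apply/rowP => i; rewrite !mxE; case: eqVneq => [->|] //; rewrite (negbTE js).
  rewrite exprS -mulrA -IHs// [in RHS]e1.
  have [r hr] := hf (dbl s) j (dblp s).
  rewrite (hr (2 * t 0 j)) ?mulr_ge0// (hr (t 0 j))//.
  suff -> : f (upd (dbl s) j 0) = 0 by rewrite !add0r mulrA.
  apply: IH; first exact: nneg_upd.
  rewrite -tk; apply: proper_card; apply/properP; split.
    apply/fintype.subsetP => i; rewrite !inE !mxE; case: (i == j); first by rewrite eqxx.
    by case: ifP => // _; rewrite mulf_eq0 pnatr_eq0.
  by exists j; rewrite !inE// !mxE eqxx eqxx.
have := step (enum [set j | t 0%R j != 0%R]%SET) (enum_uniq _).
rewrite -cardE tk (_ : dbl _ = 2 *: t); last first.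
  by apply/rowP => i; rewrite !mxE mem_enum inE; case: eqP => // ->; rewrite mulr0.
rewrite hh// => h; have {h} /eqP : 2 ^+ n * f t = 2 ^+ k * f t.
  by apply: h; apply/allP => j; rewrite mem_enum inE.
rewrite -subr_eq0 -mulrBl mulf_eq0 => /orP[|/eqP//].
by rewrite subr_eq0 -!natrX eqr_nat eqn_exp2l// eq_sym (negbTE kn).
Qed.

End Multiaffine.

Section PolyGrowth.
Context (R : realType).
Implicit Types p : {poly R}.

Lemma horner_growth p : exists2 M : R, 0 <= M & forall s, 1 <= s -> `|p.[s]| <= M * s ^+ (size p).-1.
Proof.
exists (\sum_(i < size p) `|p`_i|) => [|s s1]; first by rewrite sumr_ge0.
rewrite horner_coef mulr_suml; apply: le_trans (ler_norm_sum _ _ _) _; apply: ler_sum => i _.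
rewrite normrM ler_wpM2l// ger0_norm ?exprn_ge0 ?(le_trans ler01)//.
by rewrite ler_weXn2l// -ltnS (leq_trans (ltn_ord i))// leqSpred.
Qed.

Lemma size_growth p n (M : R) : (forall s, 1 <= s -> `|p.[s]| <= M * s ^+ n) -> (size p <= n.+1)%N.
Proof.
move=> hp; rewrite leqNgt; apply/negP => sp.
have M0 : 0 <= M by have := hp 1 (lexx _); rewrite expr1n mulr1; apply: le_trans.
pose d := (size p).-1; have dn : (n < d)%N by rewrite -ltnS /d prednK// (leq_trans _ sp).
pose c := lead_coef p; pose r := p - c *: 'X^d.
have pd : size p = d.+1 by rewrite prednK// (leq_trans _ sp).
have sr : (size r <= d)%N.
  apply/leq_sizeP => j; rewrite leq_eqVlt => /predU1P[<-|dj].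
    by rewrite coefB coefZ coefXn eqxx mulr1 /c lead_coefE subrr.
  by rewrite coefB coefZ coefXn gtn_eqF// mulr0 subr0 nth_default// pd.
have c0 : c != 0 by rewrite lead_coef_eq0 -size_poly_gt0 pd.
have [M' M'0 hr] := horner_growth r.
have key s : 1 <= s -> `|c| * s <= M + M'.
  move=> s1; have s0 : 0 < s := lt_le_trans ltr01 s1.
  have -> : `|c| * s = `|c * s ^+ d| / s ^+ d.-1.
    rewrite normrM normrX (gtr0_norm s0) -{1}(prednK (leq_ltn_trans (leq0n _) dn)) exprS.
    by field; rewrite expf_neq0// gt_eqF.
  rewrite ler_pdivrMr ?exprn_gt0// mulrDl.
  have -> : c * s ^+ d = p.[s] - r.[s] by rewrite !hornerE; ring.
  apply: le_trans (ler_normB _ _) _; apply: lerD.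
    apply: le_trans (hp s s1) _; rewrite ler_wpM2l// ler_weXn2l//.
    by rewrite -ltnS prednK// (leq_ltn_trans (leq0n _) dn).
  apply: le_trans (hr s s1) _; rewrite ler_wpM2l// ler_weXn2l//.
  by rewrite -!subn1 leq_sub2r.
have := key (1 + (M + M') / `|c|).
have h0 : 0 <= (M + M') / `|c| by rewrite divr_ge0// addr_ge0.
rewrite lerDl => /(_ h0); rewrite mulrDr mulr1 mulrCA mulfV ?normr_eq0// mulr1.
by rewrite gerDr leNgt normr_gt0 c0.
Qed.

(** The Vandermonde matrix at the nodes 1, ..., n + 1 is invertible. The coefficients [l] depend on
    [n] alone, so errors at the nodes reach the value at 0 with a fixed constant. *)
Lemma extrapolate n : exists l : 'I_n.+1 -> R, forall p, (size p <= n.+1)%N -> p.[0] = \sum_k l k * p.[k.+1%:R].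
Proof.
pose a : 'rV[R]_n.+1 := \row_k k.+1%:R.
pose A := Vandermonde n.+1 a.
have uA : A \in unitmx.
  rewrite unitmxE det_Vandermonde unitfE; apply/prodf_neq0 => i _; apply/prodf_neq0 => j ij.
  by rewrite !mxE subr_eq0 eqr_nat eqSS gtn_eqF.
pose l := invmx A *m (delta_mx 0 0 : 'cV_n.+1).
exists (fun k => l k 0) => p sp.
have h (i : 'I_n.+1) : \sum_k l k 0 * k.+1%:R ^+ i = (i == 0)%:R.
  have := congr1 (fun B : 'cV_n.+1 => B i 0) (mulKVmx uA (delta_mx 0 0 : 'cV_n.+1)).
  by rewrite !mxE eqxx andbT => <-; apply: eq_bigr => k _; rewrite !mxE mulrC.
have pE s : p.[s] = \sum_(i < n.+1) p`_i * s ^+ i by exact: horner_coef_wide.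
under eq_bigr do rewrite pE mulr_sumr.
rewrite exchange_big /= pE; apply: eq_bigr => i _.
under eq_bigr do rewrite mulrCA.
by rewrite -mulr_sumr h; congr (_ * _); rewrite expr0n -val_eqE.
Qed.

End PolyGrowth.

(** * Zonotopes and their volume *)

Section Zonotopes.
Context (R : realType) (n : nat).
Implicit Types (K L : set 'rV[R]_n).


Lemma compact_box m (a b : 'rV[R]_m) : compact (box a b).
Proof.
apply: bounded_closed_compact; last exact: closed_box.
exists (mxsum a + mxsum b); split=> [|M hM q qab]; first exact: num_real.
apply: le_trans (ltW hM); apply: rV_norm_le => [|j]; first by rewrite addr_ge0// mxsum_ge0.
have ha : `|a 0 j| <= mxsum a by rewrite /mxsum big_ord1 (bigD1 j)//= lerDl sumr_ge0.
have hb : `|b 0 j| <= mxsum b by rewrite /mxsum big_ord1 (bigD1 j)//= lerDl sumr_ge0.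
have /andP[h1 h2] := qab j.
rewrite ler_norml; apply/andP; split.
  by apply: le_trans h1; rewrite lerNl (le_trans (ler_norm _))// normrN (le_trans ha)// lerDl mxsum_ge0.
by apply: le_trans h2 _; apply: le_trans (ler_norm _) _; rewrite (le_trans hb)// lerDr mxsum_ge0.
Qed.

Lemma compact_msum K L : compact K -> compact L -> compact (msum K L).
Proof.
move=> cK cL; have -> : msum K L = (fun p : 'rV[R]_n * 'rV[R]_n => p.1 + p.2) @` (K `*` L).
  apply/seteqP; split=> [_ [a Ka [b Lb <-]]|_ [[a b] [/= Ka Lb] <-]]; first by exists (a, b).
  by exists a => //; exists b.
apply: continuous_compact; last exact: compact_setX.
by apply: continuous_subspaceT; exact: add_continuous.
Qed.

Lemma cvx_msum K L : cvx K -> cvx L -> cvx (msum K L).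
Proof.
move=> vK vL _ _ t [a Ka [b Lb <-]] [a' Ka' [b' Lb' <-]] t01.
exists (t *: a + (1 - t) *: a'); first exact: vK.
exists (t *: b + (1 - t) *: b'); first exact: vL.
by rewrite !scalerDr addrACA.
Qed.

(* The zonotope sum_j t_j [-c_j, c_j], for the rows c_j of C. *)
Definition zonotope m (C : 'M[R]_(m, n)) (t : 'rV[R]_m) : set 'rV[R]_n := (fun s => s *m C) @` box (- t) t.

Definition zonotope_sum K m (C : 'M[R]_(m, n)) (t : 'rV[R]_m) := msum K (zonotope C t).

Lemma compact_zonotope m (C : 'M[R]_(m, n)) t : compact (zonotope C t).
Proof.
apply: continuous_compact; last exact: compact_box.
by apply: continuous_subspaceT; exact: mulmxr_continuous.
Qed.

Lemma cvx_box m (a b : 'rV[R]_m) : cvx (box a b).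
Proof.
move=> x y t hx hy /andP[t0 t1] j; have /andP[? ?] := hx j; have /andP[? ?] := hy j.
have t1' : 0 <= 1 - t by rewrite subr_ge0.
rewrite !mxE; apply/andP; split.
  have -> : a 0 j = t * a 0 j + (1 - t) * a 0 j by ring.
  by rewrite lerD// ler_wpM2l.
have -> : b 0 j = t * b 0 j + (1 - t) * b 0 j by ring.
by rewrite lerD// ler_wpM2l.
Qed.

Lemma cvx_zonotope m (C : 'M[R]_(m, n)) t : cvx (zonotope C t).
Proof.
move=> _ _ c [x hx <-] [y hy <-] c01; exists (c *: x + (1 - c) *: y); first exact: cvx_box.
by rewrite mulmxDl !scalemxAl.
Qed.

Lemma compact_zonotope_sum K m (C : 'M[R]_(m, n)) t : compact K -> compact (zonotope_sum K C t).
Proof. by move=> cK; apply: compact_msum => //; exact: compact_zonotope. Qed.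

Lemma cvx_zonotope_sum K m (C : 'M[R]_(m, n)) t : cvx K -> cvx (zonotope_sum K C t).
Proof. by move=> cK; apply: cvx_msum => //; exact: cvx_zonotope. Qed.

Lemma zonotope_sum_upd K m (C : 'M[R]_(m, n)) t j x : nneg t -> 0 <= x ->
  zonotope_sum K C (upd t j x) = msum (zonotope_sum K C (upd t j 0)) (seg (x *: row j C)).
Proof.
move=> tp x0; apply/seteqP; split.
  move=> _ [k Kk [_ [s hs <-] <-]].
  exists (k + (s - s 0 j *: delta_mx 0 j) *m C).
    exists k => //; exists ((s - s 0 j *: delta_mx 0 j) *m C) => //; eexists; last reflexivity.
    move=> i; have := hs i; rewrite !mxE eqxx /=; case: eqVneq => [->|ij].
      by rewrite mulr1 subrr oppr0 lexx.
    by rewrite mulr0 subr0.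
  exists (s 0 j *: row j C).
    have [x00|xn0] := eqVneq x 0.
      exists 0; first by rewrite /= lerN10 ler01.
      have := hs j; rewrite !mxE eqxx x00 oppr0 => /le_anti <-.
      by rewrite !scale0r.
    exists (s 0 j / x); last by rewrite scalerA divfK.
    have xp : 0 < x by rewrite lt_def xn0.
    have := hs j; rewrite !mxE eqxx /= ler_pdivlMr// ler_pdivrMr// mulN1r mul1r//.
  by rewrite mulmxBl -scalemxAl -rowE addrA subrK.
move=> _ [_ [k Kk [_ [s hs <-] <-]] [_ [c c1 <-] <-]].
exists k => //; exists ((s + (c * x) *: delta_mx 0 j) *m C); last first.
  by rewrite mulmxDl -scalemxAl -rowE scalerA addrA.
eexists; last reflexivity.
move=> i; have := hs i; rewrite !mxE eqxx /=; case: eqVneq => [->|ij].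
  rewrite oppr0 => /le_anti <-; rewrite add0r mulr1 -ler_norml normrM (ger0_norm x0).
  by rewrite ler_piMl// ler_norml.
by rewrite mulr0 addr0.
Qed.

Definition vol K : R := fine (lebesgue_n (K : set (borel 'rV[R]_n))).

Lemma volE K : compact K -> lebesgue_n (K : set (borel 'rV[R]_n)) = (vol K)%:E.
Proof. by move=> cK; rewrite /vol fineK//; exact: compact_fin_num. Qed.

Lemma vol_ge0 K : 0 <= vol K.
Proof. exact/fine_ge0/measure_ge0. Qed.

Lemma le_vol K L : compact K -> compact L -> K `<=` L -> vol K <= vol L.
Proof.
by move=> cK cL KL; rewrite -lee_fin -!volE//; apply: le_measure => //; apply/mem_set; exact: compact_borel.
Qed.

Lemma vol_norm_le K (M : R) : 0 <= M -> compact K -> (forall x, K x -> `|x| <= M) -> vol K <= (2 * M) ^+ n.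
Proof. by move=> M0 cK h; rewrite -lee_fin -volE//; exact: lebesgue_n_norm_le. Qed.

Lemma zonotope_sum_multiaffine K m (C : 'M[R]_(m, n)) : compact K -> cvx K -> multiaffine (fun t => vol (zonotope_sum K C t)).
Proof.
move=> cK vK t j tp.
have [s s0 hs] := segment_affine (row j C) (@compact_zonotope_sum K m C (upd t j 0) cK) (@cvx_zonotope_sum K m C (upd t j 0) vK).
exists s => x x0; rewrite zonotope_sum_upd// /vol hs// volE//; last exact: compact_zonotope_sum.
Qed.

Lemma zonotope_sum_norm K m (C : 'M[R]_(m, n)) t (M : R) : (forall k, K k -> `|k| <= M) -> nneg t ->
  forall x, zonotope_sum K C t x -> `|x| <= M + \sum_j t 0 j * `|row j C|.
Proof.
move=> hK tp _ [k Kk [_ [s hs <-] <-]]; apply: le_trans (ler_normD _ _) _; apply: lerD; first exact: hK.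
rewrite mulmx_sum_row; apply: le_trans (ler_norm_sum _ _ _) _; apply: ler_sum => j _.
by rewrite normrZ ler_wpM2r// ler_norml; have := hs j; rewrite mxE.
Qed.

(** The cube is added one edge direction at a time. The volume is affine in each edge length, so an
    increment is at most e times the volume with that edge of length parameter 1, and [V] bounds
    this because the bodies involved have norm at most M + n. *)
Lemma vol_cube_le K (e M : R) : compact K -> cvx K -> (forall k, K k -> `|k| <= M) -> 0 <= M ->
  0 <= e <= 1 -> vol (zonotope_sum K 1%:M (const_mx e : 'rV_n)) <= vol K + e * (n%:R * (2 * (M + n%:R)) ^+ n).
Proof.
move=> cK vK hK M0 /andP[e0 e1].
pose V : R := (2 * (M + n%:R)) ^+ n.
pose t (k : nat) : 'rV[R]_n := \row_j if (j < k)%N then e else 0.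
have V1 (u : 'rV[R]_n) : nneg u -> (forall j, u 0 j <= 1) -> vol (zonotope_sum K 1%:M u) <= V.
  move=> up u1; apply: vol_norm_le; [by rewrite addr_ge0|exact: compact_zonotope_sum|].
  move=> x /(zonotope_sum_norm hK up); move/le_trans; apply; rewrite lerD2l.
  apply: le_trans (_ : \sum_(j < n) 1 <= _); last by rewrite sumr_const card_ord.
  apply: ler_sum => j _; rewrite -[leRHS]mulr1; apply: ler_pM => //.
  apply: rV_norm_le => // i; rewrite !mxE; case: eqP => _; by rewrite ?normr1 ?normr0.
have tp k : nneg (t k) by move=> j; rewrite mxE; case: ifP.
have step k : (k <= n)%N -> vol (zonotope_sum K 1%:M (t k)) <= vol K + e * (k%:R * V).
  elim: k => [_|k IH kn].
    rewrite mul0r mulr0 addr0; apply: le_vol => //; first exact: compact_zonotope_sum.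
    move=> _ [x Kx [_ [s hs <-] <-]]; rewrite (_ : s = 0) ?mul0mx ?addr0//.
    by apply/rowP => j; have := hs j; rewrite !mxE /= oppr0 => /le_anti <-.
  pose j : 'I_n := Ordinal kn.
  have -> : t k.+1 = upd (t k) j e.
    apply/rowP => i; rewrite !mxE ltnS leq_eqVlt -val_eqE /=; case: eqP => //= -> .
  have t0 : upd (t k) j 0 = t k.
    by rewrite -[RHS](upd_id (t k) j); congr (upd _ _ _); rewrite mxE ltnn.
  rewrite (multiaffineE j (zonotope_sum_multiaffine 1%:M cK vK)) //.
  rewrite t0; apply: le_trans (_ : vol K + e * (k%:R * V) + e * V <= _); last first.
    by rewrite -natr1 -addrA lerD2l -mulrDr mulrDl mul1r.
  apply: lerD; first by apply: IH; exact: ltnW.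
  rewrite ler_wpM2l// lerBlDr; apply: le_trans (V1 _ _ _) _; last by rewrite lerDl vol_ge0.
    by apply: nneg_upd.
  by move=> i; rewrite !mxE; do 2 case: ifP => _ //.
have := step n (leqnn n); rewrite (_ : t n = const_mx e) //.
by apply/rowP => j; rewrite !mxE ltn_ord.
Qed.

End Zonotopes.

Section ZonotopeVolume.
Context (R : realType) (n m : nat) (C : 'M[R]_(m, n)).

(** The sum runs over all ordered n-tuples of rows; those with a repetition have determinant 0. *)
Definition Dsum (w : 'rV[R]_m) : R :=
  \sum_(f : {ffun 'I_n -> 'I_m}) (\prod_k w 0 (f k)) * `|\det (rowsub f C)|.

Lemma det_rowsub_noninj (f : 'I_n -> 'I_m) : ~~ injectiveb f -> \det (rowsub f C) = 0.
Proof.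
move=> /injectivePn[i [j ij fij]]; apply: (determinant_alternate ij) => k.
by rewrite !mxE fij.
Qed.

Lemma Dsum_multiaffine : multiaffine Dsum.
Proof.
move=> t j _.
suff h (f : {ffun 'I_n -> 'I_m}) : exists s : R, forall x,
    (\prod_k upd t j x 0 (f k)) * `|\det (rowsub f C)| =
    (\prod_k upd t j 0 0 (f k)) * `|\det (rowsub f C)| + x * s.
  have [s hs] := choice h; exists (\sum_f s f) => x _.
  by rewrite mulr_sumr -big_split /=; apply: eq_bigr => f _; rewrite hs.
have [/injectiveP fi|/det_rowsub_noninj ->] := boolP (injectiveb f); last first.
  by exists 0 => x; rewrite normr0 !mulr0 addr0.
have [/existsP[k /eqP fk]|nj] := boolP [exists k, f k == j]; last first.
  exists 0 => x; rewrite mulr0 addr0; congr (_ * _); apply: eq_bigr => k _; rewrite !mxE.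
  by case: eqP => // fk; case/negP: nj; apply/existsP; exists k; apply/eqP.
exists ((\prod_(i | i != k) t 0 (f i)) * `|\det (rowsub f C)|) => x.
have pE y : \prod_i upd t j y 0 (f i) = y * \prod_(i | i != k) t 0 (f i).
  rewrite (bigD1 k)//= mxE fk eqxx; congr (_ * _); apply: eq_bigr => i ik; rewrite mxE.
  by case: eqP => // fij; case/eqP: ik; apply: fi; rewrite fij.
by rewrite !pE; ring.
Qed.

Lemma Dsum_scale (s : R) w : Dsum (s *: w) = s ^+ n * Dsum w.
Proof.
rewrite /Dsum mulr_sumr; apply: eq_bigr => f _; rewrite mulrA; congr (_ * _).
under eq_bigr do rewrite mxE.
by rewrite big_split /= prodr_const card_ord.
Qed.

Lemma zonotope_scale (s : R) t : 0 < s -> zonotope C (s *: t) = (fun q => q *m s%:M) @` zonotope C t.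
Proof.
move=> s0; apply/seteqP; split.
  move=> _ [x hx <-]; exists ((s^-1 *: x) *m C).
    exists (s^-1 *: x) => // j; have := hx j; rewrite !mxE -mulrN => /andP[h1 h2].
    by rewrite ler_pdivlMl// h1 ler_pdivrMl.
  by rewrite mul_mx_scalar scalemxAl scalerA mulfV ?gt_eqF// scale1r.
move=> _ [_ [x hx <-] <-]; exists (s *: x); last by rewrite mul_mx_scalar scalemxAl.
by move=> j; have := hx j; rewrite !mxE -mulrN => /andP[h1 h2]; rewrite !ler_pM2l// h1.
Qed.

Lemma KZ0E t : zonotope_sum [set 0] C t = zonotope C t.
Proof.
apply/seteqP; split=> [_ [_ -> [y hy <-]]|y hy]; first by rewrite add0r.
by exists 0 => //; exists y => //; rewrite add0r.
Qed.

Lemma zonotope_vol_scale (s : R) t : 0 < s -> vol (zonotope C (s *: t)) = s ^+ n * vol (zonotope C t).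
Proof.
move=> s0; have us : (s%:M : 'M[R]_n) \in unitmx by rewrite unitmxE det_scalar unitfE expf_neq0 ?gt_eqF.
rewrite /vol zonotope_scale// lebesgue_n_image//; last by apply: compact_borel; exact: compact_zonotope.
rewrite det_scalar ger0_norm ?exprn_ge0 ?ltW//.
by rewrite (volE (compact_zonotope (C := C) (t := t))).
Qed.

Lemma linear_strict_deriv p (A : 'M[R]_(p, n)) x : strict_deriv (fun q => q *m A) x A.
Proof.
move=> e e0; exists 1 => // y z _ _; rewrite -mulmxBl subrr normr0.
by rewrite mulr_ge0// ltW.
Qed.
End ZonotopeVolume.

Section ZonotopeFormula.
Context (R : realType) (n m : nat) (C : 'M[R]_(m, n)).

(** When the rows are dependent, the image is null as a set of critical values of a linear map. *)
Lemma zonotope_square (A : 'M[R]_n) (t : 'rV[R]_n) : nneg t ->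
  vol (zonotope A t) = 2 ^+ n * (\prod_k t 0 k) * `|\det A|.
Proof.
move=> tp; have bv : lebesgue_n (box (- t) t) = (2 ^+ n * \prod_k t 0 k)%:E.
  rewrite lebesgue_n_box; last by move=> j; rewrite mxE ge0_cp// tp.
  congr EFin; rewrite /box_vol -[2 ^+ n](_ : \prod_(k < n) 2 = _); last by rewrite prodr_const card_ord.
  by rewrite -big_split; apply: eq_bigr => k _; rewrite mxE /=; ring.
have [dA|dA] := eqVneq (\det A) 0.
  rewrite dA normr0 mulr0 /vol /zonotope.
  rewrite (_ : lebesgue_n _ = 0)//; apply: (sard (D := fun=> A)) => x _; split=> //.
  exact: linear_strict_deriv.
rewrite /vol /zonotope lebesgue_n_image//; last exact: measurable_box.
  by rewrite bv -EFinM /= mulrC.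
by rewrite unitmxE unitfE.
Qed.

(** Both sides are multiaffine and homogeneous of degree [n] in [t], so by
    [multiaffine_homogeneous_eq0] they are compared only when exactly [n] coordinates are nonzero.
    The zonotope is then a parallelotope of volume 2^n |det| times the product of its t_j, and
    [Dsum] counts this determinant once for each of the n! orders of the rows. *)
Lemma zonotope_vol t : nneg t -> vol (zonotope C t) = 2 ^+ n / n`!%:R * Dsum C t.
Proof.
move=> tp; apply/eqP; rewrite -subr_eq0; apply/eqP; move: t tp.
pose f t := 1 * vol (zonotope C t) + (- (2 ^+ n / n`!%:R)) * Dsum C t.
suff h t : nneg t -> f t = 0 by move=> t /h; rewrite /f mul1r mulNr.
apply: (@multiaffine_homogeneous_eq0 R m f n).
- apply: multiaffine_lin; last exact: Dsum_multiaffine.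
  have c0 : compact [set (0 : 'rV[R]_n)] by exact: compact_set1.
  have := @zonotope_sum_multiaffine R n [set 0] m C c0 _.
  under eq_fun do rewrite KZ0E; apply=> x y c -> -> _.
  by rewrite /= !scaler0 addr0.
- move=> s {}t; rewrite le_eqVlt => /predU1P[<-|s0] tp; last first.
    by rewrite /f zonotope_vol_scale// Dsum_scale; ring.
  (* Scaling by 0 is treated apart: for n = 0 the factor 0^0 is 1, while for n > 0 both sides vanish
     at the origin. *)
  have [n0|n0] := posnP n.
    rewrite [in _ ^+ n]n0 expr0 mul1r scale0r /f; congr (_ * _ + _ * _); last first.
      rewrite /Dsum; apply: eq_bigr => g _; congr (_ * _); apply: eq_bigr => k _.
      by have := ltn_ord k; rewrite [X in (_ < X)%N]n0.
    congr vol; apply/seteqP; split=> _ [x hx <-].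
      exists 0; last by apply/rowP => k; have := ltn_ord k; rewrite [X in (_ < X)%N]n0.
      by move=> j; rewrite !mxE ge0_cp// tp.
    exists 0; last by apply/rowP => k; have := ltn_ord k; rewrite [X in (_ < X)%N]n0.
    by move=> j; rewrite !mxE oppr0 lexx.
  rewrite expr0n gtn_eqF// mul0r scale0r /f.
  have -> : zonotope C 0 = [set 0].
    apply/seteqP; split=> [_ [x hx <-]|_ ->]; last by exists 0; [move=> j; rewrite !mxE oppr0 lexx|rewrite mul0mx].
    rewrite (_ : x = 0) ?mul0mx//; apply/rowP => j; have := hx j; rewrite !mxE oppr0 => /le_anti; by [].
  have -> : Dsum C 0 = 0.
    rewrite /Dsum big1// => g _; rewrite (_ : \prod_k _ = 0) ?mul0r//.
    by rewrite (bigD1 (Ordinal n0))//= mxE mul0r.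
  suff -> : vol [set (0 : 'rV[R]_n)] = 0 by rewrite !mulr0 addr0.
  rewrite /vol (_ : [set 0] = box 0 0); last first.
    apply/seteqP; split=> [_ -> j|x hx]; first by rewrite mxE lexx.
    apply/rowP => j; have := hx j; rewrite !mxE => /le_anti; by [].
  by rewrite lebesgue_n_box// /box_vol (bigD1 (Ordinal n0))//= subrr mul0r.
- move=> {}t tp tn; rewrite /f mul1r.
pose S := [set j | t 0%R j != 0%R]%SET.
pose phi0 (k : 'I_n) : 'I_m := enum_val (cast_ord (esym tn) k : 'I_#|S|).
have phi0i : injective phi0 by move=> k l /enum_val_inj/cast_ord_inj.
have phi0S k : phi0 k \in S by exact: enum_valP.
have phi0on j : j \in S -> exists k, phi0 k = j.
  move=> jS; exists (cast_ord tn (enum_rank_in jS j)).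
  by rewrite /phi0 cast_ordK enum_rankK_in.
pose t0 : 'rV[R]_n := \row_k t 0 (phi0 k).
have sumS (x : 'rV[R]_m) (F : 'I_m -> 'rV[R]_n) : (forall j, j \notin S -> x 0 j = 0) ->
    \sum_j x 0 j *: F j = \sum_k x 0 (phi0 k) *: F (phi0 k).
  move=> xS; rewrite (bigID (mem S))/= [X in _ + X]big1 ?addr0; last first.
    by move=> j /xS ->; rewrite scale0r.
  rewrite big_enum_val (reindex (cast_ord (esym tn)))//.
  by apply: onW_bij; exists (cast_ord tn); [exact: cast_ordKV|exact: cast_ordK].
have xS (x : 'rV[R]_m) : box (- t) t x -> forall j, j \notin S -> x 0 j = 0.
  move=> hx j; rewrite inE negbK => /eqP tj; have := hx j; rewrite mxE tj oppr0 => /le_anti; by [].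
have zonotopeE : zonotope C t = zonotope (rowsub phi0 C) t0.
  apply/seteqP; split=> _ [x hx <-].
    exists (\row_k x 0 (phi0 k)); first by move=> k; have := hx (phi0 k); rewrite !mxE.
    rewrite !mulmx_sum_row (sumS x (fun j => row j C) (xS _ hx)); apply: eq_bigr => k _.
    by rewrite mxE; congr (_ *: _); apply/rowP => i; rewrite !mxE.
  have inv j : exists y : R, (forall k, phi0 k = j -> y = x 0 k) /\ (j \notin S -> y = 0).
    have [jS|jS] := boolP (j \in S); last by exists 0; split=> // k kj; move: (phi0S k); rewrite kj (negbTE jS).
    by have [k <-] := phi0on j jS; exists (x 0 k); split=> // l /phi0i ->.
  have [y hy] := choice inv; exists (\row_j y j).
    move=> j; rewrite !mxE; have [jS|jS] := boolP (j \in S); last first.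
      by rewrite (hy j).2// ge0_cp// tp.
    have [k kj] := phi0on j jS; rewrite ((hy j).1 k)// -kj; have := hx k; rewrite !mxE//.
  rewrite !mulmx_sum_row (sumS _ (fun j => row j C)); last by move=> j /(hy j).2; rewrite mxE.
  apply: eq_bigr => k _; rewrite mxE ((hy _).1 k)//; congr (_ *: _).
  by apply/rowP => i; rewrite !mxE.
rewrite zonotopeE zonotope_square; last by move=> k; rewrite mxE.
(* The injections of the n indices into the support [S]; all other tuples contribute 0, through a
   zero weight or a repeated row. *)
pose P := [pred f : {ffun 'I_n -> 'I_m} | (f \in ffun_on (mem S)) && injectiveb f].
have cP : #|P| = n`!.
  apply: etrans (etrans (card_inj_ffuns_on 'I_n (fun j : 'I_m => j \in S)) _).
    by apply: eq_card => g; rewrite [RHS]inE.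
  by rewrite card_ord -[RHS]ffactnn; congr (_ ^_ _)%N; rewrite -[RHS]tn; apply: eq_card.
rewrite /Dsum (bigID P)/= [X in _ * (_ + X)]big1 ?addr0; last first.
  move=> g; rewrite negb_and => /orP[/ffun_onP gS|/det_rowsub_noninj ->]; last by rewrite normr0 mulr0.
  suff [k gk] : exists k, t 0 (g k) = 0 by rewrite (bigD1 k)//= gk !mul0r.
  apply: contrapT => nk; apply: gS => k; have [//|] := boolP (g k \in S).
  by rewrite inE negbK => /eqP gk; case: nk; exists k.
pose c := (\prod_k t0 0 k) * `|\det (rowsub phi0 C)|.
rewrite (_ : \sum_(g in ffun_on (mem S) | injectiveb g) _ = \sum_(g in P) c).
  rewrite sumr_const cP -(mulr_natl c) /c.
  have : (n`!%:R : R) != 0 by rewrite pnatr_eq0 -lt0n fact_gt0.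
  by move=> nn; field.
apply: eq_bigr => g /andP[/ffun_onP gS /injectiveP gi].
have [s hs] := choice (fun k => phi0on _ (gS k)).
have si : injective s by move=> k l kl; apply: gi; rewrite -hs kl hs.
pose sg := perm si; congr (_ * _).
  rewrite [RHS](reindex_inj (@perm_inj _ sg)); apply: eq_bigr => k _.
  by rewrite mxE permE hs.
have -> : rowsub g C = row_perm sg (rowsub phi0 C).
  by apply/matrixP => k i; rewrite !mxE permE hs.
by rewrite row_permE det_mulmx det_perm normrM normr_sign mul1r.
Qed.

End ZonotopeFormula.

(** * Support functions and the estimate for signed zonotopes *)

Section Separation.
Context (R : realType) (n : nat).
Implicit Types (A B K : set 'rV[R]_n) (u v : 'rV[R]_n).

Definition dot u v : R := (u *m v^T) 0 0.

Lemma dotE u v : dot u v = \sum_j u 0 j * v 0 j.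
Proof. by rewrite /dot mxE; apply: eq_bigr => j _; rewrite mxE. Qed.

Lemma dotC u v : dot u v = dot v u.
Proof. by rewrite !dotE; apply: eq_bigr => j _; rewrite mulrC. Qed.

Lemma dotDl u u' v : dot (u + u') v = dot u v + dot u' v.
Proof. by rewrite /dot mulmxDl mxE. Qed.

Lemma dotZl (c : R) u v : dot (c *: u) v = c * dot u v.
Proof. by rewrite /dot -scalemxAl mxE. Qed.

Lemma dotNl u v : dot (- u) v = - dot u v.
Proof. by rewrite -scaleN1r dotZl mulN1r. Qed.

Lemma dot_mulmx m (s : 'rV[R]_m) (C : 'M[R]_(m, n)) v : dot (s *m C) v = \sum_j s 0 j * dot (row j C) v.
Proof.
rewrite /dot -mulmxA mxE; apply: eq_bigr => j _; congr (_ * _).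
by rewrite -row_mul [RHS]mxE.
Qed.

Lemma dot_continuous v : continuous (fun u => dot u v).
Proof.
move=> u; have h := @mulmxr_continuous R n 1 v^T u.
apply: (@continuous_comp _ _ _ (fun u : 'rV[R]_n => u *m v^T) (fun M : 'M[R]_1 => M 0 0)) => //.
exact: coord_continuous.
Qed.

Lemma sqr_dot_continuous u : continuous (fun v => dot (u - v) (u - v)).
Proof.
rewrite (_ : (fun v => _) = (fun v : 'rV[R]_n => \sum_j (u 0 j - v 0 j) * (u 0 j - v 0 j))); last first.
  by apply/funext => v; rewrite dotE; apply: eq_bigr => j _; rewrite !mxE.
move=> v; apply: continuous_at_sum => j.
have h : {for v, continuous (fun x : 'rV[R]_n => u 0 j - x 0 j)}.
  by apply: continuousB; [exact: cst_continuous|exact: coord_continuous].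
exact: continuousM.
Qed.

Lemma dot_gt0 u : u != 0 -> 0 < dot u u.
Proof.
move=> u0; rewrite lt_def dotE sumr_ge0 ?andbT; last by move=> j _; rewrite -expr2 sqr_ge0.
rewrite psumr_eq0 => [|j _]; last by rewrite -expr2 sqr_ge0.
apply: contra u0 => /allP h; apply/eqP/rowP => j; rewrite mxE.
by have := h j (mem_index_enum _); rewrite -expr2 sqrf_eq0 => /eqP.
Qed.

(** Take [b] nearest to [a] in [B]. If they differ, some [c] in [B] reaches at least as far as [a]
    in the direction a - b, and a small step from [b] towards [c] comes closer to [a], against the
    choice of [b]. *)
Lemma separation_subset A B : compact B -> cvx B ->
  (forall a, A a -> forall v, exists2 b, B b & dot a v <= dot b v) -> A `<=` B.
Proof.
move=> cB vB h a Aa.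
have B0 : B !=set0 by have [b Bb _] := h a Aa 0; exists b.
have [b /set_mem Bb hb] := compact_EVT_min B0 cB (continuous_subspaceT (@sqr_dot_continuous a)).
have [/eqP|ab] := eqVneq (a - b) 0; first by rewrite subr_eq0 => /eqP ->.
have [c Bc hc] := h a Aa (a - b).
have ab0 := dot_gt0 ab.
pose P := dot (a - b) (a - b); pose Q := dot (c - b) (a - b); pose S := dot (c - b) (c - b).
have PQ : P <= Q by rewrite /P /Q !(dotDl _ (- b)) lerD2r.
have S0 : 0 <= S by rewrite /S dotE sumr_ge0// => j _; rewrite -expr2 sqr_ge0.
have key (t : R) : 0 <= t <= 1 -> P <= P - 2 * t * Q + t ^+ 2 * S.
  move=> t01; have /(_ (mem_set _)) := hb (t *: c + (1 - t) *: b); move=> /(_ (vB _ _ _ Bc Bb t01)).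
  rewrite (_ : a - (t *: c + (1 - t) *: b) = (a - b) - t *: (c - b)); last first.
    by apply/rowP => j; rewrite !mxE; ring.
  have -> // : dot (a - b - t *: (c - b)) (a - b - t *: (c - b)) = P - 2 * t * Q + t ^+ 2 * S.
  rewrite dotDl dotNl dotZl [dot (a - b) (_ - _)]dotC [dot (c - b) (_ - _)]dotC.
  rewrite !(dotDl (a - b)) !dotNl !dotZl [dot (c - b) (a - b)]dotC -/P.
  by rewrite /Q [dot (c - b) (a - b)]dotC -/S; ring.
have P0 : 0 < P by [].
(* A step length in (0, 1] with t S <= P, so that the linear gain 2 t Q >= 2 t P beats the quadratic
   term t^2 S. *)
pose t := P / (P + S + 1); have d0 : 0 < P + S + 1 by rewrite ltr_wpDl// addr_ge0// ltW.
have t0 : 0 < t by rewrite divr_gt0.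
have t1 : t <= 1 by rewrite ler_pdivrMr// mul1r -addrA lerDl addr_ge0.
have := key t; rewrite t1 (ltW t0) => /(_ isT) kt; exfalso.
have tS : t * S <= P.
  by rewrite /t mulrAC ler_pdivrMr// ler_wpM2l// ?(ltW P0)//; lra.
have : t * (2 * Q) <= t * (t * S) by rewrite -subr_ge0; nra.
rewrite ler_pM2l// => h2; lra.
Qed.

(** [h] is the support function of [K], with the maximum attained, as it is on nonempty compact
    sets. *)
Definition has_supp K (h : 'rV[R]_n -> R) :=
  (forall k v, K k -> dot k v <= h v) /\ (forall v, exists2 k, K k & dot k v = h v).

Lemma zonotope_supp m (C : 'M[R]_(m, n)) t : nneg t ->
  has_supp (zonotope C t) (fun v => \sum_j t 0 j * `|dot (row j C) v|).
Proof.
move=> tp; split=> [_ v [s hs <-]|v].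
  rewrite dot_mulmx; apply: ler_sum => j _; apply: le_trans (ler_norm _) _.
  by rewrite normrM ler_wpM2r// ler_norml; have := hs j; rewrite mxE.
exists ((\row_j (t 0 j * Num.sg (dot (row j C) v))) *m C); last first.
  rewrite dot_mulmx; apply: eq_bigr => j _; rewrite mxE -mulrA; congr (_ * _).
  by rewrite normrEsg.
exists (\row_j (t 0 j * Num.sg (dot (row j C) v))) => // j; rewrite !mxE -ler_norml normrM (ger0_norm (tp j)).
rewrite ler_piMr// normr_sg; by case: eqP.
Qed.

Lemma msum_supp K L h g : has_supp K h -> has_supp L g -> has_supp (msum K L) (fun v => h v + g v).
Proof.
move=> [h1 h2] [g1 g2]; split=> [_ v [a Ka [b Lb <-]]|v]; first by rewrite dotDl lerD ?h1 ?g1.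
have [a Ka <-] := h2 v; have [b Lb <-] := g2 v; exists (a + b); last by rewrite dotDl.
by exists a => //; exists b.
Qed.

Lemma supp_subset A B h g : compact B -> cvx B -> has_supp A h -> has_supp B g ->
  (forall v, h v <= g v) -> A `<=` B.
Proof.
move=> cB vB [hA _] [_ gB] hg; apply: separation_subset => // a Aa v.
have [b Bb bv] := gB v; exists b => //; rewrite bv; apply: le_trans (hg v); exact: hA.
Qed.

Lemma row1_dot (j : 'I_n) v : dot (row j 1%:M) v = v 0 j.
Proof. by rewrite /dot -row_mul mul1mx !mxE. Qed.

End Separation.

Section ZonoidEstimate.
Context (R : realType) (n : nat).

(** Split w = a - b into positive and negative parts and write Z for zonotopes with rows in [C]. The
    hypothesis on support functions says that, for s >= 1, each of K + Z(s b) and Z(w + s b) lies in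
    the other enlarged by a cube of half-width e. Their volumes are polynomials in [s] of degree at
    most [n], equal at s = 0 to the two quantities compared, and [extrapolate] carries the bound
    from s = 1, ..., n + 1 to s = 0. The constant depends on [rho] and [n] only, so that finer and
    finer zonotopes may be used. *)
Lemma zonoid_estimate (rho : R) : 0 <= rho -> exists2 Cst : R, 0 <= Cst &
  forall m (C : 'M[R]_(m, n)) (w : 'rV[R]_m) (K : set 'rV[R]_n) (h : 'rV[R]_n -> R) (e : R),
  compact K -> cvx K -> (forall k, K k -> `|k| <= rho) -> has_supp K h -> 0 <= e <= 1 ->
  \sum_j `|w 0 j| * `|row j C| <= rho ->
  (forall v, `|h v - \sum_j w 0 j * `|dot (row j C) v| | <= e * \sum_i `|v 0 i|) ->
  `|vol K - 2 ^+ n / n`!%:R * Dsum C w| <= e * Cst.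
Proof.
move=> rho0; have [l hl] := extrapolate R n.
(* A bound for the norm on both bodies for every s <= n + 1. *)
pose M : R := n.+2%:R * rho; have M0 : 0 <= M by rewrite mulr_ge0.
pose V : R := n%:R * (2 * (M + n%:R)) ^+ n.
have V0 : 0 <= V by rewrite mulr_ge0// exprn_ge0// mulr_ge0// addr_ge0.
exists ((\sum_k `|l k|) * V) => [|m C w K h e cK vK hK sK e01 wrho hh].
  by rewrite mulr_ge0// sumr_ge0.
pose a : 'rV[R]_m := \row_j Num.max (w 0 j) 0; pose b : 'rV[R]_m := \row_j Num.max (- w 0 j) 0.
have ap : nneg a by move=> j; rewrite mxE le_max lexx orbT.
have bp : nneg b by move=> j; rewrite mxE le_max lexx orbT.
have abw j : a 0 j - b 0 j = w 0 j.
  rewrite !mxE; case: (lerP (w 0 j) 0) => h1; case: (lerP (- w 0 j) 0) => h2; lra.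
have abn j : a 0 j + b 0 j = `|w 0 j|.
  rewrite !mxE; case: (lerP (w 0 j) 0) => h1; case: (lerP (- w 0 j) 0) => h2.
  - by rewrite ler0_norm//; lra.
  - by rewrite ler0_norm//; lra.
  - by rewrite gtr0_norm//; lra.
  - by lra.
have brho : \sum_j b 0 j * `|row j C| <= rho.
  apply: le_trans wrho; apply: ler_sum => j _; rewrite ler_wpM2r// -abn lerDr; exact: ap.
have [p hp] := ray_poly (zonotope_sum_multiaffine C cK vK) bp.
pose c (s : R) : 'rV[R]_m := a + (s - 1) *: b.
have cp s : 1 <= s -> nneg (c s).
  by move=> s1 j; rewrite !mxE addr_ge0 ?mulr_ge0 ?subr_ge0//; [have := ap j|have := bp j]; rewrite mxE.
have cwE s : c s = w + s *: b by apply/rowP => j; rewrite mxE [RHS]mxE -abw !mxE; ring.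
(* The formula for the volume of Z(w + s b) as a polynomial in [s]; its value at s = 0 is the signed
   sum, where the weights may be negative. *)
pose q : {poly R} := (2 ^+ n / n`!%:R)%:P * \sum_(f : {ffun 'I_n -> 'I_m})
   (\prod_k ((w 0 (f k))%:P + b 0 (f k) *: 'X)) * (`|\det (rowsub f C)|)%:P.
have qE s : q.[s] = 2 ^+ n / n`!%:R * Dsum C (w + s *: b).
  rewrite hornerM hornerC; congr (_ * _); rewrite horner_sum; apply: eq_bigr => f _.
  rewrite hornerM hornerC; congr (_ * _); rewrite horner_prod; apply: eq_bigr => k _.
  by rewrite !hornerE !mxE mulrC.
have qv s : 1 <= s -> q.[s] = vol (zonotope C (c s)) by move=> s1; rewrite qE -cwE -zonotope_vol//; exact: cp.
have bA s : 0 <= s -> forall x, zonotope_sum K C (s *: b) x -> `|x| <= (1 + s) * rho.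
  move=> s0 x /(zonotope_sum_norm hK) h1; have {}h1 := h1 _; apply: le_trans (h1 _) _.
    by move=> j; rewrite mxE mulr_ge0.
  rewrite mulrDl mul1r lerD2l; apply: le_trans (_ : s * \sum_j b 0 j * `|row j C| <= _).
    by rewrite mulr_sumr; apply: ler_sum => j _; rewrite mxE mulrA.
  by rewrite ler_wpM2l.
have bB s : 1 <= s -> forall x, zonotope C (c s) x -> `|x| <= s * rho.
  move=> s1 x; rewrite -KZ0E => /(@zonotope_sum_norm R n [set 0] m C (c s) 0) h1; apply: le_trans (h1 _ _) _.
  - by move=> _ ->; rewrite normr0.
  - exact: cp.
  rewrite add0r; apply: le_trans (_ : s * \sum_j `|w 0 j| * `|row j C| <= _); last first.
    by rewrite ler_wpM2l// (le_trans ler01).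
  rewrite mulr_sumr; apply: ler_sum => j _; rewrite mulrA ler_wpM2r// -abn.
  have := ap j; have := bp j; rewrite [c s 0 j](_ : _ = a 0 j + (s - 1) * b 0 j); last by rewrite !mxE.
  move=> b0 a0; nra.
(* The degree is read off the growth: the body lies in a ball of radius linear in [s], so its volume
   is O(s^n). *)
have sp : (size p <= n.+1)%N.
  apply: (@size_growth _ _ _ ((4 * rho) ^+ n)) => s s1; have s0 : 0 <= s by rewrite (le_trans ler01).
  rewrite -hp// ger0_norm ?vol_ge0// -exprMn.
  have h1 : 0 <= (1 + s) * rho by rewrite mulr_ge0// addr_ge0.
  apply: le_trans (vol_norm_le h1 _ (bA s s0)) _; first exact: compact_zonotope_sum.
  by apply: lerXn2r; rewrite ?nnegrE ?mulr_ge0//; nra.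
have sq : (size q <= n.+1)%N.
  apply: (@size_growth _ _ _ ((2 * rho) ^+ n)) => s s1; have s0 : 0 <= s by rewrite (le_trans ler01).
  rewrite qv// ger0_norm ?vol_ge0// -exprMn.
  have h1 : 0 <= s * rho by rewrite mulr_ge0.
  apply: le_trans (vol_norm_le h1 _ (bB s s1)) _; first exact: compact_zonotope.
  by apply: lerXn2r; rewrite ?nnegrE ?mulr_ge0//; nra.
have p0 : p.[0] = vol K.
  rewrite -hp// scale0r; congr vol; apply/seteqP; split=> [_ [x Kx [_ [s hs <-] <-]]|x Kx].
    rewrite (_ : s = 0) ?mul0mx ?addr0//; apply/rowP => j; have := hs j; rewrite !mxE oppr0 => /le_anti; by [].
  exists x => //; exists 0; rewrite ?addr0//; exists 0; rewrite ?mul0mx// => j; by rewrite !mxE oppr0 lexx.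
have q0 : q.[0] = 2 ^+ n / n`!%:R * Dsum C w by rewrite qE scale0r addr0.
rewrite -p0 -q0 !hl// -sumrB; apply: le_trans (ler_norm_sum _ _ _) _.
rewrite mulr_suml mulr_sumr; apply: ler_sum => k _; rewrite -mulrBr normrM mulrCA ler_wpM2l//.
set s : R := k.+1%:R; have s1 : 1 <= s by rewrite ler1n.
have s0 : 0 <= s by rewrite (le_trans ler01).
rewrite -hp// qv//.
have sbp : nneg (s *: b) by move=> j; rewrite mxE mulr_ge0.
have /andP[e0 e1] := e01.
have ep : nneg (const_mx e : 'rV[R]_n) by move=> j; rewrite mxE.
have sM : (1 + s) * rho <= M by rewrite ler_wpM2r// /s nat1r ler_nat !ltnS -ltnS.
have sM' : s * rho <= M by apply: le_trans sM; rewrite ler_wpM2r// lerDr.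
have cA := @compact_zonotope_sum _ _ K _ C (s *: b) cK; have vA := @cvx_zonotope_sum _ _ K _ C (s *: b) vK.
have cB := @compact_zonotope _ _ _ C (c s); have vB := @cvx_zonotope _ _ _ C (c s).
have sA := msum_supp sK (zonotope_supp C sbp).
have sB := zonotope_supp C (cp s s1).
have sE := zonotope_supp (1%:M : 'M[R]_n) ep.
have hsum v : \sum_j c s 0 j * `|dot (row j C) v| = \sum_j w 0 j * `|dot (row j C) v| + \sum_j (s *: b) 0 j * `|dot (row j C) v|.
  by rewrite -big_split /=; apply: eq_bigr => j _; rewrite cwE mxE mulrDl.
have hcube v : \sum_j (const_mx e : 'rV[R]_n) 0 j * `|dot (row j 1%:M) v| = e * \sum_i `|v 0 i|.
  by rewrite mulr_sumr; apply: eq_bigr => j _; rewrite mxE row1_dot.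
have AB : zonotope_sum K C (s *: b) `<=` zonotope_sum (zonotope C (c s)) 1%:M (const_mx e : 'rV[R]_n).
  apply: (supp_subset _ _ sA (msum_supp sB sE)); [exact: compact_zonotope_sum|exact: cvx_zonotope_sum|].
  by move=> v; rewrite hcube hsum; have := hh v; rewrite ler_norml => /andP[_]; lra.
have BA : zonotope C (c s) `<=` zonotope_sum (zonotope_sum K C (s *: b)) 1%:M (const_mx e : 'rV[R]_n).
  apply: (supp_subset _ _ sB (msum_supp sA sE)); [exact: compact_zonotope_sum|exact: cvx_zonotope_sum|].
  by move=> v; rewrite hcube hsum; have := hh v; rewrite ler_norml => /andP[+ _]; lra.
have hA : vol (zonotope_sum K C (s *: b)) <= vol (zonotope C (c s)) + e * V.
  apply: le_trans (le_vol cA _ AB) _; first exact: compact_zonotope_sum.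
  apply: vol_cube_le => //.
  by move=> x /bB h1; apply: le_trans (h1 s1) _.
have hB : vol (zonotope C (c s)) <= vol (zonotope_sum K C (s *: b)) + e * V.
  apply: le_trans (le_vol cB _ BA) _; first exact: compact_zonotope_sum.
  apply: vol_cube_le => //.
  by move=> x /(bA s s0) h1; apply: le_trans h1 _.
by rewrite ler_norml; apply/andP; split; lra.
Qed.

End ZonoidEstimate.

(** * From C^1 functions to strict derivatives *)

Section MeanValue.
Context (R : realType) (n : nat).
Implicit Types (f : 'rV[R]_n -> R) (x y z p e : 'rV[R]_n).

Lemma mvt_segment f p e (a b : R) : a <= b -> (forall s, a <= s <= b -> derivable f (p + s *: e) e) ->
  exists2 s, a <= s <= b & f (p + b *: e) - f (p + a *: e) = 'D_e f (p + s *: e) * (b - a).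
Proof.
move=> ab df; pose g (s : R) := f (p + s *: e).
have quot s : (fun h : R => h^-1 *: ((f \o shift (p + s *: e)) (h *: e) - f (p + s *: e))) =
              (fun h : R => h^-1 *: ((g \o shift s) (h *: 1) - g s)).
  apply/funext => h /=; rewrite /g; congr (_ *: (f _ - _)).
  by rewrite addrCA -scalerDl [h *: 1]mulr1.
have dg s : a <= s <= b -> derivable g s 1 by move=> /df; rewrite /derivable quot.
have gE s : 'D_1 g s = 'D_e f (p + s *: e) by rewrite /derive quot.
have h1 s : s \in `]a, b[ -> is_derive s 1 g ('D_1 g s).
  rewrite in_itv /= => /andP[/ltW as_ /ltW sb].
  by apply: DeriveDef => //; apply: dg; rewrite as_.
have h2 : {within `[a, b], continuous g}.
  by apply: derivable_within_continuous => s; rewrite in_itv; exact: dg.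
by have [s sab e1] := MVT_segment ab h1 h2; exists s; rewrite -?gE//; move: sab; rewrite in_itv.
Qed.

Lemma norm_segment (a b x t d : R) : `|a - x| < d -> `|b - x| < d -> 0 <= t <= 1 -> `|a + t * (b - a) - x| < d.
Proof.
move=> ha hb /andP[t0 t1].
have -> : a + t * (b - a) - x = (1 - t) * (a - x) + t * (b - x) by ring.
pose M := Num.max `|a - x| `|b - x|.
have Md : M < d by rewrite gt_max ha.
apply: le_lt_trans Md; apply: le_trans (ler_normD _ _) _; rewrite !normrM.
rewrite (ger0_norm t0) (ger0_norm (_ : 0 <= 1 - t)) ?subr_ge0//.
have -> : M = (1 - t) * M + t * M by ring.
by apply: lerD; rewrite ler_wpM2l ?subr_ge0// le_max lexx ?orbT.
Qed.

Lemma mvt_direction f p e (h c eta : R) :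
  (forall t, 0 <= t <= 1 -> derivable f (p + (t * h) *: e) e /\ `|'D_e f (p + (t * h) *: e) - c| <= eta) ->
  `|f (p + h *: e) - f p - h * c| <= eta * `|h|.
Proof.
move=> H.
have H' s : Num.min 0 h <= s <= Num.max 0 h -> derivable f (p + s *: e) e /\ `|'D_e f (p + s *: e) - c| <= eta.
  move=> sh; have [h0|hn0] := eqVneq h 0.
    by move: sh; rewrite h0 minxx maxxx => /le_anti <-; have := H 0; rewrite lexx ler01 mul0r; apply.
  rewrite (_ : s = (s / h) * h); last by rewrite divfK.
  apply: H; move: sh; case: (lerP 0 h) => hh /andP[s1 s2].
    by rewrite divr_ge0// ler_pdivrMr ?mul1r// lt_def hn0.
  by rewrite -mulrNN -invrN divr_ge0 ?oppr_ge0 ?(ltW hh)//= ler_pdivrMr ?oppr_gt0// mul1r lerN2.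
have key a b : a <= b -> (forall s, a <= s <= b -> derivable f (p + s *: e) e /\ `|'D_e f (p + s *: e) - c| <= eta) ->
    `|f (p + b *: e) - f (p + a *: e) - (b - a) * c| <= eta * (b - a).
  move=> ab Hs; have [|s sab ->] := @mvt_segment f p e a b ab; first by move=> s /Hs[].
  rewrite mulrC -mulrBr normrM (ger0_norm (_ : 0 <= b - a)) ?subr_ge0// mulrC.
  by rewrite ler_wpM2r ?subr_ge0//; have [] := Hs s sab.
case: (lerP 0 h) H' => hh H'.
  have := key 0 h hh H'; by rewrite scale0r addr0 subr0 (ger0_norm hh).
have := key h 0 (ltW hh) H'; rewrite scale0r addr0 sub0r (ltr0_norm hh).
by rewrite -normrN; congr (`|_| <= _); ring.
Qed.

(** From [z] to [y] one coordinate is changed at a time, so that only partial derivatives enter; the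
    intermediate points stay in the ball because the norm is the maximum norm. *)
Lemma mvt_cube f x (d eta : R) (c : 'rV[R]_n) :
  (forall y, `|y - x| < d -> forall j, derivable f y (delta_mx 0 j) /\ `|'D_(delta_mx 0 j) f y - c 0 j| <= eta) ->
  forall y z, `|y - x| < d -> `|z - x| < d -> `|f y - f z - dot (y - z) c| <= n%:R * eta * `|y - z|.
Proof.
move=> H y z yd zd; have [n0|n0] := posnP n.
  have -> : y = z by apply/rowP => j; have := ltn_ord j; rewrite [X in (_ < X)%N]n0.
  by rewrite !subrr normr0 dotE big1 ?subr0 ?normr0 ?mulr0// => j _; rewrite !mxE mul0r.
have d0 : 0 < d by apply: le_lt_trans yd.
pose pt (k : nat) : 'rV[R]_n := \row_j if (j < k)%N then y 0 j else z 0 j.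
have coord u (j : 'I_n) : `|u - x| < d -> `|u 0 j - x 0 j| < d.
  by move=> h; apply: le_lt_trans h; have := rV_coord_le (u - x) j; rewrite !mxE.
have ptd (u : 'rV[R]_n) : (forall j, `|u 0 j - x 0 j| < d) -> `|u - x| < d.
  move=> h; rewrite [ltLHS]mx_normrE.
  apply: bigmax_lt => // -[i j] _; rewrite (ord1 i) !mxE; exact: h.
have eta0 : 0 <= eta by have [_] := H y yd (Ordinal n0); apply: le_trans.
have step (k : nat) : (k <= n)%N -> `|f (pt k) - f z - \sum_(j < n | (j < k)%N) (y 0 j - z 0 j) * c 0 j| <= k%:R * eta * `|y - z|.
  elim: k => [_|k IH kn].
    rewrite big_pred0 => [|j]; last by rewrite ltn0.
    rewrite (_ : pt 0%N = z); first by rewrite subrr subr0 normr0 !mul0r.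
    by apply/rowP => j; rewrite mxE.
  pose j : 'I_n := Ordinal kn; pose h := y 0 j - z 0 j.
  have ptS t : pt k + (t * h) *: delta_mx 0 j = \row_i if i == j then z 0 j + t * h else pt k 0 i.
    apply/rowP => i; rewrite !mxE eqxx /=; case: eqVneq => [->|]; last by rewrite mulr0 addr0.
    by rewrite mulr1 ltnn.
  have pk1 : pt k.+1 = pt k + h *: delta_mx 0 j.
    rewrite -[h in h *: _]mul1r ptS; apply/rowP => i; rewrite !mxE ltnS leq_eqVlt -val_eqE /=.
    by case: eqP => [ik|//]; rewrite mul1r /h addrCA subrr addr0; congr (y _ _); exact: val_inj.
  have inc t : 0 <= t <= 1 -> `|pt k + (t * h) *: delta_mx 0 j - x| < d.
    move=> t01; rewrite ptS; apply: ptd => i; rewrite mxE.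
    case: eqVneq => [->|_]; last by rewrite mxE; case: ifP => _; exact: coord.
    by apply: norm_segment => //; exact: coord.
  have Hs := @mvt_direction f (pt k) (delta_mx 0 j) h (c 0 j) eta (fun t t01 => H _ (inc t t01) j).
  rewrite -pk1 in Hs.
  rewrite (bigD1 j)//= (eq_bigl (fun i : 'I_n => (i < k)%N)); last first.
    move=> i; rewrite ltnS leq_eqVlt -val_eqE /=; case: eqP => [->|] //=; by rewrite ?ltnn ?andbT.
  rewrite (_ : _ - _ = (f (pt k.+1) - f (pt k) - h * c 0 j) +
     (f (pt k) - f z - \sum_(i < n | (i < k)%N) (y 0 i - z 0 i) * c 0 i)); last by rewrite /h; ring.
  apply: le_trans (ler_normD _ _) _; 
  have -> : k.+1%:R * eta * `|y - z| = eta * `|y - z| + k%:R * eta * `|y - z| by rewrite -natr1; ring.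
  apply: lerD; last exact/IH/ltnW.
  apply: le_trans Hs _; rewrite ler_wpM2l//.
  by have := rV_coord_le (y - z) j; rewrite !mxE.
have := step n (leqnn n); rewrite (_ : pt n = y); last by apply/rowP => j; rewrite mxE ltn_ord.
rewrite dotE (eq_bigl xpredT) => [|j]; last by rewrite ltn_ord.
by under [X in _ -> `|_ - X| <= _]eq_bigr do rewrite !mxE.
Qed.

End MeanValue.

Section C1.
Context (R : realType) (n m : nat).

Definition grad (f : 'rV[R]_n -> R) (x : 'rV[R]_n) : 'rV[R]_n := \row_j 'D_(delta_mx 0 j) f x.

Lemma C1_strict (O : set 'rV[R]_n) (f : 'rV[R]_n -> R) x : open O -> O x -> Ck_on 1 O f ->
  forall e, 0 < e -> exists2 d, 0 < d &
    forall y z, `|y - x| < d -> `|z - x| < d -> `|f y - f z - dot (y - z) (grad f x)| <= e * `|y - z|.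
Proof.
move=> oO Ox [_ C1] e e0.
pose eta := e / (n%:R + 1); have eta0 : 0 < eta by rewrite divr_gt0// ltr_wpDl.
have hj (j : 'I_n) : exists d, 0 < d /\ forall y, `|y - x| < d -> `|'D_(delta_mx 0 j) f y - 'D_(delta_mx 0 j) f x| <= eta.
  have [_ [/(_ x Ox) cD _]] := C1 (delta_mx 0 j).
  have /nbhs_ballP[d /= d0 hd] := cD _ (nbhsx_ballx _ eta eta0).
  exists d; split=> // y yd; have := hd y; rewrite /= -!ball_normE /= distrC => /(_ yd).
  by rewrite distrC => /ltW.
have [d hd] := choice hj.
have /nbhs_ballP[d' /= d'0 hd'] := open_nbhs_nbhs (conj oO Ox).
pose D := \big[Num.min/d']_j d j.
have D0 : 0 < D by apply: lt_bigmin => // j _; have [] := hd j.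
exists D => // y z yD zD.
apply: le_trans (@mvt_cube _ _ f x D eta (grad f x) _ y z yD zD) _; last first.
  by rewrite ler_wpM2r// /eta mulrCA ler_piMr ?(ltW e0)// ler_pdivrMr ?ltr_wpDl// mul1r lerDl.
move=> u uD j; split.
  have [+ _] := C1 (delta_mx 0 j); apply; apply: hd'; rewrite -ball_normE /= distrC.
  by apply: lt_le_trans uD _; exact: bigmin_le_id.
rewrite mxE; have [_] := hd j; apply; apply: lt_le_trans uD _; exact: bigmin_le.
Qed.

Definition jac (F : 'rV[R]_n -> 'rV[R]_m) x : 'M[R]_(n, m) := \matrix_(i, j) grad (fun q => F q 0 j) x 0 i.

Lemma C1_strict_deriv (O : set 'rV[R]_n) (F : 'rV[R]_n -> 'rV[R]_m) x : open O -> O x ->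
  (forall j, Ck_on 1 O (fun q => F q 0 j)) -> strict_deriv F x (jac F x).
Proof.
move=> oO Ox C1 e e0.
have hj (j : 'I_m) := C1_strict oO Ox (C1 j) e0.
have [d hd] := choice (fun j => let: ex_intro2 d d0 h := hj j in ex_intro (fun d => 0 < d /\ _) d (conj d0 h)).
pose D := \big[Num.min/1]_j d j.
have D0 : 0 < D by apply: lt_bigmin => // j _; have [] := hd j.
exists D => // y z yD zD; apply: rV_norm_le => [|j]; first by rewrite mulr_ge0// ltW.
have [_ h] := hd j; have := h y z (lt_le_trans yD (bigmin_le _ _ _)) (lt_le_trans zD (bigmin_le _ _ _)).
rewrite dotE !mxE; congr (`|_ - _| <= _); apply: eq_bigr => i _.
by rewrite [jac _ _ _ _]mxE !mxE.
Qed.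

Lemma jac_continuous (O : set 'rV[R]_n) (F : 'rV[R]_n -> 'rV[R]_m) x i j : O x ->
  (forall j, Ck_on 1 O (fun q => F q 0 j)) -> {for x, continuous (fun q => jac F q i j)}.
Proof.
move=> Ox C1; have [_ /(_ (delta_mx 0 i))[_ [+ _]]] := C1 j.
move=> h; have := h x Ox; rewrite (_ : (fun q => jac F q i j) = 'D_(delta_mx 0 i) (fun q => F q 0 j)) //.
by apply/funext => q; rewrite !mxE.
Qed.

(** Connects strict derivatives with the differential ['d] that defines [tdiff]. *)
Lemma strict_deriv_diff (F : 'rV[R]_n -> 'rV[R]_m) x L : strict_deriv F x L ->
  differentiable F x /\ forall v, 'd F x v = v *m L.
Proof.
move=> h.
have cL : continuous (mulmxr L : 'rV[R]_n -> 'rV[R]_m) by exact: mulmxr_continuous.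
have e : F \o shift x = cst (F x) + (mulmxr L : 'rV[R]_n -> 'rV[R]_m) +o_ (0 : 'rV[R]_n) id.
  apply/eqaddoP => eps eps0; have [d d0 hd] := h eps eps0.
  near=> v; have vd : `|v| < d by near: v; apply/nbhs_ballP; exists d => //= v; rewrite -ball_normE /= sub0r normrN.
  have := hd (v + x) x; rewrite addrK subrr normr0 => /(_ vd d0).
  by rewrite /= opprD addrA.
split; last by move=> v; rewrite (diff_unique cL e).
apply/diff_locallyxP; rewrite (diff_unique cL e); split=> // h0.
have := congr1 (@^~ h0) e; exact.
Unshelve. all: by end_near.
Qed.

End C1.

(** * Finite measures, product spaces and bounded functions *)

Section FiniteMeasures.
Context (R : realType) (d : measure_display) (T : measurableType d).

(* A synonym of m carrying the structure of finite measure. *)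
Definition finm (m : {measure set T -> \bar R}) of (m setT < +oo)%E : set T -> \bar R := m.

Context (m : {measure set T -> \bar R}) (mf : (m setT < +oo)%E).

HB.instance Definition _ := isMeasure.Build _ _ _ (finm mf) (@measure0 _ _ _ m) (@measure_ge0 _ _ _ m)
  (@measure_semi_sigma_additive _ _ _ m).
HB.instance Definition _ := Measure_isFinite.Build _ _ _ (finm mf) (lty_fin_num_fun mf).

Lemma bounded_integrable (f : T -> R) (c : R) :
    measurable_fun setT f -> (forall x, `|f x| <= c) -> m.-integrable setT (EFin \o f).
Proof.
move=> mm fc; apply: measurable_bounded_integrable => //.
exists c; split=> [|M cM x _]; first exact: num_real.
exact: le_trans (fc x) (ltW cM).
Qed.

End FiniteMeasures.

Section ProductSpace.
Context (R : realType) (n : nat) (d : 'I_n -> measure_display) (T : forall i, measurableType (d i)).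

Definition cyl : set (set (forall i, T i)) :=
  [set B | exists i (A : set (T i)), measurable A /\ B = [set L | A (L i)]].

Definition prodT := g_sigma_algebraType cyl.

Lemma measurable_proj i : measurable_fun setT (fun L : prodT => L i).
Proof. by move=> _ A mA; rewrite setTI; apply: sub_gen_smallest; exists i, A. Qed.

Lemma measurable_to_prodT d' (S : measurableType d') (f : S -> prodT) :
  (forall i, measurable_fun setT (fun x => f x i)) -> measurable_fun setT f.
Proof.
move=> h; apply: (@measurability _ _ S prodT setT f cyl erefl) => _ [_ [i [A [mA ->]]] <-].
exact: h.
Qed.

Lemma measurable_dfwith i : measurable_fun setT (fun p : T i * prodT => dfwith p.2 i p.1 : prodT).
Proof.
apply: measurable_to_prodT => j; have [ij|ij] := eqVneq i j.
  by subst j; rewrite (_ : (fun p => _) = fst)//; apply/funext => p; exact: dfwithin.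
rewrite (_ : (fun p => _) = (fun p : T i * prodT => p.2 j)); last by apply/funext => p; exact: dfwithout.
move=> _ A mA; rewrite setTI; have := @measurable_proj j measurableT _ mA; rewrite setTI => mB.
by have := @measurable_snd _ _ (T i) prodT measurableT _ mB; rewrite setTI.
Qed.

(** The factors are added one at a time: coordinates not yet treated sit at the base point under a
    Dirac mass, and [dfwith] overwrites one of them by a new variable. Besides finiteness, the
    integrals of products of bounded functions are all that is recorded of the product. *)
Lemma prod_measure (nu : forall i, {measure set (T i) -> \bar R}) : (forall i, (nu i setT < +oo)%E) ->
  exists Lam : {measure set prodT -> \bar R}, (Lam setT < +oo)%E /\
  forall (g : forall i, T i -> R) (c : R), (forall i, measurable_fun setT (g i)) -> (forall i x, `|g i x| <= c) ->
    (\int[Lam]_L (\prod_i g i (L i))%:E)%E = (\prod_i fine (\int[nu i]_x (g i x)%:E)%E)%:E.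
Proof.
move=> nuf.
pose good (s : seq 'I_n) (Lam : {measure set prodT -> \bar R}) := (Lam setT < +oo)%E /\
  forall (g : forall i, T i -> R) (c : R), (forall i, measurable_fun setT (g i)) -> (forall i x, `|g i x| <= c) ->
    (\int[Lam]_L (\prod_(i <- s) g i (L i))%:E)%E = (\prod_(i <- s) fine (\int[nu i]_x (g i x)%:E)%E)%:E.
suff h s : uniq s -> exists Lam, good s Lam by have := h _ (index_enum_uniq _).
have mprod (s0 : seq 'I_n) (g : forall i, T i -> R) : (forall i, measurable_fun setT (g i)) ->
    measurable_fun setT (fun L : prodT => \prod_(i <- s0) g i (L i)).
  by move=> mg; apply: measurable_prod => i _; apply: measurableT_comp => //; exact: measurable_proj.
have bprod (s0 : seq 'I_n) (g : forall i, T i -> R) (c : R) (L : prodT) : (forall i x, `|g i x| <= c) ->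
    `|\prod_(i <- s0) g i (L i)| <= `|c| ^+ size s0.
  move=> gc; elim: s0 => [|i s0 IH0]; first by rewrite big_nil normr1 expr0.
  by rewrite big_cons exprS normrM ler_pM//; apply: le_trans (gc i _) (ler_norm _).
elim: s => [_|i s IH /= /andP[is_ us]].
  exists (dirac (point : prodT)); split; first by rewrite /= diracT ltry.
  by move=> g c mg gc; rewrite big_nil; under eq_integral do rewrite big_nil; rewrite integral_cst// /= diracT mule1.
have [Lam [Lf hL]] := IH us.
pose nui : {finite_measure set (T i) -> \bar R} := finm (nuf i).
pose LamF : {finite_measure set prodT -> \bar R} := finm Lf.
have mdf := @measurable_dfwith i.
have key (g : forall i, T i -> R) (c : R) : (forall i, measurable_fun setT (g i)) -> (forall i x, `|g i x| <= c) ->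
    (\int[pushm (nui \x LamF)%E mdf]_L (\prod_(k <- i :: s) g k (L k))%:E)%E =
    (\prod_(k <- i :: s) fine (\int[nu k]_x (g k x)%:E)%E)%:E.
  move=> mg gc.
  have eg (p : T i * prodT) : \prod_(k <- i :: s) g k ((dfwith p.2 i p.1 : prodT) k) = g i p.1 * \prod_(k <- s) g k (p.2 k).
    rewrite big_cons dfwithin; congr (_ * _); apply: eq_big_seq => k ks.
    by rewrite dfwithout//; apply: contraNneq is_ => ->.
  have mF : measurable_fun setT (fun p : T i * prodT => g i p.1 * \prod_(k <- s) g k (p.2 k)).
    apply: measurable_funM; first by apply: measurableT_comp => //; exact: measurable_fst.
    by apply: (measurableT_comp (mprod s g mg)); exact: measurable_snd.
  have iF : (nui \x LamF)%E.-integrable setT (fun p : T i * prodT => (g i p.1 * \prod_(k <- s) g k (p.2 k))%:E).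
    apply: (@bounded_integrable _ _ _ _ _ _ (`|c| * `|c| ^+ size s)) => //.
      have := @product_measure1E _ _ (T i) prodT R nui LamF setT setT measurableT measurableT.
      rewrite setXTT /= => ->; apply: lte_mul_pinfty; [exact: measure_ge0|exact: fin_num_measure|exact: Lf].
    by move=> p; rewrite normrM ler_pM//; [apply: le_trans (gc i _) (ler_norm _)|exact: bprod].
  rewrite integral_pushforward//; last 2 first.
  - by apply/measurable_EFinP; exact: mprod.
  - by rewrite preimage_setT; apply: eq_integrable iF => // p _; rewrite /= eg.
  rewrite preimage_setT; under eq_integral do rewrite /= eg.
  rewrite -(integral12_prod_meas1 iF) /fubini_F big_cons.
  have ip : Lam.-integrable setT (fun L : prodT => (\prod_(k <- s) g k (L k))%:E).
    by apply: (@bounded_integrable _ _ _ _ _ _ (`|c| ^+ size s)) => //; [exact: mprod|move=> L; exact: bprod].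
  have e1 x : (\int[LamF]_y (g i x * \prod_(k <- s) g k (y k))%:E)%E = ((\prod_(k <- s) fine (\int[nu k]_x (g k x)%:E)%E)%:E * (g i x)%:E)%E.
    under eq_integral do rewrite EFinM.
    by rewrite integralZl// muleC; congr (_ * _)%E; exact: hL gc.
  apply: (@etrans _ _ (\int[nui]_x ((\prod_(k <- s) fine (\int[nu k]_x (g k x)%:E))%:E * (g i x)%:E))%E).
    by apply: eq_integral => x _; exact: e1.
  have ig : (nu i).-integrable setT (fun x => (g i x)%:E) by apply: (@bounded_integrable _ _ _ _ _ _ c) => //; exact: gc.
  rewrite integralZl// muleC EFinM; congr (_ * _)%E.
  by rewrite fineK//; exact: integrable_fin_num.
exists (pushm (nui \x LamF)%E mdf); split; last exact: key.
have := key (fun _ _ => 1) 1 (fun i => measurable_cst _) (fun i x => _).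
under eq_integral do rewrite big1//.
rewrite integral_cst// mul1e => -> //; first exact: ltry.
by rewrite normr1.
Qed.

End ProductSpace.

Section BoundedFunctions.
Context (R : realType).

(** The class is stable under sums, products and determinants, and its members are integrable for
    every finite measure, which settles the integrability conditions below. *)
Definition bounded_mfun d (T : measurableType d) (f : T -> R) :=
  measurable_fun setT f /\ exists c, forall x, `|f x| <= c.

Section Algebra.
Context d (T : measurableType d).
Implicit Types f g : T -> R.

Lemma bounded_mfun_cst (c : R) : bounded_mfun (fun _ : T => c).
Proof. by split; [exact: measurable_cst|exists `|c|]. Qed.

Lemma bounded_mfun_eq f g : f =1 g -> bounded_mfun f -> bounded_mfun g.
Proof. by move=> /funext ->. Qed.

Lemma bounded_mfunM f g : bounded_mfun f -> bounded_mfun g -> bounded_mfun (fun x => f x * g x).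
Proof.
move=> [mf [c fc]] [mg [e ge]]; split; first exact: measurable_funM.
by exists (c * e) => x; rewrite normrM ler_pM.
Qed.

Lemma bounded_mfunD f g : bounded_mfun f -> bounded_mfun g -> bounded_mfun (fun x => f x + g x).
Proof.
move=> [mf [c fc]] [mg [e ge]]; split; first exact: measurable_funD.
by exists (c + e) => x; rewrite (le_trans (ler_normD _ _))// lerD.
Qed.

Lemma bounded_mfun_sum (I : Type) (r : seq I) (f : I -> T -> R) : (forall i, bounded_mfun (f i)) -> bounded_mfun (fun x => \sum_(i <- r) f i x).
Proof.
move=> h; elim: r => [|i r IH]; first by under eq_fun do rewrite big_nil; exact: bounded_mfun_cst.
by under eq_fun do rewrite big_cons; exact: bounded_mfunD.
Qed.

Lemma bounded_mfun_prod (I : Type) (r : seq I) (f : I -> T -> R) : (forall i, bounded_mfun (f i)) -> bounded_mfun (fun x => \prod_(i <- r) f i x).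
Proof.
move=> h; elim: r => [|i r IH]; first by under eq_fun do rewrite big_nil; exact: bounded_mfun_cst.
by under eq_fun do rewrite big_cons; exact: bounded_mfunM.
Qed.

Lemma bounded_mfun_norm f : bounded_mfun f -> bounded_mfun (fun x => `|f x|).
Proof.
move=> [mf [c fc]]; split; first exact: measurableT_comp.
by exists c => x; rewrite normr_id.
Qed.

Lemma bounded_mfun_det n (D : T -> 'M[R]_n) : (forall i j, bounded_mfun (fun x => D x i j)) -> bounded_mfun (fun x => \det (D x)).
Proof.
move=> h; apply: bounded_mfun_sum => s; apply: bounded_mfunM; first exact: bounded_mfun_cst.
by apply: bounded_mfun_prod => i.
Qed.

Context (m : {measure set T -> \bar R}) (mf : (m setT < +oo)%E).

Lemma bounded_mfun_integrable f : bounded_mfun f -> m.-integrable setT (EFin \o f).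
Proof. by move=> [h [c hc]]; exact: bounded_integrable hc. Qed.

Lemma RintD f g : bounded_mfun f -> bounded_mfun g -> \int[m]_x (f x + g x) = \int[m]_x f x + \int[m]_x g x.
Proof. by move=> hf hg; rewrite RintegralD//; exact: bounded_mfun_integrable. Qed.

Lemma RintZ (c : R) f : bounded_mfun f -> \int[m]_x (c * f x) = c * \int[m]_x f x.
Proof. by move=> hf; rewrite RintegralZl//; exact: bounded_mfun_integrable. Qed.

Lemma Rint_sum (I : Type) (r : seq I) (f : I -> T -> R) : (forall i, bounded_mfun (f i)) ->
  \int[m]_x (\sum_(i <- r) f i x) = \sum_(i <- r) \int[m]_x f i x.
Proof.
move=> h; elim: r => [|i r IH].
  by under eq_Rintegral do rewrite big_nil; rewrite big_nil Rintegral_cst// mul0r.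
under eq_Rintegral do rewrite big_cons.
by rewrite big_cons RintD ?IH//; exact: bounded_mfun_sum.
Qed.

Lemma Rint_le f g : bounded_mfun f -> bounded_mfun g -> (forall x, f x <= g x) -> \int[m]_x f x <= \int[m]_x g x.
Proof. by move=> hf hg fg; apply: le_Rintegral => //; exact: bounded_mfun_integrable. Qed.

Lemma Rint_bound f (c : R) : bounded_mfun f -> (forall x, `|f x| <= c) -> `|\int[m]_x f x| <= c * fine (m setT).
Proof.
move=> hf fc; apply: le_trans (le_normr_Rintegral _ _) _ => //; first exact: bounded_mfun_integrable.
rewrite -Rintegral_cst//; apply: Rint_le => //; [exact: bounded_mfun_norm|exact: bounded_mfun_cst].
Qed.

End Algebra.

Lemma bounded_mfun_comp d d' (T : measurableType d) (S : measurableType d') (f : T -> R) (g : S -> T) :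
  bounded_mfun f -> measurable_fun setT g -> bounded_mfun (fun x => f (g x)).
Proof. by move=> [mf [c fc]] mg; split; [exact: measurableT_comp|exists c]. Qed.

End BoundedFunctions.

(** * Discretisation and the volume of a generalized zonoid *)

Section Perturbation.
Context (R : realType).

Lemma prod_diff (I : Type) (r : seq I) (a b : I -> R) (rho del : R) : 1 <= rho -> 0 <= del ->
  (forall i, `|a i| <= rho) -> (forall i, `|b i| <= rho) -> (forall i, `|a i - b i| <= del) ->
  `|\prod_(i <- r) a i - \prod_(i <- r) b i| <= (size r)%:R * rho ^+ size r * del.
Proof.
move=> r1 d0 ha hb hab; have r0 : 0 <= rho := le_trans ler01 r1.
elim: r => [|i r IH]; first by rewrite !big_nil subrr normr0 /= !mul0r.
rewrite !big_cons.
have -> : a i * \prod_(j <- r) a j - b i * \prod_(j <- r) b j =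
  a i * (\prod_(j <- r) a j - \prod_(j <- r) b j) + (a i - b i) * \prod_(j <- r) b j by ring.
apply: le_trans (ler_normD _ _) _; rewrite !normrM /=.
have hB : `|\prod_(j <- r) b j| <= rho ^+ size r.
  elim: r {IH} => [|j r IH]; first by rewrite big_nil normr1 expr0.
  by rewrite big_cons normrM exprS ler_pM.
have -> : (size r).+1%:R * rho ^+ (size r).+1 * del = rho * ((size r)%:R * rho ^+ size r * del) + rho * (del * rho ^+ size r).
  by rewrite -natr1 exprS; ring.
apply: lerD; first by rewrite ler_pM.
apply: le_trans (_ : del * rho ^+ size r <= _); first by rewrite ler_pM.
by rewrite ler_peMl// mulr_ge0// exprn_ge0.
Qed.

Lemma det_diff n (A B : 'M[R]_n) (rho del : R) : 1 <= rho -> 0 <= del ->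
  (forall i j, `|A i j| <= rho) -> (forall i j, `|B i j| <= rho) -> (forall i j, `|A i j - B i j| <= del) ->
  `| `|\det A| - `|\det B| | <= (n`!%:R * (n%:R * rho ^+ n)) * del.
Proof.
move=> r1 d0 hA hB hAB; apply: le_trans (ler_dist_dist _ _) _.
rewrite /determinant -sumrB; apply: le_trans (ler_norm_sum _ _ _) _.
apply: le_trans (_ : \sum_(s : 'S_n) n%:R * rho ^+ n * del <= _); last first.
  rewrite sumr_const (_ : #|_| = n`!) -?[leLHS]mulr_natl ?mulrA//.
  by rewrite -card_Sn; apply: eq_card => s; rewrite !inE.
apply: ler_sum => s _; rewrite -mulrBr normrM normr_sign mul1r.
have := @prod_diff 'I_n (index_enum _) (fun i => A i (s i)) (fun i => B i (s i)) rho del r1 d0.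
by rewrite [size _](_ : _ = n); [apply|rewrite /index_enum -enumT size_enum_ord].
Qed.

End Perturbation.

Section Rounding.
Context (R : realType) (n : nat).

(** Take a finite cover of the compact ball by balls of radius [del]; [rd] points to the first one
    in the list that contains the vector, so its level sets are Borel. Rounding the generators turns
    a zonoid into a zonotope. *)
Lemma rounding (rho del : R) : 0 <= rho -> 0 < del -> exists (p : nat) (C : 'M[R]_(p.+1, n)) (rd : borel 'rV[R]_n -> 'I_p.+1),
  [/\ forall a, measurable [set v | rd v = a], forall v : 'rV[R]_n, `|v| <= rho -> `|v - row (rd v) C| <= del
    & forall a, `|row a C| <= rho].
Proof.
move=> rho0 del0; pose B : set 'rV[R]_n := [set v | `|v| <= rho].
have cB : compact B.
  rewrite (_ : B = box (const_mx (- rho)) (const_mx rho)); first exact: compact_box.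
  apply/seteqP; split=> [v vr|v hv]; first exact: (norm_le_box (K := B)).
  by apply: rV_norm_le => // j; rewrite ler_norml; have := hv j; rewrite !mxE.
have := cB; rewrite compact_cover => /(_ 'rV[R]_n B (fun c => nball c del)).
case=> [c _|v Bv|D DB BD].
- exact: nball_open.
- by exists v => //; rewrite /nball /= subrr normr0.
(* The leading 0 keeps the list of centres nonempty, so that its positions form ['I_p.+1]. *)
pose s : seq 'rV[R]_n := 0 :: finmap.enum_fset D.
have sB c : c \in s -> `|c| <= rho.
  by rewrite inE => /predU1P[->|/DB /set_mem]; rewrite ?normr0.
pose near (v c : 'rV[R]_n) := `|v - c| < del.
have mfind (t : seq 'rV[R]_n) (P : nat -> Prop) : measurable ([set v | P (find (near v) t)] : set (borel 'rV[R]_n)).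
  elim: t P => [|c t IH] P.
    have [P0|P0] := pselect (P 0%N); first by rewrite (_ : [set _ | _] = setT)//; apply/seteqP; split.
    by rewrite (_ : [set _ | _] = set0)//; apply/seteqP; split.
  have mc : measurable (nball c del : set (borel 'rV[R]_n)) by apply: open_borel; exact: nball_open.
  have [P0|P0] := pselect (P 0%N).
    rewrite (_ : [set _ | _] = (nball c del : set (borel 'rV[R]_n)) `|` [set v | P (find (near v) t).+1]).
      by apply: measurableU => //; exact: (IH (fun k => P k.+1)).
    apply/seteqP; split=> v /=; rewrite -/(near v) /nball /= -/(near v c); case: ifP => // vc; by [left|right|case|move=> _].
  rewrite (_ : [set _ | _] = ~` (nball c del : set (borel 'rV[R]_n)) `&` [set v | P (find (near v) t).+1]).
    by apply: measurableI; [exact: measurableC|exact: (IH (fun k => P k.+1))].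
  by apply/seteqP; split=> v /=; rewrite /nball /= -/(near v c); case: (near v c) => /=; [move/P0|move=> h; split|case=> /(_ isT)|case].
pose C : 'M[R]_((size (finmap.enum_fset D)).+1, n) := \matrix_(a, j) (nth 0 s a) 0 j.
have rC a : row a C = nth 0 s a by apply/rowP => j; rewrite !mxE.
exists (size (finmap.enum_fset D)), C, (fun v => inord (find (near v) s)); split.
- move=> a; exact: (mfind s (fun k => inord k = a)).
- move=> v vr; have /BD [c /= cD vc] := vr.
  have hs : has (near v) s by apply/hasP; exists c => //; rewrite inE [X in _ || X]cD orbT.
  rewrite rC inordK; last by move: hs; rewrite has_find.
  by apply: ltW; have := nth_find 0 hs.
- by move=> a; rewrite rC; apply: sB; exact: mem_nth.
Qed.

End Rounding.

Section ZonoidVolume.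
Unset Implicit Arguments.
Context (R : realType) (n r : nat) (d : 'I_r -> measure_display) (T : forall i, measurableType (d i)).
Context (nu : forall i, {measure set (T i) -> \bar R}) (nuf : forall i, (nu i setT < +oo)%E).

Set Implicit Arguments.

Definition prod_nu (s : 'I_n -> 'I_r) : {measure set (prodT (fun k => T (s k))) -> \bar R} :=
  proj1_sig (cid (prod_measure (fun k => nuf (s k)))).

Lemma prod_nu_fin s : (prod_nu s setT < +oo)%E.
Proof. by have [] := proj2_sig (cid (prod_measure (fun k => nuf (s k)))). Qed.

Lemma prod_nu_prod (s : 'I_n -> 'I_r) (g : forall k : 'I_n, T (s k) -> R) : (forall k, bounded_mfun (g k)) ->
  \int[prod_nu s]_L (\prod_k g k (L k)) = \prod_k \int[nu (s k)]_x g k x.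
Proof.
move=> bg; have /choice[c hc] : forall k, exists c : R, forall x, `|g k x| <= c by move=> k; have [] := bg k.
have [_ /(_ g (\sum_k `|c k|))] := proj2_sig (cid (prod_measure (fun k => nuf (s k)))).
rewrite /prod_nu /Rintegral => -> //; first by move=> k; have [] := bg k.
move=> k x; apply: le_trans (hc k x) _; rewrite (bigD1 k)//=; apply: le_trans (ler_norm _) _.
by rewrite lerDl sumr_ge0.
Qed.

Unset Implicit Arguments.
Context (phi : forall i, T i -> R) (bphi : forall i, bounded_mfun (phi i)).
Context (u : forall i, T i -> 'rV[R]_n) (mu : forall i, measurable_fun setT (u i : T i -> borel 'rV[R]_n)).
Context (rho : R) (rho1 : 1 <= rho) (urho : forall i x, `|u i x| <= rho).

Set Implicit Arguments.

(** The mixed coefficient of the volume: the mean of |det| over independent generators taken from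
    the families s(k), with signed densities. *)
Definition mean_det (s : 'I_n -> 'I_r) : R :=
  \int[prod_nu s]_L (\prod_k phi (s k) (L k) * `|\det (\matrix_(k, j) u (s k) (L k) 0 j)|).

Let rho0 : 0 <= rho. Proof. exact: le_trans rho1. Qed.

Let cphi_ex : exists c : R, 0 <= c /\ forall i x, `|phi i x| <= c.
Proof.
have /choice[c hc] : forall i, exists c : R, forall x, `|phi i x| <= c by move=> i; have [] := bphi i.
exists (\sum_i `|c i|); split=> [|i x]; first exact: sumr_ge0.
apply: le_trans (hc i x) _; rewrite (bigD1 i)//=; apply: le_trans (ler_norm _) _.
by rewrite lerDl sumr_ge0.
Qed.

Section Rounded.
Context (p : nat) (C : 'M[R]_(p.+1, n)) (rd : borel 'rV[R]_n -> 'I_p.+1) (del : R).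
Context (mrd : forall a, measurable [set v | rd v = a]).
Context (rdel : forall v : 'rV[R]_n, `|v| <= rho -> `|v - row (rd v) C| <= del).
Context (Crho : forall a, `|row a C| <= rho).

Lemma bounded_mfun_rd i (F : 'I_p.+1 -> R) : bounded_mfun (fun x : T i => F (rd (u i x))).
Proof.
rewrite (_ : (fun _ => _) = (fun x => \sum_a F a * \1_[set x : T i | rd (u i x) = a] x)).
  apply: bounded_mfun_sum => a; apply: bounded_mfunM; first exact: bounded_mfun_cst.
  split; last by exists 1 => x; rewrite indicE; case: (_ \in _); rewrite ?normr1 ?normr0.
  by apply: measurable_indic; have := mu i measurableT _ (mrd a); rewrite setTI.
apply/funext => x; rewrite (bigD1 (rd (u i x)))//= big1 => [|a ax].
  by rewrite indicE mem_set// mulr1 addr0.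
by rewrite indicE memNset ?mulr0//= => xa; rewrite xa eqxx in ax.
Qed.

(** The signed mass that the family [i] gives to the cell [a] of the rounding, i.e. its share in the
    weight of row [a] of the approximating zonotope. *)
Definition wgt i a : R := \int[nu i]_x (phi i x * (rd (u i x) == a)%:R).

Lemma wgt_sum i (F : 'I_p.+1 -> R) : \sum_a wgt i a * F a = \int[nu i]_x (phi i x * F (rd (u i x))).
Proof.
have b1 a : bounded_mfun (fun x => phi i x * (rd (u i x) == a)%:R).
  by apply: bounded_mfunM; [exact: bphi|exact: (bounded_mfun_rd i (fun b => (b == a)%:R))].
under eq_bigr do rewrite mulrC -(RintZ (nuf i) _ (b1 _)).
rewrite -(Rint_sum (nuf i)); last first.
  by move=> a; apply: bounded_mfunM; [exact: bounded_mfun_cst|exact: b1].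
apply: eq_Rintegral => x _; rewrite (bigD1 (rd (u i x)))//= big1 => [|a ax].
  by rewrite eqxx mulr1 addr0 mulrC.
by rewrite eq_sym (negbTE ax) !mulr0.
Qed.

Definition rounded_det (s : 'I_n -> 'I_r) : R :=
  \sum_(f : {ffun 'I_n -> 'I_p.+1}) (\prod_k wgt (s k) (f k)) * `|\det (rowsub f C)|.

(** In the sum over [f] the product of the indicators of the cells keeps, at each [L], the single
    [f] given by rounding. *)
Lemma rounded_detE (s : 'I_n -> 'I_r) : rounded_det s = \int[prod_nu s]_L (\prod_k phi (s k) (L k) *
   `|\det (rowsub (fun k => rd (u (s k) (L k))) C)|).
Proof.
have bg (f : {ffun 'I_n -> 'I_p.+1}) k : bounded_mfun (fun x : T (s k) => phi (s k) x * (rd (u (s k) x) == f k)%:R).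
  by apply: bounded_mfunM; [exact: bphi|exact: (bounded_mfun_rd (s k) (fun b => (b == f k)%:R))].
have bG (f : {ffun 'I_n -> 'I_p.+1}) : bounded_mfun (fun L : prodT (fun k => T (s k)) => \prod_k (phi (s k) (L k) * (rd (u (s k) (L k)) == f k)%:R)).
  by apply: bounded_mfun_prod => k; apply: (bounded_mfun_comp (bg f k)); exact: measurable_proj.
rewrite /rounded_det; under eq_bigr => f _ do rewrite -(prod_nu_prod (bg f)) mulrC -(RintZ (prod_nu_fin s) _ (bG f)).
rewrite -(Rint_sum (prod_nu_fin s)); last by move=> f; apply: bounded_mfunM; [exact: bounded_mfun_cst|exact: bG].
apply: eq_Rintegral => L _.
pose f0 : {ffun 'I_n -> 'I_p.+1} := [ffun k => rd (u (s k) (L k))].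
rewrite (bigD1 f0)//= [X in _ + X]big1 ?addr0 => [|f ff0].
  have -> : rowsub f0 C = rowsub (fun k => rd (u (s k) (L k))) C.
    by apply/matrixP => k j; rewrite !mxE ffunE.
  by rewrite mulrC; congr *%R; apply: eq_bigr => k _; rewrite ffunE eqxx mulr1.
have [k fk] : exists k, rd (u (s k) (L k)) != f k.
  apply/existsP; apply: contraNT ff0 => /existsPn h; apply/eqP/ffunP => k; rewrite ffunE.
  by have := h k; rewrite negbK => /eqP ->.
by rewrite (bigD1 k)//= (negbTE fk) mulr0 mul0r mulr0.
Qed.

Lemma rounded_det_perm (s : 'I_n -> 'I_r) (sg : 'S_n) : rounded_det (fun k => s (sg k)) = rounded_det s.
Proof.
rewrite /rounded_det (reindex (fun f : {ffun 'I_n -> 'I_p.+1} => [ffun k => f (sg k)])); last first.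
  exists (fun f : {ffun 'I_n -> 'I_p.+1} => [ffun k => f (sg^-1 k)%g]) => f _; apply/ffunP => k; rewrite !ffunE.
    by rewrite permKV.
  by rewrite permK.
apply: eq_bigr => f _; congr (_ * _).
  by rewrite [RHS](reindex_inj (@perm_inj _ sg)); apply: eq_bigr => k _; rewrite !ffunE.
have -> : rowsub [ffun k => f (sg k)] C = row_perm sg (rowsub f C).
  by apply/matrixP => k j; rewrite !mxE ffunE.
by rewrite row_permE det_mulmx det_perm normrM normr_sign mul1r.
Qed.

Lemma bounded_mfun_phis (s : 'I_n -> 'I_r) : bounded_mfun (fun L : prodT (fun k => T (s k)) => \prod_k phi (s k) (L k)).
Proof. by apply: bounded_mfun_prod => k; apply: (bounded_mfun_comp (bphi (s k))); exact: measurable_proj. Qed.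

Lemma bounded_mfun_u i j : bounded_mfun (fun x => u i x 0 j).
Proof.
split; last by exists rho => x; apply: le_trans (rV_coord_le _ _) (urho i x).
exact: (measurableT_comp (@measurable_coord R n j) (mu i)).
Qed.

Lemma rounded_det_close (s : 'I_n -> 'I_r) (c : R) : (forall i x, `|phi i x| <= c) -> 0 <= c -> 0 <= del ->
  `|rounded_det s - mean_det s| <= c ^+ n * (n`!%:R * (n%:R * rho ^+ n)) * fine (prod_nu s setT) * del.
Proof.
move=> hc c0 d0.
have b1 : bounded_mfun (fun L : prodT (fun k => T (s k)) => `|\det (rowsub (fun k => rd (u (s k) (L k))) C)|).
  apply: bounded_mfun_norm; apply: bounded_mfun_det => k j.
  apply: (bounded_mfun_eq (f := fun L : prodT (fun k => T (s k)) => C (rd (u (s k) (L k))) j)); first by move=> L; rewrite mxE.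
  exact: (bounded_mfun_comp (bounded_mfun_rd (s k) (fun a => C a j)) (@measurable_proj _ _ _ k)).
have b2 : bounded_mfun (fun L : prodT (fun k => T (s k)) => `|\det (\matrix_(k, j) u (s k) (L k) 0 j)|).
  apply: bounded_mfun_norm; apply: bounded_mfun_det => k j.
  apply: (bounded_mfun_eq (f := fun L : prodT (fun k => T (s k)) => u (s k) (L k) 0 j)); first by move=> L; rewrite mxE.
  exact: (bounded_mfun_comp (bounded_mfun_u (s k) j) (@measurable_proj _ _ _ k)).
have bp := bounded_mfun_phis s.
have b3 := bounded_mfunM bp b1; have b4 := bounded_mfunM bp b2.
rewrite rounded_detE /mean_det -mulN1r -(RintZ (prod_nu_fin s) _ b4) -(RintD (prod_nu_fin s) b3); last first.
  by apply: bounded_mfunM => //; exact: bounded_mfun_cst.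
apply: le_trans (Rint_bound (prod_nu_fin s) (c := c ^+ n * (n`!%:R * (n%:R * rho ^+ n) * del)) _ _) _; last first.
- by rewrite [X in X * _]mulrA mulrAC.
- move=> L; rewrite mulN1r -mulrBr normrM; apply: ler_pM => //.
    rewrite normr_prod -[X in c ^+ X](card_ord n) -prodr_const; apply: ler_prod => k _; by rewrite normr_ge0 hc.
  apply: det_diff => // k j; rewrite !mxE.
  + by have := rV_coord_le (row (rd (u (s k) (L k))) C) j; rewrite mxE => /le_trans; apply.
  + exact: le_trans (rV_coord_le _ _) (urho _ _).
  + have := rV_coord_le (u (s k) (L k) - row (rd (u (s k) (L k))) C) j; rewrite !mxE distrC => /le_trans; apply.
    exact: rdel.
- by apply: bounded_mfunD => //; apply: bounded_mfunM => //; exact: bounded_mfun_cst.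
Qed.

End Rounded.

Lemma small_eq0 (x K : R) : (forall e, 0 < e <= 1 -> `|x| <= K * e) -> x = 0.
Proof.
move=> h; apply/eqP; rewrite -normr_le0; apply/ler_addgt0Pl => e e0; rewrite addr0.
have K0 : 0 <= K by have := h 1; rewrite ltr01 lexx mulr1 => /(_ isT); apply: le_trans.
apply: le_trans (h (Num.min 1 (e / (K + 1))) _) _.
  by rewrite lt_min ltr01 divr_gt0// ?ltr_wpDl//= ge_min lexx.
apply: le_trans (_ : K * (e / (K + 1)) <= _); first by rewrite ler_wpM2l// ge_min lexx orbT.
rewrite mulrCA; apply: ler_piMr; first exact: ltW.
by rewrite ler_pdivrMr ?ltr_wpDl// mul1r lerDl.
Qed.

(** The two integrals live on different product spaces. Comparing them through their roundings
    replaces a transport of measures by a reindexing of finite sums, up to an error that tends to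
    0. *)
Lemma mean_det_perm (s : 'I_n -> 'I_r) (sg : 'S_n) : mean_det (fun k => s (sg k)) = mean_det s.
Proof.
have [c [c0 hc]] := cphi_ex; set s' := (fun k => s (sg k)).
pose K t := c ^+ n * (n`!%:R * (n%:R * rho ^+ n)) * fine (prod_nu t setT).
apply/eqP; rewrite -subr_eq0; apply/eqP; apply: (@small_eq0 _ (K s' + K s)) => e /andP[e0 _].
have [p [C [rd [mrd rdel Crho]]]] := rounding n rho0 e0.
have h1 := rounded_det_close mrd rdel Crho s' hc c0 (ltW e0).
have h2 := rounded_det_close mrd rdel Crho s hc c0 (ltW e0).
have -> : mean_det s' - mean_det s = (rounded_det C rd s - mean_det s) - (rounded_det C rd s' - mean_det s').
  by rewrite /s' rounded_det_perm; ring.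
by apply: le_trans (ler_normB _ _) _; rewrite mulrDl addrC lerD.
Qed.

Lemma dot_norm_le (a b v : 'rV[R]_n) (e : R) : `|a - b| <= e ->
  `| `|dot a v| - `|dot b v| | <= e * \sum_i `|v 0 i|.
Proof.
move=> ab; apply: le_trans (ler_dist_dist _ _) _; rewrite -dotNl -dotDl dotE mulr_sumr.
apply: le_trans (ler_norm_sum _ _ _) _; apply: ler_sum => i _; rewrite normrM ler_wpM2r//.
exact: le_trans (rV_coord_le _ _) ab.
Qed.

Lemma bounded_mfun_dot i v : bounded_mfun (fun x => `|dot (u i x) v|).
Proof.
apply: bounded_mfun_norm; under eq_fun do rewrite dotE; apply: bounded_mfun_sum => j.
by apply: bounded_mfunM; [exact: bounded_mfun_u|exact: bounded_mfun_cst].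
Qed.

(* For weights phi >= 0 this is the limit of the formula for zonotopes. For signed weights the sum of K and the
   zonoid of the negative parts is the zonoid of the positive parts, and the volume of K + t Z is a polynomial
   in t, recovered at t = 0 from its values at positive t. *)
Theorem zonoid_volume (K : set 'rV[R]_n) (lam : 'I_r -> R) : compact K -> cvx K ->
  has_supp K (fun v => \sum_i lam i * \int[nu i]_x (phi i x * `|dot (u i x) v|)) ->
  vol K = 2 ^+ n / n`!%:R * \sum_(s : {ffun 'I_n -> 'I_r}) (\prod_k lam (s k)) * mean_det s.
Proof.
move=> cK vK sK; have [c [c0 hc]] := cphi_ex.
have [M M0 hM] := compact_norm_le cK.
pose W : R := \sum_i `|lam i| * (c * fine (nu i setT)).
have W0 : 0 <= W by apply: sumr_ge0 => i _; rewrite !mulr_ge0// fine_ge0.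
pose Q : R := M + W * rho; have Q0 : 0 <= Q by rewrite addr_ge0 ?(ltW M0)// mulr_ge0.
have [Cst Cst0 hZ] := zonoid_estimate n Q0.
pose KD t := c ^+ n * (n`!%:R * (n%:R * rho ^+ n)) * fine (prod_nu t setT).
pose P : R := 2 ^+ n / n`!%:R.
apply/eqP; rewrite -subr_eq0; apply/eqP.
(* The constant adds the error of [zonoid_estimate] to the errors made in rounding the
   determinants. *)
apply: (@small_eq0 _ (Cst + P * \sum_(s : {ffun 'I_n -> 'I_r}) `|\prod_k lam (s k)| * KD s)) => e /andP[e0 e1].
have W1 : 0 < W + 1 by rewrite ltr_wpDl.
(* [W] bounds the total mass of the weights, so rounding the generators by [del] changes the support
   function at [v] by at most e times the l^1 norm of [v]. *)
pose del := e / (W + 1); have del0 : 0 < del by rewrite divr_gt0.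
have dele : del <= e by rewrite ler_pdivrMr// ler_peMr ?(ltW e0)// lerDr.
have Wdel : W * del <= e by rewrite /del mulrCA ler_piMr ?(ltW e0)// ler_pdivrMr// mul1r lerDl.
have [p [C [rd [mrd rdel Crho]]]] := rounding n rho0 del0.
pose w : 'rV[R]_p.+1 := \row_a \sum_i lam i * wgt rd i a.
have wF (F : 'I_p.+1 -> R) : \sum_a w 0 a * F a = \sum_i lam i * \int[nu i]_x (phi i x * F (rd (u i x))).
  under [RHS]eq_bigr do rewrite -(wgt_sum mrd) mulr_sumr.
  rewrite exchange_big; apply: eq_bigr => a _; rewrite mxE mulr_suml; apply: eq_bigr => i _.
  by rewrite mulrA.
have wabs : \sum_a `|w 0 a| * `|row a C| <= Q.
  apply: le_trans (_ : \sum_i `|lam i| * (\sum_a `|wgt rd i a|) * rho <= _).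
    rewrite -mulr_suml; apply: le_trans (_ : \sum_a `|w 0 a| * rho <= _).
      by apply: ler_sum => a _; rewrite ler_wpM2l.
    rewrite -mulr_suml ler_wpM2r//.
    under [leRHS]eq_bigr do rewrite mulr_sumr.
    rewrite exchange_big; apply: ler_sum => a _; rewrite mxE; apply: le_trans (ler_norm_sum _ _ _) _.
    by apply: ler_sum => i _; rewrite normrM.
  rewrite -mulr_suml /Q; apply: le_trans (_ : W * rho <= _); last by rewrite lerDr ltW.
  rewrite ler_wpM2r//; apply: ler_sum => i _; rewrite ler_wpM2l//.
  under eq_bigr do rewrite normrEsg mulrC.
  rewrite (wgt_sum mrd) (le_trans (ler_norm _))//; apply: (Rint_bound (nuf i)).
    by apply: bounded_mfunM; [exact: bphi|exact: (bounded_mfun_rd mrd i (fun a => Num.sg (wgt rd i a)))].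
  move=> x; rewrite normrM -[leRHS]mulr1 ler_pM// normr_sg; by case: eqP.
have KQ k : K k -> `|k| <= Q by move=> /hM h; apply: le_trans h _; rewrite lerDl mulr_ge0.
have e01 : 0 <= e <= 1 by rewrite (ltW e0).
have happ v : `|\sum_i lam i * \int[nu i]_x (phi i x * `|dot (u i x) v|) - \sum_a w 0 a * `|dot (row a C) v| | <= e * \sum_j `|v 0 j|.
  rewrite (wF (fun a => `|dot (row a C) v|)) -sumrB; apply: le_trans (ler_norm_sum _ _ _) _.
  apply: le_trans (_ : W * del * \sum_j `|v 0 j| <= _); last first.
    by rewrite ler_wpM2r// sumr_ge0.
  rewrite /W !mulr_suml; apply: ler_sum => i _; rewrite -mulrBr normrM -!mulrA ler_wpM2l//.
  have b1 : bounded_mfun (fun x => phi i x * `|dot (u i x) v|) by apply: bounded_mfunM; [exact: bphi|exact: bounded_mfun_dot].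
  have b2 : bounded_mfun (fun x => phi i x * `|dot (row (rd (u i x)) C) v|).
    by apply: bounded_mfunM; [exact: bphi|exact: (bounded_mfun_rd mrd i (fun a => `|dot (row a C) v|))].
  rewrite -mulN1r -(RintZ (nuf i) _ b2) -(RintD (nuf i) b1); last by apply: bounded_mfunM => //; exact: bounded_mfun_cst.
  apply: le_trans (Rint_bound (nuf i) (c := c * (del * \sum_j `|v 0 j|)) _ _) _.
  - by apply: bounded_mfunD => //; apply: bounded_mfunM => //; exact: bounded_mfun_cst.
  - move=> x; rewrite mulN1r -mulrBr normrM ler_pM//; apply: dot_norm_le; exact: rdel.
  - by rewrite /del le_eqVlt; apply/orP; left; apply/eqP; ring.
have := hZ _ C w K _ e cK vK KQ sK e01 wabs happ.
(* Each weight of the zonotope is a sum over the families; multiplying out distributes the families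
   over the [n] factors. *)
have -> : Dsum C w = \sum_(s : {ffun 'I_n -> 'I_r}) (\prod_k lam (s k)) * rounded_det C rd s.
  rewrite /Dsum; under eq_bigr => f _.
    under eq_bigr do rewrite mxE.
    rewrite bigA_distr_bigA /= mulr_suml.
    over.
  rewrite exchange_big /=; apply: eq_bigr => s _; rewrite /rounded_det mulr_sumr; apply: eq_bigr => f _.
  by rewrite big_split /= mulrA.
move=> h.
have P0 : 0 <= P by rewrite divr_ge0// exprn_ge0.
rewrite -/P in h *.
set S1 := \sum_(s : {ffun 'I_n -> 'I_r}) _ * rounded_det C rd s in h; set S2 := \sum_(s : {ffun 'I_n -> 'I_r}) _ * mean_det s.
have hS : `|S1 - S2| <= (\sum_(s : {ffun 'I_n -> 'I_r}) `|\prod_k lam (s k)| * KD s) * e.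
  rewrite /S1 /S2 -sumrB mulr_suml; apply: le_trans (ler_norm_sum _ _ _) _; apply: ler_sum => s _.
  rewrite -mulrBr normrM -mulrA ler_wpM2l//.
  apply: le_trans (rounded_det_close mrd rdel Crho s hc c0 (ltW del0)) _.
  rewrite -/(KD s) ler_wpM2l// /KD !mulr_ge0 ?exprn_ge0// fine_ge0//.
have -> : vol K - P * S2 = (vol K - P * S1) + P * (S1 - S2) by ring.
apply: le_trans (ler_normD _ _) _; rewrite mulrDl; apply: lerD; first by rewrite [leRHS]mulrC.
by rewrite normrM (ger0_norm P0) -mulrA ler_wpM2l.
Qed.

End ZonoidVolume.

(** * Measurability for the final topologies; equations of lines and hyperplanes *)

Section FinalMeasurable.
Context (S : topologicalType) (D : set S) (oD : open D) (T : pointedType) (g : S -> T).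
Local Notation Tf := (final_topology oD g).

Lemma open_final (A : set Tf) : open (D `&` g @^-1` A) -> open A.
Proof. by []. Qed.

Lemma open_finalE (A : set Tf) : open A -> open (D `&` g @^-1` A).
Proof. by []. Qed.

Lemma open_off_image (A : set Tf) : A `&` g @` D = set0 -> open A.
Proof.
move=> h; apply: open_final; rewrite (_ : _ `&` _ = set0); first exact: open0.
by apply/seteqP; split=> // x [Dx Ax]; have : (A `&` g @` D) (g x) by [split => //; exists x]; rewrite h.
Qed.

Lemma final_continuous x : D x -> {for x, continuous (g : S -> Tf)}.
Proof.
move=> Dx A; rewrite /= nbhsE /= => -[B [oB Bgx] BA].
have h := open_finalE oB.
by rewrite nbhsE /=; exists (D `&` g @^-1` B) => //= y [_ /BA].
Qed.

Definition saturated (U : set S) := forall x y, D x -> D y -> g x = g y -> U x -> U y.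

Lemma open_saturated (U : set S) : open (D `&` U) -> saturated U -> open (g @` (D `&` U) : set Tf).
Proof.
move=> oU sU; apply: open_final; rewrite (_ : _ `&` _ = D `&` U)//.
apply/seteqP; split=> [x [Dx [y [Dy Uy] yx]]|x [Dx Ux]]; last by split=> //; exists x.
by split=> //; exact: sU Uy.
Qed.

Lemma measurable_open_final (A : set Tf) : open A -> measurable (A : set (borel Tf)).
Proof. exact: sub_gen_smallest. Qed.

(** On the quotient [f] is given by the continuous function [fj j] for the first [j] whose saturated
    open set contains the point, so over the image of [D] the preimage of an open set is a finite
    union of differences of open sets; off the image every set is open. *)
Lemma final_measurable (R : realType) (p : nat) (U : 'I_p -> set S) (f : borel Tf -> R) (fj : 'I_p -> S -> R) :
  (forall j, open (D `&` U j)) -> (forall j, saturated (U j)) ->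
  (forall j x, D x -> U j x -> {for x, continuous (fj j)}) ->
  (forall j x y, D x -> D y -> g x = g y -> U j x -> fj j x = fj j y) ->
  (forall x, D x -> exists j, U j x) ->
  (forall x j, D x -> U j x -> (forall i : 'I_p, (i < j)%N -> ~ U i x) -> f (g x) = fj j x) ->
  measurable_fun setT f.
Proof.
move=> oU sU cf ff DU fE.
apply: (measurability _ (RGenOpens.measurableE R)) => _ [_ [lo [hi ->]] <-]; rewrite setTI.
have oO : open (`]lo, hi[%classic : set R) by exact: interval_open.
set O := `]lo, hi[%classic in oO *.
pose G (j : 'I_p) : set Tf := g @` (D `&` (U j `&` fj j @^-1` O)).
pose G0 (j : 'I_p) : set Tf := g @` (D `&` U j).
have oG j : open (G j).
  apply: open_saturated.
    rewrite setIA openE => x [[Dx Ux] fx]; rewrite /interior.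
    have h1 : nbhs x (D `&` U j) by apply: open_nbhs_nbhs; split.
    have h2 : nbhs x (fj j @^-1` O) by apply: cf => //; exact: open_nbhs_nbhs.
    exact: filterI.
  move=> x y Dx Dy xy [Ux fx]; split; first exact: sU Ux.
  by rewrite /preimage /= -(ff j x y).
have oG0 j : open (G0 j) by exact: open_saturated.
have -> : f @^-1` O = ((f @^-1` O) `\` (g @` D)) `|`
    \bigcup_(j in [set: 'I_p]) (G j `\` \bigcup_(i in [set i : 'I_p | (i < j)%N]) G0 i).
  apply/seteqP; split=> [t Ot|t].
    have [[x Dx xt]|nD] := pselect ((g @` D) t); last by left.
    right; have [j0 Uj0] := DU x Dx.
    pose P := fun k => `[< exists2 j : 'I_p, j = k :> nat & U j x >].
    have eP : exists k, P k by exists j0; apply/asboolP; exists j0.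
    have [k /asboolP[j jk Uj] kmin] := ex_minnP eP.
    have jm (i : 'I_p) : (i < j)%N -> ~ U i x.
      move=> ij Ui; have : P i by apply/asboolP; exists i.
      by move=> /kmin; rewrite -jk leqNgt ij.
    exists j => //; split.
      exists x => //; split=> //; split=> //.
      by rewrite /preimage /= -(fE x j) // xt.
    move=> [i /= ij [y [Dy Uy] yt]]; apply: (jm i ij).
    by apply: (sU i y x) => //; rewrite yt xt.
  case=> [[] //|[j _ [[x [Dx [Ux fx]] xt] nG]]].
  rewrite /preimage /= -xt (fE x j) // => i ij Ui; apply: nG; exists i => //; by exists x.
apply: measurableU.
  apply: measurable_open_final; apply: open_off_image.
  by apply/seteqP; split=> // t [[_ nt] gt].
apply: fin_bigcup_measurable => // j _; apply: measurableD; first exact: measurable_open_final.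
by apply: fin_bigcup_measurable => // i _; exact: measurable_open_final.
Qed.

End FinalMeasurable.

Section DualCoordinates.
Context (R : realType).
Implicit Types V W : vectType R.

Definition evalf V (f : V) : dualsp V -> R^o := fun xi => xi f.
HB.instance Definition _ V (f : V) := GRing.isLinear.Build R (dualsp V) R^o *:%R (evalf f)
  (fun a u v => etrans (add_lfunE (a *: u) v f) (congr1 (fun z => z + v f) (scale_lfunE a u f))).

Lemma bidualE V (f : V) (xi : dualsp V) : bidual f xi = xi f.
Proof. exact: (lfunE (evalf f) xi). Qed.

Definition dcoord V (k : 'I_(dim V)) : V -> R^o := fun f => v2r f 0 k.
HB.instance Definition _ V (k : 'I_(dim V)) := GRing.isLinear.Build R V R^o *:%R (@dcoord V k)
  (fun a u v => etrans (congr1 (fun z : 'rV[R]_(dim V) => z 0 k) (linearP v2r a u v)) (etrans (mxE _ _ _ _) (congr1 (fun z => z + v2r v 0 k) (mxE _ _ _ _)))).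

Definition dbase V (k : 'I_(dim V)) : dualsp V := linfun (@dcoord V k).

Lemma dbaseE V (k : 'I_(dim V)) (f : V) : dbase k f = v2r f 0 k.
Proof. exact: (lfunE (@dcoord V k) f). Qed.

Definition vbase V (k : 'I_(dim V)) : V := r2v (delta_mx 0 k).

Lemma vbase_sum V (f : V) : f = \sum_k v2r f 0 k *: vbase k.
Proof.
rewrite -{1}(v2rK f) {1}(row_sum_delta (v2r f)) linear_sum.
by apply: eq_bigr => k _; rewrite linearZ.
Qed.

Definition dual_row V (xi : dualsp V) : 'rV[R]_(dim V) := \row_k (xi (vbase k) : R).

Lemma dual_rowE V (xi : dualsp V) (f : V) : xi f = dot (dual_row xi) (v2r f).
Proof.
rewrite {1}(vbase_sum f) linear_sum dotE; apply: eq_bigr => k _.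
by rewrite linearZ mxE mulrC.
Qed.

Lemma dual_row_sum V (xi : dualsp V) : xi = \sum_k dual_row xi 0 k *: dbase k.
Proof.
apply/lfunP => f; rewrite sum_lfunE dual_rowE dotE; apply: eq_bigr => k _.
by rewrite scale_lfunE dbaseE.
Qed.

Definition dual_of V (x : 'rV[R]_(dim V)) : dualsp V := \sum_k x 0 k *: dbase k.

Lemma dual_ofE V (x : 'rV[R]_(dim V)) (f : V) : dual_of x f = dot x (v2r f).
Proof.
by rewrite sum_lfunE dotE; apply: eq_bigr => k _; rewrite scale_lfunE dbaseE.
Qed.

(** Coordinates of the vector of V that represents [l]: the inverse of the canonical map V ->
    V^**. *)
Definition bicoord V (l : dualsp (dualsp V)) : 'rV[R]_(dim V) := \row_k (l (dbase k) : R).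

Lemma bicoordK V (l : dualsp (dualsp V)) : bidual (r2v (bicoord l)) = l.
Proof.
apply/lfunP => xi; rewrite bidualE {2}(dual_row_sum xi) linear_sum dual_rowE r2vK dotE.
by apply: eq_bigr => k _; rewrite linearZ !mxE.
Qed.

Lemma bicoord_bidual V (f : V) : bicoord (bidual f) = v2r f.
Proof. by apply/rowP => k; rewrite mxE bidualE dbaseE. Qed.

Lemma bicoord_linear V (a : R) (u v : dualsp (dualsp V)) : bicoord (a *: u + v) = a *: bicoord u + bicoord v.
Proof. by apply/rowP => k; rewrite !mxE add_lfunE scale_lfunE. Qed.

End DualCoordinates.

Section LinearContinuity.
Context (R : realType).

Lemma linear_mulmx m n (f : 'rV[R]_m -> 'rV[R]_n) : (forall a u v, f (a *: u + v) = a *: f u + f v) ->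
  exists A : 'M[R]_(m, n), forall u, f u = u *m A.
Proof.
move=> fl; have f0 : f 0 = 0.
  by have := fl 1 0 0; rewrite scaler0 !addr0 scale1r => /(congr1 (fun z => z - f 0)); rewrite subrr addrK.
have fD u v : f (u + v) = f u + f v by have := fl 1 u v; rewrite !scale1r.
have fZ a u : f (a *: u) = a *: f u by have := fl a u 0; rewrite !addr0 f0 addr0.
exists (\matrix_(i, j) f (delta_mx 0 i) 0 j) => u; rewrite mulmx_sum_row {1}(row_sum_delta u).
have fs (I : Type) (r : seq I) (h : I -> 'rV[R]_m) : f (\sum_(i <- r) h i) = \sum_(i <- r) f (h i).
  by elim: r => [|i r IH]; rewrite ?big_nil// !big_cons fD IH.
rewrite fs; apply: eq_bigr => i _; rewrite fZ; congr (_ *: _); apply/rowP => j; by rewrite !mxE.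
Qed.

Lemma linear_continuous_rV m n (f : 'rV[R]_m -> 'rV[R]_n) : (forall a u v, f (a *: u + v) = a *: f u + f v) -> continuous f.
Proof. by move=> /linear_mulmx[A /funext ->]; exact: mulmxr_continuous. Qed.

End LinearContinuity.

Section LeadingCoordinate.
Context (R : realType) (d : nat).
Implicit Types r : 'rV[R]_d.

(* The first nonzero coordinate, or 0. *)
Definition lead r : R := \sum_(j < d) if [forall i : 'I_d, (i < j)%N ==> (r 0 i == 0)] then r 0 j else 0.

Lemma leadE r j : r 0 j != 0 -> (forall i : 'I_d, (i < j)%N -> r 0 i = 0) -> lead r = r 0 j.
Proof.
move=> rj hj; rewrite /lead (bigD1 j)//= big1 ?addr0 => [|k kj].
  by rewrite ifT//; apply/forallP => i; apply/implyP => /hj ->.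
case: ifP => // /forallP h; have := ltn_ord k; case: (ltngtP k j) => [/hj ->//|jk _|e].
  by have := h j; rewrite jk (negbTE rj).
by move: kj; rewrite -val_eqE /= e eqxx.
Qed.

Lemma first_nonzero r : r != 0 -> exists2 j : 'I_d, r 0 j != 0 & forall i : 'I_d, (i < j)%N -> r 0 i = 0.
Proof.
move=> r0; have /existsP[j rj] : [exists j, r 0 j != 0].
  rewrite -[X in is_true X]negbK negb_exists; apply: contra r0 => /forallP h.
  by apply/eqP/rowP => j; rewrite mxE; have := h j; rewrite negbK => /eqP.
case: (@arg_minnP _ j (fun j => r 0 j != 0) (fun j => j : nat) rj) => k rk hk.
exists k => // i ik; apply/eqP; apply: contraTT ik => /hk; by rewrite -leqNgt.
Qed.

Lemma lead_neq0 r : r != 0 -> lead r != 0.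
Proof. by move=> /first_nonzero[j rj hj]; rewrite (leadE rj hj). Qed.

Lemma leadZ (c : R) r : lead (c *: r) = c * lead r.
Proof.
have [->|c0] := eqVneq c 0.
  by rewrite scale0r mul0r /lead big1// => j _; rewrite mxE if_same.
rewrite /lead mulr_sumr; apply: eq_bigr => j _; rewrite mxE.
rewrite (eq_forallb (P2 := fun i : 'I_d => (i < j)%N ==> (r 0 i == 0))); last first.
  by move=> i; rewrite mxE mulf_eq0 (negbTE c0).
by case: ifP => // _; rewrite mulr0.
Qed.

(** For nonzero [r], its multiple with leading coordinate 1: a normal form for the line through
    [r]. *)
Definition nrm r : 'rV[R]_d := (lead r)^-1 *: r.

Lemma nrmZ (c : R) r : c != 0 -> nrm (c *: r) = nrm r.
Proof.
move=> c0; rewrite /nrm leadZ scalerA; congr (_ *: _).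
by rewrite invfM mulrAC mulVf// mul1r.
Qed.

End LeadingCoordinate.

Lemma open_coord_neq0 (R : realType) d (j : 'I_d) : open [set r : 'rV[R]_d | r 0 j != 0].
Proof.
rewrite (_ : [set r | _] = (fun r : 'rV[R]_d => r 0 j) @^-1` (~` [set 0])).
  apply: open_comp => [x _|]; first exact: coord_continuous.
  by apply: closed_openC; apply: accessible_closed_set1; exact/hausdorff_accessible/norm_hausdorff.
by apply/seteqP; split=> r /=; [move/eqP|move=> h; exact/eqP].
Qed.

Section LineSection.
Context (R : realType) (W : vectType R).
Implicit Types (r : 'rV[R]_(dim W)).

Lemma line_eq r r' : r != 0 -> line (r2v r : W) = line (r2v r' : W) -> exists2 c, c != 0 & r = c *: r'.
Proof.
move=> r0 h; have : (r2v r : W) \in (line (r2v r' : W) : {vspace W}) by rewrite -h memv_line.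
move=> /vlineP[c]; rewrite -linearZ => /(congr1 v2r); rewrite !r2vK => e; exists c => //.
by apply: contraNneq r0 => c0; rewrite e c0 scale0r.
Qed.

Lemma dim_line r : r != 0 -> \dim (line (r2v r : W)) = 1%N.
Proof. by move=> r0; rewrite dim_vline; case: eqP => // /(congr1 v2r); rewrite r2vK linear0 => /eqP; rewrite (negbTE r0). Qed.

(* A generator of the line L depending measurably on L. *)
Definition line_vector (L : Gr1_space W) : 'rV[R]_(dim W) :=
  if \dim (L : {vspace W}) == 1%N then nrm (v2r (vpick (L : {vspace W}))) else 0.

Lemma line_vector_line (L : Gr1_space W) : Gr1 L -> line_vector L != 0 /\ L = line (r2v (line_vector L) : W).
Proof.
move=> dL; rewrite /line_vector dL eqxx.
have p0 : vpick (L : {vspace W}) != 0 by rewrite vpick0 -dimv_eq0 dL.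
have r0 : v2r (vpick (L : {vspace W})) != 0 by rewrite -[X in _ != X](linear0 v2r) (can_eq v2rK).
have l0 := lead_neq0 r0.
split; first by rewrite /nrm scaler_eq0 negb_or invr_eq0 l0.
rewrite /nrm linearZ /= v2rK /line.
apply/esym/eqP; rewrite eqEdim; apply/andP; split.
  by rewrite -memvE rpredZ// memv_pick.
by rewrite dim_vline scaler_eq0 invr_eq0 (negbTE l0) (negbTE p0) dL.
Qed.

Lemma line_vector_lineE r : r != 0 -> line_vector (line (r2v r : W)) = nrm r.
Proof.
move=> r0; set L := line _; have dL : Gr1 (L : Gr1_space W) by exact: dim_line.
have [s0 sL] := line_vector_line dL.
have [c c0 ->] := line_eq r0 sL; rewrite nrmZ//.
have p0 : vpick (L : {vspace W}) != 0 by rewrite vpick0 -dimv_eq0 dL.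
have q0 : v2r (vpick (L : {vspace W})) != 0 by rewrite -[X in _ != X](linear0 v2r) (can_eq v2rK).
have -> : line_vector L = nrm (v2r (vpick (L : {vspace W}))) by rewrite /line_vector dL eqxx.
set q := v2r _ in q0 *; by rewrite -[nrm (nrm q)]/(nrm ((lead q)^-1 *: q)) nrmZ// invr_eq0 lead_neq0.
Qed.

Lemma measurable_Gr1 : measurable (@Gr1 R W : set (borel (Gr1_space W))).
Proof.
apply: measurable_open_final; apply: open_final.
rewrite (_ : _ `&` _ = [set r | r != 0]); first exact: open_nonzero.
by apply/seteqP; split=> [r []//|r r0]; split => //; exact: dim_line.
Qed.

(** Where the j-th coordinate is nonzero, r / r_j depends on the line only and is continuous in [r];
    it equals [nrm r] when [j] is the first such index, which is the form asked for by
    [final_measurable]. *)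
Lemma measurable_line_vector (F : 'rV[R]_(dim W) -> R) : (forall r, r != 0 -> {for r, continuous F}) ->
  measurable_fun setT (fun L : borel (Gr1_space W) => F (line_vector L)).
Proof.
move=> cF.
apply: (@final_measurable _ _ (@open_nonzero R (dim W)) _ (fun r => line (r2v r : W)) R (dim W)
  (fun j => [set r | r 0 j != 0]) _ (fun j r => F ((r 0 j)^-1 *: r))).
- move=> j; apply: openI; first exact: open_nonzero.
  exact: open_coord_neq0.
- move=> j x y x0 y0 /(line_eq x0)[c c0 ->] /=; rewrite mxE mulf_eq0 negb_or => /andP[] //.
- move=> j x x0 xj; apply: continuous_comp; last first.
    by apply: cF; rewrite scaler_eq0 negb_or invr_eq0 xj.
  apply: (@continuousZ _ _ _ (fun r : 'rV[R]_(dim W) => (r 0 j)^-1) id); last exact: cvg_id.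
  by apply: continuousV => //; exact: coord_continuous.
- move=> j x y x0 y0 /(line_eq x0)[c c0 ->] /=; rewrite mxE mulf_eq0 negb_or => /andP[_ yj].
  by rewrite scalerA invfM mulrAC mulVf// mul1r.
- by move=> x /first_nonzero[j xj _]; exists j.
- move=> x j x0 xj hj; rewrite line_vector_lineE// /nrm (leadE xj)// => i ij.
  by apply/eqP; have := hj i ij => /= /negP; rewrite negbK.
Qed.

End LineSection.

Section ProductContinuity.
Context (S1 S2 S Z Z1 Z2 : topologicalType).

Lemma continuous_fst_comp (f : S1 -> Z) (p : S1 * S2) : {for p.1, continuous f} -> {for p, continuous (fun p => f p.1)}.
Proof. by move=> h; apply: (@continuous_comp _ _ _ fst f) => //; exact: cvg_fst. Qed.

Lemma continuous_snd_comp (f : S2 -> Z) (p : S1 * S2) : {for p.2, continuous f} -> {for p, continuous (fun p => f p.2)}.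
Proof. by move=> h; apply: (@continuous_comp _ _ _ snd f) => //; exact: cvg_snd. Qed.

Lemma continuous_pair (f : S -> Z1) (g : S -> Z2) x : {for x, continuous f} -> {for x, continuous g} ->
  {for x, continuous (fun y => (f y, g y))}.
Proof. by move=> hf hg; exact: (cvg_pair hf hg). Qed.

End ProductContinuity.

Section HyperplaneSection.
Context (R : realType) (W : vectType R).

Lemma hyperplane_nonempty (l : dualsp W) (a : R) : l != 0 -> exists w, hyperplane l a w.
Proof.
move=> l0; have [v lv] : exists v, l v != 0.
  apply: contrapT => h; case/eqP: l0; apply/lfunP => v; rewrite lfunE /=.
  by apply/eqP; apply: contrapT => /negP lv; apply: h; exists v.
exists ((a / l v) *: v); rewrite /hyperplane /= linearZ /= /GRing.scale /=.
by rewrite divfK.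
Qed.

(** The kernel of [l'] lies in that of [l], because a translation along it keeps a point of the
    common hyperplane inside; hence the two forms are proportional. *)
Lemma hyperplane_eq (l l' : dualsp W) (a a' : R) : l != 0 -> l' != 0 -> hyperplane l a = hyperplane l' a' ->
  exists2 c : R, c != 0 & l = c *: l' /\ a = c * a'.
Proof.
move=> l0 l'0 e; have [w0 hw0] := hyperplane_nonempty a' l'0.
have hw1 : l w0 = a by have : hyperplane l a w0 by rewrite e.
have ker v : l' v = 0 -> l v = 0.
  move=> lv; have : hyperplane l a (w0 + v) by rewrite e /hyperplane /= linearD /= lv addr0.
  by rewrite /hyperplane /= linearD /= hw1 -{2}[a]addr0 => /addrI.
have [u lu] := hyperplane_nonempty 1 l'0.
have lE : l = (l u : R) *: l'.
  apply/lfunP => v; rewrite scale_lfunE /=.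
  have : l (v - (l' v : R) *: u) = 0.
    apply: ker; rewrite linearB linearZ /= lu /GRing.scale /= mulr1 subrr//.
  rewrite linearB linearZ /= => /eqP; rewrite subr_eq0 => /eqP ->.
  by rewrite /GRing.scale /= mulrC.
exists (l u); first by apply: contraNneq l0 => c0; rewrite lE c0 scale0r.
by split=> //; rewrite -hw1 {1}lE scale_lfunE /= hw0.
Qed.

Definition hyperplane_rep (H : AGr_space W) : 'rV[R]_(dim (dualsp W)) * R :=
  xget (0, 0) [set p | p.1 != 0 /\ hyperplane (r2v p.1 : dualsp W) p.2 = H].

(* An equation of the hyperplane H depending measurably on H. *)
Definition hyperplane_eqn (H : AGr_space W) : 'rV[R]_(dim (dualsp W)) * R :=
  (nrm (hyperplane_rep H).1, (hyperplane_rep H).2 / lead (hyperplane_rep H).1).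

Lemma r2v_neq0 (U : vectType R) (r : 'rV[R]_(dim U)) : (r2v r : U) != 0 <-> r != 0.
Proof. by rewrite -[X in _ != X](linear0 r2v) (can_eq r2vK). Qed.

Lemma hyperplane_rep_AGr (H : AGr_space W) : AGr H -> (hyperplane_rep H).1 != 0 /\ hyperplane (r2v (hyperplane_rep H).1 : dualsp W) (hyperplane_rep H).2 = H.
Proof.
move=> [l [a [l0 HE]]].
apply: (@xgetPex _ (0, 0) [set p : 'rV[R]_(dim (dualsp W)) * R | p.1 != 0 /\ hyperplane (r2v p.1 : dualsp W) p.2 = H]).
exists (v2r l, a) => /=; rewrite v2rK; split => //.
by apply/r2v_neq0; rewrite v2rK.
Qed.

Lemma hyperplaneZ (c : R) (l : dualsp W) a : c != 0 -> hyperplane (c *: l) (c * a) = hyperplane l a.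
Proof.
move=> c0; apply/seteqP; split=> w; rewrite /hyperplane /= scale_lfunE /GRing.scale /=.
  by move/(mulfI c0).
by move=> ->.
Qed.

Lemma hyperplane_eqn_AGr (H : AGr_space W) : AGr H -> (hyperplane_eqn H).1 != 0 /\ hyperplane (r2v (hyperplane_eqn H).1 : dualsp W) (hyperplane_eqn H).2 = H.
Proof.
move=> /hyperplane_rep_AGr[r0 e]; have l0 := lead_neq0 r0.
split; first by rewrite /hyperplane_eqn /nrm scaler_eq0 negb_or invr_eq0 l0.
by rewrite -[RHS]e /hyperplane_eqn /nrm linearZ /= mulrC hyperplaneZ// invr_eq0.
Qed.

Lemma hyperplane_eqnE (r : 'rV[R]_(dim (dualsp W))) (a : R) : r != 0 ->
  hyperplane_eqn (hyperplane (r2v r : dualsp W) a) = (nrm r, a / lead r).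
Proof.
move=> r0; set H : AGr_space W := hyperplane _ _.
have aH : AGr H by exists (r2v r), a; split=> //; exact/r2v_neq0.
have [s0 sH] := hyperplane_rep_AGr aH.
have [c c0 [e1 e2]] : exists2 c : R, c != 0 & (r2v r : dualsp W) = c *: r2v (hyperplane_rep H).1 /\ a = c * (hyperplane_rep H).2.
  by apply: hyperplane_eq; [exact/r2v_neq0|exact/r2v_neq0|rewrite sH].
have rE : r = c *: (hyperplane_rep H).1 by apply: (can_inj (@r2vK _ (dualsp W))); rewrite linearZ.
rewrite /hyperplane_eqn rE nrmZ// leadZ e2; congr (_, _).
by rewrite invfM mulrACA mulfV// mul1r.
Qed.

Lemma AGr_image (H : AGr_space W) : AGr H <->
  ((fun la : 'rV[R]_(dim (dualsp W)) * R => hyperplane (r2v la.1 : dualsp W) la.2) @` [set la | la.1 != 0]) H.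
Proof.
split=> [/hyperplane_eqn_AGr[r0 <-]|[[r a] /= r0 <-]]; first by exists (hyperplane_eqn H).
by exists (r2v r), a; split=> //; exact/r2v_neq0.
Qed.

Lemma measurable_AGr : measurable (@AGr R W : set (borel (AGr_space W))).
Proof.
apply: measurable_open_final; apply: open_final.
rewrite (_ : _ `&` _ = [set la | la.1 != 0]); first exact: open_nonzero_fst.
apply/seteqP; split=> [r []//|[r a] r0]; split => //; exists (r2v r), a; split=> //; exact/r2v_neq0.
Qed.

Lemma measurable_hyperplane_eqn (F : 'rV[R]_(dim (dualsp W)) * R -> R) : (forall p, p.1 != 0 -> {for p, continuous F}) ->
  measurable_fun setT (fun H : borel (AGr_space W) => F (hyperplane_eqn H)).
Proof.
move=> cF.
pose g (la : 'rV[R]_(dim (dualsp W)) * R) := hyperplane (r2v la.1 : dualsp W) la.2.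
have gE x y : x.1 != 0 -> y.1 != 0 -> g x = g y -> exists2 c : R, c != 0 & x = (c *: y.1, c * y.2).
  case: x y => [r a] [s b] /= r0 s0 h.
  have [c c0 [e1 e2]] : exists2 c : R, c != 0 & (r2v r : dualsp W) = c *: r2v s /\ a = c * b.
    by apply: hyperplane_eq => //; exact/r2v_neq0.
  exists c => //; rewrite e2; congr (_, _).
  by apply: (can_inj (@r2vK _ (dualsp W))); rewrite linearZ.
apply: (@final_measurable _ _ _ _ _ R (dim (dualsp W))
  (fun j => [set p : 'rV[R]_(dim (dualsp W)) * R | p.1 0 j != 0]) (fun H : borel (AGr_space W) => F (hyperplane_eqn H))
  (fun j (p : 'rV[R]_(dim (dualsp W)) * R) => F ((p.1 0 j)^-1 *: p.1, p.2 / p.1 0 j))).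
- move=> j; apply: openI; first exact: open_nonzero_fst.
  have h : open ((fst : 'rV[R]_(dim (dualsp W)) * R -> 'rV[R]_(dim (dualsp W))) @^-1` [set r | r 0 j != 0]).
    by apply: open_comp; [move=> p _; exact: cvg_fst|exact: open_coord_neq0].
  exact: h.
- move=> j x y x0 y0 /(gE _ _ x0 y0)[c c0 ->] /=; rewrite mxE mulf_eq0 negb_or => /andP[] //.
- move=> j x x0 xj.
  have cj : {for x, continuous (fun p : 'rV[R]_(dim (dualsp W)) * R => (p.1 0 j)^-1)}.
    apply: continuousV => //; apply: (@continuous_fst_comp _ _ _ (fun r : 'rV[R]_(dim (dualsp W)) => r 0 j)).
    exact: coord_continuous.
  apply: (@continuous_comp _ _ _ (fun p : 'rV[R]_(dim (dualsp W)) * R => ((p.1 0 j)^-1 *: p.1, p.2 / p.1 0 j)) F); last first.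
    by apply: cF; rewrite /= scaler_eq0 negb_or invr_eq0 xj.
  apply: continuous_pair.
    by apply: (@continuousZ _ _ _ (fun p : 'rV[R]_(dim (dualsp W)) * R => (p.1 0 j)^-1) fst); [exact: cj|exact: cvg_fst].
  by apply: (@continuousM _ _ snd (fun p : 'rV[R]_(dim (dualsp W)) * R => (p.1 0 j)^-1)); [exact: cvg_snd|exact: cj].
- move=> j x y x0 y0 /(gE _ _ x0 y0)[c c0 ->] /=; rewrite mxE mulf_eq0 negb_or => /andP[_ yj].
  by rewrite scalerA invfM mulrAC mulVf// mul1r mulrACA mulfV// mul1r.
- by move=> x /first_nonzero[j xj _]; exists j.
- move=> [r a] j /= r0 rj hj; rewrite /g hyperplane_eqnE// /nrm (leadE rj)// => i ij.
  by apply/eqP; have := hj i ij => /= /negP; rewrite negbK.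
Qed.

End HyperplaneSection.

Section HyperplaneParameters.
Context (R : realType) (V : vectType R).

(** The hyperplane of V^* that encodes the equation f = t, for the function f in V with coordinates
    [c]. *)
Definition hyp (c : 'rV[R]_(dim V)) (t : R) : AGr_space (dualsp V) := hyperplane (bidual (r2v c : V)) t.

Lemma bidual_neq0 (c : 'rV[R]_(dim V)) : c != 0 <-> bidual (r2v c : V) != 0.
Proof.
split; apply: contra_neq => h.
  by have := bicoord_bidual (r2v c : V); rewrite h r2vK => <-; apply/rowP => k; rewrite !mxE lfunE.
by apply/lfunP => xi; rewrite h linear0 bidualE linear0 lfunE.
Qed.

Lemma AGr_hyp c t : c != 0 -> AGr (hyp c t).
Proof. by move=> /bidual_neq0 c0; exists (bidual (r2v c)), t. Qed.

(** A measurable choice of an equation f = t for each hyperplane, in the coordinates of V; a right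
    inverse of [hyp] on hyperplanes. *)
Definition secV (H : AGr_space (dualsp V)) : 'rV[R]_(dim V) * R :=
  (bicoord (r2v (hyperplane_eqn H).1 : dualsp (dualsp V)), (hyperplane_eqn H).2).

Lemma secV_AGr (H : AGr_space (dualsp V)) : AGr H -> (secV H).1 != 0 /\ hyp (secV H).1 (secV H).2 = H.
Proof.
move=> /hyperplane_eqn_AGr[r0 HE]; rewrite /hyp /secV /= bicoordK; split=> //.
by apply/bidual_neq0; rewrite bicoordK; exact/r2v_neq0.
Qed.

Lemma bicoord_continuous : continuous (fun r : 'rV[R]_(dim (dualsp (dualsp V))) => bicoord (r2v r : dualsp (dualsp V))).
Proof. by apply: linear_continuous_rV => a u v; rewrite linearP bicoord_linear. Qed.

Lemma measurable_secV1 : measurable_fun setT (fun H : borel (AGr_space (dualsp V)) => (secV H).1 : borel 'rV[R]_(dim V)).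
Proof.
apply: measurable_rV => k.
apply: (measurable_hyperplane_eqn (F := fun p => bicoord (r2v p.1 : dualsp (dualsp V)) 0 k)) => p _.
apply: (@continuous_comp _ _ _ (fun p : 'rV[R]_(dim (dualsp (dualsp V))) * R => bicoord (r2v p.1 : dualsp (dualsp V)))
  (fun u : 'rV[R]_(dim V) => u 0 k)); last exact: coord_continuous.
apply: (@continuous_fst_comp _ _ _ (fun r : 'rV[R]_(dim (dualsp (dualsp V))) => bicoord (r2v r : dualsp (dualsp V)))).
exact: bicoord_continuous.
Qed.

Lemma measurable_secV2 : measurable_fun setT (fun H : borel (AGr_space (dualsp V)) => (secV H).2 : R).
Proof. by apply: (measurable_hyperplane_eqn (F := snd)) => p _; exact: cvg_snd. Qed.

Lemma open_prod_measurable d (O : set ('rV[R]_d * R)) : open O -> measurable (O : set (borel 'rV[R]_d * R)).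
Proof.
move=> oO; pose E : set 'rV[R]_(d + 1) := (fun z : 'rV[R]_(d + 1) => (lsubmx z, rsubmx z 0 0)) @^-1` O.
have mE : measurable (E : set (borel 'rV[R]_(d + 1))).
  apply: open_borel; apply: open_comp oO => z _; apply: continuous_pair; first exact: continuous_lsubmx.
  rewrite (_ : (fun y => _) = (fun y : 'rV[R]_(d + 1) => y 0 (rshift d 0))); first exact: coord_continuous.
  by apply/funext => y; rewrite mxE.
have := measurable_row_preimage mE.
have mf : measurable_fun setT (fun p : borel 'rV[R]_d * R => (p.1, p.2%:M) : borel 'rV[R]_d * borel 'rV[R]_1).
  apply/measurable_fun_pairP; split; first exact: measurable_fst.
  apply: measurable_rV => j; rewrite (_ : (fun _ => _) = snd); first exact: measurable_snd.
  by apply/funext => p; rewrite /= (ord1 j) mxE eqxx.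
move=> /(mf measurableT); rewrite setTI; congr measurable.
by apply/seteqP; split=> -[c t]; rewrite /E /preimage /= row_mxKl row_mxKr mxE eqxx.
Qed.

Lemma hyp_continuous p : p.1 != 0 -> {for p, continuous (fun p : 'rV[R]_(dim V) * R => hyp p.1 p.2)}.
Proof.
move=> p0; pose b (c : 'rV[R]_(dim V)) := v2r (bidual (r2v c : V)).
have cb : continuous b.
  apply: linear_continuous_rV => a u v; rewrite /b -linearP; congr v2r.
  by apply/lfunP => xi; rewrite add_lfunE scale_lfunE !bidualE !linearP.
rewrite (_ : (fun _ => _) = (fun la : 'rV[R]_(dim (dualsp (dualsp V))) * R =>
   hyperplane (r2v la.1 : dualsp (dualsp V)) la.2) \o (fun p : 'rV[R]_(dim V) * R => (b p.1, p.2))); last first.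
  by apply/funext => q; rewrite /= /b v2rK.
apply: (@continuous_comp _ _ _ (fun p : 'rV[R]_(dim V) * R => (b p.1, p.2))).
  by apply: continuous_pair; [apply: (@continuous_fst_comp _ _ _ b); exact: cb|exact: cvg_snd].
apply: final_continuous; rewrite /= /b; apply/r2v_neq0; rewrite v2rK; exact/bidual_neq0.
Qed.

Lemma measurable_hyp : measurable_fun [set p : borel 'rV[R]_(dim V) * R | p.1 != 0]
  (fun p : borel 'rV[R]_(dim V) * R => hyp p.1 p.2 : borel (AGr_space (dualsp V))).
Proof.
apply: (@measurability _ _ (borel 'rV[R]_(dim V) * R)%type (borel (AGr_space (dualsp V))) _ _ (@open (AGr_space (dualsp V))) erefl) => _ [B oB <-].
apply: open_prod_measurable; rewrite openE => p [p0 Bp]; rewrite /interior; apply: filterI.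
  by apply: open_nbhs_nbhs; split=> //; exact: open_nonzero_fst.
by apply: hyp_continuous => //; exact: open_nbhs_nbhs.
Qed.

End HyperplaneParameters.

Section HomogeneousBound.
Context (R : realType) (d : nat).

Lemma homogeneous_bounded (G : 'rV[R]_d -> R) : (forall r, r != 0 -> {for r, continuous G}) ->
  (forall (c : R) r, c != 0 -> r != 0 -> `|G (c *: r)| = `|G r|) -> exists M, forall r, r != 0 -> `|G r| <= M.
Proof.
move=> cG hG; pose S : set 'rV[R]_d := [set r | `|r| = 1].
have cS : compact S.
  apply: bounded_closed_compact.
    exists 1; split=> [|M M1 r rS]; first exact: num_real.
    by move: rS; rewrite /S /= => ->; rewrite ltW.
  rewrite (_ : S = (fun r : 'rV[R]_d => `|r|) @^-1` [set 1])//.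
  apply: preimage_closed; last by apply: accessible_closed_set1; exact/hausdorff_accessible/norm_hausdorff.
  by move=> r _; exact: norm_continuous.
have S0 r : S r -> r != 0.
  by move=> rS; apply: contra_eq_neq rS => ->; rewrite normr0 eq_sym oner_neq0.
have cGS : {within S, continuous G}.
  apply: continuous_in_subspaceT => r /set_mem /S0 r0; exact: cG.
have [M [_ hM]] := compact_bounded (continuous_compact cGS cS).
exists (`|M| + 1) => r r0; have nr0 : `|r| != 0 by rewrite normr_eq0.
rewrite -(hG `|r|^-1 r) ?invr_eq0//; apply: (hM (`|M| + 1)); first by rewrite (le_lt_trans (ler_norm _))// ltrDl.
exists (`|r|^-1 *: r) => //; by rewrite /S /= normrZ normfV normr_id mulVf.
Qed.

End HomogeneousBound.

Lemma lebesgue_opp (R : realType) (A : set R) : measurable A ->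
  lebesgue_measure ((fun t : R => - t) @^-1` A) = lebesgue_measure A.
Proof.
move=> mA; have mo : @measurable_fun _ _ (measurableTypeR R) (measurableTypeR R) setT (fun t : R => - t) by exact: oppr_measurable.
symmetry; apply: (@lebesgue_measure_unique R (pushm lebesgue_measure mo)) => //.
move=> _ [[a b] _ <-] /=; rewrite /pushforward /=.
rewrite (_ : _ @^-1` _ = `[- b, - a[%classic); last first.
  by apply/seteqP; split=> t /=; rewrite !in_itv /= ltrNr lerNl andbC.
by rewrite !lebesgue_measure_itv /= !lte_fin ltrN2; case: ifP => // _; rewrite -!EFinB opprK addrC.
Qed.

(** * A single factor: the normal measure in coordinates and the unit ball as a zonoid *)

Section Factor.
Context (R : realType) (V : vectType R).
Local Notation W := (dualsp V).
Context (ip : W -> W -> R) (ipP : scalar_product ip).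

Lemma ipC u v : ip u v = ip v u. Proof. by have [_ /(_ u v)] := ipP. Qed.
Lemma ip_lin a u v w : ip (a *: u + v) w = a * ip u w + ip v w. Proof. by have [/(_ a u v w)] := ipP. Qed.
Lemma ip_gt0 u : u != 0 -> 0 < ip u u. Proof. by have [_ _ /(_ u)] := ipP. Qed.
Lemma ip0l w : ip 0 w = 0.
Proof. by have := ip_lin 1 0 0 w; rewrite scaler0 addr0 mul1r => /(congr1 (fun z => z - ip 0 w)); rewrite subrr addrK. Qed.
Lemma ipDl u v w : ip (u + v) w = ip u w + ip v w. Proof. by rewrite -{1}[u]scale1r ip_lin mul1r. Qed.
Lemma ipZl a u w : ip (a *: u) w = a * ip u w. Proof. by rewrite -[a *: u]addr0 ip_lin ip0l addr0. Qed.
Lemma ipZr a u w : ip u (a *: w) = a * ip u w. Proof. by rewrite ipC ipZl ipC. Qed.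
Lemma ip_sum (I : Type) (r : seq I) (F : I -> W) w : ip (\sum_(i <- r) F i) w = \sum_(i <- r) ip (F i) w.
Proof. by elim: r => [|i r IH]; rewrite ?big_nil ?ip0l// !big_cons ipDl IH. Qed.

Lemma ip_cont1 (w : W) : continuous (fun r : 'rV[R]_(dim W) => ip w (r2v r)).
Proof.
have h : continuous (fun r : 'rV[R]_(dim W) => (ip w (r2v r))%:M : 'rV[R]_1).
  apply: linear_continuous_rV => a u v; apply/rowP => k; rewrite !mxE (ord1 k) eqxx !mulr1n.
  by rewrite ipC linearP ip_lin !(ipC _ w).
move=> r; rewrite (_ : (fun _ => _) = (fun M : 'rV[R]_1 => M 0 0) \o (fun r : 'rV[R]_(dim W) => (ip w (r2v r))%:M)).
  by apply: continuous_comp; [exact: h|exact: coord_continuous].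
by apply/funext => s; rewrite /= mxE mulr1n.
Qed.

Lemma ip_cont2 : continuous (fun r : 'rV[R]_(dim W) => ip (r2v r) (r2v r)).
Proof.
rewrite (_ : (fun _ => _) = (fun r : 'rV[R]_(dim W) => \sum_k r 0 k * ip (r2v (delta_mx 0 k)) (r2v r))); last first.
  apply/funext => r; rewrite {1}(row_sum_delta r) linear_sum ip_sum; apply: eq_bigr => k _.
  by rewrite linearZ ipZl.
move=> r; apply: continuous_at_sum => k.
apply: (@continuousM _ _ (fun y : 'rV[R]_(dim W) => y 0 k) (fun y => ip (r2v (delta_mx 0 k)) (r2v y))).
  exact: coord_continuous.
exact: ip_cont1.
Qed.

Definition enorm (r : 'rV[R]_(dim W)) : R := Num.sqrt (ip (r2v r) (r2v r)).

Lemma enorm_gt0 r : r != 0 -> 0 < enorm r.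
Proof. by move=> r0; rewrite sqrtr_gt0 ip_gt0//; exact/r2v_neq0. Qed.

Lemma enormZ c r : enorm (c *: r) = `|c| * enorm r.
Proof. by rewrite /enorm linearZ ipZl ipZr mulrA -expr2 sqrtrM ?sqr_ge0// sqrtr_sqr. Qed.

Definition evec (r : 'rV[R]_(dim W)) : W := (enorm r)^-1 *: r2v r.

Lemma evec_ip r : r != 0 -> ip (evec r) (evec r) = 1.
Proof.
move=> r0; rewrite /evec ipZl ipZr mulrA -expr2 exprVn sqr_sqrtr ?ltW ?ip_gt0//; last exact/r2v_neq0.
by rewrite mulVf// gt_eqF// ip_gt0//; exact/r2v_neq0.
Qed.

(** Coordinates of the element of V that acts on V^* as the scalar product with the unit vector
    [evec r]; see [acoef_ip]. *)
Definition acoef (r : 'rV[R]_(dim W)) : 'rV[R]_(dim V) := \row_k ip (dbase k) (evec r).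

Lemma acoef_cont k r : r != 0 -> {for r, continuous (fun r => acoef r 0 k)}.
Proof.
move=> r0; rewrite (_ : (fun _ => _) = (fun r => (enorm r)^-1 * ip (dbase k) (r2v r))); last first.
  by apply/funext => s; rewrite mxE /evec ipZr.
apply: (@continuousM _ _ (fun r => (enorm r)^-1) (fun y => ip (dbase k) (r2v y))); last exact: ip_cont1.
apply: (@continuousV _ _ enorm); first by rewrite gt_eqF// enorm_gt0.
by apply: continuous_comp; [exact: ip_cont2|exact: sqrt_continuous].
Qed.

Lemma acoefZ k c r : c != 0 -> r != 0 -> `|acoef (c *: r) 0 k| = `|acoef r 0 k|.
Proof.
move=> c0 r0; rewrite !mxE /evec enormZ linearZ scalerA !ipZr !normrM; congr (_ * _).
by rewrite !normfV normrM normr_id invfM mulrAC mulVf ?normr_eq0// mul1r.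
Qed.

Lemma acoef_ip r (xi : W) : dot (dual_row xi) (acoef r) = ip xi (evec r).
Proof.
rewrite dotE {2}(dual_row_sum xi) ip_sum; apply: eq_bigr => k _.
by rewrite ipZl !mxE.
Qed.

Lemma acoef_neq0 r : r != 0 -> acoef r != 0.
Proof.
move=> r0; apply/eqP => a0; have := evec_ip r0.
rewrite -acoef_ip a0 dotE big1 => [/eqP|k _]; last by rewrite [X in _ * X]mxE mulr0.
by rewrite eq_sym oner_eq0.
Qed.

Lemma hyp_acoef r t (w : W) : hyp (acoef r) t w <-> ip w (evec r) = t.
Proof. by rewrite /hyp /hyperplane /= bidualE dual_rowE r2vK acoef_ip. Qed.

Definition aL (L : Gr1_space W) : 'rV[R]_(dim V) := acoef (line_vector L).

Lemma aL_measurable : measurable_fun setT (fun L : borel (Gr1_space W) => aL L : borel 'rV[R]_(dim V)).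
Proof.
by apply: measurable_rV => k; apply: (measurable_line_vector (F := fun r => acoef r 0 k)) => r r0; exact: acoef_cont.
Qed.

Lemma aL_bounded : exists M, forall L, Gr1 L -> `|aL L| <= M.
Proof.
have /choice[M hM] k : exists M, forall r, r != 0 -> `|acoef r 0 k| <= M.
  apply: homogeneous_bounded; [exact: acoef_cont|exact: acoefZ].
exists (\sum_k `|M k|) => L /line_vector_line[r0 _]; apply: rV_norm_le => [|k]; first exact: sumr_ge0.
apply: le_trans (hM k _ r0) _; rewrite (bigD1 k)//=; apply: le_trans (ler_norm _) _.
by rewrite lerDl sumr_ge0.
Qed.

(** The point t of the Euclidean line L corresponds to the hyperplane on which the element [aL L] of
    V equals t. The generators chosen by [unit_vector] and [evec] may differ by a sign, which
    Lebesgue measure ignores. *)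
Lemma transverse_hyp (A : set (borel (AGr_space W))) L : Gr1 L -> measurable A ->
  transverse_measure ip A L = lebesgue_measure [set t : R | A (hyp (aL L) t)].
Proof.
move=> dL mA; have [r0 Lr] := line_vector_line dL; set r := line_vector L in r0 Lr.
have a0 : aL L != 0 by exact: acoef_neq0.
have mhyp : measurable [set t : R | A (hyp (aL L) t)].
  have mp : measurable_fun setT (fun t : R => (aL L, t) : borel 'rV[R]_(dim V) * R).
    by apply/measurable_fun_pairP; split; [exact: measurable_cst|exact: measurable_id].
  have := mp measurableT _ (measurable_hyp (V := V) _ mA); rewrite setTI.
  rewrite (_ : _ @^-1` _ = [set t : R | A (hyp (aL L) t)]); last by apply/seteqP; split=> t /=; [case|].
  apply; have mo := open_prod_measurable (@open_nonzero_fst R (dim V)).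
  exact: mo.
have p0 : vpick (L : {vspace W}) != 0 by rewrite vpick0 -dimv_eq0 dL.
have [c c0 pc] : exists2 c : R, c != 0 & vpick (L : {vspace W}) = c *: r2v r.
  have : vpick (L : {vspace W}) \in (L : {vspace W}) by exact: memv_pick.
  rewrite {2}Lr => /vlineP[c pc]; exists c => //.
  by apply: contraNneq p0 => c0; rewrite pc c0 scale0r.
have uE : unit_vector ip L = Num.sg c *: evec r.
  rewrite /unit_vector pc ipZl ipZr mulrA -expr2 sqrtrM ?sqr_ge0// sqrtr_sqr scalerA invfM mulrAC.
  rewrite /evec scalerA; congr (_ *: _); rewrite -/(enorm r); congr (_ * _).
  by rewrite {2}[c]numEsg mulrC mulfK// normr_eq0.
have sgE : (Num.sg c = 1 \/ Num.sg c = -1) by case: sgrP c0 => // _ _; [left|right].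
have orth h : orthogonal_to ip (L : {vspace W}) h <-> ip h (evec r) = 0.
  split=> [ho|ho l]; last first.
    rewrite Lr => /vlineP[b ->]; rewrite ipZl.
    have -> : r2v r = enorm r *: evec r by rewrite /evec scalerA mulfV ?scale1r// gt_eqF// enorm_gt0.
    by rewrite ipZl ipC ho !mulr0.
  rewrite ipC; apply: ho; rewrite Lr /evec /line; apply: rpredZ; exact: memv_line.
have trE t : translate (t *: unit_vector ip L) (orthogonal_to ip (L : {vspace W})) = hyp (aL L) (Num.sg c * t) :> AGr_space W.
  apply/seteqP; split=> [_ [h /orth ho <-]|w /hyp_acoef hw].
    by apply/hyp_acoef; rewrite ipDl ho add0r uE scalerA ipZl (evec_ip r0) mulr1 mulrC.
  exists (w - t *: unit_vector ip L); last by rewrite subrK.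
  by apply/orth; rewrite -scaleNr ipDl uE scalerA ipZl (evec_ip r0) mulr1 hw mulNr mulrC subrr.
rewrite /transverse_measure.
under [X in lebesgue_measure X]eq_set do rewrite trE.
case: sgE => ->.
  by under [X in lebesgue_measure X]eq_set do rewrite mul1r.
rewrite -[RHS]lebesgue_opp//; congr lebesgue_measure.
by apply/seteqP; split=> t /=; rewrite mulN1r.
Qed.

End Factor.

Section CompactHyperplanes.
Context (R : realType) (W : vectType R).

(* The hyperplanes at distance at most k from 0, for the norm dual to |.|. *)
Definition hyperplanes_near (k : nat) : set (AGr_space W) :=
  (fun la : 'rV[R]_(dim (dualsp W)) * R => hyperplane (r2v la.1 : dualsp W) la.2) @`
    [set la | `|la.1| = 1 /\ `|la.2| <= k%:R].

Lemma norm1_neq0 d (r : 'rV[R]_d) : `|r| = 1 -> r != 0.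
Proof. by move=> rS; apply: contra_eq_neq rS => ->; rewrite normr0 eq_sym oner_neq0. Qed.

(** Normal measures are finite on compact sets, so these sets will exhaust the hyperplanes by sets
    of finite mass. *)
Lemma compact_hyperplanes_near k : compact (hyperplanes_near k).
Proof.
apply: continuous_compact.
  apply: continuous_in_subspaceT => la /set_mem[/norm1_neq0 la0 _].
  exact: (@final_continuous _ _ (@open_nonzero_fst R (dim (dualsp W))) (set W : pointedType)
    (fun la => hyperplane (r2v la.1 : dualsp W) la.2) la la0).
have cS : compact [set r : 'rV[R]_(dim (dualsp W)) | `|r| = 1].
  apply: bounded_closed_compact.
    exists 1; split=> [|M M1 r rS]; first exact: num_real.
    by move: rS => /= ->; rewrite ltW.
  rewrite (_ : [set r | _] = (fun r : 'rV[R]_(dim (dualsp W)) => `|r|) @^-1` [set 1])//.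
  apply: preimage_closed; last by apply: accessible_closed_set1; exact/hausdorff_accessible/norm_hausdorff.
  by move=> r _; exact: norm_continuous.
have cI : compact (`[- k%:R, k%:R]%classic : set R) by exact: segment_compact.
rewrite (_ : [set la | _] = [set r : 'rV[R]_(dim (dualsp W)) | `|r| = 1] `*` `[- k%:R, k%:R]%classic).
  exact: compact_setX.
by apply/seteqP; split=> -[r t] /= [h1 h2]; split=> //; move: h2; rewrite in_itv /= ler_norml.
Qed.

Lemma hyperplanes_near_AGr k : hyperplanes_near k `<=` @AGr R W.
Proof. by move=> _ [[r t] /= [/norm1_neq0 r0 _] <-]; exists (r2v r), t; split=> //; exact/r2v_neq0. Qed.

Lemma hyperplanes_nearE (r : 'rV[R]_(dim (dualsp W))) (t : R) k : r != 0 ->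
  hyperplanes_near k (hyperplane (r2v r : dualsp W) t : AGr_space W) <-> `|t| <= k%:R * `|r|.
Proof.
move=> r0; have nr : 0 < `|r| by rewrite normr_gt0.
split=> [[[s u] /= [s1 uk] e]|h].
  have [c c0 [e1 e2]] : exists2 c : R, c != 0 & (r2v r : dualsp W) = c *: r2v s /\ t = c * u.
    by apply: hyperplane_eq => //; [exact/r2v_neq0|apply/r2v_neq0; exact: norm1_neq0].
  have -> : r = c *: s by apply: (can_inj (@r2vK _ (dualsp W))); rewrite linearZ.
  have {}s1 : `|s| = 1 :> R := s1.
  have -> : `|c *: s| = `|c| by rewrite normrZ [X in _ * X]s1 mulr1.
  by rewrite e2 normrM mulrC ler_wpM2r.
exists (`|r|^-1 *: r, `|r|^-1 * t); last by rewrite /= linearZ /= hyperplaneZ// invr_eq0 gt_eqF.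
by rewrite /= normrZ normrM normfV normr_id mulVf ?gt_eqF//; split=> //; rewrite mulrC ler_pdivrMr.
Qed.

Lemma hyperplanes_near_nd k : hyperplanes_near k `<=` hyperplanes_near k.+1.
Proof. by move=> _ [la [h1 h2] <-]; exists la => //; split=> //; apply: le_trans h2 _; rewrite ler_nat. Qed.

Lemma bigcup_hyperplanes_near : \bigcup_k hyperplanes_near k = @AGr R W.
Proof.
apply/seteqP; split=> [H [k _ /hyperplanes_near_AGr]//|H /AGr_image[[r t] /= r0 <-]].
have nr : 0 < `|r| by rewrite normr_gt0.
exists (Num.truncn (`|t| / `|r|)).+1 => //; apply/hyperplanes_nearE => //.
by rewrite -ler_pdivrMr// ltW// truncnS_gt.
Qed.

Lemma measurable_hyperplanes_near k : measurable (hyperplanes_near k : set (borel (AGr_space W))).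
Proof.
pose f (p : 'rV[R]_(dim (dualsp W)) * R) := `|p.2| - k%:R * `|p.1|.
have mf : measurable_fun setT (fun H : borel (AGr_space W) => f (hyperplane_eqn H)).
  apply: measurable_hyperplane_eqn => p _; apply: continuousB.
    by apply: (@continuous_snd_comp _ _ _ (fun t : R => `|t|)); exact: norm_continuous.
  apply: continuousM; first exact: cst_continuous.
  by apply: (@continuous_fst_comp _ _ _ (fun t : 'rV[R]_(dim (dualsp W)) => `|t|)); exact: norm_continuous.
have -> : hyperplanes_near k = @AGr R W `&` (fun H : borel (AGr_space W) => f (hyperplane_eqn H)) @^-1` `]-oo, 0].
  apply/seteqP; split=> H.
    move=> KH; have AH := hyperplanes_near_AGr KH; split=> //; have [s0 sH] := hyperplane_eqn_AGr AH.
    by move: KH; rewrite -{1}sH /= in_itv /= subr_le0 => /hyperplanes_nearE; apply.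
  move=> [AH]; have [s0 sH] := hyperplane_eqn_AGr AH; rewrite /= in_itv /= subr_le0 => h.
  by rewrite -sH; apply/hyperplanes_nearE.
apply: measurableI; first exact: measurable_AGr.
by rewrite -[X in measurable X]setTI; exact: mf.
Qed.

End CompactHyperplanes.

Section DualNorm.
Context (R : realType) (V : vectType R) (N : V -> R) (Nn : is_norm N).

Definition K0 : set 'rV[R]_(dim V) := [set k | N (r2v k) <= 1].

Hypothesis cK : compact K0.

Lemma K0_zero : K0 0.
Proof. by rewrite /K0 /= linear0; have [_ /(_ 0 0) + _] := Nn; rewrite scale0r normr0 mul0r => ->. Qed.

Lemma K0_opp k : K0 k -> K0 (- k).
Proof. by rewrite /K0 /= linearN -scaleN1r; have [_ -> _] := Nn; rewrite normrN normr1 mul1r. Qed.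

Lemma cvx_K0 : cvx K0.
Proof.
have [ND NZ _] := Nn; move=> x y t Kx Ky /andP[t0 t1].
rewrite /K0 /= linearD !linearZ /=; apply: le_trans (ND _ _) _; rewrite !NZ.
rewrite (ger0_norm t0) (ger0_norm (_ : 0 <= 1 - t)) ?subr_ge0//.
apply: le_trans (_ : t * 1 + (1 - t) * 1 <= _); last by rewrite !mulr1 addrC subrK.
by apply: lerD; rewrite ler_wpM2l ?subr_ge0.
Qed.

(** The dual norm is a supremum of absolute values over the unit ball; compactness makes it a
    maximum and the symmetry of the ball removes the absolute value. *)
Lemma K0_supp : has_supp K0 (fun x => dual_norm N (dual_of x)).
Proof.
have bnd x : has_ubound [set `|dual_of x v : R| | v in unit_ball N].
  have [M M0 hM] := compact_norm_le cK; exists (\sum_j `|x 0 j| * M) => _ [v Nv <-].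
  rewrite dual_ofE dotE; apply: le_trans (ler_norm_sum _ _ _) _; apply: ler_sum => j _.
  rewrite normrM ler_wpM2l//; apply: le_trans (rV_coord_le _ _) _; apply: hM.
  by rewrite /K0 /= v2rK.
have up x k : K0 k -> `|dot k x| <= dual_norm N (dual_of x).
  move=> Kk; apply: (ub_le_sup (bnd x)); exists (r2v k) => //.
  by rewrite dual_ofE r2vK dotC.
split=> [k x Kk|x]; first exact: le_trans (ler_norm _) (up x k Kk).
have [k /set_mem Kk hk] := compact_EVT_max (ex_intro _ _ K0_zero) cK (continuous_subspaceT (@dot_continuous R _ x)).
exists k => //; apply/eqP; rewrite eq_le (le_trans (ler_norm _) (up x k Kk)) /=.
apply: ge_sup; first by exists `|dual_of x (r2v 0 : V) : R|, (r2v 0); rewrite ?linear0//; have := K0_zero; rewrite /K0 /= linear0.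
move=> _ [v Nv <-]; rewrite dual_ofE dotC.
have Kv : K0 (v2r v) by rewrite /K0 /= v2rK.
rewrite ler_norml lerNl -dotNl; apply/andP; split; apply: hk; apply/mem_set => //; exact: K0_opp.
Qed.

End DualNorm.

(** The value t lies between 0 and x, whatever the sign of x. The condition of meeting the segment
    [0, xi] thus becomes a polynomial inequality, hence a measurable one. *)
Lemma between_iff (R : realFieldType) (x t : R) : (exists2 s, 0 <= s <= 1 & s * x = t) <-> t * (t - x) <= 0.
Proof.
split=> [[s /andP[s0 s1] <-]|h].
  have -> : s * x * (s * x - x) = - (s * (1 - s) * x ^+ 2) by ring.
  by rewrite oppr_le0 mulr_ge0 ?sqr_ge0// mulr_ge0// subr_ge0.
have [x0|x0] := eqVneq x 0.
  exists 0; first by rewrite lexx ler01.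
  move: h; rewrite x0 subr0 mulr0 -expr2 => h; apply/esym/eqP.
  by rewrite -sqrf_eq0 eq_le h sqr_ge0.
have x2 : 0 < x ^+ 2 by rewrite lt_def sqrf_eq0 x0 sqr_ge0.
exists (t / x); last by rewrite divfK.
pose s := t / x; have e : t = s * x by rewrite /s divfK.
have {h} : s * (s - 1) <= 0.
  by rewrite -(pmulr_rle0 _ x2); move: h; rewrite e; congr (_ <= _); ring.
rewrite -/s => h; apply/andP; split; rewrite leNgt; apply/negP => hs; nra.
Qed.

Section FactorData.
Context (R : realType) (V : vectType R).
Local Notation W := (dualsp V).

Lemma measurable_meet (xi : W) : measurable
  ([set H | AGr H /\ exists2 t : R, 0 <= t <= 1 & (H : set W) (t *: xi)] : set (borel (AGr_space W))).
Proof.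
pose f (H : borel (AGr_space W)) : R := (secV H).2 * ((secV H).2 - dot (secV H).1 (dual_row xi)).
have mf : measurable_fun setT f.
  have md : measurable_fun setT (fun H : borel (AGr_space W) => dot (secV H).1 (dual_row xi)).
    by apply: (measurableT_comp (continuous_borelR (@dot_continuous R _ (dual_row xi)))); exact: measurable_secV1.
  by apply: measurable_funM; [exact: measurable_secV2|apply: measurable_funB; [exact: measurable_secV2|exact: md]].
rewrite (_ : [set H | _] = @AGr R W `&` f @^-1` `]-oo, 0]).
  by apply: measurableI; [exact: measurable_AGr|rewrite -[X in measurable X]setTI; exact: mf].
apply/seteqP; split=> H [AH hH]; split=> //; have [c0 cH] := secV_AGr AH; move: hH.
  move=> [s s01]; rewrite -{1}cH /hyp /hyperplane /= bidualE scale_lfunE dual_rowE r2vK => e.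
  rewrite /f /preimage /= in_itv /=; apply/between_iff; exists s => //.
  by rewrite -e dotC.
rewrite /f /preimage /= in_itv /= => /between_iff[s s01 e]; exists s => //.
by rewrite -cH /hyp /hyperplane /= bidualE scale_lfunE dual_rowE r2vK -e dotC.
Qed.

Context (N : V -> R) (Nn : is_norm N) (cK : compact (K0 N)).
Context (mu : AGr_measure W) (munu : normal_measure mu).
Context (ip : W -> W -> R) (ipP : scalar_product ip).
Context (nu : {measure set (borel (Gr1_space W)) -> \bar R}) (phi : Gr1_space W -> R).
Context (nuH : haar_measure ip nu) (sphi : smooth_on_Gr1 phi).
Context (muE : forall A : set (borel (AGr_space W)), measurable A -> A `<=` @AGr R W -> finite_mass mu A ->
   smeasure mu A = (\int[nu]_(L in @Gr1 R W) ((phi L)%:E * transverse_measure ip A L))%E).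
Context (chi : forall xi : W, chi1 mu xi = (dual_norm N xi)%:E).

(** Extended by 0 from the lines to the whole ambient type of subspaces, so that integrals carry no
    domain. *)
Definition phi1 (L : Gr1_space W) : R := if \dim (L : {vspace W}) == 1%N then phi L else 0.

Definition a1 (L : Gr1_space W) : 'rV[R]_(dim V) := aL ip L.

Lemma a1_off L : ~ Gr1 L -> a1 L = 0.
Proof.
move=> dL; rewrite /a1 /aL /line_vector ifF; last by apply/negP => /eqP.
by apply/rowP => k; rewrite !mxE /evec linear0 scaler0 (ipC ipP) (ip0l ipP).
Qed.

Lemma a1_neq0 L : phi1 L != 0 -> a1 L != 0.
Proof.
rewrite /phi1; case: ifP => [/eqP dL _|]; last by rewrite eqxx.
by have [r0 _] := @line_vector_line R W L dL; exact: acoef_neq0.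
Qed.

Lemma a1_meas : measurable_fun setT (fun L : borel (Gr1_space W) => a1 L : borel 'rV[R]_(dim V)).
Proof. exact: aL_measurable. Qed.

Lemma a1_bounded : exists M, forall L, `|a1 L| <= M.
Proof.
have [M hM] := aL_bounded ipP; exists (`|M|) => L.
have [dL|/a1_off ->] := pselect (Gr1 L); last by rewrite normr0.
exact: le_trans (hM L dL) (ler_norm _).
Qed.

Lemma phi1_bounded_mfun : bounded_mfun (phi1 : borel (Gr1_space W) -> R).
Proof.
pose F (r : 'rV[R]_(dim W)) := phi (line (r2v r)).
have cF r : r != 0 -> {for r, continuous F} by move=> r0; have [h _] := sphi 0%N; exact: h.
have pE L : phi1 L = F (line_vector L) * \1_(@Gr1 R W) L.
  rewrite /phi1 indicE; have [dL|dL] := pselect (Gr1 L).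
    by rewrite mem_set// mulr1 dL eqxx /F; have [_ <-] := line_vector_line dL.
  by rewrite memNset// mulr0 ifF//; apply/negP => /eqP.
have [M hM] : exists M, forall r, r != 0 -> `|F r| <= M.
  apply: homogeneous_bounded => // c r c0 r0; rewrite /F; congr (`|phi _|).
  rewrite /line linearZ /=; apply/eqP; rewrite eqEdim; apply/andP; split.
    by rewrite -memvE rpredZ// memv_line.
  by rewrite !dim_vline scaler_eq0 (negbTE c0).
split.
  rewrite (_ : phi1 = fun L => F (line_vector L) * \1_(@Gr1 R W) L); last exact/funext.
  by apply: measurable_funM; [exact: measurable_line_vector|apply: measurable_indic; exact: measurable_Gr1].
exists `|M| => L; rewrite /phi1; case: ifP => [/eqP dL|_]; last by rewrite normr0.
have [r0 {1}->] := @line_vector_line R W L dL; exact: le_trans (hM _ r0) (ler_norm _).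
Qed.

Lemma mu_hyp (A : set (borel (AGr_space W))) : measurable A -> A `<=` @AGr R W -> finite_mass mu A ->
  smeasure mu A = (\int[nu]_L ((phi1 L)%:E * lebesgue_measure [set t : R | A (hyp (a1 L) t)]))%E.
Proof.
move=> mA AA fA; rewrite muE// integral_mkcond; apply: eq_integral => L _.
rewrite patchE /phi1; case: ifP => [/set_mem dL|dL].
  by rewrite dL eqxx (transverse_hyp ipP).
by rewrite ifF ?mul0e//; apply/negP => /eqP h; move: dL; rewrite mem_set.
Qed.

Lemma mu_off (A : set (borel (AGr_space W))) : measurable A -> smeasure mu A = smeasure mu (A `&` @AGr R W).
Proof.
have [[p0 n0] _ _] := munu; move=> mA; have mAGr := @measurable_AGr R W.
have h (m : {measure set (borel (AGr_space W)) -> \bar R}) : m (~` @AGr R W) = 0%E -> m A = m (A `&` @AGr R W).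
  move=> m0; rewrite -[in LHS](setUIDK A (@AGr R W)) measureU//; last 3 first.
  - exact: measurableI.
  - exact: measurableD.
  - by rewrite setDE setICA -setIA setICr !setI0.
  rewrite [X in (_ + X)%E](_ : _ = 0%E) ?adde0//.
  apply: (subset_measure0 _ _ _ m0); [exact: measurableD|exact: measurableC|by move=> H []].
by rewrite /smeasure !h.
Qed.

Lemma hyperplanes_near_fin k : finite_mass mu (@hyperplanes_near R W k).
Proof. by have [_ h _] := munu; apply: h; exact: compact_hyperplanes_near. Qed.

Lemma sub_hyperplanes_near_fin (A : set (borel (AGr_space W))) k : measurable A -> A `<=` @hyperplanes_near R W k -> finite_mass mu A.
Proof.
move=> mA AK; have [h1 h2] := hyperplanes_near_fin k.
by split; [apply: le_lt_trans h1|apply: le_lt_trans h2]; apply: le_measure => //; apply/mem_set => //; exact: measurable_hyperplanes_near.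
Qed.

(** The hypothesis on chi_1 evaluated at xi: the hyperplane where [a1 L] takes the value t meets
    [0, xi] exactly for t between 0 and <a1 L, xi>, an interval of length |<a1 L, xi>|. *)
Lemma K0_zonoid : has_supp (K0 N) (fun x => \int[nu]_L (phi1 L * `|dot (a1 L) x|)).
Proof.
have [h1 h2] := K0_supp Nn cK.
have e x : dual_norm N (dual_of x) = \int[nu]_L (phi1 L * `|dot (a1 L) x|).
  set A := [set H | AGr H /\ exists2 t : R, 0 <= t <= 1 & (H : set W) (t *: dual_of x)].
  have mA : measurable (A : set (borel (AGr_space W))) by exact: measurable_meet.
  (* The formula for [mu] is available on sets of finite mass; the hyperplanes that meet a segment
     stay at bounded distance from 0. *)
  have [k Ak] : exists k, A `<=` @hyperplanes_near R W k.
    have [B hB] : exists B : 'M[R]_(dim (dualsp W), 1), forall r, ((r2v r : dualsp W) (dual_of x) : R)%:M = r *m B.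
      apply: linear_mulmx => a u v; rewrite linearP add_lfunE scale_lfunE.
      by apply/rowP => j; rewrite !mxE (ord1 j) eqxx !mulr1n.
    exists (Num.truncn (mxsum B)).+1 => H [/AGr_image[[r t] /= r0 <-] [s /andP[s0 s1]]].
    rewrite /hyperplane /= linearZ /= => e; apply/hyperplanes_nearE => //.
    rewrite -e /GRing.scale /= normrM (ger0_norm s0); apply: le_trans (_ : `|(r2v r : dualsp W) (dual_of x) : R| <= _).
      by rewrite ler_piMl.
    have -> : `|(r2v r : dualsp W) (dual_of x) : R| = `|(r *m B) 0 0|.
      by rewrite -hB mxE eqxx mulr1n.
    apply: le_trans (rV_coord_le _ _) _; apply: le_trans (rV_norm_mul _ _) _.
    by rewrite mulrC ler_wpM2r// ltW// truncnS_gt.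
  have := chi (dual_of x); rewrite /chi1 -/A (mu_hyp mA); last 2 first.
  - by move=> H [].
  - exact: (sub_hyperplanes_near_fin mA Ak).
  move=> /(congr1 fine) /= <-; rewrite /Rintegral; congr fine; apply: eq_integral => L _.
  have [p0|p0] := eqVneq (phi1 L) 0; first by rewrite p0 mul0r mul0e.
  rewrite EFinM; congr (_ * _)%E; set z := dot (a1 L) x.
  rewrite (_ : [set t | _] = `[Num.min 0 z, Num.max 0 z]%classic).
    rewrite lebesgue_segment; last by rewrite ge_min le_max lexx.
    by congr EFin; rewrite /Num.max /Num.min; case: ltP => hz; [rewrite subr0 gtr0_norm|rewrite sub0r ler0_norm].
  have itvE t : (Num.min 0 z <= t <= Num.max 0 z) <-> t * (t - z) <= 0.
    rewrite /Num.max /Num.min; case: ltP => hz; split=> h.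
    - by move/andP: h => [? ?]; nra.
    - by apply/andP; split; rewrite leNgt; apply/negP => ht; nra.
    - by move/andP: h => [? ?]; nra.
    - by apply/andP; split; rewrite leNgt; apply/negP => ht; nra.
  apply/seteqP; split=> t /=; rewrite in_itv /=.
    move=> [_ [s s01]]; rewrite /hyp /hyperplane /= bidualE scale_lfunE dual_ofE r2vK dotC => <-.
    by apply/itvE/between_iff; exists s.
  move=> /itvE/between_iff[s s01 <-]; split; first exact/AGr_hyp/a1_neq0.
  by exists s => //; rewrite /hyp /hyperplane /= bidualE scale_lfunE dual_ofE r2vK dotC.
by split=> [k x Kk|x]; rewrite -e; [exact: h1|exact: h2].
Qed.

End FactorData.

(** * The product of signed normal measures *)

Section WeightedPush.
Context (R : realType) (d1 d2 d3 : measure_display) (X : measurableType d1) (Y : measurableType d2) (Z : measurableType d3).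
Context (m1 : {measure set X -> \bar R}) (m2 : {sigma_finite_measure set Y -> \bar R}).
Context (w : X -> R) (mw : measurable_fun setT w) (w0 : forall x, 0 <= w x).
Context (Psi : X * Y -> Z) (mPsi : measurable_fun setT Psi).

Definition psec (B : set Z) (x : X) : set Y := [set y | B (Psi (x, y))].

Lemma measurable_psec B x : measurable B -> measurable (psec B x).
Proof.
move=> mB; have := mPsi measurableT mB; rewrite setTI => /(measurable_xsection x).
by congr measurable; apply/seteqP; split=> y; [move=> /set_mem|move=> h; apply/mem_set].
Qed.

Lemma measurable_fun_psec B : measurable B -> measurable_fun setT (fun x => m2 (psec B x)).
Proof.
move=> mB; have := mPsi measurableT mB; rewrite setTI => mE.
have := measurable_fun_xsection m2 mE; congr measurable_fun; apply/funext => x /=; congr (m2 _).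
by apply/seteqP; split=> y; [move=> /set_mem|move=> h; apply/mem_set].
Qed.

(* The image by Psi of the measure w m1 x m2. *)
Definition weighted_push of measurable_fun setT w & (forall x, 0 <= w x) & measurable_fun setT Psi : set Z -> \bar R :=
  fun B => (\int[m1]_x ((w x)%:E * m2 (psec B x)))%E.

Local Notation P := (weighted_push mw w0 mPsi).

Lemma mwE : measurable_fun setT (fun x => (w x)%:E). Proof. exact/measurable_EFinP. Qed.

Let wpush0 : P set0 = 0%E.
Proof. by rewrite /weighted_push; apply: integral0_eq => x _; rewrite /psec measure0 mule0. Qed.

Let weighted_push_ge0 B : (0 <= P B)%E.
Proof. by apply: integral_ge0 => x _; rewrite mule_ge0// lee_fin. Qed.

Let weighted_push_sigma : semi_sigma_additive P.
Proof.
move=> F mF tF mUF; rewrite [X in _ --> X](_ : _ = (\sum_(0 <= k <oo) P (F k))%E).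
  by apply: is_cvg_nneseries => k _ _; exact: weighted_push_ge0.
rewrite /weighted_push -integral_nneseries//; last 2 first.
- by move=> k; apply: emeasurable_funM; [exact: mwE|exact: measurable_fun_psec].
- by move=> k x _; rewrite mule_ge0// lee_fin.
apply: eq_integral => x _.
have -> : psec (\bigcup_k F k) x = \bigcup_k psec (F k) x by [].
rewrite measure_semi_bigcup//; last 3 first.
- by move=> k; exact: measurable_psec.
- apply/trivIsetP => i j _ _ ij; apply/seteqP; split=> // y [Fi Fj].
  by have /trivIsetP/(_ i j I I ij) := tF; move=> /seteqP[+ _] => /(_ (Psi (x, y))); apply.
- by apply: bigcup_measurable => k _; exact: measurable_psec.
by rewrite nneseriesZl// => k _; exact: measure_ge0.
Qed.

HB.instance Definition _ := isMeasure.Build _ _ _ P wpush0 weighted_push_ge0 weighted_push_sigma.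

Definition weighted_image : {measure set Z -> \bar R} := P.

Lemma weighted_imageE B : weighted_image B = (\int[m1]_x ((w x)%:E * m2 (psec B x)))%E. Proof. by []. Qed.

Lemma weighted_push_integral (E : nat -> set Z) : (forall k, measurable (E k)) ->
  (\int[weighted_image]_z (\sum_(0 <= k <oo) (\1_(E k) z)%:E) =
   \int[m1]_x ((w x)%:E * \int[m2]_y (\sum_(0 <= k <oo) (\1_(E k) (Psi (x, y)))%:E)))%E.
Proof.
move=> mE; rewrite integral_nneseries//; last by move=> k; apply/measurable_EFinP; exact: measurable_indic.
rewrite (eq_eseriesr (g := fun k => (\int[m1]_x ((w x)%:E * m2 (psec (E k) x)))%E)); last first.
  by move=> k _; rewrite integral_indic// setIT.
rewrite -integral_nneseries//; last 2 first.
- by move=> k; apply: emeasurable_funM; [exact: mwE|exact: measurable_fun_psec].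
- by move=> k x _; rewrite mule_ge0// lee_fin.
apply: eq_integral => x _; rewrite nneseriesZl; last by move=> k _; exact: measure_ge0.
congr (_ * _)%E; rewrite integral_nneseries//; last first.
  move=> k; apply/measurable_EFinP; rewrite (_ : (fun _ => _) = \1_(psec (E k) x)).
    by apply: measurable_indic; exact: measurable_psec.
  by apply/funext => y; rewrite !indicE; congr (_%:R); apply/idP/idP => /set_mem h; apply/mem_set.
apply: eq_eseriesr => k _; rewrite (_ : (fun _ => _) = (fun y => (\1_(psec (E k) x) y)%:E)).
  by rewrite integral_indic// ?setIT//; exact: measurable_psec.
by apply/funext => y; rewrite !indicE; congr ((_%:R)%:E); apply/idP/idP => /set_mem h; apply/mem_set.
Qed.

End WeightedPush.

(* No measurability is needed: [nb_solutions] is not known to be measurable where it is infinite. *)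
Lemma le_lower_integral (R : realType) d (T : measurableType d) (m : {measure set T -> \bar R}) (f g : T -> \bar R) :
  (forall x, 0 <= f x)%E -> (forall x, f x <= g x)%E -> (\int[m]_x f x <= \int[m]_x g x)%E.
Proof.
move=> f0 fg; have g0 x : (0 <= g x)%E by apply: le_trans (fg x).
rewrite !ge0_integralTE//; apply: le_ereal_sup => _ [h hf <-]; exists h => // x.
exact: le_trans (hf x) (fg x).
Qed.

Section ProductOfSides.
Context (R : realType).

Definition sides n (A : 'I_n -> set R) : set (borel 'rV[R]_n) := fun t => forall i, A i ((t : 'rV[R]_n) 0 i).

Lemma measurable_sides n (A : 'I_n -> set R) : (forall i, measurable (A i)) -> measurable (sides A).
Proof.
move=> mA; rewrite (_ : sides A = \bigcap_(i in [set: 'I_n]) ((fun t : borel 'rV[R]_n => t 0 i) @^-1` A i)).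
  apply: fin_bigcap_measurable => // i _; rewrite -[X in measurable X]setTI.
  exact: (@measurable_coord R n i).
by apply/seteqP; split=> t h i; [move=> _; exact: h|exact: h].
Qed.

Lemma lebesgue_n_sides n (A : 'I_n -> set R) (l : 'I_n -> R) : (forall i, measurable (A i)) ->
  (forall i, lebesgue_measure (A i) = (l i)%:E) -> lebesgue_n (sides A) = (\prod_i l i)%:E.
Proof.
move=> mA lA.
elim: n A l mA lA => [|n IH] A l mA lA.
  rewrite big_ord0 (_ : sides A = box 0 0).
    by rewrite lebesgue_n_box ?/box_vol ?big_ord0// => -[].
  by apply/seteqP; split=> t _ [].
rewrite (@lebesgue_n_cons R n (sides A)); last exact: measurable_sides.
pose E := sides (fun i : 'I_n => A (rshift 1 i)).
have sE (x : R) : lebesgue_n [set y : borel 'rV[R]_n | @sides (1 + n) A (row_mx x%:M y : borel 'rV[R]_(1 + n))] =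
    ((\1_(A (@lshift 1 n 0)) x)%:E * lebesgue_n E)%E.
  rewrite indicE; have [xA|xA] := boolP (x \in A (@lshift 1 n 0)).
    rewrite mul1e; congr (lebesgue_n _); apply/seteqP; split=> y h i; first by have := h (rshift 1 i); rewrite row_mxEr.
    case: (splitP i) => j ij.
      have -> : i = @lshift 1 n 0 by apply: val_inj => /=; rewrite [LHS]ij (ord1 j).
      by rewrite row_mxEl mxE eqxx mulr1n; exact/set_mem.
    have -> : i = rshift 1 j by apply: val_inj.
    by rewrite row_mxEr; exact: h.
  rewrite mul0e (_ : [set y | _] = set0) ?measure0//; apply/seteqP; split=> // y /(_ (@lshift 1 n 0)).
  by rewrite row_mxEl mxE eqxx mulr1n => /mem_set; rewrite (negbTE xA).
under eq_integral do rewrite sE.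
rewrite ge0_integralZr//; last by apply/measurable_EFinP; apply: measurable_indic; exact: mA.
have -> : (\int[lebesgue_measure]_x (\1_(A (@lshift 1 n 0)) x)%:E = (l (@lshift 1 n 0))%:E)%E.
  by rewrite integral_indic//; [rewrite setIT; exact: lA|exact: mA].
rewrite (IH (fun i => A (rshift 1 i)) (fun i => l (rshift 1 i)))//.
rewrite -EFinM big_ord_recl; congr (_ * _)%:E; first by congr l; exact: val_inj.
by apply: eq_bigr => i _; congr l; exact: val_inj.
Qed.

End ProductOfSides.

Lemma EFin_Rint (R : realType) d (T : measurableType d) (m : {measure set T -> \bar R}) (f : T -> R) :
  (m setT < +oo)%E -> bounded_mfun f -> (\int[m]_x (f x)%:E)%E = (\int[m]_x f x)%:E.
Proof. by move=> mf bf; rewrite /Rintegral fineK//; apply: integrable_fin_num => //; exact: bounded_mfun_integrable. Qed.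

Section TotalHyperplane.
Context (R : realType) (V : vectType R).

(* [hyp] made total: it is not a hyperplane, and [AGr] fails, when p.1 = 0. *)
Definition hyp_total (p : 'rV[R]_(dim V) * R) : AGr_space (dualsp V) := if p.1 == 0 then set0 else hyp p.1 p.2.

Lemma hyp_total_neq0 c t : c != 0 -> hyp_total (c, t) = hyp c t.
Proof. by rewrite /hyp_total /= => /negbTE ->. Qed.

Lemma set0_notin_AGr : ~ AGr (set0 : AGr_space (dualsp V)).
Proof. by move=> [l [a [l0 e]]]; have [w] := hyperplane_nonempty a l0; rewrite -e. Qed.

Lemma measurable_hyp_total : measurable_fun setT (hyp_total : borel 'rV[R]_(dim V) * R -> borel (AGr_space (dualsp V))).
Proof.
have mD : measurable [set p : borel 'rV[R]_(dim V) * R | p.1 != 0].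
  exact: (open_prod_measurable (@open_nonzero_fst R (dim V))).
move=> _ B mB; rewrite setTI.
rewrite (_ : _ @^-1` _ = ([set p : borel 'rV[R]_(dim V) * R | p.1 != 0] `&`
    (fun p : borel 'rV[R]_(dim V) * R => hyp p.1 p.2 : borel (AGr_space (dualsp V))) @^-1` B) `|`
   (~` [set p : borel 'rV[R]_(dim V) * R | p.1 != 0] `&` [set p | B set0])).
  apply: measurableU; first exact: (measurable_hyp (V := V)).
  have [B0|B0] := pselect (B set0).
    have -> : [set _ : borel 'rV[R]_(dim V) * R | B set0] = setT by apply/seteqP; split.
    by rewrite setIT; exact: measurableC.
  have -> : [set _ : borel 'rV[R]_(dim V) * R | B set0] = set0 by apply/seteqP; split.
  by rewrite setI0.
apply/seteqP; split=> p; rewrite /preimage /hyp_total /=.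
  by case: eqVneq => h Bp; [right; split=> //; rewrite h eqxx|left].
by case=> -[h Bp]; case: eqVneq h => //.
Qed.

(** The intersection with [AGr] discards the value that [hyp_total] takes at c = 0. *)
Definition hsec (A : set (borel (AGr_space (dualsp V)))) (c : 'rV[R]_(dim V)) : set R :=
  [set t | (A `&` @AGr R (dualsp V)) (hyp_total (c, t))].

Lemma measurable_hsec_pair (A : set (borel (AGr_space (dualsp V)))) : measurable A ->
  measurable [set p : borel 'rV[R]_(dim V) * R | (A `&` @AGr R (dualsp V)) (hyp_total p)].
Proof.
move=> mA; rewrite -[X in measurable X]setTI; apply: measurable_hyp_total => //.
by apply: measurableI => //; exact: measurable_AGr.
Qed.

Lemma measurable_hsec A c : measurable A -> measurable (hsec A c).
Proof.
move=> /measurable_hsec_pair /(measurable_xsection (c : borel 'rV[R]_(dim V))).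
by congr measurable; apply/seteqP; split=> y; [move=> /set_mem|move=> h; apply/mem_set].
Qed.

Lemma measurable_fun_hsec A : measurable A ->
  measurable_fun setT (fun c : borel 'rV[R]_(dim V) => lebesgue_measure (hsec A c)).
Proof.
move=> /measurable_hsec_pair /(measurable_fun_xsection (@lebesgue_measure R)).
congr measurable_fun; apply/funext => c /=; congr (lebesgue_measure _).
by apply/seteqP; split=> y; [move=> /set_mem|move=> h; apply/mem_set].
Qed.

(** A hyperplane f = t in [hyperplanes_near k] has |t| at most k times the norm of the form given by
    f, which is controlled by [M]: the sections have bounded length, uniformly in [c]. *)
Lemma hsec_bound (M : R) : exists C : R, 0 <= C /\ forall k (A : set (borel (AGr_space (dualsp V)))) (c : 'rV[R]_(dim V)), measurable A ->
  A `<=` @hyperplanes_near R (dualsp V) k `|` ~` @AGr R (dualsp V) -> `|c| <= M -> (lebesgue_measure (hsec A c) <= (k%:R * C)%:E)%E.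
Proof.
have [B hB] : exists B : 'M[R]_(dim V, dim (dualsp (dualsp V))), forall c, v2r (bidual (r2v c : V)) = c *m B.
  apply: linear_mulmx => a u v; rewrite -linearP; congr v2r.
  by apply/lfunP => xi; rewrite add_lfunE scale_lfunE !bidualE !linearP.
exists (2 * (`|M| * mxsum B)); split; first by rewrite !mulr_ge0// mxsum_ge0.
move=> k A c mA AK cM.
pose r := k%:R * (`|M| * mxsum B); have r0 : 0 <= r by rewrite !mulr_ge0// mxsum_ge0.
have sub : hsec A c `<=` `[- r, r]%classic.
  move=> t [At AGt]; have [c0|c0] := eqVneq c 0.
    by move: AGt; rewrite /hyp_total c0 eqxx => /set0_notin_AGr.
  move: At AGt; rewrite hyp_total_neq0// => /AK[|//] + _.
  have b0 : v2r (bidual (r2v c : V)) != 0 by apply/r2v_neq0; rewrite v2rK; exact/bidual_neq0.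
  rewrite /hyp -[bidual _]v2rK => /(hyperplanes_nearE _ _ b0) h.
  rewrite /= in_itv /= -ler_norml; apply: le_trans h _; rewrite ler_wpM2l// hB.
  by apply: le_trans (rV_norm_mul _ _) _; rewrite ler_wpM2r ?mxsum_ge0// (le_trans cM)// ler_norm.
apply: (@le_trans _ _ (lebesgue_measure (`[- r, r]%classic : set R))).
  by apply: le_measure => //; apply/mem_set => //; exact: measurable_hsec.
by rewrite lebesgue_segment ?ge0_cp// lee_fin le_eqVlt; apply/orP; left; apply/eqP; rewrite /r; ring.
Qed.

End TotalHyperplane.

Section ProductSigned.
Unset Implicit Arguments.
Context (R : realType) (n : nat) (V : 'I_n -> vectType R).
Context (d : 'I_n -> measure_display) (T : forall i, measurableType (d i)).
Context (nu : forall i, {measure set (T i) -> \bar R}) (nuf : forall i, (nu i setT < +oo)%E).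
Context (phi : forall i, T i -> R) (bphi : forall i, bounded_mfun (phi i)).
Context (a : forall i, T i -> 'rV[R]_(dim (V i))) (ma : forall i, measurable_fun setT (a i : T i -> borel 'rV[R]_(dim (V i)))).
Context (M : R) (aM : forall i L, `|a i L| <= M) (a0 : forall i L, phi i L != 0 -> a i L != 0).
Context (Lam : {measure set (prodT T) -> \bar R}) (Lamf : (Lam setT < +oo)%E).
Context (LamP : forall g : forall k, T k -> R, (forall k, bounded_mfun (g k)) ->
  \int[Lam]_L (\prod_k g k (L k)) = \prod_k \int[nu k]_x g k x).
Set Implicit Arguments.

Local Notation W := (fun i => dualsp (V i)).

Definition Psi (p : prodT T * borel 'rV[R]_n) : AGr_tuple W := fun i => hyp_total (a i (p.1 i), (p.2 : 'rV[R]_n) 0 i).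

Lemma mPsi : measurable_fun setT Psi.
Proof.
apply: (@measurable_to_prodT _ _ (fun i => borel (AGr_space (W i)))) => i.
apply: (measurableT_comp (@measurable_hyp_total R (V i))); apply/measurable_fun_pairP; split.
  move=> _ B mB; rewrite setTI.
  have m1 := ma i measurableT _ mB; rewrite setTI in m1.
  have m2 := @measurable_proj n d T i measurableT _ m1; rewrite setTI in m2.
  by have := @measurable_fst _ _ (prodT T) (borel 'rV[R]_n) measurableT _ m2; rewrite setTI.
by apply: (measurableT_comp (@measurable_coord R n i)); exact: measurable_snd.
Qed.

Definition sfun (L : prodT T) : R := \prod_i phi i (L i).
Definition sp (L : prodT T) : R := Num.max (sfun L) 0.
Definition sn (L : prodT T) : R := Num.max (- sfun L) 0.

Lemma bounded_mfun_sfun : bounded_mfun sfun.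
Proof. by apply: bounded_mfun_prod => i; apply: (bounded_mfun_comp (bphi i)); exact: measurable_proj. Qed.

Lemma spsn L : sp L - sn L = sfun L.
Proof. by rewrite /sp /sn; case: (lerP (sfun L) 0) => h1; case: (lerP (- sfun L) 0) => h2; lra. Qed.

Lemma sp_ge0 L : 0 <= sp L. Proof. by rewrite /sp le_max lexx orbT. Qed.
Lemma sn_ge0 L : 0 <= sn L. Proof. by rewrite /sn le_max lexx orbT. Qed.

Lemma bounded_mfun_sp : bounded_mfun sp.
Proof.
have [ms [c hc]] := bounded_mfun_sfun; split; first by apply: measurable_funrpos.
by exists c => L; rewrite ger0_norm ?sp_ge0// /sp ge_max (le_trans (ler_norm _) (hc L)) (le_trans _ (hc L)).
Qed.

Lemma bounded_mfun_sn : bounded_mfun sn.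
Proof.
have [ms [c hc]] := bounded_mfun_sfun; split; first by apply: measurable_funrneg.
exists c => L; rewrite ger0_norm ?sn_ge0// /sn ge_max; apply/andP; split; apply: le_trans (hc L) => //.
by rewrite -normrN ler_norm.
Qed.

(** [Pm] and [Mm] are the images of the positive and the negative part of the product density. Their
    difference represents [Xi], but unlike the two parts of [Xi] they need not be mutually
    singular. *)
Definition Pm := weighted_image Lam (@lebesgue_n R n) (proj1 bounded_mfun_sp) sp_ge0 mPsi.
Definition Mm := weighted_image Lam (@lebesgue_n R n) (proj1 bounded_mfun_sn) sn_ge0 mPsi.

Section Box.
Unset Implicit Arguments.
Context (A : forall i, set (borel (AGr_space (W i)))) (mA : forall i, measurable (A i)).
Context (kA : 'I_n -> nat) (AK : forall i, A i `<=` @hyperplanes_near R (W i) (kA i) `|` ~` @AGr R (W i)).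

Set Implicit Arguments.

Definition ell i (L : T i) : R := fine (lebesgue_measure (hsec (A i) (a i L))).

Lemma ell_leb i L : lebesgue_measure (hsec (A i) (a i L)) = (ell L)%:E.
Proof.
have [C [C0 hC]] := @hsec_bound R (V i) M.
rewrite /ell fineK// ge0_fin_numE ?measure_ge0//.
by apply: le_lt_trans (hC _ _ _ (mA i) (AK i) (aM i L)) _; exact: ltry.
Qed.

Lemma bounded_mfun_ell i : bounded_mfun (@ell i).
Proof.
have [C [C0 hC]] := @hsec_bound R (V i) M; split; last first.
  exists ((kA i)%:R * C) => L; rewrite ger0_norm; last exact/fine_ge0/measure_ge0.
  by rewrite -lee_fin -ell_leb; exact: hC.
apply/measurable_EFinP; rewrite (_ : EFin \o _ = fun L : T i => lebesgue_measure (hsec (A i) (a i L))).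
  by apply: (measurableT_comp (measurable_fun_hsec (mA i))); exact: ma.
by apply/funext => L; rewrite /= ell_leb.
Qed.

Definition boxA : set (AGr_tuple W) := [set H | forall i, A i (H i)].

Lemma psec_box L : sfun L != 0 -> psec Psi boxA L = sides (fun i => hsec (A i) (a i (L i))).
Proof.
move=> s0; have c0 i : a i (L i) != 0.
  by apply: a0; apply: contra_neq s0 => p0; rewrite /sfun (bigD1 i)//= p0 mul0r.
apply/seteqP; split=> t h i; have := h i; rewrite /hsec /Psi /=.
  by move=> At; split=> //; rewrite hyp_total_neq0; [apply: AGr_hyp; exact: c0|exact: c0].
by case.
Qed.

Lemma weighted_push_box (w : prodT T -> R) (bw : bounded_mfun w) (w0 : forall L, 0 <= w L) : (forall L, sfun L = 0 -> w L = 0) ->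
  weighted_image Lam (@lebesgue_n R n) (proj1 bw) w0 mPsi boxA = (\int[Lam]_L (w L * \prod_i ell (L i)))%:E.
Proof.
move=> ws; have bl : bounded_mfun (fun L : prodT T => \prod_i ell (L i)).
  by apply: bounded_mfun_prod => i; apply: (bounded_mfun_comp (@bounded_mfun_ell i)); exact: measurable_proj.
rewrite -EFin_Rint//; last exact: bounded_mfunM.
rewrite weighted_imageE; apply: eq_integral => L _; have [s0|s0] := eqVneq (sfun L) 0.
  by rewrite ws// mul0r mul0e.
rewrite EFinM; congr (_ * _)%E; rewrite psec_box//; apply: lebesgue_n_sides => i; last exact: ell_leb.
exact: measurable_hsec.
Qed.

End Box.

Context (mu : forall i, AGr_measure (W i)) (Xi : signed_measure (AGr_tuple W) R).
Hypothesis Hoff : forall i (A : set (borel (AGr_space (W i)))), measurable A -> smeasure (mu i) A = smeasure (mu i) (A `&` @AGr R (W i)).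
Hypothesis Hhyp : forall i (A : set (borel (AGr_space (W i)))), measurable A -> A `<=` @AGr R (W i) -> finite_mass (mu i) A ->
  smeasure (mu i) A = (\int[nu i]_L ((phi i L)%:E * lebesgue_measure [set t : R | A (hyp (a i L) t)]))%E.
Hypothesis Hfin : forall i (A : set (borel (AGr_space (W i)))) k, measurable A -> A `<=` @hyperplanes_near R (W i) k `|` ~` @AGr R (W i) -> finite_mass (mu i) A.
Hypothesis HXi : is_product_measure mu Xi.

(** On a box of sets of finite mass the value of [Xi] is the product of the one-factor formulas,
    i.e. the integral of the product density times the product of the section lengths. Written as an
    equality of sums it is fit for measures of infinite total mass. *)
Lemma Xi_box (A : forall i, set (borel (AGr_space (W i)))) (kA : 'I_n -> nat) : (forall i, measurable (A i)) ->
  (forall i, A i `<=` @hyperplanes_near R (W i) (kA i) `|` ~` @AGr R (W i)) ->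
  [/\ pos_part Xi (boxA A) \is a fin_num, neg_part Xi (boxA A) \is a fin_num,
      Pm (boxA A) \is a fin_num, Mm (boxA A) \is a fin_num &
      (pos_part Xi (boxA A) + Mm (boxA A) = neg_part Xi (boxA A) + Pm (boxA A))%E].
Proof.
move=> mA AK; have := HXi (fun i => conj (mA i) (Hfin (mA i) (AK i))).
rewrite -/(boxA A) /smeasure => e.
have mu_ell i : fine (smeasure (mu i) (A i)) = \int[nu i]_L (phi i L * ell A L).
  rewrite Hoff// Hhyp; last 3 first.
  - by apply: measurableI => //; exact: measurable_AGr.
  - by move=> H [].
  - by apply: (Hfin (k := kA i)); [apply: measurableI => //; exact: measurable_AGr|move=> H [/AK]].
  rewrite /Rintegral; congr fine; apply: eq_integral => L _.
  have [p0|p0] := eqVneq (phi i L) 0; first by rewrite p0 mul0r mul0e.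
  rewrite EFinM -(ell_leb mA AK); congr (_ * lebesgue_measure _)%E.
  by apply/seteqP; split=> t; rewrite /hsec /= hyp_total_neq0//; exact: a0.
have hp L : sfun L = 0 -> sp L = 0 by rewrite /sp => ->; rewrite maxxx.
have hn L : sfun L = 0 -> sn L = 0 by rewrite /sn => ->; rewrite oppr0 maxxx.
have PE := weighted_push_box mA AK bounded_mfun_sp sp_ge0 hp; have ME := weighted_push_box mA AK bounded_mfun_sn sn_ge0 hn.
have bl : bounded_mfun (fun L : prodT T => \prod_i ell A (L i)).
  by apply: bounded_mfun_prod => i; apply: (bounded_mfun_comp (@bounded_mfun_ell A mA kA AK i)); exact: measurable_proj.
have PM : \int[Lam]_L (sp L * \prod_i ell A (L i)) - \int[Lam]_L (sn L * \prod_i ell A (L i)) =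
    \prod_i fine (smeasure (mu i) (A i)).
  rewrite -mulN1r -(RintZ Lamf); last exact: bounded_mfunM bounded_mfun_sn bl.
  rewrite -(RintD Lamf); [|exact: bounded_mfunM bounded_mfun_sp bl|by apply: bounded_mfunM; [exact: bounded_mfun_cst|exact: bounded_mfunM bounded_mfun_sn bl]].
  under [RHS]eq_bigr do rewrite mu_ell.
  rewrite -(LamP (fun k L => phi k L * ell A L) (fun k => bounded_mfunM (bphi k) (@bounded_mfun_ell A mA kA AK k))).
  apply: eq_Rintegral => L _; rewrite big_split /= -/(sfun L) -spsn; ring.
rewrite -PM in e; rewrite /Pm /Mm PE ME; split=> //.
(* A difference of extended reals is real only if both terms are. *)
- by move: e; case: (pos_part Xi (boxA A)) => // ; case: (neg_part Xi (boxA A)).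
- by move: e; case: (neg_part Xi (boxA A)) => // ; case: (pos_part Xi (boxA A)).
move: e; case: (pos_part Xi (boxA A)) => [p||]; case: (neg_part Xi (boxA A)) => [q||] //= [e].
by congr EFin; lra.
Qed.

(* Xi is a difference of two measures in two ways, since Xi and the image of the weighted product agree on boxes. *)
Lemma Xi_eq B : measurable B -> (pos_part Xi B + Mm B = neg_part Xi B + Pm B)%E.
Proof.
(* The points that are not hyperplanes are kept, the measures [mu i] being 0 there: these sets then
   exhaust the whole ambient type. *)
pose Ak (k : nat) i := @hyperplanes_near R (W i) k `|` ~` @AGr R (W i).
have mAk k i : measurable (Ak k i : set (borel (AGr_space (W i)))).
  by apply: measurableU; [exact: measurable_hyperplanes_near|apply: measurableC; exact: measurable_AGr].
(* A family stable under intersection that generates the product sigma-algebra and contains an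
   exhausting sequence of finite mass, as the uniqueness theorem for measures requires. *)
pose G : set (set (AGr_tuple W)) := [set B | exists (A : forall i, set (borel (AGr_space (W i)))) (kA : 'I_n -> nat),
  [/\ forall i, measurable (A i), forall i, A i `<=` Ak (kA i) i & B = boxA A]].
have mG C : G C -> measurable C.
  move=> [A [kA [mA _ ->]]]; rewrite (_ : boxA A = \bigcap_(i in [set: 'I_n]) [set H : AGr_tuple W | A i (H i)]).
    by apply: fin_bigcap_measurable => // i _; apply: sub_gen_smallest; exists i, (A i).
  by apply/seteqP; split=> H h i; [move=> _; exact: h|exact: h].
have KAub k k' i : (k <= k')%N -> @hyperplanes_near R (W i) k `<=` @hyperplanes_near R (W i) k'.
  elim: k' => [|k' IH]; first by rewrite leqn0 => /eqP ->.
  rewrite leq_eqVlt => /predU1P[->//|]; rewrite ltnS => /IH h H /h; exact: hyperplanes_near_nd.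
have cov i (H : AGr_space (W i)) : exists k0, forall k, (k0 <= k)%N -> Ak k i H.
  have [AH|nH] := pselect (AGr H); last by exists 0%N => k _; right.
  have : (\bigcup_k @hyperplanes_near R (W i) k) H by rewrite bigcup_hyperplanes_near.
  by case=> k0 _ Hk; exists k0 => k kk; left; exact: KAub Hk.
have covT (H : AGr_tuple W) : exists k, forall i, Ak k i (H i).
  have [k0 hk] := choice (fun i => cov i (H i)).
  exists (\max_i k0 i)%N => i; apply: hk; exact: leq_bigmax.
move=> mB.
have : measure_add (pos_part Xi) Mm B = measure_add (neg_part Xi) Pm B; last by rewrite !measure_addE.
apply: (@measure_unique _ R (AGr_tuple W) G (fun k => boxA (Ak k))) => //.
- apply/seteqP; split.
    apply: smallest_sub; first exact: smallest_sigma_algebra.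
    move=> _ [i [C [mC ->]]].
    (* Factor [i] is constrained by [C] and the others are not; [ecast] transports a point of factor
       [j] along a proof of j = i. *)
    have -> : [set H : AGr_tuple W | C (H i)] = \bigcup_k boxA (fun j => Ak k j `&` [set H : AGr_space (W j) | forall e : j = i, C (ecast z (AGr_space (W z)) e H)]).
      apply/seteqP; split=> [H CH|H [k _ /(_ i)[_ /(_ erefl)]]//].
      have [k hk] := covT H; exists k => // j; split=> // e; subst j; exact: CH.
    apply: (@bigcup_measurable _ (g_sigma_algebraType G)) => k _; apply: sub_gen_smallest.
    exists (fun j => Ak k j `&` [set H : AGr_space (W j) | forall e : j = i, C (ecast z (AGr_space (W z)) e H)]), (fun=> k).
    split; [move=> j|by move=> j H []|by []]; apply: measurableI => //.
    have [ji|ji] := eqVneq j i.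
      subst j; suff -> : [set H : AGr_space (W i) | forall e : i = i, C (ecast z (AGr_space (W z)) e H)] = C by exact: mC.
      apply/seteqP; split=> H; first by move=> /(_ erefl).
      by move=> CH e; rewrite eq_axiomK.
    suff -> : [set H : AGr_space (W j) | forall e : j = i, C (ecast z (AGr_space (W z)) e H)] = setT by exact: measurableT.
    by apply/seteqP; split=> // H _ e; have /eqP := ji; case.
  by apply: smallest_sub; [exact: (@sigma_algebra_measurable _ (AGr_tuple W))|exact: mG].
- move=> _ _ [A [kA [mA AK ->]]] [C [kC [mC CK ->]]].
  exists (fun i => A i `&` C i), kA; split=> [i|i H [/AK]//|]; first exact: measurableI.
  by apply/seteqP; split=> H; [move=> [h1 h2] i; split|move=> h; split=> i; have [] := h i].
- by move=> k; exists (Ak k), (fun=> k); split=> // i; exact: subset_refl.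
- by apply/seteqP; split=> // H _; have [k hk] := covT H; exists k.
- move=> _ [A [kA [mA AK ->]]]; have [_ _ _ _ h] := Xi_box mA AK.
  change (measure_add (pos_part Xi) Mm (boxA A) = measure_add (neg_part Xi) Pm (boxA A)).
  by rewrite !measure_addE.
- move=> k; change (measure_add (pos_part Xi) Mm (boxA (Ak k)) < +oo)%E; rewrite measure_addE.
  have [f1 f2 f3 f4 _] := Xi_box (mAk k) (fun i => @subset_refl _ (Ak k i)).
  by rewrite lte_add_pinfty// -ge0_fin_numE// measure_ge0.
Qed.

(* The Jordan decomposition is the smallest one. *)
Lemma Xi_le B : measurable B -> (pos_part Xi B <= Pm B)%E /\ (neg_part Xi B <= Mm B)%E.
Proof.
move=> mB; have [D [mD pD nD]] := jordan_singular Xi.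
have split (m : {measure set (AGr_tuple W) -> \bar R}) E : measurable E -> m (~` E) = 0%E -> m B = m (B `&` E).
  move=> mE mE0; rewrite -[in LHS](setUIDK B E) measureU//; last 3 first.
  - exact: measurableI.
  - exact: measurableD.
  - by rewrite setDE setICA -setIA setICr !setI0.
  rewrite [X in (_ + X)%E](_ : _ = 0%E) ?adde0//.
  by apply: (subset_measure0 _ _ _ mE0); [exact: measurableD|exact: measurableC|move=> H []].
have null (m : {measure set (AGr_tuple W) -> \bar R}) E : measurable E -> m E = 0%E -> m (B `&` E) = 0%E.
  by move=> mE mE0; apply: (subset_measure0 _ _ _ mE0); [exact: measurableI|exact: mE|move=> H []].
have mono (m : {measure set (AGr_tuple W) -> \bar R}) E : measurable E -> (m (B `&` E) <= m B)%E.
  move=> mE; apply: le_measure; [apply/mem_set; exact: measurableI|exact/mem_set|exact: subIsetl].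
split.
  (* The negative part of [Xi] is 0 on [D], so there [Xi_eq] bounds the positive part by [Pm]. *)
  rewrite (split _ D)//; apply: (@le_trans _ _ (pos_part Xi (B `&` D) + Mm (B `&` D))%E).
    by rewrite leeDl// measure_ge0.
  rewrite Xi_eq; last exact: measurableI.
  rewrite (null (neg_part Xi) D)//.
  by rewrite add0e; exact: mono.
rewrite (split _ (~` D)) ?setCK//; last exact: measurableC.
apply: (@le_trans _ _ (neg_part Xi (B `&` ~` D) + Pm (B `&` ~` D))%E).
  by rewrite leeDl// measure_ge0.
rewrite -Xi_eq; last by apply: measurableI => //; exact: measurableC.
rewrite (null (pos_part Xi) (~` D))//; last exact: measurableC.
by rewrite add0e; apply: mono; exact: measurableC.
Qed.

End ProductSigned.

(** * Integrals of counting functions against signed measures *)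

(** The layer cake form of a function with values in the extended naturals: with E k = {f > k} the
    sum is f. *)
Definition layer (R : realType) {T : Type} (E : nat -> set T) (z : T) : \bar R :=
  (\sum_(0 <= k <oo) (\1_(E k) z)%:E)%E.

Section LayerIntegral.
Context (R : realType) d (T : measurableType d).
Implicit Types (m p q P M : {measure set T -> \bar R}) (E : nat -> set T).

Lemma layer_ge0 E z : (0 <= layer R E z)%E.
Proof. by apply: nneseries_ge0 => k _ _; rewrite lee_fin. Qed.

Lemma measurable_layer E : (forall k, measurable (E k)) -> measurable_fun setT (layer R E).
Proof.
move=> mE; apply: ge0_emeasurable_sum => // k _; apply/measurable_EFinP; exact: measurable_indic.
Qed.

Lemma integral_layer m E : (forall k, measurable (E k)) -> (\int[m]_z layer R E z = \sum_(0 <= k <oo) m (E k))%E.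
Proof.
move=> mE; rewrite integral_nneseries//; last by move=> k; apply/measurable_EFinP; exact: measurable_indic.
by apply: eq_eseriesr => k _; rewrite integral_indic// setIT.
Qed.

(** Only positive measures are integrated: the identity p + M = q + P is summed over the layers, and
    the finiteness of the integrals against P and M, which dominate p and q, allows terms to be
    moved across. *)
Lemma signed_layer p q P M E : (forall k, measurable (E k)) ->
  (forall B, measurable B -> p B + M B = q B + P B)%E ->
  (forall B, measurable B -> p B <= P B /\ q B <= M B)%E ->
  (\int[P]_z layer R E z < +oo)%E -> (\int[M]_z layer R E z < +oo)%E ->
  [/\ (\int[p]_z layer R E z < +oo)%E, (\int[q]_z layer R E z < +oo)%E &
      (\int[p]_z layer R E z - \int[q]_z layer R E z = \int[P]_z layer R E z - \int[M]_z layer R E z)%E].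
Proof.
move=> mE eqm lem fP fM.
have fp : (\int[p]_z layer R E z < +oo)%E.
  by apply: le_lt_trans fP; rewrite !integral_layer//; apply: lee_nneseries => // k _; have [] := lem _ (mE k).
have fq : (\int[q]_z layer R E z < +oo)%E.
  by apply: le_lt_trans fM; rewrite !integral_layer//; apply: lee_nneseries => // k _; have [] := lem _ (mE k).
split=> //.
have e : (\int[p]_z layer R E z + \int[M]_z layer R E z = \int[q]_z layer R E z + \int[P]_z layer R E z)%E.
  by rewrite !integral_layer// -!nneseriesD//; apply: eq_eseriesr => k _; exact: eqm.
have n0 m : (0 <= \int[m]_z layer R E z)%E by apply: integral_ge0 => z _; exact: layer_ge0.
move: e fp fq fP fM (n0 p) (n0 q) (n0 P) (n0 M).
do 4![case: (\int[_]_z _)%E => [?||] //] => -[e] _ _ _ _ _ _ _ _.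
by rewrite -!EFinB; congr EFin; lra.
Qed.

(** The layer sum has a finite integral, so it is finite almost everywhere, and there [f] equals it.
    The inequalities go through [le_lower_integral], no measurability of [f] being at hand. *)
Lemma integral_eq_layer p E (f : T -> \bar R) : (forall k, measurable (E k)) ->
  (forall z, 0 <= f z <= layer R E z)%E -> (forall z, layer R E z < +oo -> f z = layer R E z)%E ->
  (\int[p]_z layer R E z < +oo)%E -> (\int[p]_z f z = \int[p]_z layer R E z)%E.
Proof.
move=> mE f0 fE fin; apply/eqP; rewrite eq_le; apply/andP; split.
  by apply: le_lower_integral => z; have /andP[] := f0 z.
pose D := [set z | (layer R E z < +oo)%E].
have mD : measurable D.
  rewrite (_ : D = layer R E @^-1` [set~ +oo%E]).
    by rewrite -[X in measurable X]setTI; apply: measurable_layer => //; exact: measurableC.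
  by apply/seteqP; split=> z; rewrite /D /= ltey => /eqP.
have int : p.-integrable setT (layer R E).
  apply/integrableP; split; first exact: measurable_layer.
  by under eq_integral do rewrite gee0_abs ?layer_ge0//.
have ND : p (~` D) = 0%E.
  have [A [mA A0 sA]] := integrable_ae measurableT int.
  apply: (subset_measure0 _ _ _ A0) => //; first exact: measurableC.
  move=> z nz; apply: sA => h; apply: nz; rewrite /D /= ltey.
  by have := h I; rewrite fin_numE => /andP[].
rewrite (ge0_negligible_integral (N := ~` D) _ _ _ _ ND)//; last 3 first.
- exact: measurableC.
- exact: measurable_layer.
- by move=> z _; exact: layer_ge0.
rewrite setTD setCK integral_mkcond; apply: le_lower_integral => z; rewrite /patch; case: ifPn => //.
- by move=> _; exact: layer_ge0.
- by move=> zD; rewrite fE//; exact/set_mem.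
by move=> _; have /andP[] := f0 z.
Qed.

End LayerIntegral.

Section SignedAverage.
Unset Implicit Arguments.
Context (R : realType) (n : nat) (V : 'I_n -> vectType R).
Context (d : 'I_n -> measure_display) (T : forall i, measurableType (d i)).
Context (phi : forall i, T i -> R) (bphi : forall i, bounded_mfun (phi i)).
Context (a : forall i, T i -> 'rV[R]_(dim (V i))) (ma : forall i, measurable_fun setT (a i : T i -> borel 'rV[R]_(dim (V i)))).
Context (Lam : {measure set (prodT T) -> \bar R}) (Lamf : (Lam setT < +oo)%E).
Set Implicit Arguments.

Local Notation W := (fun i => dualsp (V i)).
Context (Xi : signed_measure (AGr_tuple W) R).
Local Notation Pm := (@Pm R n V d T phi bphi a ma Lam).
Local Notation Mm := (@Mm R n V d T phi bphi a ma Lam).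
Local Notation Psi := (@Psi R n V d T a).
Local Notation sfun := (@sfun R n d T phi).
Hypothesis HE : forall B, measurable B -> (pos_part Xi B + Mm B = neg_part Xi B + Pm B)%E.
Hypothesis HL : forall B, measurable B -> (pos_part Xi B <= Pm B)%E /\ (neg_part Xi B <= Mm B)%E.

(** [C] bounds the inner integral wherever the product density is nonzero, which makes both iterated
    integrals finite; where the density is 0 the integrand is 0 whatever the inner integral. *)
Lemma signed_average (E : nat -> set (AGr_tuple W)) (f : AGr_tuple W -> \bar R) (C : R) : 0 <= C ->
  (forall k, measurable (E k)) ->
  (forall z : AGr_tuple W, 0 <= f z <= layer R E z)%E -> (forall z : AGr_tuple W, layer R E z < +oo -> f z = layer R E z)%E ->
  (forall L, sfun L != 0 -> (\int[@lebesgue_n R n]_t layer R E (Psi (L, t)) <= C%:E)%E) ->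
  bounded_mfun (fun L => sfun L * fine (\int[@lebesgue_n R n]_t layer R E (Psi (L, t)))%E) /\
  Defs.sintegral Xi f = (\int[Lam]_L (sfun L * fine (\int[@lebesgue_n R n]_t layer R E (Psi (L, t)))%E))%:E.
Proof.
move=> C0 mE f0 fE IC.
pose I L := (\int[@lebesgue_n R n]_t layer R E (Psi (L, t)))%E.
have I0 L : (0 <= I L)%E by apply: integral_ge0 => t _; exact: layer_ge0.
have mPsi := @mPsi R n V d T a ma.
have mI : measurable_fun setT I.
  have -> : I = fun L => (\sum_(0 <= k <oo) @lebesgue_n R n (psec Psi (E k) L))%E.
    apply/funext => L; rewrite /I -integral_layer; last by move=> k; exact: measurable_psec.
    apply: eq_integral => t _; by apply: eq_eseriesr => k _; rewrite !indicE.
  apply: ge0_emeasurable_sum => // k _; exact: measurable_fun_psec.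
have Ifin L : sfun L != 0 -> I L \is a fin_num.
  by move=> s0; rewrite ge0_fin_numE//; apply: le_lt_trans (IC L s0) _; exact: ltry.
have bI (w : prodT T -> R) : bounded_mfun w -> (forall L, sfun L = 0 -> w L = 0) ->
    bounded_mfun (fun L => w L * fine (I L)) /\
    (\int[Lam]_L ((w L)%:E * I L))%E = (\int[Lam]_L (w L * fine (I L)))%:E.
  move=> bw ws; have b : bounded_mfun (fun L => w L * fine (I L)).
    have [mw [c hc]] := bw; split.
      apply: measurable_funM => //; exact: (measurableT_comp (@fine_measurable R setT measurableT)).
    exists (c * C) => L; rewrite normrM; have [s0|s0] := eqVneq (sfun L) 0.
      rewrite ws// normr0 mul0r mulr_ge0//; apply: le_trans (hc L); exact: normr_ge0.
    rewrite ler_pM// ger0_norm; last exact: fine_ge0.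
    by rewrite -lee_fin fineK ?Ifin//; exact: IC.
  split=> //; rewrite -EFin_Rint//; apply: eq_integral => L _.
  have [s0|s0] := eqVneq (sfun L) 0; first by rewrite ws// mul0r mul0e.
  by rewrite EFinM fineK ?Ifin.
have bs := @bounded_mfun_sfun R n d T phi bphi.
have hp L : sfun L = 0 -> @sp R n d T phi L = 0 by rewrite /sp => ->; rewrite maxxx.
have hn L : sfun L = 0 -> @sn R n d T phi L = 0 by rewrite /sn => ->; rewrite oppr0 maxxx.
have bp := @bounded_mfun_sp R n d T phi bphi; have bn := @bounded_mfun_sn R n d T phi bphi.
have [bs' _] := bI _ bs (fun L h => h); split=> //.
have PE : (\int[Pm]_z layer R E z = (\int[Lam]_L (@sp R n d T phi L * fine (I L)))%:E)%E.
  by rewrite -(bI _ bp hp).2; exact: weighted_push_integral.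
have ME : (\int[Mm]_z layer R E z = (\int[Lam]_L (@sn R n d T phi L * fine (I L)))%:E)%E.
  by rewrite -(bI _ bn hn).2; exact: weighted_push_integral.
have [||fp fq e] := signed_layer mE HE HL; [by rewrite PE ltry|by rewrite ME ltry|].
rewrite /Defs.sintegral (integral_eq_layer mE f0 fE fp) (integral_eq_layer mE f0 fE fq) e PE ME -EFinB.
congr EFin; have [bp' _] := bI _ bp hp; have [bn' _] := bI _ bn hn.
rewrite -mulN1r -(RintZ Lamf)// -(RintD Lamf)//; last by apply: bounded_mfunM => //; exact: bounded_mfun_cst.
by apply: eq_Rintegral => L _; rewrite -(spsn phi); ring.
Qed.

End SignedAverage.

(** * The maps theta, the bodies and the systems in chart coordinates *)

Section StrictCombinations.
Context (R : realType) (n : nat).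

Lemma strict_deriv_mulmx m p (F : 'rV[R]_n -> 'rV[R]_m) x L (B : 'M[R]_(m, p)) : strict_deriv F x L ->
  strict_deriv (fun q => F q *m B) x (L *m B).
Proof.
move=> sF e e0; have S0 : 0 < mxsum B + 1 by rewrite ltr_wpDl// mxsum_ge0.
have [d d0 h] := sF (e / (mxsum B + 1)) (divr_gt0 e0 S0); exists d => // y z yd zd.
rewrite mulmxA -!mulmxBl; apply: le_trans (rV_norm_mul _ _) _.
apply: le_trans (ler_wpM2r (mxsum_ge0 _) (h y z yd zd)) _.
rewrite mulrAC ler_wpM2r// mulrAC -mulrA; apply: ler_piMr; first exact: ltW.
by rewrite ler_pdivrMr// mul1r lerDl.
Qed.

Lemma strict_deriv_row m (f : 'I_m -> 'rV[R]_n -> R) x (l : 'I_m -> 'cV[R]_n) :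
  (forall i, strict_deriv (fun q => (f i q)%:M : 'rV[R]_1) x (l i)) ->
  strict_deriv (fun q => \row_i f i q) x (\matrix_(a, i) l i a 0).
Proof.
move=> sf e e0.
have [d hd] := choice (fun j => let: ex_intro2 d d0 h := sf j e e0 in ex_intro (fun d => 0 < d /\ _) d (conj d0 h)).
pose D := \big[Num.min/1]_j d j.
have D0 : 0 < D by apply: lt_bigmin => // j _; have [] := hd j.
exists D => // y z yD zD; apply: rV_norm_le => [|j]; first by rewrite mulr_ge0// ltW.
have [_ h] := hd j; have := h y z (lt_le_trans yD (bigmin_le _ _ _)) (lt_le_trans zD (bigmin_le _ _ _)).
move=> h1; apply: le_trans (le_trans (rV_coord_le _ (0 : 'I_1)) h1).
rewrite !mxE !eqxx !mulr1n le_eqVlt; apply/orP; left; apply/eqP; congr (`|_ - _|).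
by apply: eq_bigr => i _; rewrite !mxE.
Qed.

End StrictCombinations.

Section ChartCoordinates.
Context (R : realType) (n : nat) (X : manifold R n).
Implicit Types (V : function_space X) (k : nat) (x : X).

Lemma local_repE (W : pointedType) (c : chart R n X) (F : X -> W) x : dom c x -> local_rep c F (fwd c x) = F x.
Proof.
move=> dx; apply: get_unique; first by exists x.
move=> w [y [dy e] <-]; have -> // : y = x by apply: (fwd_inj (c := c)) => //; exact/mem_set.
Qed.

Definition img k : set 'rV[R]_n := fwd (atlas X k) @` dom (atlas X k).

Lemma open_img k : open (img k).
Proof. by apply: fwd_open => //; exact: dom_open. Qed.

(* The map theta_V in the chart k, in the basis dual to [vbase]. *)
Definition th V k (q : 'rV[R]_n) : 'rV[R]_(dim V) := \row_a local_rep (atlas X k) (fun_of (vbase a : V)) q.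

Lemma fun_of0 V x : fun_of (0 : V) x = 0.
Proof. by have := fun_of_linear 1 (0 : V) 0 x; rewrite scaler0 addr0 mul1r => h; lra. Qed.

Lemma fun_of_sum V x (I : finType) (c : I -> R) (f : I -> V) :
  fun_of (\sum_i c i *: f i) x = \sum_i c i * fun_of (f i) x.
Proof.
elim/big_rec2: _ => [|i u v _ <-]; first exact: fun_of0.
exact: fun_of_linear.
Qed.

Lemma fun_ofE V k x (f : V) : dom (atlas X k) x -> fun_of f x = dot (v2r f) (th V k (fwd (atlas X k) x)).
Proof.
move=> dx; rewrite {1}(vbase_sum f) fun_of_sum dotE; apply: eq_bigr => a _.
by rewrite mxE local_repE.
Qed.

Lemma th_C1 V k j : Ck_on 1 (img k) (fun q => th V k q 0 j).
Proof.
rewrite (_ : (fun _ => _) = local_rep (atlas X k) (fun_of (vbase j : V))).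
  exact: (fun_of_smooth (vbase j : V) k 1%N).
by apply/funext => q; rewrite mxE.
Qed.

Lemma th_strict V k q : img k q -> strict_deriv (th V k) q (jac (th V k) q).
Proof. by move=> kq; have h := @C1_strict_deriv R n (dim V) (img k) (th V k) q (@open_img k) kq (@th_C1 V k); exact: h. Qed.

Lemma th_continuous V k q : img k q -> {for q, continuous (th V k)}.
Proof. by move=> /(@th_strict V)/strict_deriv_diff[/differentiable_continuous]. Qed.

(* Row a is the differential of the basis function [vbase a]. *)
Definition eval_jac V k q : 'M[R]_(dim V, n) := (jac (th V k) q)^T.

Lemma eval_jac_continuous V k q i j : img k q -> {for q, continuous (fun q => eval_jac V k q i j)}.
Proof.
move=> kq; rewrite (_ : (fun _ => _) = fun q => jac (th V k) q j i); last by apply/funext => z; rewrite mxE.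
have h := @jac_continuous R n (dim V) (img k) (th V k) q j i kq (@th_C1 V k); exact: h.
Qed.

Lemma dual_of_linear V : exists B : 'M[R]_(dim V, dim (dualsp V)), forall y, v2r (dual_of y : dualsp V) = y *m B.
Proof.
apply: linear_mulmx => a u v; rewrite -linearP; congr v2r.
apply/lfunP => f; rewrite add_lfunE scale_lfunE !dual_ofE dotDl dotZl //.
Qed.

Lemma thetaE V x k : dom (atlas X k) x -> theta V x = dual_of (th V k (fwd (atlas X k) x)).
Proof.
move=> dx; apply/lfunP => f; rewrite dual_ofE dotC -fun_ofE//.
pose ev : V -> R^o := fun f => fun_of f x.
pose L := GRing.isLinear.Build R V R^o *:%R ev (fun a u v => fun_of_linear a u v x).
pose ev' : {linear V -> R^o} := HB.pack ev L.
exact: (lfunE ev').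
Qed.

(** In a chart [theta V] is [th V k] followed by the linear map [dual_of], and the derivative of
    [th] is known. *)
Lemma tdiff_theta V x (v : 'rV[R]_n) : tdiff (theta V) x v =
  dual_of (v *m jac (th V (chart_idx x)) (fwd (chart_at x) x)).
Proof.
pose k := chart_idx x.
have dx : dom (atlas X k) x by rewrite /k /chart_idx; case: ex_minnP => m /asboolP.
have [B hB] := dual_of_linear V.
have kx : img k (fwd (atlas X k) x) by exists x.
set F := local_rep (atlas X k) (v2r \o theta V).
have sF : strict_deriv F (fwd (atlas X k) x) (jac (th V k) (fwd (atlas X k) x) *m B).
  have /nbhs_ballP[d0 /= d00 hd] : nbhs (fwd (atlas X k) x) (img k) by apply: open_nbhs_nbhs; split => //; exact: open_img.
  have FE y : img k y -> F y = th V k y *m B.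
    by move=> [z dz <-]; rewrite /F local_repE//= (thetaE V dz) hB.
  move=> e e0; have [d dp h] := strict_deriv_mulmx B (th_strict V kx) e0.
  (* [local_rep] is arbitrary outside the image of the chart, so the radius is cut down to stay
     inside it. *)
  exists (Num.min d d0) => [|y z]; first by rewrite lt_min dp.
  rewrite !lt_min => /andP[y1 y2] /andP[z1 z2].
  rewrite !FE; first exact: h.
    by apply: hd; rewrite -ball_normE /= distrC.
  by apply: hd; rewrite -ball_normE /= distrC.
have [_ dF] := strict_deriv_diff sF.
have E u : r2v ('d F (fwd (atlas X k) x) u) = dual_of (u *m jac (th V k) (fwd (atlas X k) x)) :> dualsp V.
  by rewrite dF mulmxA -hB v2rK.
rewrite /tdiff /chart_at -/k -/F.
pose D : 'rV[R]_n -> dualsp V := fun u => r2v ('d F (fwd (atlas X k) x) u).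
have Dl a u w : D (a *: u + w) = a *: D u + D w.
  rewrite /D !E; apply/lfunP => f; rewrite add_lfunE scale_lfunE !dual_ofE mulmxDl dotDl -scalemxAl dotZl //.
pose D' : {linear 'rV[R]_n -> dualsp V} := HB.pack D (GRing.isLinear.Build R _ _ *:%R D Dl).
by rewrite -E; exact: (lfunE D').
Qed.

(** In canonical coordinates the fibre of the body is therefore the image of the unit ball [K0]
    under the matrix [eval_jac]. *)
Lemma body_coordinates V x (f : V) :
  \row_j (adjoint (tdiff (theta V) x) (bidual f) (delta_mx 0 j : 'rV[R]_n) : R) =
  v2r f *m eval_jac V (chart_idx x) (fwd (chart_at x) x).
Proof.
apply/rowP => j; rewrite mxE comp_lfunE bidualE tdiff_theta dual_ofE dotC dotE mxE.
apply: eq_bigr => a _; congr (_ * _); rewrite [RHS]mxE -rowE [LHS]mxE //.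
Qed.

End ChartCoordinates.

Section SystemCoordinates.
Context (R : realType) (n : nat) (X : manifold R n) (V : 'I_n -> function_space X).

Definition system_map k (c : forall i, 'rV[R]_(dim (V i))) (q : 'rV[R]_n) : 'rV[R]_n := \row_i dot (c i) (th (V i) k q).
Definition system_jac k (c : forall i, 'rV[R]_(dim (V i))) (q : 'rV[R]_n) : 'M[R]_n := \matrix_(i, j) (c i *m eval_jac (V i) k q) 0 j.

Lemma system_map_strict k c q : img X k q -> strict_deriv (system_map k c) q (system_jac k c q)^T.
Proof.
move=> kq; have -> : (system_jac k c q)^T = \matrix_(a, i) (jac (th (V i) k) q *m (c i)^T) a 0.
  apply/matrixP => a i; rewrite !mxE; apply: eq_bigr => b _; rewrite mulrC [eval_jac _ _ _ _ _]mxE; congr (_ * _).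
  by rewrite mxE.
apply: strict_deriv_row => i; have := strict_deriv_mulmx (c i)^T (th_strict (V i) kq).
rewrite (_ : (fun _ => _ *m _) = fun z => (dot (c i) (th (V i) k z))%:M)//.
by apply/funext => z; apply/matrixP => a b; rewrite !ord1 [RHS]mxE eqxx mulr1n dotC.
Qed.

Lemma system_jac_continuous k c q i j : img X k q -> {for q, continuous (fun q => system_jac k c q i j)}.
Proof.
move=> kq; rewrite (_ : (fun _ => _) = fun q => \sum_a c i 0 a * eval_jac (V i) k q a j).
  apply: continuous_at_sum => a; apply: (@continuousM _ _ (fun=> c i 0 a) (fun q => eval_jac (V i) k q a j)); first exact: cst_continuous.
  exact: eval_jac_continuous.
by apply/funext => z; rewrite !mxE.
Qed.

End SystemCoordinates.

(** * Measurability of the number of solutions *)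

Section CountingLayers.
Context (R : realType).

Lemma nneseries_ltn (N : nat) : (\sum_(0 <= k <oo) ((k < N)%N%:R : R)%:E)%E = N%:R%:E.
Proof.
apply: cvg_lim => //; apply: cvg_near_cst; near=> m.
have mN : (N <= m)%N by near: m; exact: nbhs_infty_ge.
rewrite sumEFin -natr_sum; congr (_%:R%:E).
rewrite (big_cat_nat (n := N))//= big_nat (eq_bigr (fun=> 1%N)); last by move=> i /andP[_ ->].
rewrite -big_nat sum_nat_const_nat subn0 muln1 big_nat big1 ?addn0// => i /andP[Ni _].
by rewrite ltnNge Ni.
Unshelve. all: by end_near. Qed.

(** The m-th layer is the condition of having at least m + 1 distinct points, phrased by an
    injection so that it can be tested with finite families from a countable base. *)
Lemma counting_layers (T : choiceType) (S : set T) :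
  counting S = (\sum_(0 <= m <oo) ((`[< exists x : 'I_m.+1 -> T, injective x /\ forall l, S (x l) >])%:R : R)%:E)%E.
Proof.
rewrite /counting; case: asboolP => [fS|iS].
  rewrite -nneseries_ltn; apply: eq_eseriesr => m _; congr ((nat_of_bool _)%:R%:E); apply/idP/asboolP => [mS|[x [xi xS]]]; last first.
    have u : uniq [seq x i | i <- enum 'I_m.+1] by rewrite map_inj_uniq ?enum_uniq.
    have := @uniq_leq_size _ _ (finmap.enum_fset (fset_set S)) u; rewrite size_map size_enum_ord; apply.
    by move=> _ /mapP[i _ ->]; rewrite in_fset_set//; exact/mem_set.
  case E : (finmap.enum_fset (fset_set S)) => [|x0 s]; first by move: mS; rewrite E.
  exists (fun i => nth x0 (finmap.enum_fset (fset_set S)) i); split=> [i j /eqP|l].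
    rewrite nth_uniq ?finmap.fset_uniq//; [by move/eqP/val_inj| |]; by apply: leq_trans mS; rewrite ltn_ord.
  have := mem_nth x0 (leq_trans (ltn_ord l) mS) => h; apply/set_mem; rewrite -(in_fset_set fS); exact: h.
apply/esym/eqyP => r r0; apply: (@le_trans _ _ (\sum_(0 <= m < (Num.truncn r).+1) (1 : R)%:E)%E).
  rewrite sumEFin big_const_nat subn0 iter_addr addr0 lee_fin; exact/ltW/truncnS_gt.
rewrite (eq_bigr (fun m => ((`[< exists x : 'I_m.+1 -> T, injective x /\ forall l, S (x l) >])%:R : R)%:E)).
  exact: nneseries_lim_ge.
move=> m _; rewrite asboolT//; have [B BS mB] := infinite_set_fset m.+1 iS.
case E : (finmap.enum_fset B) => [|x0 s]; first by move: mB; rewrite E.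
exists (fun i => nth x0 (finmap.enum_fset B) i); split=> [i j /eqP|l].
  rewrite nth_uniq ?finmap.fset_uniq//; [by move/eqP/val_inj| |]; by apply: leq_trans mB; rewrite ltn_ord.
by apply: BS; exact: (mem_nth x0 (leq_trans (ltn_ord l) mB)).
Qed.

Lemma le_counting (T : choiceType) (A B : set T) : A `<=` B -> (counting A <= counting B :> \bar R)%E.
Proof.
move=> AB; rewrite !counting_layers; apply: lee_nneseries => m _; first by rewrite lee_fin.
rewrite lee_fin ler_nat; case: asboolP => // -[x [xi xS]].
by rewrite asboolT//; exists x; split=> // l; exact/AB.
Qed.

End CountingLayers.

Section Incidence.
Context (R : realType) (n : nat) d (Z : measurableType d).

(* By compactness, g q z = 0 has a solution q in K if and only if inf g (_, z) = 0 over a countable dense subset of K. *)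
Lemma measurable_incidence (K : set 'rV[R]_n) (g : 'rV[R]_n -> Z -> R) : compact K ->
  (forall z q, K q -> {for q, continuous (fun q => g q z)}) ->
  (forall q, K q -> measurable_fun setT (g q)) -> (forall q z, 0 <= g q z) ->
  measurable [set z | exists2 q, K q & g q z = 0].
Proof.
move=> cK gc mg g0.
have hex (p : 'rV[rat]_n * rat) : exists o : option 'rV[R]_n,
    match o with Some q => K q /\ ratbox p q | None => forall q, K q -> ~ ratbox p q end.
  have [[q h]|h] := pselect (exists q, K q /\ ratbox p q); first by exists (Some q).
  by exists None => q Kq pq; apply: h; exists q.
have [D hD] := choice hex.
pose E (m : nat) p := if D p is Some q then [set z | g q z < m.+1%:R^-1] else set0.
have mE m p : measurable (E m p).
  rewrite /E; have := hD p; case: (D p) => // q [Kq _].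
  have := mg q Kq measurableT _ (measurable_itv `]-oo, m.+1%:R^-1[); rewrite setTI; congr measurable.
have -> : [set z | exists2 q, K q & g q z = 0] = \bigcap_m \bigcup_p E m p.
  apply/seteqP; split=> [z [q Kq gq] m _|z hz].
    have /nbhs_interior qi : nbhs q [set y | g y z < m.+1%:R^-1].
      apply: (gc z q Kq [set r | r < m.+1%:R^-1]); rewrite gq.
      by exists m.+1%:R^-1 => //= y; rewrite /ball /= sub0r normrN => /(le_lt_trans (ler_norm _)).
    have := open_ratbox (@open_interior _ [set y | g y z < m.+1%:R^-1]).
    move/seteqP => [+ _] => /(_ q (nbhs_singleton qi))[p pO pq].
    exists p => //; rewrite /E; have := hD p; case: (D p) => [y [Ky py]|/(_ q Kq)//].
    exact: interior_subset (pO _ py).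
  have cI : compact ((fun q => g q z) @` K).
    by apply: continuous_compact => //; apply: continuous_in_subspaceT => q /set_mem; exact: gc.
  have /closure_id clI := compact_closed (@Rhausdorff R) cI.
  have : closure ((fun q => g q z) @` K) 0.
    move=> B /nbhs_ballP[e /= e0 eB]; pose m := Num.truncn e^-1.
    have [p _] := hz m I; rewrite /E; have := hD p; case: (D p) => // q [Kq _] gq.
    exists (g q z); split; first by exists q.
    apply: eB; rewrite /ball /= sub0r normrN ger0_norm//; apply: lt_le_trans gq _.
    by rewrite invf_ple ?posrE// ltW// truncnS_gt.
  by rewrite -clI => -[q Kq gq]; exists q.
apply: bigcapT_measurable => m; exact: countable_bigcupT_measurable.
Qed.

End Incidence.

Section ManifoldCounting.
Unset Implicit Arguments.
Context (R : realType) (n : nat) (X : manifold R n) (V : 'I_n -> function_space X).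
Context d (Z : measurableType d) (c : forall i, Z -> 'rV[R]_(dim (V i))) (t : 'I_n -> Z -> R).
Context (mc : forall i, measurable_fun setT (c i : Z -> borel 'rV[R]_(dim (V i)))) (mt : forall i, measurable_fun setT (t i)).
Set Implicit Arguments.

Definition sol_of (z : Z) : set X := [set x | forall i, fun_of (r2v (c i z) : V i) x = t i z].

Definition residual k (q : 'rV[R]_n) (z : Z) : R := \sum_i `|dot (c i z) (th (V i) k q) - t i z|.

Lemma residualE k x z : dom (atlas X k) x -> residual k (fwd (atlas X k) x) z = 0 <-> sol_of z x.
Proof.
move=> dx; split=> [/eqP|h].
  rewrite psumr_eq0; last by move=> i _; exact: normr_ge0.
  move/allP => h i; have := h i (mem_index_enum _); rewrite normr_eq0 subr_eq0 => /eqP <-.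
  by rewrite (fun_ofE _ dx) r2vK.
by apply: big1 => i _; rewrite -(h i) (fun_ofE _ dx) r2vK subrr normr0.
Qed.

Lemma residual_continuous k z q : img X k q -> {for q, continuous (fun q => residual k q z)}.
Proof.
move=> kq; apply: continuous_at_sum => i.
apply: (@continuous_comp _ _ _ (fun q => dot (c i z) (th (V i) k q) - t i z) (fun y => `|y|)); last exact: norm_continuous.
apply: (@continuousB _ _ _ (fun q => dot (c i z) (th (V i) k q)) (fun=> t i z)); last exact: cst_continuous.
rewrite (_ : (fun _ => _) = (fun u => dot u (c i z)) \o th (V i) k); last by apply/funext => y; rewrite /= dotC.
by apply: continuous_comp; [exact: th_continuous|exact: dot_continuous].
Qed.

Lemma measurable_residual k q : measurable_fun setT (residual k q).
Proof.
apply: measurable_sum => i; apply: measurableT_comp => //; apply: measurable_funB => //.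
rewrite (_ : (fun _ => _) = fun z => \sum_j c i z 0 j * th (V i) k q 0 j); last by apply/funext => z; rewrite dotE.
apply: measurable_sum => j; apply: measurable_funM => //.
exact: (measurableT_comp (@measurable_coord R _ j) (mc i)).
Qed.

(* Every neighbourhood of a point x contains a piece that contains x, but x may lie on its boundary. *)
Definition piece (b : nat * ('rV[rat]_n * rat)) : set X := [set x | dom (atlas X b.1) x /\
  @ratbox R n b.2 (fwd (atlas X b.1) x) /\ @ratbox R n b.2 `<=` img X b.1].

Lemma piece_base x (A : set X) : open A -> A x -> exists b, piece b x /\ piece b `<=` A.
Proof.
move=> oA Ax; have [k /asboolP dx] := atlas_cover x.
have oi : open (fwd (atlas X k) @` (dom (atlas X k) `&` A)).
  by apply: fwd_open => [|y []//]; apply: openI => //; exact: dom_open.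
have := open_ratbox oi => /seteqP[+ _] => /(_ (fwd (atlas X k) x))[|p pA px]; first by exists x.
exists (k, p); split.
  by split=> //; split=> // q /pA[y [dy _] <-]; exists y.
move=> y [/= dy [py _]]; have [w [dw Aw] e] := pA _ py.
by have <- // : w = y by apply: (fwd_inj (c := atlas X k)) => //; exact/mem_set.
Qed.

Lemma measurable_piece b : measurable [set z | exists2 x, piece b x & sol_of z x].
Proof.
have [pi|pi] := pselect (@ratbox R n b.2 `<=` img X b.1); last first.
  by rewrite (_ : [set _ | _] = set0)//; apply/seteqP; split=> // z [x [_ [_ /pi]]].
have -> : [set z | exists2 x, piece b x & sol_of z x] = [set z | exists2 q, @ratbox R n b.2 q & residual b.1 q z = 0].
  apply/seteqP; split=> z [x].
    by move=> [dx [px _]] sx; exists (fwd (atlas X b.1) x) => //; exact/residualE.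
  by move=> px g0; have [y dy yx] := pi _ px; subst x; exists y => //; exact/(residualE _ dy).
apply: measurable_incidence => [|z q /pi kq|q _|q z].
- rewrite (_ : @ratbox R n b.2 = box (\row_j ratr (b.2.1 0 j - b.2.2)) (\row_j ratr (b.2.1 0 j + b.2.2))); first exact: compact_box.
  by apply/seteqP; split=> q h j; have := h j; rewrite !mxE.
- exact: residual_continuous.
- exact: measurable_residual.
by apply: sumr_ge0.
Qed.

Definition multi (U : set X) (m : nat) : set Z :=
  [set z | exists x : 'I_m.+1 -> X, injective x /\ forall l, (U `&` sol_of z) (x l)].

(** Finitely many distinct solutions can be enclosed in disjoint pieces contained in [U], and there
    are countably many finite families of pieces; for a given family the condition is that each
    piece contains a solution. *)
Lemma measurable_multi U m : open U -> measurable (multi U m).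
Proof.
move=> oU; pose I := {ffun 'I_m.+1 -> nat * ('rV[rat]_n * rat)}.
pose good (f : I) := (forall l, piece (f l) `<=` U) /\ forall l l', l != l' -> piece (f l) `&` piece (f l') = set0.
have -> : multi U m = \bigcup_(f : I) [set z | good f /\ forall l, exists2 x, piece (f l) x & sol_of z x].
  apply/seteqP; split=> z; last first.
    move=> [f _ [[fU fd] h]]; have [x hx] := choice (fun l => let: ex_intro2 x p s := h l in ex_intro (fun x => piece (f l) x /\ sol_of z x) x (conj p s)).
    exists x; split=> [l l' e|l]; last by have [p s] := hx l; split=> //; exact: fU p.
    apply/eqP; apply/negPn/negP => ll'; have /seteqP[+ _] := fd _ _ ll' => /(_ (x l)); apply.
    by split; [exact: (hx l).1|rewrite e; exact: (hx l').1].
  move=> [x [xi xU]].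
  have sep (p : 'I_m.+1 * 'I_m.+1) : exists AB : set X * set X, p.1 != p.2 ->
      [/\ open AB.1, open AB.2, AB.1 (x p.1), AB.2 (x p.2) & AB.1 `&` AB.2 = set0].
    have [_|ll] := eqVneq p.1 p.2; first by exists (set0, set0).
    have xx : x p.1 != x p.2 by apply: contra_neq ll => /xi.
    have := carrier_hausdorff (m := X); rewrite open_hausdorff => /(_ _ _ xx)[AB [/set_mem Ax /set_mem Bx] [oA oB /eqP AB0]].
    by exists AB.
  have [AB hAB] := choice sep.
  (* The piece around [x l] lies on its side of every separating pair that involves [l], hence
     pieces around different points are disjoint. *)
  have hO l : exists b, piece b (x l) /\ piece b `<=` U `&`
      [set y | forall l', l' != l -> (AB (l, l')).1 y /\ (AB (l', l)).2 y].
    apply: piece_base; last first.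
      split=> [|l' ll]; first exact: (xU l).1.
      have [|_ _ ? _ _] := hAB (l, l'); first by rewrite eq_sym.
      by have [|_ _ _ ? _] := hAB (l', l).
    apply: openI => //; rewrite openE => y Hy; apply: filter_forall => l'.
    have [->|ll] := eqVneq l' l; first by apply: nearW => w /eqP.
    have [Ay By] := Hy l' ll; have [|oA _ _ _ _] := hAB (l, l'); first by rewrite eq_sym.
    have [|_ oB _ _ _] := hAB (l', l); first by [].
    by apply: filterS2 (open_nbhs_nbhs (conj oA Ay)) (open_nbhs_nbhs (conj oB By)) => w Aw Bw _.
  have [f hf] := choice hO; exists [ffun l => f l] => //; split; last first.
    by move=> l; exists (x l); rewrite ?ffunE; [exact: (hf l).1|exact: (xU l).2].
  split=> [l y|l l' ll]; first by rewrite ffunE => /(hf l).2[].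
  rewrite !ffunE; apply/seteqP; split=> // y [/(hf l).2[_ h] /(hf l').2[_ h']].
  have [|_ _ _ _ /seteqP[+ _]] := hAB (l, l'); first by [].
  by move=> /(_ y); apply; split; [have [] := h l'; rewrite 1?eq_sym|have [] := h' l].
apply: countable_bigcupT_measurable => [|f]; first exact: (@countableP {ffun 'I_m.+1 -> nat * ('rV[rat]_n * rat)}).
have [gf|gf] := pselect (good f); last by rewrite (_ : [set _ | _] = set0)//; apply/seteqP; split=> // z [].
rewrite (_ : [set _ | _] = \bigcap_(l in [set: 'I_m.+1]) [set z | exists2 x, piece (f l) x & sol_of z x]).
  apply: fin_bigcap_measurable => // l _; exact: measurable_piece.
by apply/seteqP; split=> z h; [move=> l _; exact: h.2|split=> // l; exact: h].
Qed.

Lemma counting_sol (U : set X) z : counting (U `&` sol_of z) = layer R (multi U) z.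
Proof.
rewrite counting_layers /layer; apply: eq_eseriesr => m _; rewrite indicE; congr ((nat_of_bool _)%:R%:E).
Qed.

End ManifoldCounting.

(** * The area formula in the charts and a uniform bound over U *)

Lemma det_le (R : realType) n (A : 'M[R]_n) (rho : R) : 0 <= rho -> (forall i j, `|A i j| <= rho) ->
  `|\det A| <= n`!%:R * rho ^+ n.
Proof.
move=> r0 hA; apply: le_trans (ler_norm_sum _ _ _) _.
rewrite -[in leRHS]card_Sn -sum1_card natr_sum mulr_suml; apply: ler_sum => s _.
rewrite mul1r normrM normr_sign mul1r normr_prod.
by rewrite -[n in rho ^+ n]card_ord -prodr_const; apply: ler_prod => i _; rewrite normr_ge0 hA.
Qed.

Lemma nneseries_finite (R : realType) (f : nat -> \bar R) m : (forall j, (m <= j)%N -> f j = 0%E) ->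
  (\sum_(0 <= j <oo) f j = \sum_(0 <= j < m) f j)%E.
Proof.
move=> f0; apply: cvg_lim => //; apply: cvg_near_cst; near=> k.
have mk : (m <= k)%N by near: k; exact: nbhs_infty_ge.
rewrite (big_cat_nat (n := m))//= [X in (_ + X)%E]big_nat [X in (_ + X)%E]big1 ?adde0// => i /andP[mi _].
exact: f0.
Unshelve. all: by end_near. Qed.

Lemma counting_image (R : realType) (T U : choiceType) (f : T -> U) (A : set T) :
  (forall x y, A x -> A y -> f x = f y -> x = y) -> counting (f @` A) = counting A :> \bar R.
Proof.
move=> fi; rewrite !counting_layers; apply: eq_eseriesr => m _; congr ((nat_of_bool _)%:R%:E).
apply/asboolP/asboolP => -[x [xi xA]].
  have hx l : exists2 a, A a & f a = x l by exact: xA.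
  have [a ha] := choice (fun l => let: ex_intro2 a Aa e := hx l in ex_intro (fun a => A a /\ f a = x l) a (conj Aa e)).
  exists a; split=> [l l' e|l]; last by have [] := ha l.
  by apply: xi; rewrite -(ha l).2 -(ha l').2 e.
exists (f \o x); split=> [l l' /= e|l]; last by exists (x l).
by apply: xi; exact: fi.
Qed.

Lemma counting_bigcup_choice (R : realType) (T : choiceType) (G : (set T)^nat) :
  trivIset setT G -> counting (\bigcup_k G k) = (\sum_(0 <= k <oo) counting (G k) : \bar R)%E.
Proof.
move=> tG; have cI (A : set T) : counting A = counting (Some @` A) :> \bar R.
  by rewrite counting_image// => x y _ _ [].
rewrite cI image_bigcup (@counting_bigcup R (option T)); first by apply: eq_eseriesr => k _; rewrite cI.
apply/trivIsetP => i j _ _ ij; apply/seteqP; split=> // _ [[x Gx <-] [y Gy [yx]]].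
by have /trivIsetP/(_ i j I I ij)/seteqP[/(_ x)+ _] := tG; apply; split=> //; rewrite -yx.
Qed.

Section AreaAlmostEverywhere.
Context (R : realType) (n : nat) (F : 'rV[R]_n -> 'rV[R]_n) (D : 'rV[R]_n -> 'M[R]_n) (O : set 'rV[R]_n).
Hypothesis oO : open O.
Hypothesis sF : forall x, O x -> strict_deriv F x (D x).
Hypothesis cD : forall x i j, O x -> {for x, continuous (fun y => D y i j)}.

(* The fibre count itself need not be Borel for an arbitrary Borel set A. *)
Lemma area_ae (A : set (borel 'rV[R]_n)) : measurable A -> A `<=` O ->
  exists (g : borel 'rV[R]_n -> \bar R) (N : set (borel 'rV[R]_n)),
  [/\ measurable_fun setT g, forall y, (0 <= g y)%E, measurable N /\ lebesgue_n N = 0%E,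
      forall y, ~ N y -> fibre_count F A y = g y &
      (\int[@lebesgue_n R n]_y g y = \int[@lebesgue_n R n]_(x in A) (`|\det (D x)|)%:E)%E].
Proof.
move=> mA AO; pose reg := [set x | O x /\ \det (D x) != 0].
have mreg : measurable (reg : set (borel 'rV[R]_n)) := measurable_regular oO cD.
have [mfr IE] := area_regular oO sF cD (measurableI _ _ mA mreg) (@subIsetr _ _ _).
have crit : lebesgue_rV (F @` [set x | O x /\ \det (D x) = 0]) = 0%E.
  by apply: (@sard R n F D) => x [Ox dx]; split => //; exact: sF.
have [N [mN critN N0]] := null_superset crit.
exists (fibre_count F (A `&` reg)), N; split; [exact: mfr|by move=> y; exact: measure_ge0|by split| |].
  move=> y Ny; rewrite /fibre_count; congr counting; apply/seteqP; split=> [x [Ax Fx]|x [[Ax _] Fx]]; last by split.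
  split => //; split => //; split; first exact: AO.
  by apply/eqP => dx; apply/Ny/critN; exists x => //; split=> //; exact: AO.
rewrite IE [LHS]integral_mkcond [RHS]integral_mkcond; apply: eq_integral => x _ /=.
rewrite /patch; case: (boolP (x \in A)) => [/set_mem Ax|/negP Ax]; last first.
  by rewrite ifF//; apply/negP => /set_mem[/mem_set].
case: ifPn => // /negP xr; congr EFin; apply/esym/eqP; rewrite normr_eq0; apply/negPn/negP => dx.
by apply: xr; apply/mem_set; split => //; split => //; exact: AO.
Qed.

End AreaAlmostEverywhere.

Lemma compact_finite_cover (T : topologicalType) (A : set T) : compact A -> cover_compact A.
Proof.
move=> cA; have [[x0 _]|h] := pselect (exists x0, A x0); last first.
  by move=> I D f _ _; exists finmap.fset0 => // x Ax; exfalso; apply: h; exists x.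
pose T' : ptopologicalType := HB.pack (T : Type) (isPointed.Build T x0) (Topological.class T).
change (@cover_compact T' A); rewrite -compact_cover; exact: cA.
Qed.

Section AverageOverLevels.
Context (R : realType) (n : nat) (X : manifold R n) (V : 'I_n -> function_space X).
Implicit Types (c : forall i, 'rV[R]_(dim (V i))).

(* The number of solutions in U of f_i = t_i, for the functions f_i with coordinates c_i; see [nb_level_solutionsE]. *)
Definition nb_level_solutions c (U : set X) (t : borel 'rV[R]_n) : \bar R :=
  layer R (multi (V := V) (fun i (_ : borel 'rV[R]_n) => c i) (fun i (t : borel 'rV[R]_n) => (t : 'rV[R]_n) 0 i) U) t.

Lemma nb_level_solutionsE c U (t : borel 'rV[R]_n) : nb_level_solutions c U t = counting (U `&` [set x | forall i, fun_of (r2v (c i) : V i) x = (t : 'rV[R]_n) 0 i]).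
Proof. by rewrite /nb_level_solutions -counting_sol. Qed.

Lemma measurable_nb_level_solutions c U : open U -> measurable_fun setT (nb_level_solutions c U).
Proof.
by move=> oU; apply: measurable_layer => k; apply: measurable_multi => // i; exact: measurable_coord.
Qed.

Lemma measurable_system_jac k c : measurable_fun (img X k : set (borel 'rV[R]_n)) (fun q : borel 'rV[R]_n => `|\det (system_jac k c q)|).
Proof. by apply: (measurable_jac (@open_img R n X k)) => q i j kq; exact: system_jac_continuous. Qed.

Section Pieces.
Unset Implicit Arguments.
Context (U : set X) (oU : open U) (kap : nat -> nat) (O : nat -> set X).
Context (oO : forall j, open (O j)) (Od : forall j, O j `<=` dom (atlas X (kap j))) (OU : U `<=` \bigcup_j O j).
Set Implicit Arguments.

(** A disjoint decomposition of [U], each part inside one chart. The sequence of charts is a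
    parameter because two are used: a finite one, made of boxes, for the uniform bound, and the
    whole atlas for the comparison with the volume. *)
Definition part (j : nat) : set X := seqDU (fun j => U `&` O j) j.
Definition cpart (j : nat) : set (borel 'rV[R]_n) := fwd (atlas X (kap j)) @` part j.

Lemma part_sub j : part j `<=` U `&` O j. Proof. by move=> x []. Qed.

Lemma part_bigcup : U = \bigcup_j part j.
Proof. by rewrite -seqDU_bigcup_eq -setI_bigcupr; apply/seteqP; split=> [x Ux|x []//]; split=> //; exact: OU. Qed.

Lemma cpart_img j : cpart j `<=` img X (kap j).
Proof. by move=> _ [x /part_sub[_ /Od dx] <-]; exists x. Qed.

(** A chart is injective and open, so the image of a difference of open sets is again such a
    difference. *)
Lemma measurable_cpart j : measurable (cpart j).
Proof.
pose f := fwd (atlas X (kap j)).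
have -> : cpart j = f @` (U `&` O j) `\` f @` (U `&` O j `&` \bigcup_(i < j) (U `&` O i)).
  rewrite /cpart /part (_ : seqDU (fun j => U `&` O j) j = (U `&` O j) `\` \bigcup_(i < j) (U `&` O i)); last by rewrite bigcup_mkord.
  apply/seteqP; split=> q.
    move=> [x [UO nx] <-]; split; first by exists x.
    move=> [y [[Uy Oy] hy] e]; apply: nx; suff <- : y = x by [].
    by apply: (fwd_inj (c := atlas X (kap j))) => //; apply/mem_set; [exact: Od Oy|exact: Od UO.2].
  move=> [[x UO <-] h]; exists x => //; split=> // hx; apply: h; exists x => //.
have UOj : U `&` O j `<=` dom (atlas X (kap j)) by move=> x [_ /Od].
by apply: measurableD; apply: open_borel; apply: fwd_open => //;
  [exact: openI|apply: openI; [exact: openI|by apply: bigcup_open => i _; exact: openI]|move=> x [/UOj]].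
Qed.

Lemma nb_level_solutions_parts c t : nb_level_solutions c U t = (\sum_(0 <= j <oo) fibre_count (system_map (kap j) c) (cpart j) t)%E.
Proof.
rewrite nb_level_solutionsE {1}part_bigcup setI_bigcupl counting_bigcup_choice; last first.
  apply/trivIsetP => i j _ _ ij; have /trivIsetP/(_ i j I I ij) := @trivIset_seqDU _ (fun j => U `&` O j).
  by apply: subsetI_eq0; exact: subIsetl.
apply: eq_eseriesr => j _; rewrite /fibre_count.
rewrite -(@counting_image R _ _ (fwd (atlas X (kap j)))); last first.
  by move=> x y [/part_sub[_ /Od dx] _] [/part_sub[_ /Od dy] _]; apply: (fwd_inj (c := atlas X (kap j))); exact/mem_set.
congr counting; apply/seteqP; split=> q.
  move=> [x [px sx] <-]; have [_ /Od dx] := part_sub px; split; first by exists x.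
  by apply/rowP => i; rewrite mxE -(sx i) (fun_ofE _ dx) r2vK.
move=> [[x px <-] e]; have [_ /Od dx] := part_sub px; exists x => //; split=> // i.
by rewrite -e mxE (fun_ofE _ dx) r2vK.
Qed.

(** Off a null set the fibre counts of the parts are replaced by the Borel functions of
    [area_ae]. *)
Lemma integral_nb_level_solutions c : (\int[@lebesgue_n R n]_t nb_level_solutions c U t =
  \sum_(0 <= j <oo) \int[@lebesgue_n R n]_(q in cpart j) (`|\det (system_jac (kap j) c q)|)%:E)%E.
Proof.
have hj j := area_ae (F := system_map (kap j) c) (D := fun q => (system_jac (kap j) c q)^T) (@open_img R n X (kap j))
  (fun q => @system_map_strict R n X V (kap j) c q)
  (fun q a b kq => ltac:(rewrite (_ : (fun _ => _) = fun y => system_jac (kap j) c y b a); [exact: system_jac_continuous|by apply/funext => y; rewrite mxE]))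
  (measurable_cpart j) (@cpart_img j).
have [g hg] := choice hj; have [N hN] := choice hg.
have mg j : measurable_fun setT (g j) by have [] := hN j.
have g0 j y : (0 <= g j y)%E by have [] := hN j.
transitivity (\int[@lebesgue_n R n]_t (\sum_(0 <= j <oo) g j t))%E; first apply: ae_eq_integral => //.
- exact: measurable_nb_level_solutions.
- exact: ge0_emeasurable_sum.
- exists (\bigcup_j N j); split.
  + by apply: bigcupT_measurable => j; have [_ _ [] ] := hN j.
  + have mN j : measurable (N j) by have [_ _ []] := hN j.
    apply/eqP; rewrite eq_le measure_ge0 andbT.
    apply: le_trans (measure_sigma_subadditive _ mN _ (@subset_refl _ _)) _; first exact: bigcupT_measurable.
    by rewrite eseries0// => j _; have [_ _ []] := hN j.
  move=> t /= ht; apply: contrapT => nt; apply: ht => _; rewrite nb_level_solutions_parts; apply: eq_eseriesr => j _.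
  by have [_ _ _ h _] := hN j; apply: h => Nt; apply: nt; exists j.
rewrite integral_nneseries//; apply: eq_eseriesr => j _; have [_ _ _ _ ->] := hN j.
by apply: eq_integral => q _; rewrite det_tr.
Qed.

End Pieces.

(** The closure of [U] is covered by finitely many boxes inside images of charts; on each box the
    derivatives are bounded by compactness, uniformly for coefficient vectors of norm at most [M].
    This makes the later integrals over the parameters finite. *)
Lemma integral_nb_level_solutions_bounded (U : set X) (M : R) : open U -> compact (closure U) -> exists2 C : R, 0 <= C &
  forall c, (forall i, `|c i| <= M) -> (\int[@lebesgue_n R n]_t nb_level_solutions c U t <= C%:E)%E.
Proof.
move=> oU cU.
have hx (x : X) : exists d : R, 0 < d /\ box (fwd (chart_at x) x - const_mx d) (fwd (chart_at x) x + const_mx d) `<=` img X (chart_idx x).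
  have dx : dom (atlas X (chart_idx x)) x by rewrite /chart_idx; case: ex_minnP => m /asboolP.
  have /nbhs_ballP[e /= e0 he] : nbhs (fwd (chart_at x) x) (img X (chart_idx x)).
    by apply: open_nbhs_nbhs; split; [exact: open_img|exists x].
  exists (e / 2); split=> [|q hq]; first by rewrite divr_gt0.
  apply: he; rewrite -ball_normE /=; apply: (@le_lt_trans _ _ (e / 2)); last by rewrite ltr_pdivrMr// mulr2n mulrDr mulr1 ltrDr.
  apply: rV_norm_le => [|j]; first by rewrite ltW// divr_gt0.
  by have := hq j; rewrite !mxE ler_norml => /andP[h1 h2]; apply/andP; split; lra.
have [d hd] := choice hx.
pose B x : set 'rV[R]_n := box (fwd (chart_at x) x - const_mx (d x)) (fwd (chart_at x) x + const_mx (d x)).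
pose Ox x : set X := dom (chart_at x) `&` fwd (chart_at x) @^-1` (nball (fwd (chart_at x) x) (d x)).
have oOx x : open (Ox x).
  rewrite openE => y [dy ny]; apply: filterI; first by apply: open_nbhs_nbhs; split=> //; exact: dom_open.
  by have := fwd_continuous dy; apply; apply: open_nbhs_nbhs; split=> //; exact: nball_open.
have OxB x y : Ox x y -> B x (fwd (chart_at x) y).
  move=> [_ ny] j; rewrite !mxE; have := rV_coord_le (fwd (chart_at x) y - fwd (chart_at x) x) j.
  by move=> /le_lt_trans /(_ ny); rewrite !mxE ltr_norml => /andP[h1 h2]; apply/andP; split; lra.
have [//|y _|D _ cD] := compact_finite_cover cU (D := setT) (f := Ox).
  by exists y => //; split; [rewrite /chart_at /chart_idx; case: ex_minnP => m /asboolP|rewrite /= /nball /= subrr normr0; exact: (hd y).1].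
pose s : seq X := finmap.enum_fset D.
(* Beyond the end of the finite list the sequence of charts is padded with empty sets. *)
pose xo j : option X := nth None (map Some s) j.
pose O j := if xo j is Some x then Ox x else set0.
pose kap j := if xo j is Some x then chart_idx x else 0%N.
have oO j : open (O j) by rewrite /O; case: (xo j) => [x|]; [exact: oOx|exact: open0].
have Od j : O j `<=` dom (atlas X (kap j)) by rewrite /O /kap; case: (xo j) => // x y [].
have OU : U `<=` \bigcup_j O j.
  move=> y /subset_closure/cD[x /= xD xy]; exists (index x s) => //.
  have xs : (index x s < size s)%N by rewrite index_mem.
  by rewrite /O /xo (nth_map x)// nth_index.
have Mc c : (forall i, `|c i| <= M) -> forall x q i j, B x q -> `|system_jac (chart_idx x) c q i j| <= `|M| * \sum_i mxsum (eval_jac (V i) (chart_idx x) q).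
  move=> cM x q i j Bq; rewrite mxE; apply: le_trans (rV_coord_le _ _) _; apply: le_trans (rV_norm_mul _ _) _.
  apply: ler_pM => //; [exact: mxsum_ge0|exact: le_trans (cM i) (ler_norm _)|].
  by rewrite (bigD1 i)//= lerDl; apply: sumr_ge0 => l _; exact: mxsum_ge0.
have hb x : exists C : R, 0 <= C /\ forall q, B x q -> \sum_i mxsum (eval_jac (V i) (chart_idx x) q) <= C.
  have cB : compact (B x) by exact: compact_box.
  have : compact ((fun q => \sum_i mxsum (eval_jac (V i) (chart_idx x) q)) @` B x).
    apply: continuous_compact => //; apply: continuous_in_subspaceT => q /set_mem Bq.
    apply: continuous_at_sum => i; apply: continuous_at_sum => a; apply: continuous_at_sum => b.
    apply: (@continuous_comp _ _ _ (fun q => eval_jac (V i) (chart_idx x) q a b) (fun y => `|y|)); last exact: norm_continuous.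
    by apply: eval_jac_continuous; exact: (hd x).2.
  move/compact_bounded => [C [_ hC]]; exists (`|C| + 1); split; first by rewrite ltW// ltr_wpDl.
  move=> q Bq; apply: le_trans (ler_norm _) _; apply: (hC (`|C| + 1)); last by exists q.
  by rewrite ltr_pwDr// ler_norm.
have [Cb hCb] := choice hb.
pose bnd x : R := (n`!%:R * (`|M| * Cb x) ^+ n) * fine (lebesgue_n (B x : set (borel 'rV[R]_n))).
have bnd0 x : 0 <= bnd x.
  by rewrite /bnd mulr_ge0 ?fine_ge0 ?measure_ge0// mulr_ge0// exprn_ge0// mulr_ge0// (hCb x).1.
exists (\sum_(0 <= j < size s) if xo j is Some x then bnd x else 0).
  by apply: sumr_ge0 => j _; case: (xo j).
move=> c cM; rewrite (integral_nb_level_solutions oU oO Od OU) (@nneseries_finite _ _ (size s)); last first.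
  move=> j sj; rewrite (_ : cpart _ _ _ _ = set0) ?integral_set0//; apply/seteqP; split=> // q [y [[_ +] _] _].
  by rewrite /O /xo nth_default ?size_map.
rewrite -sumEFin; apply: lee_sum => j _; rewrite /cpart /part /kap /O; case Ej : (xo j) => [x|]; last first.
  rewrite (_ : [set _ | _ in _] = set0) ?integral_set0//; apply/seteqP; split=> // q [y [[_]]].
  by rewrite Ej.
have sub : cpart U kap O j `<=` B x.
  by move=> _ [y [[_ Oy] _] <-]; move: Oy; rewrite /O /kap Ej; exact: OxB.
have -> : [set fwd (atlas X (chart_idx x)) x0 | x0 in seqDU (fun j0 => U `&` match xo j0 with Some x1 => Ox x1 | None => set0 end) j] = cpart U kap O j.
  by rewrite /cpart /part /kap Ej.
apply: (@le_trans _ _ (\int[@lebesgue_n R n]_(q in cpart U kap O j) ((n`!%:R * (`|M| * Cb x) ^+ n)%:E))%E).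
  apply: ge0_le_integral => //.
  - exact: (measurable_cpart oU oO Od).
  - apply/measurable_EFinP; have si : cpart U kap O j `<=` img X (chart_idx x) by move=> q /sub; exact: (hd x).2.
    have mm := measurable_funS (open_borel (@open_img R n X (chart_idx x))) si (@measurable_system_jac (chart_idx x) c).
    refine mm.
  move=> q /sub Bq; rewrite lee_fin; apply: det_le => [|a b]; first by rewrite mulr_ge0// (hCb x).1.
  by apply: le_trans (Mc c cM x q a b Bq) _; rewrite ler_wpM2l//; exact: (hCb x).2.
rewrite integral_cst; last exact: (measurable_cpart oU oO Od).
rewrite /bnd [leRHS]EFinM; apply: lee_pmul => //; first by rewrite lee_fin mulr_ge0// exprn_ge0// mulr_ge0// (hCb x).1.
have mB : measurable (B x : set (borel 'rV[R]_n)) by exact: measurable_box.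
rewrite fineK; last by apply: compact_fin_num; exact: compact_box.
by apply: le_measure => //; apply/mem_set => //; exact: (measurable_cpart oU oO Od).
Qed.

End AverageOverLevels.

(** * Systems of equations and the average as an iterated integral *)

Section Solutions.
Context (R : realType) (n : nat) (X : manifold R n) (V : 'I_n -> function_space X).
Local Notation W := (fun i => dualsp (V i)).

Lemma hyp_eq (U : vectType R) (f : U) (c : 'rV[R]_(dim U)) (a t : R) : f != 0 -> c != 0 ->
  hyp c t = hyperplane (bidual f) a -> exists2 s : R, s != 0 & r2v c = s *: f /\ t = s * a.
Proof.
move=> f0 c0; have f1 : bidual f != 0 by rewrite -[f]v2rK; apply/bidual_neq0; apply/r2v_neq0; rewrite v2rK.
move/(hyperplane_eq ((bidual_neq0 c).1 c0) f1) => [s s0 [e ta]]; exists s => //; split=> //.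
have := congr1 (@bicoord R U) e; rewrite bicoord_bidual -[s *: _]addr0 bicoord_linear bicoord_bidual => h.
apply: (can_inj (@v2rK _ _)); rewrite h linearZ /= (_ : bicoord 0 = 0) ?addr0//.
by apply/rowP => j; rewrite !mxE lfunE.
Qed.

(** An equation of a hyperplane is unique up to a common factor, so the existentially quantified
    equations in [solutions] may be replaced by chosen ones. *)
Lemma solutionsE (H : AGr_tuple W) (c : forall i, 'rV[R]_(dim (V i))) (t : 'I_n -> R) :
  (forall i, c i != 0) -> (forall i, H i = hyp (c i) (t i)) ->
  solutions H = [set x | forall i, fun_of (r2v (c i) : V i) x = t i].
Proof.
move=> c0 HE; apply/seteqP; split=> x h i.
  have [f [a [f0 Ha fa]]] := h i; rewrite HE in Ha.
  have [s s0 [-> ->]] := hyp_eq f0 (c0 i) Ha.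
  by have := fun_of_linear s f 0 x; rewrite addr0 fun_of0 addr0 fa.
by exists (r2v (c i)), (t i); split=> //; exact/r2v_neq0.
Qed.

Lemma solutions_off (H : AGr_tuple W) i : ~ AGr (H i) -> solutions H = set0.
Proof.
move=> nH; apply/seteqP; split=> // x /(_ i)[f [a [f0 e _]]]; apply: nH; exists (bidual f), a; split=> //.
by rewrite -[f]v2rK; apply/bidual_neq0; apply/r2v_neq0; rewrite v2rK.
Qed.

Definition cof i (H : AGr_tuple W) : 'rV[R]_(dim (V i)) := (secV (H i)).1.
Definition tof i (H : AGr_tuple W) : R := (secV (H i)).2.

Lemma measurable_AGr_proj i : measurable_fun setT (fun H : AGr_tuple W => H i : borel (AGr_space (W i))).
Proof. exact: (@measurable_proj _ _ (fun i => borel (AGr_space (W i))) i). Qed.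

Definition level (U : set X) m : set (AGr_tuple W) := [set H | forall i, @AGr R (W i) (H i)] `&` multi cof tof U m.

Lemma measurable_level U m : open U -> measurable (level U m).
Proof.
move=> oU; apply: measurableI.
  rewrite (_ : [set H : AGr_tuple W | _] = \bigcap_(i in [set: 'I_n]) ((fun H : AGr_tuple W => H i : borel (AGr_space (W i))) @^-1` @AGr R (W i))).
    apply: fin_bigcap_measurable => // i _; rewrite -[X in measurable X]setTI.
    by apply: measurable_AGr_proj => //; exact: measurable_AGr.
  by apply/seteqP; split=> H h i; [move=> _; exact: h|exact: h].
apply: measurable_multi => // i.
- move=> _ B mB; rewrite setTI; have m1 := @measurable_secV1 R (V i) measurableT _ mB; rewrite setTI in m1.
  by have := @measurable_AGr_proj i measurableT _ m1; rewrite setTI.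
- move=> _ B mB; rewrite setTI; have m1 := @measurable_secV2 R (V i) measurableT _ mB; rewrite setTI in m1.
  by have := @measurable_AGr_proj i measurableT _ m1; rewrite setTI.
Qed.

Lemma layer_level U (H : AGr_tuple W) : layer R (level U) H = counting (U `&` solutions H).
Proof.
have [AH|nH] := pselect (forall i, @AGr R (W i) (H i)); last first.
  move/existsNP : nH => [i nH]; rewrite (solutions_off nH) setI0 /counting asboolT// fset_set0.
  by rewrite /layer eseries0// => k _; rewrite indicE memNset// => -[/(_ i)].
have -> : solutions H = sol_of cof tof H.
  by apply: solutionsE => i; have [h1 h2] := secV_AGr (AH i).
rewrite counting_sol /layer; apply: eq_eseriesr => m _; rewrite !indicE; congr ((nat_of_bool _)%:R%:E).
by apply/idP/idP => /set_mem h; apply/mem_set; [case: h|split].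
Qed.

(** Removing from [U] the other, finitely many, points of [S] in it leaves a neighbourhood in which
    [x] is the only point of [S]. *)
Lemma isolated_finite (T : topologicalType) (U S : set T) : hausdorff_space T -> open U -> finite_set (U `&` S) ->
  U `&` isolated S = U `&` S.
Proof.
move=> hT oU fS; apply/seteqP; split=> x [Ux]; first by move=> /isolatedS.
move=> Sx; split=> //; split; first exact/mem_set.
have cl : closed ((U `&` S) `\ x).
  have /accessible_finite_set_closed h := hausdorff_accessible hT.
  by apply: h; apply: sub_finite_set fS => y [].
exists (U `&` ~` ((U `&` S) `\ x)).
  apply: open_nbhs_nbhs; split; first by apply: openI => //; exact: closed_openC.
  by split=> // -[_]; apply.
apply/seteqP; split=> y; last by move=> ->; split=> //; split=> // -[_]; apply.
by move=> [[Uy ny] Sy]; apply: contrapT => yx; apply: ny; split.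
Qed.

(** [nb_solutions] counts isolated solutions and the layers count all of them; the counts can differ
    only where there are infinitely many solutions in [U]. *)
Lemma nb_solutions_layer U (H : AGr_tuple W) : open U ->
  (0 <= nb_solutions U H <= layer R (level U) H)%E /\
  ((layer R (level U) H < +oo)%E -> nb_solutions U H = layer R (level U) H).
Proof.
move=> oU; rewrite layer_level /nb_solutions; split.
  apply/andP; split; first by rewrite counting_layers; apply: nneseries_ge0 => m _ _; rewrite lee_fin.
  by apply: le_counting => x [Ux [Sx _]]; split=> //; exact/set_mem.
move=> fin; rewrite isolated_finite//; first exact: carrier_hausdorff.
by move: fin; rewrite /counting; case: asboolP.
Qed.

End Solutions.

Section AverageFormula.
Unset Implicit Arguments.
Context (R : realType) (n : nat) (X : manifold R n) (V : 'I_n -> function_space X).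
Context (d : 'I_n -> measure_display) (T : forall i, measurableType (d i)).
Context (nu : forall i, {measure set (T i) -> \bar R}).
Context (phi : forall i, T i -> R) (bphi : forall i, bounded_mfun (phi i)).
Context (a : forall i, T i -> 'rV[R]_(dim (V i))) (ma : forall i, measurable_fun setT (a i : T i -> borel 'rV[R]_(dim (V i)))).
Context (M : R) (aM : forall i L, `|a i L| <= M) (a0 : forall i L, phi i L != 0 -> a i L != 0).
Context (Lam : {measure set (prodT T) -> \bar R}) (Lamf : (Lam setT < +oo)%E).
Context (LamP : forall g : forall k, T k -> R, (forall k, bounded_mfun (g k)) ->
  \int[Lam]_L (\prod_k g k (L k)) = \prod_k \int[nu k]_x g k x).
Set Implicit Arguments.

Local Notation W := (fun i => dualsp (V i)).
Context (mu : forall i, AGr_measure (W i)) (Xi : signed_measure (AGr_tuple W) R).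
Hypothesis Hoff : forall i (A : set (borel (AGr_space (W i)))), measurable A -> smeasure (mu i) A = smeasure (mu i) (A `&` @AGr R (W i)).
Hypothesis Hhyp : forall i (A : set (borel (AGr_space (W i)))), measurable A -> A `<=` @AGr R (W i) -> finite_mass (mu i) A ->
  smeasure (mu i) A = (\int[nu i]_L ((phi i L)%:E * lebesgue_measure [set t : R | A (hyp (a i L) t)]))%E.
Hypothesis Hfin : forall i (A : set (borel (AGr_space (W i)))) k, measurable A -> A `<=` @hyperplanes_near R (W i) k `|` ~` @AGr R (W i) -> finite_mass (mu i) A.
Hypothesis HXi : is_product_measure mu Xi.

Context (U : set X) (oU : open U) (cU : compact (closure U)).

(** Where the product density is nonzero all the vectors [a i (L i)] are nonzero, so the tuple
    consists of genuine hyperplanes and its solutions form a level set; elsewhere the density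
    annihilates the integrand. *)
Lemma average_formula : average_nb_solutions Xi U =
  (\int[Lam]_L (sfun phi L * fine (\int[@lebesgue_n R n]_t nb_level_solutions (fun i => a i (L i)) U t)%E))%:E.
Proof.
have [C C0 hC] := integral_nb_level_solutions_bounded V M oU cU.
have IE (L : prodT T) : sfun phi L != 0 -> (\int[@lebesgue_n R n]_t layer R (level U) (Psi a (L, t)) =
    \int[@lebesgue_n R n]_t nb_level_solutions (fun i => a i (L i)) U t)%E.
  move=> s0; have c0 i : a i (L i) != 0.
    by apply: a0; apply: contra_neq s0 => p0; rewrite /sfun (bigD1 i)//= p0 mul0r.
  apply: eq_integral => t _; rewrite layer_level nb_level_solutionsE; congr (counting (U `&` _)).
  apply: (@solutionsE R n X V (Psi a (L, t)) (fun i => a i (L i)) (fun i => (t : 'rV[R]_n) 0 i) c0) => i.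
  exact: (@hyp_total_neq0 R (V i) _ ((t : 'rV[R]_n) 0 i) (c0 i)).
have HE B : measurable B -> (pos_part Xi B + Mm bphi ma Lam B = neg_part Xi B + Pm bphi ma Lam B)%E.
  exact: (Xi_eq bphi ma aM a0 Lamf LamP Hoff Hhyp Hfin HXi).
have HL B : measurable B -> (pos_part Xi B <= Pm bphi ma Lam B)%E /\ (neg_part Xi B <= Mm bphi ma Lam B)%E.
  exact: (Xi_le bphi ma aM a0 Lamf LamP Hoff Hhyp Hfin HXi).
have [_ E] := signed_average Lamf HE HL C0 (fun k => @measurable_level R n X V U k oU)
  (fun z => (nb_solutions_layer z oU).1) (fun z => (nb_solutions_layer z oU).2)
  (fun L s0 => ltac:(rewrite IE//; apply: hC => i; exact: aM)).
refine (etrans E (congr1 EFin _)); apply: eq_Rintegral => L _.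
have [s0|s0] := eqVneq (sfun phi L) 0; first by rewrite s0 !mul0r.
by rewrite IE.
Qed.

End AverageFormula.

(** * Integration over the charts and over the parameters *)

Lemma measurable_det (R : realType) n d (Z : measurableType d) (D : Z -> 'M[R]_n) :
  (forall i j, measurable_fun setT (fun z => D z i j)) -> measurable_fun setT (fun z => \det (D z)).
Proof.
move=> mD; apply: measurable_sum => s; apply: measurable_funM; first exact: measurable_cst.
by apply: measurable_prod => i _; exact: mD.
Qed.

Lemma measurable_fun_continuous_at (R : realType) n (O : set 'rV[R]_n) (f : 'rV[R]_n -> R) : open O ->
  (forall x, O x -> {for x, continuous f}) -> measurable_fun (O : set (borel 'rV[R]_n)) (f : borel 'rV[R]_n -> R).
Proof.
move=> oO cf _; have mO : measurable (O : set (borel 'rV[R]_n)) by exact: open_borel.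
apply: (measurability _ (RGenOInfty.measurableE R)) => //.
move=> _ [_ [a ->] <-]; apply: open_borel.
rewrite openE => x [Ox xa]; apply: filterI; first exact: open_nbhs_nbhs.
by have := cf x Ox; apply; apply: open_nbhs_nbhs; split.
Qed.

Section ChartPieces.
Context (R : realType) (n : nat) (X : manifold R n) (U : set X) (oU : open U).

(** Coordinates of the points of [U] whose preferred chart is the k-th, the same pieces over which
    [volume] sums; see [chart_partE]. *)
Definition chart_part (k : nat) : set (borel 'rV[R]_n) := cpart U id (fun j => dom (atlas X j)) k.

Lemma measurable_chart_part k : measurable (chart_part k).
Proof. exact: (measurable_cpart oU (fun j => @dom_open _ _ _ (atlas X j)) (fun j x (h : dom (atlas X j) x) => h)). Qed.

Lemma chart_part_img k : chart_part k `<=` img X k. Proof. exact: (cpart_img (fun j x (h : dom (atlas X j) x) => h)). Qed.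

Lemma chart_partE k q : chart_part k q <-> exists x, [/\ U x, chart_idx x = k & q = fwd (atlas X k) x].
Proof.
rewrite /chart_part /cpart /part (_ : seqDU _ k = (U `&` dom (atlas X k)) `\` \bigcup_(i < k) (U `&` dom (atlas X i))); last first.
  by rewrite /seqDU bigcup_mkord.
split=> [[x [[Ux dx] nx] <-]|[x [Ux <- ->]]].
  exists x; split=> //; rewrite /chart_idx; case: ex_minnP => m /asboolP dm hm; apply/eqP.
  rewrite eqn_leq hm ?andTb; last exact/asboolP.
  by rewrite leqNgt; apply/negP => mk; apply: nx; exists m.
rewrite /chart_idx; case: ex_minnP => m /asboolP dm hm; exists x => //; split=> //.
move=> [l /= lm [_ dl]]; have := hm l (asboolT dl).
by rewrite leqNgt lm.
Qed.

End ChartPieces.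

Section LevelTonelli.
Unset Implicit Arguments.
Context (R : realType) (n : nat) (X : manifold R n) (V : 'I_n -> function_space X).
Context (d : 'I_n -> measure_display) (T : forall i, measurableType (d i)).
Context (a : forall i, T i -> 'rV[R]_(dim (V i))) (ma : forall i, measurable_fun setT (a i : T i -> borel 'rV[R]_(dim (V i)))).
Context (M : R) (aM : forall i L, `|a i L| <= M).
Context (Lam : {measure set (prodT T) -> \bar R}) (Lamf : (Lam setT < +oo)%E).
Context (U : set X) (oU : open U) (cU : compact (closure U)).
Set Implicit Arguments.

Local Notation Ak := (chart_part U).
Local Notation aL := (fun (L : prodT T) i => a i (L i)).

Lemma measurable_aL i b : measurable_fun setT (fun L : prodT T => a i (L i) 0 b).
Proof.
move=> _ B mB; rewrite setTI.
have m0 := @measurable_coord R (dim (V i)) b measurableT _ mB; rewrite setTI in m0.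
have m1 := ma i measurableT _ m0; rewrite setTI in m1.
by have := @measurable_proj n d T i measurableT _ m1; rewrite setTI.
Qed.

Lemma bounded_mfun_system_jac k q : bounded_mfun (fun L : prodT T => `|\det (system_jac k (aL L) q)|).
Proof.
apply: bounded_mfun_norm; apply: bounded_mfun_det => i j; apply: bounded_mfun_eq (_ : bounded_mfun (fun L : prodT T => \sum_b a i (L i) 0 b * eval_jac (V i) k q b j)).
  by move=> L; rewrite !mxE.
apply: bounded_mfun_sum => b; apply: bounded_mfunM; last exact: bounded_mfun_cst.
by split; [exact: measurable_aL|exists M => L; apply: le_trans (aM i (L i)); exact: rV_coord_le].
Qed.


(** The Jacobian extended by 0 off [Ak k], with the entries of [eval_jac] extended likewise, so that
    the function is measurable on the whole product. *)
Let g k (p : prodT T * borel 'rV[R]_n) : R := `|\det (\matrix_(i, j)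
   \sum_b a i (p.1 i) 0 b * (((fun q : borel 'rV[R]_n => eval_jac (V i) k q b j) \_ (Ak k)) p.2))| * \1_(Ak k) p.2.

Let g_in k L q : Ak k q -> g k (L, q) = `|\det (system_jac k (aL L) q)|.
Proof.
move=> Aq; rewrite /g /= indicE mem_set// mulr1; congr (`|\det _|).
by apply/matrixP => i j; rewrite !mxE; apply: eq_bigr => b _; rewrite /patch mem_set.
Qed.

Let g_out k L q : ~ Ak k q -> g k (L, q) = 0.
Proof. by move=> Aq; rewrite /g /= indicE memNset// mulr0. Qed.

Let g_ge0 k p : 0 <= g k p.
Proof. by rewrite mulr_ge0// indicE. Qed.

Let mg k : measurable_fun setT (g k).
Proof.
have mA := measurable_chart_part oU k.
apply: measurable_funM; last by apply: (measurableT_comp (measurable_indic mA)); exact: measurable_snd.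
apply: measurableT_comp => //; apply: measurable_det => i j.
rewrite (_ : (fun _ => _) = fun p : prodT T * borel 'rV[R]_n => \sum_b a i (p.1 i) 0 b *
  (((fun q : borel 'rV[R]_n => eval_jac (V i) k q b j) \_ (Ak k)) p.2)); last by apply/funext => p; rewrite mxE.
apply: measurable_sum => b; apply: measurable_funM.
  move=> _ B mB; rewrite setTI; have m1 := @measurable_aL i b measurableT _ mB; rewrite setTI in m1.
  by have := @measurable_fst _ _ (prodT T) (borel 'rV[R]_n) measurableT _ m1; rewrite setTI.
apply: measurableT_comp; last exact: measurable_snd.
apply/(measurable_restrictT _ mA); apply: (measurable_funS (open_borel (@open_img R n X k)) (@chart_part_img R n X U k)).
by apply: measurable_fun_continuous_at; [exact: open_img|move=> q; exact: eval_jac_continuous].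
Qed.

Let detint k L := (\int[@lebesgue_n R n]_(q in Ak k) (`|\det (system_jac k (aL L) q)|)%:E)%E.

Let detintE k L : detint k L = (\int[@lebesgue_n R n]_q (g k (L, q))%:E)%E.
Proof.
rewrite /detint integral_mkcond; apply: eq_integral => q _; rewrite /patch; case: ifPn => [/set_mem Aq|/negP Aq].
  by rewrite g_in.
by rewrite g_out// => /mem_set.
Qed.

Let measurable_detint k : measurable_fun setT (detint k).
Proof.
rewrite (_ : detint k = fun L => \int[@lebesgue_n R n]_q (g k (L, q))%:E)%E; last by apply/funext => L; exact: detintE.
have mG : measurable_fun setT (fun p => (g k p)%:E) by apply/measurable_EFinP; exact: mg.
apply: (@measurable_fun_fubini_tonelli_F _ _ _ _ _ (@lebesgue_n R n) _ mG) => p; by rewrite lee_fin.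
Qed.

Section Weight.
Context (w : prodT T -> R) (bw : bounded_mfun w) (w0 : forall L, 0 <= w L).

Definition Dw k (q : borel 'rV[R]_n) : R := \int[Lam]_L (w L * `|\det (system_jac k (aL L) q)|).

Lemma Dw_ge0 k q : 0 <= Dw k q.
Proof. by apply: Rintegral_ge0 => L _; rewrite mulr_ge0. Qed.

Let f k (p : prodT T * borel 'rV[R]_n) : \bar R := ((w p.1)%:E * (g k p)%:E)%E.

Let f_ge0 k p : (0 <= f k p)%E.
Proof. by rewrite mule_ge0// lee_fin. Qed.

Let mf k : measurable_fun setT (f k).
Proof.
apply: emeasurable_funM; apply/measurable_EFinP; last exact: mg.
by apply: measurableT_comp; [exact: bw.1|exact: measurable_fst].
Qed.

Let IfE k q : (\int[Lam]_L f k (L, q) = ((fun q => (Dw k q)%:E) \_ (Ak k)) q)%E.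
Proof.
rewrite /patch; case: ifPn => [/set_mem Aq|/negP Aq].
  rewrite -EFin_Rint//; last by apply: bounded_mfunM => //; exact: bounded_mfun_system_jac.
  by apply: eq_integral => L _; rewrite /f g_in// EFinM.
by rewrite integral0_eq// => L _; rewrite /f g_out ?mule0// => /mem_set.
Qed.

Lemma measurable_Dw k : measurable_fun (Ak k) (fun q => (Dw k q)%:E).
Proof.
apply/(measurable_restrictT _ (measurable_chart_part oU k)).
rewrite (_ : _ \_ _ = (fun q => \int[Lam]_L f k (L, q))%E); last by apply/funext => q; rewrite IfE.
exact: (@measurable_fun_fubini_tonelli_G _ _ _ _ _ (finm Lamf) _ (mf k) (f_ge0 k)).
Qed.

Let level_int L : (\int[@lebesgue_n R n]_t nb_level_solutions (aL L) U t = \sum_(0 <= k <oo) detint k L)%E.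
Proof.
apply: (integral_nb_level_solutions oU (kap := id) (fun j => @dom_open _ _ _ (atlas X j)) (fun j x (h : dom (atlas X j) x) => h)).
by move=> x _; have [k /asboolP dk] := atlas_cover x; exists k.
Qed.

Let level_fin C : (forall c : forall i, 'rV[R]_(dim (V i)), (forall i, `|c i| <= M) -> (\int[@lebesgue_n R n]_t nb_level_solutions c U t <= C%:E)%E) ->
  forall L, (\int[@lebesgue_n R n]_t nb_level_solutions (aL L) U t)%E \is a fin_num.
Proof.
move=> hC L; rewrite ge0_fin_numE; last by apply: integral_ge0 => t _; exact: layer_ge0.
by apply: le_lt_trans (hC _ _) _; [move=> i; exact: aM|exact: ltry].
Qed.

Let detint_ge0 k L : (0 <= detint k L)%E.
Proof. by apply: integral_ge0 => q _; rewrite lee_fin. Qed.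

Lemma bounded_mfun_level : bounded_mfun (fun L => w L * fine (\int[@lebesgue_n R n]_t nb_level_solutions (aL L) U t)%E).
Proof.
have [C C0 hC] := integral_nb_level_solutions_bounded V M oU cU; have Ifin := level_fin hC.
have [mw [c hc]] := bw; split; last first.
  exists (c * C) => L; rewrite normrM ler_pM// ger0_norm; last by apply/fine_ge0/integral_ge0 => t _; exact: layer_ge0.
  by rewrite -lee_fin fineK//; apply: hC => i; exact: aM.
apply: measurable_funM => //; apply: (measurableT_comp (@fine_measurable R setT measurableT)).
rewrite (_ : (fun _ => _) = fun L => \sum_(0 <= k <oo) detint k L)%E; last by apply/funext => L; exact: level_int.
exact: ge0_emeasurable_sum.
Qed.

(** Tonelli's theorem exchanges the parameters [L] with the point [q] on each chart piece. It is
    applied to non-negative weights; signed ones enter as differences. *)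
Lemma level_tonelli : (\sum_(0 <= k <oo) \int[@lebesgue_n R n]_(q in Ak k) (Dw k q)%:E)%E =
  (\int[Lam]_L (w L * fine (\int[@lebesgue_n R n]_t nb_level_solutions (aL L) U t)%E))%:E.
Proof.
have [C C0 hC] := integral_nb_level_solutions_bounded V M oU cU.
have d0 k L : (0 <= detint k L)%E by apply: integral_ge0 => q _; rewrite lee_fin.
have E k : (\int[@lebesgue_n R n]_(q in Ak k) (Dw k q)%:E = \int[Lam]_L ((w L)%:E * detint k L))%E.
  rewrite integral_mkcond; under eq_integral do rewrite -IfE.
  rewrite -[LHS](@fubini_tonelli _ _ _ _ _ (finm Lamf) (@lebesgue_n R n) _ (mf k) (f_ge0 k)).
  apply: eq_integral => L _; rewrite detintE -ge0_integralZl//.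
  - apply/measurable_EFinP => _ B mB; rewrite setTI; have := mg k measurableT mB; rewrite setTI.
    move/(measurable_xsection L); congr measurable; apply/seteqP.
    by split=> q; [move=> /set_mem|move=> h; apply/mem_set].
  - by move=> q _; rewrite lee_fin.
  - by rewrite lee_fin.
rewrite (eq_eseriesr (g := fun k => (\int[Lam]_L ((w L)%:E * detint k L))%E)); last by move=> k _; exact: E.
rewrite -integral_nneseries//; last 2 first.
- by move=> k; apply: emeasurable_funM => //; apply/measurable_EFinP; exact: bw.1.
- by move=> k L _; rewrite mule_ge0 ?lee_fin.
have Ifin := level_fin hC.
rewrite -EFin_Rint//; last exact: bounded_mfun_level.
apply: eq_integral => L _; rewrite nneseriesZl// -level_int EFinM fineK//.
Qed.

End Weight.

End LevelTonelli.

Section SignedSeries.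
Context (R : realType) d (T : measurableType d) (m : {measure set T -> \bar R}) (A : nat -> set T) (mA : forall k, measurable (A k)).
Context (I : finType) (Dp Dn : I -> nat -> T -> R) (Pp Pn : I -> R).
Context (Dp0 : forall s k q, 0 <= Dp s k q) (Dn0 : forall s k q, 0 <= Dn s k q).
Context (mDp : forall s k, measurable_fun (A k) (fun q => (Dp s k q)%:E)) (mDn : forall s k, measurable_fun (A k) (fun q => (Dn s k q)%:E)).
Context (EDp : forall s, (\sum_(0 <= k <oo) \int[m]_(q in A k) (Dp s k q)%:E = (Pp s)%:E)%E).
Context (EDn : forall s, (\sum_(0 <= k <oo) \int[m]_(q in A k) (Dn s k q)%:E = (Pn s)%:E)%E).

Let combo (D : I -> nat -> T -> R) (P : I -> R) (c : I -> R) : (forall s k q, 0 <= D s k q) ->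
  (forall s k, measurable_fun (A k) (fun q => (D s k q)%:E)) ->
  (forall s, (\sum_(0 <= k <oo) \int[m]_(q in A k) (D s k q)%:E = (P s)%:E)%E) -> (forall s, 0 <= c s) ->
  (forall k, measurable_fun (A k) (fun q => (\sum_s c s * D s k q)%:E)) /\
  (\sum_(0 <= k <oo) \int[m]_(q in A k) (\sum_s c s * D s k q)%:E = (\sum_s c s * P s)%:E)%E.
Proof.
move=> D0 mD ED c0.
have mc k s : measurable_fun (A k) (fun q => ((c s)%:E * (D s k q)%:E)%E) by apply: emeasurable_funM.
split=> [k|].
  rewrite (_ : (fun _ => _) = fun q => \sum_s ((c s)%:E * (D s k q)%:E)%E); first by apply: emeasurable_sum => s; exact: mc.
  by apply/funext => q; rewrite -sumEFin; apply: eq_bigr => s _; rewrite EFinM.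
have E k : (\int[m]_(q in A k) (\sum_s c s * D s k q)%:E = \sum_s (c s)%:E * \int[m]_(q in A k) (D s k q)%:E)%E.
  under eq_integral do rewrite -sumEFin.
  rewrite ge0_integral_sum//; last 2 first.
  - by move=> s; exact: mc.
  - by move=> s q _; rewrite lee_fin mulr_ge0.
  apply: eq_bigr => s _; under eq_integral do rewrite EFinM.
  by rewrite ge0_integralZl ?lee_fin// => q _; rewrite lee_fin.
have i0 s k : (0 <= \int[m]_(q in A k) (D s k q)%:E)%E by apply: integral_ge0 => q _; rewrite lee_fin.
rewrite (eq_eseriesr (g := fun k => (\sum_s (c s)%:E * \int[m]_(q in A k) (D s k q)%:E)%E)); last by move=> k _; exact: E.
rewrite nneseries_sum; last by move=> s k _; rewrite mule_ge0 ?lee_fin.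
rewrite -sumEFin; apply: eq_bigr => s _; rewrite nneseriesZl; last by move=> k _; exact: i0.
by rewrite ED EFinM.
Qed.

(** With b = bp - bn all negative terms are moved to the other side, which leaves integrals and
    series of non-negative functions; all of them but the series of [g] are known to be finite, so
    the subtraction can be made at the end. *)
Lemma signed_series (b : I -> R) (g : nat -> T -> R) :
  (forall k q, A k q -> 0 <= g k q) -> (forall k q, A k q -> g k q = \sum_s b s * (Dp s k q - Dn s k q)) ->
  (\sum_(0 <= k <oo) \int[m]_(q in A k) (g k q)%:E = (\sum_s b s * (Pp s - Pn s))%:E)%E.
Proof.
move=> g0 gE; pose bp s := Num.max (b s) 0; pose bn s := Num.max (- b s) 0.
have bE s : b s = bp s - bn s.
  by rewrite /bp /bn; case: (lerP (b s) 0) => h1; case: (lerP (- b s) 0) => h2; lra.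
have bp0 s : 0 <= bp s by rewrite /bp le_max lexx orbT.
have bn0 s : 0 <= bn s by rewrite /bn le_max lexx orbT.
have [m1 e1] := combo Dp0 mDp EDp bp0; have [m2 e2] := combo Dn0 mDn EDn bn0.
have [m3 e3] := combo Dn0 mDn EDn bp0; have [m4 e4] := combo Dp0 mDp EDp bn0.
pose F (c c' : I -> R) k q := \sum_s c s * Dp s k q + \sum_s c' s * Dn s k q.
have F0 (c : I -> R) (D : I -> nat -> T -> R) k q : (forall s, 0 <= c s) -> (forall s k q, 0 <= D s k q) -> 0 <= \sum_s c s * D s k q.
  by move=> c0 D0; apply: sumr_ge0 => s _; rewrite mulr_ge0.
have gF k q : A k q -> g k q + (\sum_s bn s * Dp s k q + \sum_s bp s * Dn s k q) = \sum_s bp s * Dp s k q + \sum_s bn s * Dn s k q.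
  move=> Aq; rewrite gE// -!big_split /=; apply: eq_bigr => s _; rewrite bE; ring.
have mg k : measurable_fun (A k) (fun q => (g k q)%:E).
  have h : measurable_fun (A k) (fun q => (\sum_s b s * (Dp s k q - Dn s k q))%:E).
    apply/measurable_EFinP; apply: measurable_sum => s; apply: measurable_funM => //.
    by apply: measurable_funB; apply/measurable_EFinP; [exact: mDp|exact: mDn].
  by apply: eq_measurable_fun h => q /set_mem Aq; rewrite gE.
have iD k (f1 f2 : T -> R) : (forall q, A k q -> 0 <= f1 q) -> (forall q, A k q -> 0 <= f2 q) ->
    measurable_fun (A k) (fun q => (f1 q)%:E) -> measurable_fun (A k) (fun q => (f2 q)%:E) ->
    (\int[m]_(q in A k) (f1 q + f2 q)%:E = \int[m]_(q in A k) (f1 q)%:E + \int[m]_(q in A k) (f2 q)%:E)%E.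
  move=> f10 f20 mf1 mf2; under eq_integral do rewrite EFinD.
  by rewrite ge0_integralD// => q Aq; rewrite lee_fin; first [exact: f10|exact: f20].
have mD k (f1 f2 : T -> R) : measurable_fun (A k) (fun q => (f1 q)%:E) -> measurable_fun (A k) (fun q => (f2 q)%:E) ->
    measurable_fun (A k) (fun q => (f1 q + f2 q)%:E).
  by move=> h1 h2; apply/measurable_EFinP; apply: measurable_funD; exact/measurable_EFinP.
have i0 k (f : T -> R) : (forall q, A k q -> 0 <= f q) -> (0 <= \int[m]_(q in A k) (f q)%:E)%E.
  by move=> f0; apply: integral_ge0 => q Aq; rewrite lee_fin; exact: f0.
have SD (f1 f2 : nat -> T -> R) : (forall k q, A k q -> 0 <= f1 k q) -> (forall k q, A k q -> 0 <= f2 k q) ->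
    (forall k, measurable_fun (A k) (fun q => (f1 k q)%:E)) -> (forall k, measurable_fun (A k) (fun q => (f2 k q)%:E)) ->
    (\sum_(0 <= k <oo) \int[m]_(q in A k) (f1 k q)%:E + \sum_(0 <= k <oo) \int[m]_(q in A k) (f2 k q)%:E =
     \sum_(0 <= k <oo) \int[m]_(q in A k) (f1 k q + f2 k q)%:E)%E.
  move=> h1 h2 h3 h4; rewrite -nneseriesD; last 2 first.
  - by move=> k _ _; apply: i0; exact: h1.
  - by move=> k _ _; apply: i0; exact: h2.
  by apply: eq_eseriesr => k _; rewrite iD//; [exact: h1|exact: h2].
have : (\sum_(0 <= k <oo) \int[m]_(q in A k) (g k q)%:E + (\sum_s bn s * Pp s + \sum_s bp s * Pn s)%:E =
    (\sum_s bp s * Pp s + \sum_s bn s * Pn s)%:E)%E.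
  have nn (c : I -> R) (D : I -> nat -> T -> R) : (forall s, 0 <= c s) -> (forall s k q, 0 <= D s k q) ->
      forall k q, A k q -> 0 <= \sum_s c s * D s k q by move=> c0 D0 k q _; exact: F0.
  rewrite !EFinD -e1 -e2 -e3 -e4 !SD//; try exact: nn.
  - by apply: eq_eseriesr => k _; apply: eq_integral => q /set_mem Aq; rewrite gF.
  - by move=> k q Aq; rewrite addr_ge0//; exact: nn Aq.
  - by move=> k; exact: mD.
have -> : \sum_s b s * (Pp s - Pn s) = (\sum_s bp s * Pp s + \sum_s bn s * Pn s) - (\sum_s bn s * Pp s + \sum_s bp s * Pn s).
  rewrite -!big_split /= -sumrB; apply: eq_bigr => s _; rewrite bE; ring.
case: (\sum_(0 <= k <oo) _)%E => [x| |] // [e]; congr EFin; lra.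
Qed.

End SignedSeries.

(** * The volume of Minkowski combinations of bodies *)

Lemma dep_choice (I : Type) (T : I -> Type) (P : forall i, T i -> Prop) :
  (forall i, exists x, P i x) -> exists f : forall i, T i, forall i, P i (f i).
Proof. by move=> h; exists (fun i => sval (cid (h i))) => i; exact: svalP. Qed.

Section MinkowskiCombination.
Context (R : realType) (n : nat).

Lemma compact_sums m (P : 'I_m -> set 'rV[R]_n) : (forall i, compact (P i)) ->
  compact [set p | exists2 x : 'I_m -> 'rV[R]_n, (forall i, P i (x i)) & p = \sum_i x i].
Proof.
elim: m P => [|m IH] P cP.
  rewrite (_ : [set _ | _] = [set 0]); first exact: compact_set1.
  apply/seteqP; split=> p; first by move=> [x _ ->]; rewrite big_ord0.
  by move=> ->; exists (fun i => 0); [case|rewrite big_ord0].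
rewrite (_ : [set _ | _] = msum (P ord0) [set p | exists2 x : 'I_m -> 'rV[R]_n, (forall i, P (lift ord0 i) (x i)) & p = \sum_i x i]).
  by apply: compact_msum => //; exact: (IH (fun i => P (lift ord0 i)) (fun i => cP (lift ord0 i))).
apply/seteqP; split=> p.
  move=> [x Px ->]; exists (x ord0) => //; exists (\sum_i x (lift ord0 i)); last by rewrite big_ord_recl.
  by exists (fun i => x (lift ord0 i)).
move=> [p0 Pp0 [_ [x Px ->] <-]].
exists (fun i => if unlift ord0 i is Some j then x j else p0).
  by move=> i; case: unliftP => [j ->|->].
rewrite big_ord_recl unlift_none; congr (_ + _); apply: eq_bigr => i _; by rewrite liftK.
Qed.

Unset Implicit Arguments.
Context (m : nat) (e : 'I_m -> nat) (K : forall i, set 'rV[R]_(e i)) (h : forall i, 'rV[R]_(e i) -> R).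
Context (cK : forall i, compact (K i)) (vK : forall i, cvx (K i)) (hK : forall i, has_supp (K i) (h i)).
Set Implicit Arguments.

(** The fibre of a combination of bodies over a point, in coordinates: [K i] will be a unit ball and
    [G i] the matrix [eval_jac]. *)
Definition fibre (G : forall i, 'M[R]_(e i, n)) (lam : 'I_m -> R) : set 'rV[R]_n :=
  [set p | exists2 k : forall i, 'rV[R]_(e i), (forall i, K i (k i)) & p = \sum_i lam i *: (k i *m G i)].

Definition hfib (G : forall i, 'M[R]_(e i, n)) (lam : 'I_m -> R) (v : 'rV[R]_n) : R :=
  \sum_i lam i * h i (v *m (G i)^T).

Lemma dot_tr p q (k : 'rV[R]_p) (G : 'M[R]_(p, q)) (v : 'rV[R]_q) : dot (k *m G) v = dot k (v *m G^T).
Proof. by rewrite /dot trmx_mul trmxK mulmxA. Qed.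

Lemma compact_fibre G lam : compact (fibre G lam).
Proof.
rewrite (_ : fibre G lam = [set p | exists2 x : 'I_m -> 'rV[R]_n, (forall i, ((fun k => lam i *: (k *m G i)) @` K i) (x i)) & p = \sum_i x i]).
  apply: (@compact_sums m (fun i => (fun k => lam i *: (k *m G i)) @` K i)) => i; apply: continuous_compact => //; apply: continuous_subspaceT.
  apply: linear_continuous_rV => a u v; by rewrite mulmxDl scalerDr -scalemxAl !scalerA mulrC.
apply/seteqP; split=> p [k Kk ->].
  by exists (fun i => lam i *: (k i *m G i)) => // i; exists (k i).
have hk i : exists y, K i y /\ lam i *: (y *m G i) = k i by have [y Ky e'] := Kk i; exists y.
have [x hx] := dep_choice hk.
by exists x => [i|]; [exact: (hx i).1|apply: eq_bigr => i _; rewrite (hx i).2].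
Qed.

Lemma cvx_fibre G lam : cvx (fibre G lam).
Proof.
move=> _ _ t [x Kx ->] [y Ky ->] t01; exists (fun i => t *: x i + (1 - t) *: y i); first by move=> i; exact: vK.
rewrite !scaler_sumr -big_split /=; apply: eq_bigr => i _.
by rewrite mulmxDl scalerDr -!scalemxAl !scalerA ![lam i * _]mulrC.
Qed.

Lemma fibre_supp G lam : (forall i, 0 <= lam i) -> has_supp (fibre G lam) (hfib G lam).
Proof.
move=> l0; have dE (x : forall i, 'rV[R]_(e i)) v : dot (\sum_i lam i *: (x i *m G i)) v = \sum_i lam i * dot (x i) (v *m (G i)^T).
  rewrite dotC (_ : dot v _ = \sum_i dot v (lam i *: (x i *m G i))).
    by apply: eq_bigr => i _; rewrite dotC dotZl dot_tr.
  by rewrite /dot linear_sum mulmx_sumr summxE.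
split=> [_ v [x Kx ->]|v].
  by rewrite dE; apply: ler_sum => i _; rewrite ler_wpM2l//; exact: (hK i).1.
have hx i : exists k, K i k /\ dot k (v *m (G i)^T) = h i (v *m (G i)^T).
  by have [k Kk e'] := (hK i).2 (v *m (G i)^T); exists k.
have [x hx'] := dep_choice hx.
exists (\sum_i lam i *: (x i *m G i)); first by exists x => // i; exact: (hx' i).1.
by rewrite dE; apply: eq_bigr => i _; rewrite (hx' i).2.
Qed.

End MinkowskiCombination.

Section SupportContinuity.
Context (R : realType) (n : nat).

Lemma supp_continuous (K : set 'rV[R]_n) h : compact K -> has_supp K h -> continuous h.
Proof.
move=> cK [h1 h2]; have [M M0 hM] := compact_norm_le cK.
have le x y : h x - h y <= M * n%:R * `|x - y|.
  have [k Kk <-] := h2 x; apply: (@le_trans _ _ (dot k x - dot k y)); first by rewrite lerB// h1.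
  rewrite dotC [dot k y]dotC -dotNl -dotDl dotE; apply: le_trans (ler_norm _) _; apply: le_trans (ler_norm_sum _ _ _) _.
  apply: (@le_trans _ _ (\sum_(j < n) M * `|x - y|)); last by rewrite sumr_const card_ord -[X in X <= _]mulr_natr mulrAC.
  apply: ler_sum => j _; rewrite normrM mulrC ler_pM//; last exact: rV_coord_le.
  by apply: le_trans (hM k Kk); exact: rV_coord_le.
have lip x y : `|h x - h y| <= M * n%:R * `|x - y|.
  by rewrite ler_norml le ?andbT; have := le y x; rewrite distrC; lra.
move=> x A /nbhs_ballP[e /= e0 eA]; apply/nbhs_ballP; exists (e / (M * n%:R + 1)).
  by rewrite /= divr_gt0// ltr_wpDl// mulr_ge0// ltW.
move=> y; rewrite -ball_normE /= => xy; apply: eA; rewrite /ball /=; apply: le_lt_trans (lip x y) _.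
apply: (@le_lt_trans _ _ ((M * n%:R + 1) * `|x - y|)); first by rewrite ler_wpM2r// lerDl.
by rewrite mulrC -ltr_pdivlMr// ltr_wpDl// mulr_ge0// ltW.
Qed.

Lemma dense_le (f : 'rV[R]_n -> R) : continuous f -> (forall p : 'rV[rat]_n, 0 <= f (map_mx ratr p)) -> forall v, 0 <= f v.
Proof.
move=> cf f0 v; rewrite leNgt; apply/negP => fv.
have oO : open [set v | f v < 0].
  by rewrite (_ : [set v | f v < 0] = f @^-1` [set y | y < 0])//; apply: open_comp => [x _|]; [exact: cf|exact: open_lt].
have := open_ratbox oO => /seteqP[+ _] => /(_ v fv)[p pO pv].
have : [set v | f v < 0] (map_mx ratr p.1).
  apply: pO => j; rewrite mxE; have /andP[h1 h2] := pv j; move: (le_trans h1 h2).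
  by rewrite !raddfB !raddfD /= => h3; apply/andP; split; lra.
by rewrite /= ltNge f0.
Qed.

End SupportContinuity.

Lemma continuous_at_row (R : realType) (T : topologicalType) n (F : T -> 'rV[R]_n) q :
  (forall j, {for q, continuous (fun y => F y 0 j)}) -> {for q, continuous F}.
Proof.
move=> h B /nbhs_ballP[e /= e0 eB].
have : \forall y \near q, forall j, ball (F q 0 j) e (F y 0 j).
  by apply: filter_forall => j; apply: (h j); apply/nbhs_ballP; exists e.
by apply: filterS => y hy; apply: eB; split=> // i j; rewrite (ord1 i).
Qed.

Section FibreVolume.
Unset Implicit Arguments.
Context (R : realType) (n m : nat) (e : 'I_m -> nat) (K : forall i, set 'rV[R]_(e i)) (h : forall i, 'rV[R]_(e i) -> R).
Context (cK : forall i, compact (K i)) (vK : forall i, cvx (K i)) (hK : forall i, has_supp (K i) (h i)).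
Context (O : set 'rV[R]_n) (G : 'rV[R]_n -> forall i, 'M[R]_(e i, n)) (oO : open O).
Context (cG : forall q i a b, O q -> {for q, continuous (fun q => G q i a b)}).
Context (A : set (borel 'rV[R]_n)) (mA : measurable A) (AO : A `<=` O).
Context (lam : 'I_m -> R) (l0 : forall i, 0 <= lam i).
Set Implicit Arguments.

Definition total : set (borel 'rV[R]_(n + n)) := [set z | A (lsubmx z) /\ fibre K (G (lsubmx z)) lam (rsubmx z)].

Lemma hfib_continuous q v : O q -> {for q, continuous (fun q => hfib h (G q) lam v)}.
Proof.
move=> Oq; apply: continuous_at_sum => i.
apply: (@continuousM _ _ (fun=> lam i) (fun q => h i (v *m (G q i)^T))); first exact: cst_continuous.
apply: (@continuous_comp _ _ _ (fun q => v *m (G q i)^T) (h i)); last exact: (supp_continuous (cK i) (hK i)).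
apply: continuous_at_row => j.
rewrite (_ : (fun _ => _) = fun q => \sum_b v 0 b * G q i j b); last first.
  by apply/funext => y; rewrite mxE; apply: eq_bigr => b _; rewrite mxE.
apply: continuous_at_sum => b; apply: (@continuousM _ _ (fun=> v 0 b) (fun q => G q i j b)); first exact: cst_continuous.
exact: cG.
Qed.

(** Support functions are continuous, so rational directions determine a compact convex set; [total]
    is thus cut out by countably many measurable inequalities. *)
Lemma fibreE q p : fibre K (G q) lam p <-> forall v : 'rV[rat]_n, dot p (map_mx ratr v) <= hfib h (G q) lam (map_mx ratr v).
Proof.
have sf := fibre_supp hK (G q) l0; have cf : compact (fibre K (G q) lam) by exact: compact_fibre.
have vf : cvx (fibre K (G q) lam) by exact: cvx_fibre.
split=> [Fp v|hp]; first exact: sf.1.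
have hp' v : 0 <= hfib h (G q) lam v - dot p v.
  apply: (dense_le (f := fun v => hfib h (G q) lam v - dot p v)) => [|w]; last by rewrite subr_ge0.
  move=> x; apply: (@continuousB _ _ _ (hfib h (G q) lam) (dot p)); first exact: (supp_continuous cf sf).
  by rewrite (_ : dot p = fun u => dot u p); [exact: dot_continuous|apply/funext => u; rewrite dotC].
apply: (@separation_subset R n [set p] _ cf vf) => // _ -> v.
by have [b Fb e'] := sf.2 v; exists b => //; rewrite e' -subr_ge0.
Qed.

Lemma measurable_total : measurable total.
Proof.
have ml : measurable_fun setT (fun z : borel 'rV[R]_(n + n) => lsubmx (z : 'rV[R]_(n + n)) : borel 'rV[R]_n).
  apply: measurable_rV => j; rewrite (_ : (fun _ => _) = fun z : borel 'rV[R]_(n + n) => (z : 'rV[R]_(n + n)) 0 (lshift n j)); last by apply/funext => z; rewrite mxE.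
  exact: measurable_coord.
have mr : measurable_fun setT (fun z : borel 'rV[R]_(n + n) => rsubmx (z : 'rV[R]_(n + n)) : borel 'rV[R]_n).
  apply: measurable_rV => j; rewrite (_ : (fun _ => _) = fun z : borel 'rV[R]_(n + n) => (z : 'rV[R]_(n + n)) 0 (rshift n j)); last by apply/funext => z; rewrite mxE.
  exact: measurable_coord.
have mlA : measurable [set z : borel 'rV[R]_(n + n) | A (lsubmx (z : 'rV[R]_(n + n)))].
  by have := ml measurableT _ mA; rewrite setTI.
pose H v := (fun q : borel 'rV[R]_n => hfib h (G q) lam v) \_ A.
have mH v : measurable_fun setT (H v).
  apply/(measurable_restrictT _ mA); apply: (measurable_funS (open_borel oO) AO).
  by apply: measurable_fun_continuous_at => // q Oq; exact: hfib_continuous.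
rewrite (_ : total = \bigcap_(v : 'rV[rat]_n) ([set z : borel 'rV[R]_(n + n) | A (lsubmx (z : 'rV[R]_(n + n)))] `&`
   [set z : borel 'rV[R]_(n + n) | 0 <= H (map_mx ratr v) (lsubmx (z : 'rV[R]_(n + n))) - dot (rsubmx (z : 'rV[R]_(n + n))) (map_mx ratr v)])).
  rewrite -[X in measurable X]setCK setC_bigcap; apply: measurableC.
  apply: countable_bigcupT_measurable => [|v]; first exact: countableP.
  apply: measurableC.
  apply: measurableI => //.
  have mF : measurable_fun setT (fun z : borel 'rV[R]_(n + n) => H (map_mx ratr v) (lsubmx (z : 'rV[R]_(n + n))) - dot (rsubmx (z : 'rV[R]_(n + n))) (map_mx ratr v)).
    apply: measurable_funB; first exact: (measurableT_comp (mH _) ml).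
    rewrite (_ : (fun _ => _) = fun z : borel 'rV[R]_(n + n) => \sum_j (z : 'rV[R]_(n + n)) 0 (rshift n j) * (map_mx ratr v : 'rV[R]_n) 0 j).
      by apply: measurable_sum => j; apply: measurable_funM => //; exact: measurable_coord.
    by apply/funext => z; rewrite dotE; apply: eq_bigr => j _; rewrite mxE.
  have := mF measurableT _ (measurable_itv `[0, +oo[); rewrite setTI; congr measurable.
  by apply/seteqP; split=> z; rewrite /= in_itv /= andbT.
apply/seteqP; split=> z.
  move=> [Az /fibreE Fz] v _; split=> //=; rewrite subr_ge0 /H /patch mem_set//; exact: Fz.
move=> hz; have [Az _] := hz 0 I; split=> //; apply/fibreE => v; have [_ /=] := hz v I.
by rewrite subr_ge0 /H /patch mem_set.
Qed.

Lemma lebesgue_n_total : lebesgue_n total = (\int[@lebesgue_n R n]_(q in A) (vol (fibre K (G q) lam))%:E)%E.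
Proof.
rewrite lebesgue_n_row; last exact: measurable_total.
rewrite [RHS]integral_mkcond; apply: eq_integral => q _; rewrite /patch; case: ifPn => [/set_mem Aq|/negP Aq].
  rewrite -volE; last exact: (compact_fibre cK).
  by congr (lebesgue_n _); apply/seteqP; split=> y; rewrite /total /= row_mxKl row_mxKr; [case|split].
rewrite (_ : [set y | _] = set0) ?measure0//; apply/seteqP; split=> // y; rewrite /total /= row_mxKl => -[Aq' _].
by apply: Aq; exact/mem_set.
Qed.

End FibreVolume.

(** * The coefficient of lambda_1 ... lambda_n of a form of degree n *)

Section SquarefreeCoefficient.
Import (coercions, canonicals) mpoly.
Context (R : realType) (n : nat).

Let ones := mpoly.Multinom [tuple 1%N | i < n].

Lemma mdeg_ones (m : mpoly.multinom n) : mpoly.mdeg m = n -> m != ones -> exists i, m i = 0%N.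
Proof.
move=> dm nm; apply: contrapT => h; move/eqP: nm; apply.
have m1 i : (1 <= m i)%N by rewrite lt0n; apply/eqP => mi; apply: h; exists i.
apply/mpoly.mnmP => i; rewrite mpoly.mnmE; apply/eqP; rewrite eqn_leq m1 andbT.
have := dm; rewrite mpoly.mdegE (bigD1 i)//= => e.
have : (\sum_(j < n | j != i) 1 <= \sum_(j < n | j != i) m j)%N by apply: leq_sum.
rewrite sum1_card cardC1 card_ord => h1.
have n0 : (0 < n)%N := leq_ltn_trans (leq0n i) (ltn_ord i).
have := leq_add (leqnn (m i)) h1; rewrite e.
by rewrite -[X in (_ <= X)%N -> _](prednK n0) -add1n leq_add2r.
Qed.

(* The coefficient of X_1 ... X_n of a form of degree n is the alternating sum of its values at the 0-1 vectors. *)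
Lemma squarefree_coef_eq0 (Q : mpoly.mpoly n R) : (forall m, mpoly.mcoeff m Q != 0 -> mpoly.mdeg m = n) ->
  (forall lam : 'I_n -> R, (forall i, 0 <= lam i) -> mpoly.meval lam Q = 0) -> mpoly.mcoeff ones Q = 0.
Proof.
move=> dQ Q0.
have : \sum_(f : {ffun 'I_n -> bool}) (\prod_i (-1) ^+ f i) * mpoly.meval (fun i => (f i)%:R) Q = 0.
  by apply: big1 => f _; rewrite Q0 ?mulr0.
under eq_bigr do rewrite mpoly.mevalE mulr_sumr.
rewrite exchange_big /=.
(* Summed over the 0-1 vectors, each variable contributes the factor 0^(m_i) - 1, which vanishes
   when m_i = 0; among the exponents of degree n only (1, ..., 1) has no such i. *)
have E m : \sum_(f : {ffun 'I_n -> bool}) (\prod_i (-1) ^+ f i) * (mpoly.mcoeff m Q * \prod_i (f i)%:R ^+ m i) =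
    mpoly.mcoeff m Q * \prod_i ((m i == 0%N)%:R - 1).
  rewrite (eq_bigr (fun f : {ffun 'I_n -> bool} => mpoly.mcoeff m Q * \prod_i ((-1) ^+ f i * (f i)%:R ^+ m i))); last by move=> f _; rewrite mulrCA big_split.
  rewrite -mulr_sumr -(bigA_distr_bigA (fun i (b : bool) => (-1) ^+ b * b%:R ^+ m i)) /=; congr (_ * _).
  apply: eq_bigr => i _; rewrite big_bool /= expr1 expr0 expr1n expr0n; ring.
under eq_bigr do rewrite E.
have [inQ|] := boolP (ones \in mpoly.msupp Q); last by rewrite -mpoly.mcoeff_eq0 => /eqP.
rewrite (bigD1_seq ones)//=.
rewrite [X in _ + X]big1_seq ?addr0.
  move/eqP; rewrite mulf_eq0 => /orP[/eqP//|]; rewrite prodf_seq_eq0 => /hasP[i _ /=].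
  by rewrite mpoly.mnmE /= sub0r oppr_eq0 oner_eq0.
move=> m /andP[mo mQ]; have [|i mi] := mdeg_ones (m := m) _ mo; first by apply: dQ; rewrite -mpoly.mcoeff_msupp.
by rewrite (bigD1 i)//= mi eqxx subrr mul0r mulr0.
Qed.

(** Exponents of the product of the variables X_(s k) over all k. *)
Definition mono (s : {ffun 'I_n -> 'I_n}) : mpoly.multinom n := mpoly.Multinom [tuple #|[pred k | s k == i]| | i < n].

Definition index_form (D : {ffun 'I_n -> 'I_n} -> R) : mpoly.mpoly n R := \sum_s D s *: mpoly.mpolyX R (mono s).

Lemma mdeg_mono s : mpoly.mdeg (mono s) = n.
Proof.
rewrite mpoly.mdegE -[RHS]card_ord -sum1_card [RHS](partition_big s xpredT)//=.
apply: eq_bigr => i _; rewrite mpoly.mnmE sum1_card; apply: eq_card => k; by rewrite inE.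
Qed.

Lemma mcoeff_form D m : mpoly.mcoeff m (index_form D) = \sum_s D s * (mono s == m)%:R.
Proof. by rewrite /index_form raddf_sum /=; apply: eq_bigr => s _; rewrite mpoly.mcoeffZ mpoly.mcoeffX. Qed.

Lemma form_homog D m : mpoly.mcoeff m (index_form D) != 0 -> mpoly.mdeg m = n.
Proof.
rewrite mcoeff_form => h; apply: contrapT => dm; move/eqP: h; apply; apply: big1 => s _.
by case: eqVneq => [e|]; [case: dm; rewrite -e mdeg_mono|rewrite mulr0].
Qed.

Lemma meval_form D lam : mpoly.meval lam (index_form D) = \sum_s D s * \prod_k lam (s k).
Proof.
rewrite /index_form raddf_sum /=; apply: eq_bigr => s _; rewrite mpoly.mevalZ mpoly.mevalX; congr (_ * _).
rewrite [RHS](partition_big s xpredT)//=; apply: eq_bigr => i _; rewrite mpoly.mnmE.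
rewrite (eq_bigr (fun=> lam i)); last by move=> k /eqP ->.
by rewrite -prodr_const; apply: eq_bigl => k; rewrite inE.
Qed.

Lemma mono_ones s : (mono s == ones) = injectiveb s.
Proof.
apply/eqP/injectiveP => [e k k' ss|si].
  have : #|[pred l | s l == s k]| = 1%N by have := congr1 (fun m : mpoly.multinom n => m (s k)) e; rewrite !mpoly.mnmE.
  move=> /mem_card1[z h]; have := h k; have := h k'; rewrite !inE ss eqxx => /esym/eqP -> /esym/eqP -> //.
apply/mpoly.mnmP => i; rewrite !mpoly.mnmE; rewrite -(card1 (invF si i)); apply: eq_card => k; rewrite !inE.
by apply/eqP/eqP => [<-|->]; [rewrite invF_f|rewrite f_invF].
Qed.

(** The maps [s] whose monomial is X_1 ... X_n are the n! permutations. *)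
Lemma form_coef D (c : R) : (forall s : {ffun 'I_n -> 'I_n}, injective s -> D s = c) ->
  mpoly.mcoeff ones (index_form D) = n`!%:R * c.
Proof.
move=> Dc; rewrite mcoeff_form (eq_bigr (fun s : {ffun 'I_n -> 'I_n} => if injectiveb s then c else 0)).
  rewrite -big_mkcond /= sumr_const mulr_natl; congr (_ *+ _).
  have := card_inj_ffuns 'I_n 'I_n; rewrite card_ord ffactnn => <-.
  by apply: eq_card => s; rewrite !inE.
by move=> s _; rewrite mono_ones; case: injectiveP => [/Dc ->|_]; rewrite ?mulr1 ?mulr0.
Qed.

(** [mixed_volume] ranges over all forms that represent the volume for lambda >= 0; they share the
    coefficient it extracts. *)
Lemma form_unique D (P : mpoly.mpoly n R) : (forall m, mpoly.mcoeff m P != 0 -> mpoly.mdeg m = n) ->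
  (forall lam : 'I_n -> R, (forall i, 0 <= lam i) -> mpoly.meval lam P = mpoly.meval lam (index_form D)) ->
  mpoly.mcoeff ones P = mpoly.mcoeff ones (index_form D).
Proof.
move=> dP eP; apply/eqP; rewrite -subr_eq0 -mpoly.mcoeffB; apply/eqP; apply: squarefree_coef_eq0 => [m|lam l0].
  rewrite mpoly.mcoeffB; have [->|/dP//] := eqVneq (mpoly.mcoeff m P) 0.
  by rewrite sub0r oppr_eq0; exact: form_homog.
by rewrite mpoly.mevalB eP// subrr.
Qed.

End SquarefreeCoefficient.

(** * The mixed volume as an average *)

Section VolumeFormula.
Unset Implicit Arguments.
Context (R : realType) (n : nat) (X : manifold R n) (V : 'I_n -> function_space X) (N : forall i, V i -> R).
Context (Nn : forall i, is_norm (N i)) (cN : forall i, compact (K0 (N i))).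
Context (d : 'I_n -> measure_display) (T : forall i, measurableType (d i)).
Context (nu : forall i, {measure set (T i) -> \bar R}) (nuf : forall i, (nu i setT < +oo)%E).
Context (phi : forall i, T i -> R) (bphi : forall i, bounded_mfun (phi i)).
Context (a : forall i, T i -> 'rV[R]_(dim (V i))) (ma : forall i, measurable_fun setT (a i : T i -> borel 'rV[R]_(dim (V i)))).
Context (M : R) (aM : forall i L, `|a i L| <= M).
Context (hK : forall i, has_supp (K0 (N i)) (fun x => \int[nu i]_L (phi i L * `|dot (a i L) x|))).
Context (U : set X) (oU : open U) (cU : compact (closure U)).
Set Implicit Arguments.

Definition level_integral (s : 'I_n -> 'I_n) (L : prodT (fun k => T (s k))) : R :=
  fine (\int[@lebesgue_n R n]_t nb_level_solutions (V := fun k => V (s k)) (fun k => a (s k) (L k)) U t)%E.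

(** The average for the system whose k-th equation is taken from the space V (s k); maps [s] with
    repetitions occur in the expansion of the volume. *)
Definition average_of (s : 'I_n -> 'I_n) : R :=
  \int[prod_nu nuf s]_L (sfun (fun k => phi (s k)) L * level_integral L).

Unset Implicit Arguments.
Let wp (s : 'I_n -> 'I_n) := @sp R n _ (fun k => T (s k)) (fun k => phi (s k)).
Let wn (s : 'I_n -> 'I_n) := @sn R n _ (fun k => T (s k)) (fun k => phi (s k)).
Let bwp s : bounded_mfun (wp s) := @bounded_mfun_sp R n _ (fun k => T (s k)) (fun k => phi (s k)) (fun k => bphi (s k)).
Let bwn s : bounded_mfun (wn s) := @bounded_mfun_sn R n _ (fun k => T (s k)) (fun k => phi (s k)) (fun k => bphi (s k)).
Let Pp s : R := \int[prod_nu nuf s]_L (wp s L * level_integral L).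
Let Pn s : R := \int[prod_nu nuf s]_L (wn s L * level_integral L).

Set Implicit Arguments.

Let blevel s (w : prodT (fun k => T (s k)) -> R) : bounded_mfun w -> (forall L, 0 <= w L) -> bounded_mfun (fun L => w L * level_integral L).
Proof.
move=> bw w0.
exact: (@bounded_mfun_level R n X (fun k => V (s k)) _ (fun k => T (s k)) (fun k => a (s k)) (fun k => ma (s k)) M (fun k => aM (s k)) U oU cU w bw).
Qed.

Let average_split s : average_of s = Pp s - Pn s.
Proof.
have bp := blevel (bwp s) (fun L => sp_ge0 _ L); have bn := blevel (bwn s) (fun L => sn_ge0 _ L).
rewrite /Pp /Pn -mulN1r -(RintZ (prod_nu_fin nuf s))// -(RintD (prod_nu_fin nuf s))//; last by apply: bounded_mfunM => //; exact: bounded_mfun_cst.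
by apply: eq_Rintegral => L _; rewrite -spsn mulrBl mulN1r.
Qed.

Definition uvec k (q : 'rV[R]_n) i (x : T i) : 'rV[R]_n := a i x *m eval_jac (V i) k q.

Lemma measurable_uvec k q i : measurable_fun setT (uvec k q (i := i) : T i -> borel 'rV[R]_n).
Proof.
apply: measurable_rV => j; rewrite (_ : (fun _ => _) = fun x : T i => \sum_b a i x 0 b * eval_jac (V i) k q b j); last by apply/funext => x; rewrite mxE.
apply: measurable_sum => b; apply: measurable_funM => //.
exact: (measurableT_comp (@measurable_coord R _ b) (ma i)).
Qed.

Lemma uvec_bounded k q : exists2 rho : R, 1 <= rho & forall i (x : T i), `|uvec k q x| <= rho.
Proof.
exists (1 + \sum_i `|M| * mxsum (eval_jac (V i) k q)); first by rewrite lerDl sumr_ge0// => i _; rewrite mulr_ge0// mxsum_ge0.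
move=> i x; apply: le_trans (rV_norm_mul _ _) _.
apply: (@le_trans _ _ (`|M| * mxsum (eval_jac (V i) k q))).
  by rewrite ler_wpM2r ?mxsum_ge0// (le_trans (aM i x))// ler_norm.
rewrite (bigD1 i)//= addrCA lerDl addr_ge0// sumr_ge0// => j _; rewrite mulr_ge0// mxsum_ge0 //.
Qed.

Let dint s k q : R := mean_det nuf phi (uvec k q) s.
Let Dws (s : 'I_n -> 'I_n) w k q := @Dw R n X (fun k => V (s k)) _ (fun k => T (s k)) (fun k => a (s k)) (prod_nu nuf s) w k q.

Let dint_split s k q : dint s k q = Dws (wp s) k q - Dws (wn s) k q.
Proof.
have bM := @bounded_mfun_system_jac R n X (fun k => V (s k)) _ (fun k => T (s k)) (fun k => a (s k)) (fun k => ma (s k)) M (fun k => aM (s k)) k q.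
rewrite /Dws /Dw -mulN1r -(RintZ (prod_nu_fin nuf s)); last by apply: bounded_mfunM => //; exact: bwn.
rewrite -(RintD (prod_nu_fin nuf s)); [|by apply: bounded_mfunM => //; exact: bwp|by apply: bounded_mfunM; [exact: bounded_mfun_cst|apply: bounded_mfunM => //; exact: bwn]].
by apply: eq_Rintegral => L _; rewrite mulN1r -mulrBl spsn.
Qed.

(** Turns a pointwise identity in terms of [mean_det] into an identity between an integral over [U]
    and averages, by [level_tonelli] for the two parts of each density. *)
Lemma chart_series (b : {ffun 'I_n -> 'I_n} -> R) (g : nat -> borel 'rV[R]_n -> R) :
  (forall k q, chart_part U k q -> 0 <= g k q) ->
  (forall k q, chart_part U k q -> g k q = \sum_s b s * mean_det nuf phi (uvec k q) s) ->
  (\sum_(0 <= k <oo) \int[@lebesgue_n R n]_(q in chart_part U k) (g k q)%:E = (\sum_s b s * average_of s)%:E)%E.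
Proof.
move=> g0 gE; under [in RHS]eq_bigr do rewrite average_split.
apply: (@signed_series R _ _ (@lebesgue_n R n) (chart_part U) (measurable_chart_part oU) _
  (fun s : {ffun 'I_n -> 'I_n} => Dws (wp s)) (fun s : {ffun 'I_n -> 'I_n} => Dws (wn s)) (fun s => Pp s) (fun s => Pn s)).
- by move=> s k q; apply: Dw_ge0 => L; exact: sp_ge0.
- by move=> s k q; apply: Dw_ge0 => L; exact: sn_ge0.
- move=> s k; exact: (@measurable_Dw R n X (fun k => V (s k)) _ (fun k => T (s k)) (fun k => a (s k)) (fun k => ma (s k)) M (fun k => aM (s k)) (prod_nu nuf s) (prod_nu_fin nuf s) U oU _ (bwp s) (fun L => sp_ge0 _ L)).
- move=> s k; exact: (@measurable_Dw R n X (fun k => V (s k)) _ (fun k => T (s k)) (fun k => a (s k)) (fun k => ma (s k)) M (fun k => aM (s k)) (prod_nu nuf s) (prod_nu_fin nuf s) U oU _ (bwn s) (fun L => sn_ge0 _ L)).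
- move=> s; exact: (@level_tonelli R n X (fun k => V (s k)) _ (fun k => T (s k)) (fun k => a (s k)) (fun k => ma (s k)) M (fun k => aM (s k)) (prod_nu nuf s) (prod_nu_fin nuf s) U oU cU _ (bwp s) (fun L => sp_ge0 _ L)).
- move=> s; exact: (@level_tonelli R n X (fun k => V (s k)) _ (fun k => T (s k)) (fun k => a (s k)) (fun k => ma (s k)) M (fun k => aM (s k)) (prod_nu nuf s) (prod_nu_fin nuf s) U oU cU _ (bwn s) (fun L => sn_ge0 _ L)).
- exact: g0.
by move=> k q Aq; rewrite gE//; apply: eq_bigr => s _; congr (_ * _); exact: dint_split.
Qed.

(** Apply [chart_series] to the zero function: [mean_det] is symmetric at every point, so the
    difference of its values at [s'] and [s] is 0, and the resulting identity says that the two
    averages agree. *)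
Lemma average_perm (s s' : {ffun 'I_n -> 'I_n}) (sg : 'S_n) : (forall k, s' k = s (sg k)) -> average_of s' = average_of s.
Proof.
move=> ss; pose b (t : {ffun 'I_n -> 'I_n}) : R := (t == s')%:R - (t == s)%:R.
have bE (F : {ffun 'I_n -> 'I_n} -> R) : \sum_t b t * F t = F s' - F s.
  under eq_bigr do rewrite mulrBl.
  rewrite sumrB; congr (_ - _).
    by rewrite (bigD1 s')//= eqxx mul1r big1 ?addr0// => t /negbTE ->; rewrite mul0r.
  by rewrite (bigD1 s)//= eqxx mul1r big1 ?addr0// => t /negbTE ->; rewrite mul0r.
have : (\sum_(0 <= k <oo) \int[@lebesgue_n R n]_(q in chart_part U k) (0 : R)%:E = (\sum_t b t * average_of t)%:E)%E.
  apply: chart_series => // k q _; rewrite (bE (fun t => mean_det nuf phi (uvec k q) t)).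
  have [rho rho1 hrho] := uvec_bounded k q.
  have := mean_det_perm nuf bphi (measurable_uvec k q) rho1 hrho s sg.
  by rewrite (_ : (fun k => s (sg k)) = s') => [->|]; [rewrite subrr|apply/funext => j; rewrite ss].
rewrite bE eseries0 => [[/esym/eqP]|k _ _]; last by rewrite integral0.
by rewrite subr_eq0 => /eqP.
Qed.

Let h i x := \int[nu i]_L (phi i L * `|dot (a i L) x|).

(** In each chart the covectors form a set [total], whose measure is the integral of the volumes of
    its fibres. These are generalized zonoids with generators [uvec], so [zonoid_volume] applies at
    each point and [chart_series] sums up. *)
Lemma volume_formula (lam : 'I_n -> R) : (forall i, 0 <= lam i) ->
  volume U (combination lam (fun i => body_of (N i))) =
  (\sum_(s : {ffun 'I_n -> 'I_n}) (2 ^+ n / n`!%:R * average_of s) * \prod_k lam (s k))%:E.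
Proof.
move=> l0; pose K i := K0 (N i); pose G k (q : 'rV[R]_n) i := eval_jac (V i) k q.
have vK i : cvx (K i) := cvx_K0 (Nn i).
have E k : lebesgue_rV [set z | exists x (p : cotangent x),
       [/\ U x, chart_idx x = k, combination lam (fun i => body_of (N i)) p & z = canonical_coordinates p]] =
     (\int[@lebesgue_n R n]_(q in chart_part U k) (vol (fibre K (G k q) lam))%:E)%E.
  rewrite -(lebesgue_n_total cN vK hK (@open_img R n X k) (fun q i a b kq => @eval_jac_continuous R n X (V i) k q a b kq) (measurable_chart_part oU k) (@chart_part_img R n X U k) l0).
  congr lebesgue_rV; apply/seteqP; split=> z.
    move=> [x [p [Ux xk [w hw pE] ->]]]; rewrite /total /= /canonical_coordinates row_mxKl row_mxKr.
    split; first by apply/chart_partE; exists x; rewrite /chart_at xk.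
    have hf i : exists f, unit_ball (N i) f /\ adjoint (tdiff (theta (V i)) x) (bidual f) = w i.
      by have [f Bf e] := hw i; exists f.
    have [f hf'] := dep_choice hf.
    exists (fun i => v2r (f i)); first by move=> i; rewrite /K /K0 /= v2rK; exact: (hf' i).1.
    apply/rowP => j; rewrite mxE pE sum_lfunE summxE; apply: eq_bigr => i _.
    rewrite scale_lfunE -(hf' i).2 [RHS]mxE; congr (_ * _).
    by rewrite /G -xk -body_coordinates mxE.
  move=> [/chart_partE[x [Ux xk lz]] [kk Kk rz]].
  exists x, (\sum_i lam i *: adjoint (tdiff (theta (V i)) x) (bidual (r2v (kk i) : V i))).
  split=> //; first by exists (fun i => adjoint (tdiff (theta (V i)) x) (bidual (r2v (kk i) : V i))) => // i; exists (r2v (kk i)) => //; exact: Kk.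
  rewrite -[z]hsubmxK; congr row_mx; first by rewrite lz /chart_at xk.
  rewrite rz; apply/rowP => j; rewrite mxE sum_lfunE summxE; apply: eq_bigr => i _.
  rewrite scale_lfunE [LHS]mxE; congr (_ * _).
  have := body_coordinates (V := V i) x (r2v (kk i)) => /rowP/(_ j); rewrite mxE r2vK /chart_at xk => ->.
  by rewrite /G lz.
rewrite /volume (eq_eseriesr (g := fun k => (\int[@lebesgue_n R n]_(q in chart_part U k) (vol (fibre K (G k q) lam))%:E)%E)); last by move=> k _; exact: E.
rewrite (@chart_series (fun s => 2 ^+ n / n`!%:R * \prod_k lam (s k))).
- by congr EFin; apply: eq_bigr => s _; rewrite mulrAC.
- by move=> k q _; exact: vol_ge0.
move=> k q Aq; have [rho rho1 hrho] := uvec_bounded k q.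
have cf : compact (fibre K (G k q) lam) by exact: compact_fibre.
have vf : cvx (fibre K (G k q) lam) by exact: cvx_fibre.
rewrite (zonoid_volume nuf bphi (measurable_uvec k q) rho1 hrho cf vf (lam := lam)).
  by rewrite mulr_sumr; apply: eq_bigr => s _; rewrite mulrA.
have := fibre_supp hK (G k q) l0; congr has_supp; apply/funext => v; apply: eq_bigr => i _; congr (_ * _).
by apply: eq_Rintegral => x _; rewrite /uvec dot_tr.
Qed.

(** The n! permutations contribute equal averages, which cancels the n! in the definition of the
    mixed volume; there remains the factor 2^n / n! of zonotopes. *)
Lemma mixed_volume_formula : mixed_volume U (fun i => body_of (N i)) = 2 ^+ n / n`!%:R * average_of (fun i => i).
Proof.
pose D (s : {ffun 'I_n -> 'I_n}) : R := 2 ^+ n / n`!%:R * average_of s.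
have n0 : n`!%:R != 0 :> R by rewrite pnatr_eq0 -lt0n fact_gt0.
have cE : mpoly.mcoeff (mpoly.Multinom [tuple 1%N | i < n]) (index_form D) / n`!%:R = 2 ^+ n / n`!%:R * average_of (fun i => i).
  rewrite (@form_coef R n D (2 ^+ n / n`!%:R * average_of (fun i => i))); first by rewrite mulrC mulKf.
  move=> s si; rewrite /D; congr (_ * _); rewrite (@average_perm [ffun i => i] s (perm si)).
    by congr average_of; apply/funext => i; rewrite ffunE.
  by move=> k; rewrite ffunE permE.
apply: get_unique => [|c [P [dP PE ->]]].
  exists (index_form D); split=> //; first exact: form_homog.
  by move=> lam l0; rewrite volume_formula// meval_form.
rewrite -cE; congr (_ / _); apply: form_unique => // lam l0.
by have := PE lam l0; rewrite volume_formula// => -[<-]; rewrite meval_form.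
Qed.

End VolumeFormula.

(** * The average number of solutions as a mixed volume *)

Unset Implicit Arguments.
Set Strict Implicit.
Set Printing Implicit Defensive.

Theorem theorem1 (R : realType) (n : nat) (X : manifold R n)
  (V : 'I_n -> function_space X)
  (N : forall i, V i -> R)
  (N_norm : forall i, is_norm (N i))
  (B_smooth : forall i, smooth_convex_body (unit_ball (N i)))
  (Bdual_smooth : forall i, smooth_convex_body (unit_ball (dual_norm (N i))))
  (mu : forall i, AGr_measure (dualsp (V i)))
  (mu_smooth : forall i, smooth_normal_measure (mu i))
  (mu_chi1 : forall i (xi : dualsp (V i)),
     chi1 (mu i) xi = (dual_norm (N i) xi)%:E)
  (Xi : signed_measure (AGr_tuple (fun i => dualsp (V i))) R)
  (Xi_product : is_product_measure mu Xi)
  (U : set X) (U_open : open U) (U_relcompact : compact (closure U)) :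
  average_nb_solutions Xi U =
    (n`!%:R / 2 ^+ n * mixed_volume U (fun i => body_of (N i)))%:E.
Proof.
have cN i : compact (K0 (N i)) by have [_ h _ _] := B_smooth i.
have hip i : exists ip, exists nu : {measure set (borel (Gr1_space (dualsp (V i)))) -> \bar R}, exists phi,
    [/\ scalar_product ip, haar_measure ip nu, smooth_on_Gr1 phi &
        forall A : set (borel (AGr_space (dualsp (V i)))), measurable A -> A `<=` @AGr R (dualsp (V i)) -> finite_mass (mu i) A ->
          smeasure (mu i) A = (\int[nu]_(L in @Gr1 R (dualsp (V i))) ((phi L)%:E * transverse_measure ip A L))%E].
  by have [_ h] := mu_smooth i.
have [ip /dep_choice[nu /dep_choice[phi hphi]]] := dep_choice hip.
have ipP i : scalar_product (ip i) by have [] := hphi i.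
have nuH i : haar_measure (ip i) (nu i) by have [] := hphi i.
have sphi i : smooth_on_Gr1 (phi i) by have [] := hphi i.
have muE i := let: And4 _ _ _ h := hphi i in h.
have munu i : normal_measure (mu i) := (mu_smooth i).1.
have nuf i : (nu i setT < +oo)%E by have [] := nuH i.
pose T i := borel (Gr1_space (dualsp (V i))).
pose f i : T i -> R := phi1 (phi i); pose a i : T i -> 'rV[R]_(dim (V i)) := a1 (ip i).
have bf i : bounded_mfun (f i) := phi1_bounded_mfun (sphi i).
have ma i : measurable_fun setT (a i : T i -> borel 'rV[R]_(dim (V i))) := a1_meas (ipP i).
have [Ma hMa] := choice (fun i => a1_bounded (ipP i)).
pose M : R := \sum_i `|Ma i|.
have aM i L : `|a i L| <= M.
  apply: le_trans (hMa i L) _; apply: le_trans (ler_norm _) _.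
  by rewrite /M (bigD1 i)//= lerDl sumr_ge0.
have a0 i L : f i L != 0 -> a i L != 0 := @a1_neq0 R (V i) (ip i) (ipP i) (phi i) L.
have hK i : has_supp (K0 (N i)) (fun x => \int[nu i]_L (f i L * `|dot (a i L) x|)).
  exact: (K0_zonoid (N_norm i) (cN i) (munu i) (ipP i) (muE i) (mu_chi1 i)).
have Hoff i (A : set (borel (AGr_space (dualsp (V i))))) : measurable A -> smeasure (mu i) A = smeasure (mu i) (A `&` @AGr R (dualsp (V i))).
  exact: (mu_off (munu i)).
have Hhyp i (A : set (borel (AGr_space (dualsp (V i))))) : measurable A -> A `<=` @AGr R (dualsp (V i)) -> finite_mass (mu i) A ->
  smeasure (mu i) A = (\int[nu i]_L ((f i L)%:E * lebesgue_measure [set t : R | A (hyp (a i L) t)]))%E.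
  exact: (mu_hyp (ipP i) (muE i)).
have Hfin i (A : set (borel (AGr_space (dualsp (V i))))) k : measurable A -> A `<=` @hyperplanes_near R (dualsp (V i)) k `|` ~` @AGr R (dualsp (V i)) ->
    finite_mass (mu i) A.
  (* Off the hyperplanes both parts of the measure vanish, so only the trace of [A] on the compact
     set [hyperplanes_near k] counts. *)
  move=> mA Ak; have mG := @measurable_AGr R (dualsp (V i)).
  have [f1 f2] : finite_mass (mu i) (A `&` @AGr R (dualsp (V i))).
    apply: (sub_hyperplanes_near_fin (munu i) (k := k)); first exact: measurableI.
    by move=> H [/Ak[]].
  have [ [off_pos off_neg] _ _] := munu i.
  have add (m : {measure set (borel (AGr_space (dualsp (V i)))) -> \bar R}) : m (~` @AGr R (dualsp (V i))) = 0%E ->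
      m A = m (A `&` @AGr R (dualsp (V i))).
    move=> m0; rewrite -[in LHS](setUIDK A (@AGr R (dualsp (V i)))) measureU//; last 3 first.
    - exact: measurableI.
    - exact: measurableD.
    - by rewrite setDE setICA -setIA setICr !setI0.
    rewrite [X in (_ + X)%E](_ : _ = 0%E) ?adde0//.
    by apply: (subset_measure0 _ _ _ m0); [exact: measurableD|exact: measurableC|move=> H []].
  by split; rewrite add.
rewrite (mixed_volume_formula N_norm cN nuf bf ma aM hK U_open U_relcompact).
rewrite (average_formula bf ma aM a0 (prod_nu_fin nuf (fun i => i)) (prod_nu_prod nuf (s := fun i => i)) Hoff Hhyp Hfin Xi_product U_open U_relcompact).
congr EFin; have n0 : n`!%:R != 0 :> R by rewrite pnatr_eq0 -lt0n fact_gt0.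
have t0 : 2 ^+ n != 0 :> R by rewrite expf_neq0.
by rewrite mulrA mulrA mulfVK// mulfV// mul1r.
Qed.
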